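(* Let $G$ be a finite group and let $p$ be an odd prime. (1) Suppose $d_{p'}(G)>1/(p-1)$. Then $G$ is $p$-solvable; moreover, $G$ has $p$-length at most $2$, and the number of nonabelian simple $p'$-groups occurring as composition factors in a composition series for $G$ (counted with multiplicity) is strictly less than $\ln(p-1)/\ln(12)$. In particular, if $p\le 13$, then $G$ is solvable. (2) Assume $G$ is not $p$-solvable. Let $H=G/\mathbf{O}_p(G)$ and $Z=\mathbf{Z}(H)$. Then $d_{p'}(G)=1/(p-1)$ if and only if $p>3$, $H/Z$ is isomorphic to $\mathrm{PSL}_2(p)$ or $\mathrm{PGL}_2(p)$, and $H'\cong \mathrm{PSL}_2(p)$.
   Context: For a finite group $G$ and a prime $p$, an element is $p$-regular if its order is not divisible by $p$; $k_{p'}(G)$ denotes the number of conjugacy classes of $p$-regular elements of $G$, $|G|_{p'}$ denotes the largest divisor of $|G|$ coprime to $p$, and $d_{p'}(G)=k_{p'}(G)/|G|_{p'}$. A $p'$-group is a group of order coprime to $p$. $\mathbf{O}_p(G)$ is the largest normal $p$-subgroup of $G$, $\mathbf{Z}(H)$ is the center of $H$, and $H'$ is the derived subgroup. $G$ is $p$-solvable if it has a normal series each of whose factors is a $p$-group or a $p'$-group; its $p$-length is the minimum number of factors that are $p$-groups among such normal series. *)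

(* Defs.v *)
From mathcomp Require Import all_boot all_order all_algebra all_fingroup all_solvable.
From Stdlib Require Reals.
Set Implicit Arguments.
Unset Strict Implicit.
Unset Printing Implicit Defensive.
Import GRing.Theory.
Local Open Scope group_scope.

Definition kp' (gT : finGroupType) (p : nat) (G : {set gT}) : nat :=
  #|[set x ^: G | x in G & p^'.-elt x]|.

Definition dp' (gT : finGroupType) (p : nat) (G : {set gT}) : rat :=
  ((kp' p G)%:R / (#|G|`_p^')%:R)%R.

Definition pp'_normal_series (gT : finGroupType) (p : nat)
    (G : {group gT}) (s : seq {group gT}) : bool :=
  (last G s == 1%G) &&
  path (fun A B : {group gT} =>
          [&& B <| G, B \subset A & (p.-group (A / B) || p^'.-group (A / B))])
       G s.

Definition num_p_factors (gT : finGroupType) (p : nat)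
    (G : {group gT}) (s : seq {group gT}) : nat :=
  count (fun AB : {group gT} * {group gT} => p.-group (AB.1 / AB.2)) (zip (G :: s) s).

Definition p_solvable (gT : finGroupType) (p : nat) (G : {group gT}) : Prop :=
  exists s, pp'_normal_series p G s.

Definition p_length_le (gT : finGroupType) (p : nat) (G : {group gT}) (k : nat) : Prop :=
  exists s, pp'_normal_series p G s /\ num_p_factors p G s <= k.

Definition num_nonab_p'_compfactors (gT : finGroupType) (p : nat)
    (G : {group gT}) (s : seq {group gT}) : nat :=
  count (fun AB : {group gT} * {group gT} =>
           ~~ abelian (AB.1 / AB.2) && p^'.-group (AB.1 / AB.2)) (zip (G :: s) s).

Definition lt_ln_ratio (n p : nat) : Prop :=
  (Rdefinitions.Rlt (Raxioms.INR n)
     (Rdefinitions.Rdiv (Rpower.ln (Raxioms.INR (p - 1))) (Rpower.ln (Raxioms.INR 12)))).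

Section SL.
Variables (n : nat) (R : finComUnitRingType).
Local Open Scope ring_scope.
Definition SLset : {set {'GL_n[R]}} := [set g : {'GL_n[R]} | \det (GLval g) == 1%R].
Lemma SL_group_set : group_set SLset.
Proof.
apply/group_setP; split; first by rewrite inE GL_1E det1.
by move=> x y; rewrite !inE GL_ME det_mulmx => /eqP-> /eqP->; rewrite mulr1.
Qed.
Canonical SL_group := group SL_group_set.
End SL.

Definition PSL2 (p : nat) := (SL_group 2 'F_p / 'Z(SL_group 2 'F_p))%G.
Definition PGL2 (p : nat) := ('GL_2(p) / 'Z('GL_2(p)))%G.

(* Main.v *)
(* The argument does not use the classification of finite simple groups. Write k for the number of p-regular classes, k(N)k(G/N) >= k(G) for N normal, and
   m for the p'-part of the order. By Brauer, k is at most the number of irreducible representations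
   in characteristic p; picking a vector and a covector fixed by a Sylow p-subgroup P in each of them
   gives independent P-biinvariant functions on G, so k is at most the number of double cosets of P.
   This gives (p + 1)k <= 2m if P is not normal.
   Now let G be perfect, generated by its p-elements, with O_p(G) = 1 and p dividing |G|. If |P| > p,
   there are at least p^2 + p + 1 Sylow subgroups and (p - 1)k < m. If P = <x> has order p, the vectors
   can be chosen so that the functions of the nontrivial representations vanish on N = N_G(P), which
   gives (p - 1)k <= m. In case of equality every representation restricted to P is a single Jordan
   block, N acts on its fixed vectors through weights, and there is a representation of dimension at
   most (p + 1)/2 on which log x has for weight the conjugation character of N on P. The module Y
   generated by log x under conjugation then has dimension 3, whence |G : N| = p + 1,
   2|N : P| = p - 1, and G acts on its p + 1 Sylow subgroups by Moebius transformations of the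
   projective line, so that G is PSL_2(p).
   Both parts of the theorem follow by applying this to suitable normal sections of G. The factor 12
   comes from 12 |classes(S)| <= |S| for nonabelian simple S, a count of ordinary character degrees. *)
Require Import Defs.
From mathcomp Require Import all_boot all_order all_algebra all_fingroup all_solvable all_field all_character.
From mathcomp Require Import zify ring.
From Stdlib Require Import Classical.
From Stdlib Require Reals.
Set Implicit Arguments.
Unset Strict Implicit.
Unset Printing Implicit Defensive.
Import GRing.Theory.

(** * Regular classes and normal subgroups *)

(** Equality has to be turned into group structure with no list of simple groups at hand. Put N =
    N_G(P), t = |N : P| and |G : N| = r p + 1. At most t r double cosets of P lie outside N, and
    equality makes the coefficients of the nontrivial representations a basis of the P-biinvariant
    functions vanishing on N. A function built by hand must then be a combination of coefficients
    with its own N-weights; this produces representations of a prescribed weight, and it proves that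
    a function vanishes when no representation has its weights. The other engine is that a
    polynomial of degree less than p - 1 has sum zero over the prime field. Entries of powers of a
    unipotent matrix are polynomials in the exponent, and P permutes freely the cosets of N other
    than N. So a left N-invariant function of low degree along the P-orbits has coset sum equal to
    its value at 1, and is constant if all its translates behave so. The bound (p + 1)/2 on a
    dimension keeps conjugation of matrices below the critical degree, up to a single term. *)

Section RegularClasses.
Local Open Scope group_scope.
Variables (gT : finGroupType) (p : nat).
Implicit Types (G N : {group gT}).

Definition pregs (A : {set gT}) := [set x in A | p^'.-elt x].

Lemma kp'_orbits G : kp' p G = #|orbit 'J G @: pregs G|.
Proof.
rewrite /kp'; apply: eq_card => c; apply/imsetP/imsetP => -[x Hx ->]; exists x => //.
Qed.

Lemma acts_pregs G (A : {set gT}) : G \subset 'N(A) -> [acts G, on pregs A | 'J].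
Proof.
move=> nAG; apply/subsetP=> x Gx; rewrite !inE; apply/subsetP=> y; rewrite !inE.
case/andP=> Ay ry; rewrite /= p_eltJ ry andbT.
by rewrite memJ_norm ?(subsetP nAG).
Qed.

(** Commuting pairs are the common form in which the two orbit counts below are compared. *)
Lemma sum_card_fix (D S : {set gT}) :
  \sum_(a in D) #|'Fix_(S | 'J)[a]| = #|[set u : gT * gT | [&& u.1 \in D, u.2 \in S & u.2 * u.1 == u.1 * u.2]]|.
Proof.
rewrite -sum1_card (eq_bigl (fun u : gT * gT => (u.1 \in D) && ((u.2 \in S) && (u.2 * u.1 == u.1 * u.2)))); last first.
  by move=> u; rewrite inE.
rewrite -(pair_big_dep (mem D) (fun a v => (v \in S) && (v * a == a * v)) (fun _ _ => 1%N)) /=.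
apply: eq_bigr => a Da; rewrite sum1dep_card; apply: eq_card => v.
rewrite !inE sub1set inE /= conjgE; congr (_ && _).
by rewrite -[_ == v](inj_eq (mulgI a)) !mulgA mulgV mul1g.
Qed.

(** Orbit counting for conjugation on the p-regular elements, the commuting pairs being grouped by
    their second member. *)
Lemma sum_cent_pregs G :
  \sum_(v in pregs G) #|'C_G[v]| = (kp' p G * #|G|)%N.
Proof.
rewrite kp'_orbits -(Frobenius_Cauchy (to := 'J)); last exact/acts_pregs/normG.
rewrite sum_card_fix -sum1_card.
rewrite (eq_bigl (fun u : gT * gT => (u.1 \in G) && ((u.2 \in pregs G) && (u.2 * u.1 == u.1 * u.2)))); last first.
  by move=> u; rewrite inE.
rewrite -(pair_big_dep (mem G) (fun a v => (v \in pregs G) && (v * a == a * v)) (fun _ _ => 1%N)) /=.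
rewrite (exchange_big_dep (mem (pregs G))) /=; last by move=> a v _ /andP[].
apply: eq_bigr => v Sv; rewrite sum1dep_card; apply: eq_card => a.
rewrite in_setI [RHS]inE Sv /=; congr (_ && _); apply/cent1P/eqP => e; exact/esym.
Qed.

(* Commuting pairs (a, y) with [a] in [N] and [y] a p-regular element of [g *: N] correspond to pairs
   (v, z) with [v] p-regular in [N] and [z] in the coset, through v = a_{p'} and z = y a_p. *)
Lemma orbits_coset_pregs N g : g \in 'N(N) ->
  (#|orbit 'J N @: pregs (g *: N)| <= kp' p N)%N.
Proof.
move=> nNg.
have actN : [acts N, on pregs (g *: N) | 'J].
  apply: acts_pregs; apply/normsP=> n Nn; apply/setP=> y; rewrite mem_conjg !mem_lcoset.
  rewrite conjgE invgK !mulgA groupMr ?groupV //.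
  rewrite -[g^-1 * n]mulg1 -(mulgV g) !mulgA -[g^-1 * n * g]mulgA -mulgA groupMl //.
  by rewrite -conjgE memJ_norm.
rewrite -(leq_pmul2r (cardG_gt0 N)) -(Frobenius_Cauchy actN) -sum_cent_pregs sum_card_fix.
pose B := [set u : gT * gT | [&& u.1 \in pregs N, u.2 \in g *: N & u.2 * u.1 == u.1 * u.2]].
pose f (u : gT * gT) := (u.1.`_p^', u.2 * u.1.`_p).
apply: (@leq_trans #|B|).
  set A := [set _ | _].
  have fK : {in A, forall u, u = ((f u).1 * (f u).2.`_p, (f u).2.`_p^')}.
    move=> [a y]; rewrite !inE /= => /and3P[Na /andP[_ ry] /eqP cya].
    have cyap : commute y a.`_p by apply: commuteX; exact: cya.
    have e1 : (y * a.`_p).`_p = a.`_p.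
      rewrite consttM // (constt1P ry) mul1g.
      by rewrite (constt_p_elt (p_elt_constt _ _)).
    have e2 : (y * a.`_p).`_p^' = y.
      rewrite consttM // (constt_p_elt ry).
      by rewrite (constt1P _) ?mulg1 // p_eltNK p_elt_constt.
    by rewrite /f /= e1 e2; have := consttC p^' a; rewrite consttNK => ->.
  rewrite -(card_in_imset (f := f) (D := A)); last first.
    by move=> u v Au Av fuv; rewrite (fK u Au) (fK v Av) fuv.
  apply/subset_leq_card/subsetP=> _ /imsetP[[a y] Au ->].
  move: Au; rewrite !inE /f /= => /and3P[Na /andP[gy ry] /eqP cya].
  rewrite p_elt_constt (groupX _ Na) /=; apply/andP; split.
    by rewrite mem_lcoset mulgA groupMr ?groupX // -mem_lcoset.
  have c1 : commute y a.`_p^' by apply: commuteX; exact: cya.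
  have c2 : commute a.`_p a.`_p^' by apply: commuteX2.
  by rewrite -mulgA c2 mulgA c1 mulgA.
rewrite -sum1_card (eq_bigl (fun u : gT * gT => (u.1 \in pregs N) && ((u.2 \in g *: N) && (u.2 * u.1 == u.1 * u.2)))); last first.
  by move=> u; rewrite inE.
rewrite -(pair_big_dep (mem (pregs N)) (fun v z => (z \in g *: N) && (z * v == v * z)) (fun _ _ => 1%N)) /=.
apply: leq_sum => v Nv; rewrite sum1dep_card.
(* For fixed [v] the admissible [z] are none, or lie in a single coset of ['C_N[v]]. *)
case: (set_0Vmem [set z | (z \in g *: N) && (z * v == v * z)]) => [->|[z0]]; first by rewrite cards0.
rewrite inE => /andP[gz0 /eqP cz0].
rewrite -(card_lcoset 'C_N[v] z0); apply/subset_leq_card/subsetP=> z.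
rewrite inE => /andP[gz /eqP cz]; rewrite mem_lcoset inE; apply/andP; split.
  move: gz gz0; rewrite !mem_lcoset => gz gz0.
  by have := groupM (groupVr gz0) gz; rewrite invMg invgK -mulgA mulKVg.
have c0 : z0 \in 'C[v] by apply/cent1P.
have c1 : z \in 'C[v] by apply/cent1P.
by rewrite groupM ?groupV.
Qed.

(** When the image of an element is p-regular, its p'-part has the same image, so every p-regular
    class of the quotient lifts. *)
Lemma kp'_quotient_ge G N : N <| G -> (kp' p (G / N) <= kp' p G)%N.
Proof.
case/andP=> sNG nNG; rewrite /kp'.
pose f (c : {set gT}) := c / N.
apply: leq_trans (leq_imset_card f _); apply/subset_leq_card/subsetP=> c /imsetP[xb + ->].
rewrite inE => /andP[/morphimP[x Nx Gx ->] rx].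
pose y := x.`_p^'.
have Gy : y \in G by rewrite groupX.
have Ny : y \in 'N(N) by rewrite groupX.
have exy : coset N x = coset N y.
  by rewrite morph_constt // (constt_p_elt rx).
apply/imsetP; exists (y ^: G); last first.
  by rewrite /f /quotient morphim_class // -[RHS]/(coset N y ^: _) -exy.
by apply/imsetP; exists y; rewrite ?inE ?Gy ?p_elt_constt.
Qed.

Lemma kp'_mul G N : N <| G -> (kp' p G <= kp' p N * kp' p (G / N))%N.
Proof.
case/andP=> sNG nNG; rewrite {1 3}/kp'.
set CG := [set x ^: G | x in _ & _]; set CQ := [set x ^: _ | x in _ & _].
pose f (c : {set gT}) := c / N.
rewrite mulnC -sum1_card (partition_big f (mem CQ)) /=; last first.
  move=> _ /imsetP[x + ->]; rewrite inE => /andP[Gx rx].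
  have Nx := subsetP nNG x Gx.
  apply/imsetP; exists (coset N x); last by rewrite /f /quotient morphim_class.
  by rewrite inE morph_p_elt // mem_morphim.
rewrite -sum_nat_const; apply: leq_sum => d _; rewrite sum1dep_card.
case: (set_0Vmem [set c | (c \in CG) && (f c == d)]) => [->|[c0]]; first by rewrite cards0.
rewrite inE => /andP[/imsetP[g + ->] /eqP <-]; rewrite inE => /andP[Gg rg].
have nNg := subsetP nNG g Gg.
apply: leq_trans (orbits_coset_pregs nNg).
(* An N-orbit in the coset of [g] is sent to the G-class of one of its elements; this reaches every
   class over the given class of the quotient. *)
apply: leq_trans (leq_imset_card (fun o : {set gT} => repr o ^: G) _).
apply/subset_leq_card/subsetP=> c; rewrite inE => /andP[/imsetP[x + ->]].
rewrite inE => /andP[Gx rx] /eqP.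
have nNx := subsetP nNG x Gx.
rewrite /f /quotient !morphim_class // -!/(_ / N) => eqc.
have : coset N x \in coset N g ^: (G / N) by rewrite -eqc class_refl.
case/imsetP=> _ /morphimP[y nNy Gy ->] exy.
have Gx' : x ^ y^-1 \in G by rewrite groupJ ?groupV.
apply/imsetP; exists (orbit 'J N (x ^ y^-1)).
  apply/imsetP; exists (x ^ y^-1) => //; rewrite inE p_eltJ rx andbT mem_lcoset.
  have: coset N (x ^ y^-1) = coset N g.
    by rewrite morphJ ?groupV // morphV // [coset_morphism N x]exy; exact: conjgK.
  move=> e; apply: coset_idr; first by rewrite groupM ?groupJ ?groupV.
  rewrite [LHS](morphM (coset_morphism N)) ?groupJ ?groupV // (morphV (coset_morphism N)) //=.
  by rewrite e mulVg.
have /orbitP[n Nn /= <-] : repr (orbit 'J N (x ^ y^-1)) \in orbit 'J N (x ^ y^-1).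
  exact: mem_repr (orbit_refl _ _ _).
by rewrite !classGidl ?groupV // (subsetP sNG).
Qed.

Lemma kp'_pgroup G : p.-group G -> kp' p G = 1%N.
Proof.
move=> pG; rewrite /kp' (_ : [set x ^: G | x in G & p^'.-elt x] = [set [set 1]]) ?cards1 //.
apply/setP=> c; rewrite inE; apply/imsetP/eqP => [[x + ->]|->].
  rewrite inE => /andP[Gx rx]; rewrite (_ : x = 1) ?class1G //.
  by apply/eqP; rewrite -order_eq1 -(constt_p_elt rx) order_eq1; apply/eqP/constt1P;
     rewrite p_eltNK (mem_p_elt pG).
by exists 1; rewrite ?class1G // inE group1 p_elt1.
Qed.
End RegularClasses.

Section Isog.
Local Open Scope group_scope.

Lemma kp'_isog (gT rT : finGroupType) p (G : {group gT}) (H : {group rT}) :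
  (G \isog H)%g -> kp' p G = kp' p H.
Proof.
wlog suff: gT rT G H / (G \isog H)%g -> (kp' p G <= kp' p H)%N.
  by move=> W iGH; apply/eqP; rewrite eqn_leq !W // isog_sym.
move=> /isogP[f injf fG].
rewrite /kp'; set CG := [set x ^: G | x in _ & _].
have sCG c : c \in CG -> c \subset G.
  by case/imsetP=> x + ->; rewrite inE => /andP[Gx _]; apply: class_subG.
rewrite -(card_in_imset (f := fun c : {set gT} => (f @* c)%g) (D := CG)); last first.
  by move=> c d /sCG sc /sCG sd /(injm_morphim_inj injf sc sd).
apply/subset_leq_card/subsetP=> _ /imsetP[c /imsetP[x + ->] ->].
rewrite inE => /andP[Gx rx]; rewrite morphim_class // fG.
by apply/imsetP; exists (f x); rewrite // inE -fG mem_morphim //= morph_p_elt.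
Qed.

End Isog.

(** * Modular representations and Brauer's bound *)

Section MatrixCoefficients.
Local Open Scope ring_scope.
Variables (F : fieldType) (gT : finGroupType) (G : {group gT}).

Lemma mulmx_all_eq0 m n n' k (X : 'M[F]_(m, n)) (A : 'M[F]_(n', k)) :
  (forall M, X *m M *m A = 0) -> A != 0 -> X = 0.
Proof.
move=> XA0 /matrix0Pn[i [j Aij]]; apply/matrixP=> a b; rewrite mxE.
have /matrixP/(_ a j) := XA0 (delta_mx b i).
rewrite mxE [RHS]mxE (bigD1 i) //= big1 ?addr0 => [|k' nk]; last first.
  by rewrite mxE big1 ?mul0r // => l _; rewrite !mxE (negPf nk) andbF mulr0.
rewrite mxE (bigD1 b) //= big1 ?addr0 => [|l nl]; last first.
  by rewrite !mxE (negPf nl) mulr0.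
by rewrite !mxE !eqxx mulr1 => /eqP; rewrite mulf_eq0 (negPf Aij) orbF => /eqP.
Qed.

Lemma mxtrace_all_eq0 n (A : 'M[F]_n) : (forall M, \tr (A *m M) = 0) -> A = 0.
Proof.
move=> A0; apply/matrixP=> i j; rewrite mxE -(A0 (delta_mx j i)).
rewrite /mxtrace (bigD1 i) //= [X in _ + X]big1 ?addr0 => [|k nk]; last first.
  by rewrite mxE big1 // => l _; rewrite !mxE (negPf nk) andbF mulr0.
rewrite mxE (bigD1 j) //= big1 ?addr0 => [|l nl]; last by rewrite !mxE (negPf nl) mulr0.
by rewrite !mxE !eqxx mulr1.
Qed.

Lemma abs_irr_span n (r : mx_representation F G n) M :
  mx_absolutely_irreducible r -> exists c, M = \sum_(g in G) c g *: r g.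
Proof. by case/mx_abs_irrP=> _ [a aE]; exists (a^~ M). Qed.

(** Matrix units of the first representation come from group algebra elements. The inclusion of
    annihilators carries their relations to the second one, where the images of one vector under a
    row of units form an intertwining matrix. *)
Lemma rsim_of_annihilator n1 n2 (r1 : mx_representation F G n1) (r2 : mx_representation F G n2) :
  mx_absolutely_irreducible r1 -> mx_irreducible r2 ->
  (forall c, \sum_(g in G) c g *: r1 g = 0 -> \sum_(g in G) c g *: r2 g = 0) ->
  mx_rsim r1 r2.
Proof.
move=> abs1 irr2 ann; have /mx_abs_irrP[n1_gt0 [a aE]] := abs1.
have [n2_gt0 _] := (mx_irrP _).1 irr2.
pose b j0 j := \sum_(g in G) a g (delta_mx j0 j) *: r2 g.
(* The diagonal units sum to the identity, so they cannot all act as zero. *)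
have [j0 nz_b] : exists j0, b j0 j0 != 0.
  apply/existsP; apply/contraT; rewrite negb_exists => /forallP b0.
  suff: (1%:M : 'M[F]_n2) = 0.
    move/matrixP/(_ (Ordinal n2_gt0) (Ordinal n2_gt0)); rewrite !mxE eqxx.
    by move/eqP; rewrite oner_eq0.
  pose c g := \sum_j a g (delta_mx j j) - (g == 1%g)%:R.
  have cE n (r : mx_representation F G n) :
      \sum_(g in G) c g *: r g = \sum_j (\sum_(g in G) a g (delta_mx j j) *: r g) - 1%:M.
    rewrite /c exchange_big /= -(repr_mx1 r).
    rewrite (eq_bigr (fun g => \sum_j a g (delta_mx j j) *: r g + - ((g == 1%g)%:R *: r g))); last first.
      by move=> g _; rewrite scalerBl scaler_suml.
    rewrite big_split /= sumrN; congr (_ - _).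
    rewrite (bigD1 1%g) //= eqxx scale1r big1 ?addr0 // => g /andP[_ /negPf->].
    by rewrite scale0r.
  have r1c : \sum_(g in G) c g *: r1 g = 0.
    rewrite cE; apply/eqP; rewrite subr_eq0; apply/eqP.
    rewrite (eq_bigr (fun j => delta_mx j j)) => [|j _]; last exact/esym/aE.
    apply/matrixP=> i k; rewrite summxE (bigD1 i) //= big1 ?addr0 => [|l nl].
      by rewrite !mxE eqxx /= eq_sym.
    by rewrite !mxE eq_sym (negPf nl).
  have := ann c r1c; rewrite cE big1 => [|j _].
    by rewrite sub0r => /eqP; rewrite oppr_eq0 => /eqP.
  by apply/eqP; have := b0 j; rewrite negbK.
have [w nz_w] : exists w : 'rV_n2, w *m b j0 j0 != 0.
  have /rowV0Pn[u /submxP[w ->] nz] := nz_b; exists w; exact: nz.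
pose B := \matrix_j (w *m b j0 j).
have homB g : g \in G -> r1 g *m B = B *m r2 g.
  move=> Gg; apply/row_matrixP=> j; rewrite !row_mul rowK.
  have -> : row j (r1 g) *m B = w *m \sum_k r1 g j k *: b j0 k.
    rewrite mulmx_sumr mulmx_sum_row; apply: eq_bigr => k _.
    by rewrite rowK mxE scalemxAr.
  rewrite -mulmxA; congr (w *m _); apply/eqP; rewrite -subr_eq0; apply/eqP.
  (* Coefficients of the relation writing E_(j0,j) r(g) as the sum of r(g)_(j,k) E_(j0,k), true in
     the first representation. *)
  pose c h := \sum_k r1 g j k * a h (delta_mx j0 k) - a (h * g^-1)%g (delta_mx j0 j).
  have cE n (r : mx_representation F G n) : \sum_(h in G) c h *: r h =
     \sum_k r1 g j k *: (\sum_(h in G) a h (delta_mx j0 k) *: r h)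
       - (\sum_(h in G) a h (delta_mx j0 j) *: r h) *m r g.
    rewrite /c; under eq_bigr do rewrite scalerBl; rewrite sumrB; congr (_ - _).
      under eq_bigr do rewrite scaler_suml; rewrite exchange_big /=.
      apply: eq_bigr => k _; rewrite scaler_sumr; apply: eq_bigr => h _.
      by rewrite scalerA.
    rewrite (reindex_inj (mulIg g)) /= mulmx_suml.
    rewrite (eq_bigl (mem G)) => [|h]; last by rewrite /= groupMr.
    by apply: eq_bigr => h Gh; rewrite mulgK repr_mxM // scalemxAl.
  suff r1c : \sum_(h in G) c h *: r1 h = 0 by have := ann c r1c; rewrite cE.
  rewrite cE -aE (eq_bigr (fun k => r1 g j k *: delta_mx j0 k)); last first.
    by move=> k _; rewrite -aE.
  apply/matrixP=> u v; rewrite !mxE summxE (bigD1 v) //= big1 ?addr0 => [|k nk]; last first.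
    by rewrite !mxE (eq_sym v) (negPf nk) andbF mulr0.
  rewrite (bigD1 j) //= big1 ?addr0 => [|k nk]; last first.
    by rewrite !mxE (negPf nk) andbF mul0r.
  by rewrite !mxE !eqxx !andbT; case: (u == j0); rewrite ?mulr1 ?mul1r ?mulr0 ?mul0r subrr.
have nz_B : B != 0.
  apply: contraNneq nz_w => B0; have /row_matrixP/(_ j0) := B0.
  by rewrite rowK row0 => ->.
have irr1 := mx_abs_irrW abs1.
have freeB : row_free B.
  rewrite -kermx_eq0; apply: contraNT nz_B => nzk.
  have modk : mxmodule r1 (kermx B).
    apply/mxmoduleP=> g Gg; apply/sub_kermxP.
    by rewrite -mulmxA homB // mulmxA mulmx_ker mul0mx.
  have [_ /(_ _ modk nzk)] := (mx_irrP _).1 irr1.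
  by rewrite -sub1mx => /sub_kermxP; rewrite mul1mx => ->.
have fullB : row_full <<B>>%MS.
  have [_] := (mx_irrP _).1 irr2; apply.
    apply/mxmoduleP=> g Gg; rewrite genmxE (eqmxMr _ (genmxE B)) -homB //.
    exact: submxMl.
  by rewrite -submx0 genmxE submx0.
exists B => //.
by move: fullB freeB; rewrite /row_full genmxE /row_free => /eqP-> /eqP.
Qed.

(** The dimension is a field so that one finite family can mix representations of different
    dimensions. *)
Record irrep := Irrep { idim : nat; irepr :> mx_representation F G idim;
                        irep_abs : mx_absolutely_irreducible irepr }.

Section Family.
Variables (I : finType) (phi : I -> irrep).
Hypothesis phi_inj : forall i j, mx_rsim (phi i) (phi j) -> i = j.

(** Induction on the number of nonzero [A i]: two nonzero terms would force two members of the
    family to be similar, and a single one is excluded because its representation spans all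
    matrices. *)
Lemma coef_indep (A : forall i, 'M[F]_(idim (phi i))) :
  (forall g, g \in G -> \sum_i \tr (A i *m phi i g) = 0) -> forall i, A i = 0.
Proof.
move: {2}#|[set i | A i != 0]| (leqnn #|[set i | A i != 0]|) => n.
elim: n A => [|n IHn] A.
  by rewrite leqn0 cards_eq0 => /eqP/setP A0 _ i; have := A0 i; rewrite !inE => /negbFE/eqP.
move=> leAn relA i1; apply/eqP/idPn => nzA1.
have A0 i2 : i2 != i1 -> A i2 = 0.
  move=> ne12; apply/eqP/idPn => nzA2.
  case/eqP: ne12; apply/esym/phi_inj.
  apply: rsim_of_annihilator (irep_abs _) (mx_abs_irrW (irep_abs _)) _ => c c0.
  (* Multiplying the relation by an element that kills [phi i1] leaves fewer nonzero matrices; by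
     induction the element kills [phi i2] as well. *)
  have rel h : h \in G -> (\sum_(g in G) c g *: phi i2 g) *m phi i2 h *m A i2 = 0.
    move=> Gh; pose A' i := (\sum_(g in G) c g *: phi i g) *m phi i h *m A i.
    apply: (IHn A') => [|g Gg].
      rewrite -ltnS; apply: leq_trans leAn; apply: proper_card.
      apply/properP; split; last first.
        by exists i1; rewrite ?inE // /A' c0 !mul0mx eqxx.
      by apply/subsetP=> i; rewrite !inE; apply: contraNneq => Ai; rewrite /A' Ai mulmx0.
    transitivity (\sum_(x in G) c x * \sum_i \tr (A i *m phi i (g * x * h)%g)).
      under [RHS]eq_bigr do rewrite mulr_sumr; rewrite exchange_big /=.
      apply: eq_bigr => i _; rewrite /A' -!mulmxA mulmx_suml raddf_sum /=.
      apply: eq_bigr => x Gx; rewrite -scalemxAl mxtraceZ; congr (_ * _).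
      rewrite mxtrace_mulC -!mulmxA mxtrace_mulC -!mulmxA -repr_mxM // -repr_mxM //.
        by rewrite mulgA.
      by rewrite groupM.
    by rewrite big1 // => x Gx; rewrite relA ?mulr0 // !groupM.
  apply: mulmx_all_eq0 nzA2 => M; have [b ->] := abs_irr_span M (irep_abs (phi i2)).
  rewrite mulmx_sumr mulmx_suml big1 // => h Gh.
  by rewrite -scalemxAr -scalemxAl rel ?scaler0.
case/eqP: nzA1; apply: mxtrace_all_eq0 => M.
have [b ->] := abs_irr_span M (irep_abs (phi i1)).
rewrite mulmx_sumr raddf_sum big1 //= => h Gh.
rewrite -scalemxAr mxtraceZ -(relA h Gh) (bigD1 i1) //= [X in _ + X]big1 ?addr0; last first.
  by move=> i ni; rewrite A0 // mul0mx raddf0.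
have := relA h Gh; rewrite (bigD1 i1) //= [X in _ + X]big1 ?addr0 => [->|]; first by rewrite mulr0.
by move=> i ni; rewrite A0 // mul0mx raddf0.
Qed.

End Family.
End MatrixCoefficients.

Section Independent.
Local Open Scope ring_scope.
Lemma indep_card (F : fieldType) (I J : finType) (f : I -> J -> F) :
  (forall c : I -> F, (forall j, \sum_i c i * f i j = 0) -> forall i, c i = 0) ->
  (#|I| <= #|J|)%N.
Proof.
move=> ind; pose M := \matrix_(i < #|I|, j < #|J|) f (enum_val i) (enum_val j).
suff: row_free M by rewrite -row_leq_rank => /leq_trans; apply; exact: rank_leq_col.
rewrite -kermx_eq0; apply/rowV0P=> v /sub_kermxP vM0; apply/rowP=> i.
rewrite mxE -(enum_valK i); apply: (ind (fun i => v 0 (enum_rank i))) => j.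
have /rowP/(_ (enum_rank j)) := vM0; rewrite !mxE => e; rewrite -[RHS]e.
rewrite (reindex (enum_val : 'I_#|I| -> I)) /=; last first.
  by apply: onW_bij; apply: enum_val_bij.
by apply: eq_bigr => k _; rewrite mxE enum_valK enum_rankK.
Qed.

Lemma dep_exists (F : fieldType) (I J : finType) (f : I -> J -> F) :
  (#|J| < #|I|)%N -> exists2 c : I -> F, (forall j, \sum_i c i * f i j = 0) & exists i, c i != 0.
Proof.
move=> ltJI; apply: NNPP => nex; move: ltJI; rewrite ltnNge => /negP; apply.
apply: indep_card (f) _ => c c0 i; apply/eqP/negPn/negP => nz; apply: nex.
by exists c => //; exists i.
Qed.
End Independent.

Section Monomial.
Local Open Scope ring_scope.
Variables (F : fieldType) (gT : finGroupType) (G E : {group gT}) (la : gT -> F).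
Hypothesis sEG : E \subset G.
Hypothesis la1 : la 1%g = 1.
Hypothesis laM : {in E &, {morph la : x y / (x * y)%g >-> x * y}}.

Definition nrc := #|rcosets E G|.
Definition rrep (c : 'I_nrc) : gT := repr (enum_val c).

Lemma rrepE c : (E :* rrep c)%g = enum_val c.
Proof.
have /rcosetsP[x Gx e] := enum_valP c; rewrite /rrep e; apply/rcoset_eqP.
by rewrite (mem_repr x) // rcoset_refl.
Qed.

Lemma rrep_in c : rrep c \in G.
Proof.
have /rcosetsP[x Gx e] := enum_valP c; have := rcoset_refl E (rrep c).
rewrite rrepE e mem_rcoset => h; have := groupM (subsetP sEG _ h) Gx.
by rewrite mulgKV.
Qed.

Lemma rrep_exists g : g \in G -> exists c, (g * (rrep c)^-1)%g \in E.
Proof.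
move=> Gg; have cE : (E :* g)%g \in rcosets E G by apply/rcosetsP; exists g.
exists (enum_rank_in cE (E :* g)%g); rewrite -mem_rcoset rrepE enum_rankK_in //.
exact: rcoset_refl.
Qed.

Lemma rrep_uniq g c d : (g * (rrep c)^-1)%g \in E -> (g * (rrep d)^-1)%g \in E -> c = d.
Proof.
rewrite -!mem_rcoset => /rcoset_eqP e1 /rcoset_eqP e2.
by apply: enum_val_inj; rewrite -!rrepE -e1.
Qed.

(** The representation induced from the linear character [la] of [E], in the basis of chosen coset
    representatives. *)
Definition mon_mx g : 'M[F]_nrc :=
  \matrix_(c, d) if (rrep c * g * (rrep d)^-1)%g \in E then la (rrep c * g * (rrep d)^-1)%g else 0.

Lemma mon_mx_repr : mx_repr G mon_mx.
Proof.
split=> [|g h Gg Gh]; apply/matrixP=> c d; rewrite !mxE.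
  case: eqVneq => [->|ncd]; first by rewrite mulg1 mulgV group1 la1.
  case: ifP => // Ecd; case/eqP: ncd; apply: (@rrep_uniq (rrep c)).
    by rewrite mulgV group1.
  by rewrite mulg1 in Ecd.
have [k Ek] := rrep_exists (groupM (rrep_in c) Gg).
rewrite (bigD1 k) //= big1 ?addr0 => [|j njk]; last first.
  rewrite !mxE; case: ifP => [Ej|]; last by rewrite mul0r.
  by case/eqP: njk; apply: rrep_uniq Ej Ek.
rewrite !mxE Ek.
have e : (rrep c * (g * h) * (rrep d)^-1 = (rrep c * g * (rrep k)^-1) * (rrep k * h * (rrep d)^-1))%g.
  by rewrite !mulgA mulgKV.
rewrite e (groupMl _ Ek); case: ifP => Ed; last by rewrite mulr0.
by rewrite (laM Ek Ed).
Qed.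
Definition mon_repr := MxRepresentation mon_mx_repr.

Lemma mon_tr g : \tr (mon_mx g) =
  \sum_c if (rrep c * g * (rrep c)^-1)%g \in E then la (rrep c * g * (rrep c)^-1)%g else 0.
Proof. by apply: eq_bigr => c _; rewrite mxE. Qed.
End Monomial.

Section Brauer.
Local Open Scope ring_scope.
Variables (F : closedFieldType) (gT : finGroupType) (G : {group gT}) (p : nat).
Hypothesis charF : p \in [pchar F].

Definition irr_distinct (I : finType) (phi : I -> irrep F G) :=
  forall i j, mx_rsim (phi i) (phi j) -> i = j.

(** One corner coefficient per representation gives independent functions. The crude bound serves to
    stop the enlargement of a family in [irr_family_exists]. *)
Lemma irr_card_bound (I : finType) (phi : I -> irrep F G) : irr_distinct phi -> (#|I| <= #|gT|)%N.
Proof.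
move=> inj; have pos i : (0 < idim (phi i))%N by have /andP[] := irep_abs (phi i).
apply: (@indep_card F I gT (fun i g => if g \in G then phi i g (Ordinal (pos i)) (Ordinal (pos i)) else 0)).
move=> c c0 i; pose A i : 'M_(idim (phi i)) := c i *: delta_mx (Ordinal (pos i)) (Ordinal (pos i)).
have /(_ _ i)/matrixP/(_ (Ordinal (pos i)) (Ordinal (pos i))) := coef_indep (A := A) inj.
rewrite !mxE !eqxx mulr1; apply=> g Gg; rewrite -[RHS](c0 g); apply: eq_bigr => j _.
rewrite Gg /A -scalemxAl mxtraceZ; congr (_ * _).
rewrite /mxtrace (bigD1 (Ordinal (pos j))) //= [X in _ + X]big1 ?addr0 => [|k nk]; last first.
  by rewrite mxE big1 // => l _; rewrite !mxE (negPf nk) mul0r.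
rewrite mxE (bigD1 (Ordinal (pos j))) //= big1 ?addr0 => [|l nl]; last by rewrite !mxE (negPf nl) andbF mul0r.
by rewrite !mxE !eqxx mul1r.
Qed.

Lemma irr_family_exists : exists (I : finType) (phi : I -> irrep F G),
  irr_distinct phi /\ forall r : irrep F G, exists i, mx_rsim r (phi i).
Proof.
have step n : (exists (I : finType) (phi : I -> irrep F G),
  irr_distinct phi /\ forall r : irrep F G, exists i, mx_rsim r (phi i)) \/
  (exists (I : finType) (phi : I -> irrep F G), irr_distinct phi /\ #|I| = n).
  elim: n => [|n [IHn|[I [phi [inj cI]]]]]; [|by left|].
    by right; exists void, (@of_void _); split=> [[]|]; rewrite ?card_void.
  have [complete|] := classic (forall r : irrep F G, exists i, mx_rsim r (phi i)).
    by left; exists I, phi.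
  case/not_all_ex_not=> r /not_ex_all_not nr; right.
  exists (option I), (fun o => if o is Some i then phi i else r); split; last first.
    by rewrite card_option cI.
  case=> [i|] [j|] //= sim; first by rewrite (inj i j).
    by case: (nr i); apply: mx_rsim_sym.
  by case: (nr j).
have [//|[I [phi [inj cI]]]] := step #|gT|.+1.
by have := irr_card_bound inj; rewrite cI ltnn.
Qed.

(** Traces add along a submodule and its quotient, so induction on the dimension reduces to the
    irreducible case. *)
Lemma trace_functional_ext (S : finType) (x : S -> gT) (c : S -> F) :
  (forall s, x s \in G) ->
  (forall r : irrep F G, \sum_s c s * \tr (r (x s)) = 0) ->
  forall n (r : mx_representation F G n), \sum_s c s * \tr (r (x s)) = 0.
Proof.
move=> Gx c0 n; elim/ltn_ind: n => n IHn r.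
have [irr|nirr] := classic (mx_irreducible r).
  exact: (c0 (Irrep (group_closure_closed_field irr))).
have [n0|n_gt0] := posnP n.
  by rewrite big1 // => s _; rewrite /mxtrace big1 ?mulr0 // => i; have := ltn_ord i; rewrite {2}n0.
have [U Umod [nzU nfU]] : exists2 U : 'M_n, mxmodule r U & U != 0 /\ ~~ row_full U.
  apply: NNPP => nex; case: nirr; apply/mx_irrP; split=> // U Umod nzU.
  by apply/negPn/negP => nf; case: nex; exists U.
have r1 : (\rank U < n)%N by rewrite ltn_neqAle rank_leq_row andbT.
have r2 : (\rank (cokermx U) < n)%N.
  by rewrite mxrank_coker ltn_subLR ?rank_leq_row // -[X in (X < _)%N]add0n ltn_add2r lt0n mxrank_eq0.
transitivity (\sum_s (c s * \tr (submod_repr Umod (x s)) + c s * \tr (factmod_repr Umod (x s)))).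
  by apply: eq_bigr => s _; rewrite -mulrDr mxtrace_sub_fact_mod.
by rewrite big_split /= (IHn _ r1 (submod_repr Umod)) (IHn _ r2 (factmod_repr Umod)) addr0.
Qed.

Lemma prim_root_exists m : (0 < m)%N -> ~~ (p %| m)%N -> exists w : F, m.-primitive_root w.
Proof.
move=> m_gt0 npm; have nzm : m%:R != 0 :> F by rewrite -(dvdn_pcharf charF).
have [rs rsE] := closed_field_poly_normal ('X^m - 1 : {poly F}).
have lead1 : lead_coef ('X^m - 1 : {poly F}) = 1 by apply/monicP/monic_Xn_sub_1.
rewrite lead1 scale1r in rsE.
have urs : uniq rs by rewrite -separable_prod_XsubC -rsE separable_Xn_sub_1.
have szrs : size rs = m.
  by apply/eqP; rewrite -eqSS -(size_prod_XsubC rs id) -rsE size_XnsubC.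
have /hasP[w _ pw] : has m.-primitive_root rs.
  apply: has_prim_root => //; last by rewrite szrs.
  by apply/allP=> z; rewrite -root_prod_XsubC -rsE.
by exists w.
Qed.

Lemma sum_prim_root m (w : F) a : m.-primitive_root w ->
  \sum_(k < m) w ^+ (k * a) = if (m %| a)%N then m%:R else 0.
Proof.
move=> pw; rewrite (prim_order_dvd pw); case: eqP => [wa|/eqP nwa].
  under eq_bigr do rewrite mulnC exprM wa expr1n.
  by rewrite sumr_const card_ord.
apply/eqP; have: (w ^+ a - 1) * \sum_(k < m) w ^+ (k * a) = 0.
  under [X in _ * X]eq_bigr do rewrite mulnC exprM.
  by rewrite -subrX1 -exprM mulnC exprM (prim_expr_order pw) expr1n subrr.
by move/eqP; rewrite mulf_eq0 subr_eq0 (negPf nwa).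
Qed.

Section Detect.
Variables (z : gT) (Q : {group gT}).
Hypothesis Gz : z \in G.
Hypothesis rz : (p^'.-elt z)%g.
Hypothesis sylQ : p.-Sylow('C_G[z])%g Q.

Let E := (Q <*> <[z]>)%G.

Let cQz : (<[z]> \subset 'C(Q))%g.
Proof.
rewrite cycle_subG -sub_cent1; apply: subset_trans (pHall_sub sylQ) _.
exact: subsetIr.
Qed.

Let EE : E = (Q * <[z]>)%g :> {set gT}.
Proof. by rewrite /= cent_joinEr. Qed.

Lemma Epart u j : u \in Q -> ((u * z ^+ j).`_p^' = z ^+ j)%g.
Proof.
move=> Qu.
have cuz : commute u (z ^+ j)%g.
  by apply/commute_sym/(centP (subsetP cQz _ (mem_cycle z j))).
rewrite consttM // (constt1P _) ?mul1g; last first.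
  by rewrite p_eltNK (mem_p_elt (pHall_pgroup sylQ)).
by rewrite constt_p_elt // p_eltX.
Qed.

Lemma memEP e : e \in E -> exists u j, u \in Q /\ e = (u * z ^+ j)%g.
Proof. by rewrite EE => /mulsgP[u v Qu /cycleP[j ->] ->]; exists u, j. Qed.

(** A logarithm of the p'-part to the base [z]. It makes the characters of [E] trivial on [Q]
    explicit powers of a root of unity. *)
Definition dlog e := find (fun j => (e.`_p^' == z ^+ j)%g) (iota 0 #[z]%g).

Lemma dlogE e : e \in E -> (e.`_p^' = z ^+ dlog e)%g.
Proof.
case/memEP=> u [j [Qu ->]]; rewrite /dlog Epart //.
have h : has (fun i => (z ^+ j == z ^+ i)%g) (iota 0 #[z]%g).
  apply/hasP; exists (j %% #[z]%g)%N; last by rewrite expg_mod_order.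
  by rewrite mem_iota /= add0n ltn_mod order_gt0.
have := nth_find 0%N h; rewrite nth_iota ?add0n => [/eqP//|].
by rewrite -[X in (_ < X)%N](size_iota 0) -has_find.
Qed.

Lemma dlogM : {in E &, forall e f, dlog (e * f)%g = dlog e + dlog f %[mod #[z]%g]}.
Proof.
move=> e f Ee Ef; apply/eqP; rewrite -eq_expg_mod_order expgD.
rewrite -!dlogE ?groupM //; apply/eqP.
have [u [i [Qu ->]]] := memEP Ee; have [v [j [Qv ->]]] := memEP Ef.
have cvz : commute (z ^+ i)%g v.
  by apply: (centP (subsetP cQz _ (mem_cycle z i))).
rewrite -mulgA (mulgA (z ^+ i)%g) cvz !mulgA -(mulgA (u * v)%g) -expgD.
by rewrite !Epart ?groupM // expgD.
Qed.

(** Inducing the characters of [E] trivial on [Q], weighted by their inverse values at [z], isolates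
    one p-regular class. The value at [z] is [#[z]] times the index of [E] in the centralizer, prime
    to p because [Q] is a Sylow subgroup there. *)
Lemma brauer_detect : exists (c : 'I_#[z]%g -> F) (r : forall k : 'I_#[z]%g, {n & mx_representation F G n}),
  (forall g, g \in G -> (p^'.-elt g)%g -> g \notin (z ^: G)%g -> \sum_k c k * \tr (projT2 (r k) g) = 0)
  /\ \sum_k c k * \tr (projT2 (r k) z) != 0.
Proof.
have m_gt0 : (0 < #[z]%g)%N := order_gt0 z.
have npm : ~~ (p %| #[z]%g)%N.
  by have := rz; rewrite /p_elt p'natE // (pcharf_prime charF).
have [w pw] := prim_root_exists m_gt0 npm.
pose la k e := w ^+ (k * dlog e) : F.
have wmod i j : i = j %[mod #[z]%g] -> w ^+ i = w ^+ j.
  by move=> e; rewrite -(prim_expr_mod pw i) e prim_expr_mod.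
have laM k : {in E &, {morph la k : x y / (x * y)%g >-> x * y}}.
  move=> e f Ee Ef; rewrite /la -exprD -mulnDr; apply: wmod.
  by rewrite -modnMmr dlogM // modnMmr.
have la1 k : la k 1%g = 1.
  have := laM k 1%g 1%g (group1 _) (group1 _); rewrite mulg1 => e.
  have nzw : w != 0.
    apply/eqP=> w0; have := prim_expr_order pw; rewrite w0 expr0n eqn0Ngt m_gt0.
    by move/esym/eqP; rewrite oner_eq0.
  have nz : la k 1%g != 0 by rewrite expf_neq0.
  by apply: (mulfI nz); rewrite -e mulr1.
have sQC : Q \subset 'C_G[z]%g := pHall_sub sylQ.
have sEC : E \subset 'C_G[z]%g.
  by rewrite join_subG sQC cycle_subG inE Gz cent1id.
have sEG : E \subset G := subset_trans sEC (subsetIl _ _).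
pose r (k : 'I_#[z]%g) : {n & mx_representation F G n} := existT _ _ (mon_repr sEG (la1 k) (laM k)).
(* The exponent [#[z].-1] stands for -1. *)
exists (fun k => w ^+ (k * (#[z]%g).-1)), r.
have trE g : (p^'.-elt g)%g -> \sum_(k < #[z]%g) w ^+ (k * (#[z]%g).-1) * \tr (projT2 (r k) g)
   = \sum_(c < nrc G E) if (rrep c * g * (rrep c)^-1 == z)%g then #[z]%g%:R else 0.
  move=> rg; under eq_bigr => k _ do rewrite /r /= mon_tr mulr_sumr.
  rewrite exchange_big /=; apply: eq_bigr => c _; set h := (_ * _ * _)%g.
  have rh : (p^'.-elt h)%g by have -> : h = (g ^ (rrep c)^-1)%g; rewrite ?p_eltJ // conjgE invgK mulgA.
  case Eh: (h \in E); last first.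
    rewrite big1 => [|k _]; last by rewrite mulr0.
    case: eqP => // hz; move: Eh; rewrite hz => /negP[].
    by rewrite EE; apply/mulsgP; exists 1%g z; rewrite ?group1 ?cycle_id ?mul1g.
  under eq_bigr => k _ do rewrite /la -exprD -mulnDr.
  rewrite (sum_prim_root _ pw); congr (if _ then _ else _).
  have hE : h = (z ^+ dlog h)%g by rewrite -dlogE // constt_p_elt.
  by rewrite order_dvdn expgD -hE -invg_expg -eq_mulVg1 eq_sym.
split=> [g Gg rg ngz|].
  rewrite trE // big1 // => c _; case: eqP => // e; case/negP: ngz.
  by apply/imsetP; exists (rrep c); rewrite ?(rrep_in sEG) // conjgE -e mulgKV mulKg.
rewrite trE // -big_mkcond /= sumr_const -mulrnA -(dvdn_pcharf charF).
set n := #|_|.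
(* The surviving cosets of [E] are those contained in the centralizer of [z]. *)
have nE : n = #|'C_G[z] : E|%g.
  rewrite /n -(card_imset _ (@enum_val_inj _ _)); apply: eq_card => A.
  apply/imsetP/rcosetsP => [[c]|[x Cx ->]].
    rewrite unfold_in => /eqP ce ->; exists (rrep c); last by rewrite rrepE.
    rewrite inE (rrep_in sEG); apply/cent1P/(mulIg (rrep c)^-1%g).
    by rewrite ce mulgK.
  have Gx : x \in G by case/setIP: Cx.
  have cE : (E :* x)%g \in rcosets E G by apply/rcosetsP; exists x.
  exists (enum_rank_in cE (E :* x)%g); last by rewrite enum_rankK_in.
  rewrite unfold_in; set c := enum_rank_in _ _.
  have : (rrep c * x^-1)%g \in E by rewrite -mem_rcoset -[(E :* x)%g](enum_rankK_in cE) // -rrepE rcoset_refl.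
  move/(subsetP sEC) => h; have := groupM h Cx; rewrite mulgKV => /setIP[_ /cent1P cc].
  by rewrite -[hasDecEq.eq_op _ _ _]/(_ == _) cc mulgK.
have cE : #|E| = (#|Q| * #[z]%g)%N.
  rewrite EE TI_cardMg // coprime_TIg // -orderE.
  exact: pnat_coprime (pHall_pgroup sylQ) rz.
have cC : (#[z]%g * n * #|Q| = #|'C_G[z]%g|)%N.
  by rewrite -(Lagrange sEC) cE nE mulnAC (mulnC #|Q|).
have p_pr := pcharf_prime charF.
have : (0 < #[z]%g * n * #|Q|)%N by rewrite cC cardG_gt0.
rewrite muln_gt0 => /andP[a_gt0 Q_gt0]; apply/negP => pdv.
have: logn p #|Q| = logn p (#[z]%g * n * #|Q|).
  by rewrite cC (card_Hall sylQ) p_part pfactorK.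
rewrite (lognM p a_gt0 Q_gt0) => /eqP; rewrite -[X in X == _]add0n eqn_add2r eq_sym.
by rewrite -leqn0 leqNgt logn_gt0 mem_primes p_pr a_gt0 pdv.
Qed.
End Detect.

(** With more regular classes than irreducible representations, a nonzero combination of class
    evaluations kills every irreducible trace, hence every trace; [brauer_detect] refutes this at a
    class with nonzero coefficient. *)
Theorem brauer_irr_count : exists (I : finType) (phi : I -> irrep F G),
  irr_distinct phi /\ (kp' p G <= #|I|)%N.
Proof.
have [I [phi [inj complete]]] := irr_family_exists; exists I, phi; split=> //.
pose CG := [set x ^: G | x in G & p^'.-elt x]%g.
rewrite leqNgt; apply/negP => lt.
pose S : finType := {c : {set gT} | c \in CG}.
pose x (s : S) := repr (val s).
have xP s : [/\ x s \in G, (p^'.-elt (x s))%g & (x s ^: G)%g = val s].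
  rewrite /x; case/imsetP: (valP s) => y + ->; rewrite inE => /andP[Gy ry].
  have /imsetP[h Gh ->] : repr (y ^: G)%g \in (y ^: G)%g by apply: mem_repr (class_refl _ _).
  by rewrite groupJ // p_eltJ classGidl.
have cardS : #|S| = kp' p G by rewrite card_sig.
have [|c c0 [s0 nz]] := @dep_exists F S I (fun s i => \tr (phi i (x s))).
  by rewrite cardS.
have c_irr (r : irrep F G) : \sum_s c s * \tr (r (x s)) = 0.
  have [i sim] := complete r; rewrite -[RHS](c0 i); apply: eq_bigr => s _.
  have [Gx _ _] := xP s; congr (_ * _).
  have [B [B' BB rE]] := mx_rsim_def sim; rewrite rE // mxtrace_mulC mulmxA BB mul1mx.
  by [].
have call := trace_functional_ext (fun s => let: And3 Gx _ _ := xP s in Gx) c_irr.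
have [Gz rz _] := xP s0.
have [Q sylQ] := Sylow_exists p ('C_G[x s0])%G.
have [d [r [d0 dnz]]] := brauer_detect Gz rz sylQ.
case/eqP: nz; apply: (mulIf dnz); rewrite mul0r.
transitivity (\sum_s c s * \sum_k d k * \tr (projT2 (r k) (x s))).
  rewrite (bigD1 s0) //= [X in _ + X]big1 ?addr0 // => s ns.
  have [Gs rs es] := xP s; rewrite d0 ?mulr0 //.
  apply: contra ns => /class_eqP; rewrite es; have [_ _ ->] := xP s0.
  by move/val_inj=> ->.
under eq_bigr do rewrite mulr_sumr; rewrite exchange_big /= big1 // => k _.
under eq_bigr do rewrite mulrCA; rewrite -mulr_sumr call mulr0.
by [].
Qed.
End Brauer.

Section ClosedField.
Lemma closed_pfield_exists p : prime p -> exists F : closedFieldType, p \in [pchar F]%R.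
Proof.
move=> p_pr; have [K [f _]] := countable_algebraic_closure 'F_p.
by exists K; rewrite (fmorph_pchar f) pchar_Fp.
Qed.
End ClosedField.

(** Puts the coefficient of a row and a column into the trace form that [coef_indep] handles. *)
Lemma mxtrace_outer (F : fieldType) n (w : 'cV[F]_n) (v : 'rV_n) (A : 'M_n) :
  (\tr ((w *m v) *m A) = (v *m A *m w) 0 0)%R.
Proof. by rewrite -mulmxA mxtrace_mulC /mxtrace big_ord1. Qed.

Lemma outer_neq0 (F : fieldType) n m (w : 'cV[F]_n) (v : 'rV_m) :
  (w != 0 -> v != 0 -> w *m v != 0)%R.
Proof.
move=> /cV0Pn[k wk] /rV0Pn[j vj].
by apply/matrix0Pn; exists k, j; rewrite mxE big_ord1 mulf_neq0.
Qed.

(** * Double cosets of a Sylow subgroup *)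

Section DoubleCosets.
Local Open Scope group_scope.
Variables (gT : finGroupType) (G P : {group gT}) (p : nat).
Hypothesis p_pr : prime p.
Hypothesis sylP : p.-Sylow(G) P.
Let N := 'N_G(P).

Definition dc (g : gT) : {set gT} := P :* g * P.

Lemma dc_refl g : g \in dc g.
Proof. by apply/mulsgP; exists g 1; rewrite ?rcoset_refl ?group1 ?mulg1. Qed.

Lemma dc_mul x y g : x \in P -> y \in P -> dc (x * g * y) = dc g.
Proof.
by move=> Px Py; rewrite /dc -!mulg_set1 !mulgA (rcoset_id Px) -!mulgA (lcoset_id Py).
Qed.

Lemma mem_dcP g h : h \in dc g -> exists x y, [/\ x \in P, y \in P & h = x * g * y].
Proof. by case/mulsgP=> _ y /rcosetP[x Px ->] Py ->; exists x, y. Qed.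

Lemma dc_eq g h : h \in dc g -> dc h = dc g.
Proof. by case/mem_dcP=> x [y [Px Py ->]]; apply: dc_mul. Qed.

Lemma dc_sub g : g \in G -> dc g \subset G.
Proof.
move=> Gg; have sPG := pHall_sub sylP.
apply/subsetP=> h /mem_dcP[x [y [Px Py ->]]].
by rewrite !groupM // (subsetP sPG).
Qed.

Lemma dc_norm g : g \in N -> dc g = P :* g.
Proof.
case/setIP=> _ nPg; rewrite /dc -mulgA -[[set g] * P]/(g *: P) -norm_rlcoset //.
by rewrite mulgA mulGid.
Qed.

(** Translation by the inverse of [g] turns the double coset into a product of two Sylow subgroups;
    outside the normalizer their intersection has index at least p. *)
Lemma card_dc g : g \in G :\: N -> (p * #|P| <= #|dc g|)%N.
Proof.
case/setDP=> Gg nNg.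
have e : #|dc g| = #|P * (P :^ g^-1)|.
  rewrite -(card_rcoset _ g^-1) /dc conjsgE invgK.
  by rewrite -!mulgA.
rewrite e; have := mul_cardG P (P :^ g^-1); rewrite cardJg => small_weight_rep.
set I := P :&: _ in small_weight_rep.
have sIP : I \subset P := subsetIl _ _.
have pI : (1 < #|P : I|)%N.
  rewrite indexg_gt1; apply: contra nNg => sPI; rewrite inE Gg /= -groupV.
  apply/normP/eqP; rewrite eq_sym eqEcard cardJg leqnn andbT.
  exact: subset_trans sPI (subsetIr _ _).
have ppI : p.-nat #|P : I| := pnat_dvd (dvdn_indexg P I) (pHall_pgroup sylP).
have leI : (p <= #|P : I|)%N.
  by case/p_natP: ppI pI => // k ->; case: k => // k _; rewrite expnS leq_pmulr // expn_gt0 prime_gt0.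
have I_gt0 : (0 < #|I|)%N by apply: cardG_gt0.
rewrite -(leq_pmul2r I_gt0) -small_weight_rep -mulnA (mulnC #|P|) mulnA leq_mul2r; apply/orP; right.
by rewrite -(Lagrange sIP) mulnC leq_mul2l leI orbT.
Qed.

Definition dcs (S : {set gT}) := dc @: S.

Lemma card_dcs_out : (#|dcs (G :\: N)| * (p * #|P|) <= #|G| - #|N|)%N.
Proof.
have sNG : N \subset G := subsetIl _ _.
rewrite -cardsDS // -[X in (_ <= X)%N]sum1_card.
rewrite (partition_big dc (mem (dcs (G :\: N)))) /=; last by move=> g Gg; apply: imset_f.
rewrite -sum_nat_const; apply: leq_sum => _ /imsetP[g GNg ->].
rewrite sum1dep_card; apply: leq_trans (card_dc GNg) _.
apply/subset_leq_card/subsetP=> h hg; rewrite inE (dc_eq hg) eqxx andbT.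
have [Gg nNg] := setDP GNg.
have [x [y [Px Py hE]]] := mem_dcP hg.
have sPN : P \subset N by rewrite subsetI (pHall_sub sylP) normG.
rewrite inE (subsetP (dc_sub Gg) _ hg) andbT hE (groupMr _ (subsetP sPN _ Py)).
by rewrite (groupMl _ (subsetP sPN _ Px)).
Qed.

Lemma card_dcs_norm : #|dcs N| = #|N : P|.
Proof.
apply: eq_card => A; apply/imsetP/rcosetsP => -[g Ng ->]; exists g => //; last exact/esym/dc_norm.
exact: dc_norm.
Qed.

Lemma card_dcs : (#|dcs G| * p <= #|G : P| + #|N : P| * p.-1)%N.
Proof.
have sNG : N \subset G := subsetIl _ _.
have sPN : P \subset N by rewrite subsetI (pHall_sub sylP) normG.
have P_gt0 : (0 < #|P|)%N := cardG_gt0 _.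
have e : dcs G = dcs N :|: dcs (G :\: N).
  by rewrite /dcs -imsetU -{1}(setID G N) (setIidPr sNG).
have h1 : (#|dcs G| <= #|N : P| + #|dcs (G :\: N)|)%N.
  by rewrite e -card_dcs_norm cardsU leq_subr.
have h2 := card_dcs_out.
have h3 := Lagrange (pHall_sub sylP); have h4 := Lagrange sPN.
have h5 := subset_leq_card sNG.
have h6 : (#|dcs (G :\: N)| * p <= #|G : P| - #|N : P|)%N.
  by rewrite -(leq_pmul2r P_gt0) -mulnA mulnBl ![(#|_ : _| * _)%N]mulnC h3 h4.
have p_gt0 := prime_gt0 p_pr.
have h7 : (#|N : P| <= #|G : P|)%N by rewrite -(leq_pmul2l P_gt0) h3 h4.
nia.
Qed.

End DoubleCosets.

Section Bounds.
Local Open Scope ring_scope.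
Variables (F : fieldType) (gT : finGroupType) (G P : {group gT}).
Hypothesis sPG : P \subset G.

(** A P-biinvariant function is determined by one value per double coset. The support [S] is a
    parameter because it is [G] in one use and [G :\: N] in the others. *)
Lemma biinv_bound (K : finType) (h : K -> gT -> F) (S : {set gT}) :
  S \subset G ->
  (forall k g x y, g \in G -> x \in P -> y \in P -> h k (x * g * y)%g = h k g) ->
  (forall k g, g \in G :\: S -> h k g = 0) ->
  (forall c : K -> F, (forall g, g \in G -> \sum_k c k * h k g = 0) -> forall k, c k = 0) ->
  (#|K| <= #|dcs P S|)%N.
Proof.
move=> sSG hP hS ind.
pose J : finType := {d : {set gT} | d \in dcs P S}.
have -> : #|dcs P S| = #|J| by rewrite card_sig.
apply: (@indep_card F K J (fun k d => h k (repr (val d)))) => c c0; apply: ind => g Gg.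
have [Sg|nSg] := boolP (g \in S); last first.
  by rewrite big1 // => k _; rewrite hS ?mulr0 // inE nSg.
have Jg : dc P g \in dcs P S by apply: imset_f.
rewrite -[RHS](c0 (Sub (dc P g) Jg : J)) /=; apply: eq_bigr => k _; congr (_ * _).
have /mem_dcP[x [y [Px Py ->]]] : repr (dc P g) \in dc P g by apply: mem_repr (dc_refl _ _).
by rewrite hP.
Qed.

Definition dual_mx n (r : mx_representation F G n) g : 'M_n := (r g^-1%g)^T.
Lemma dual_mx_repr n (r : mx_representation F G n) : mx_repr G (dual_mx r).
Proof.
split=> [|g h Gg Gh]; first by rewrite /dual_mx invg1 repr_mx1 trmx1.
by rewrite /dual_mx invMg repr_mxM ?groupV // trmx_mul.
Qed.
Definition dual_repr n (r : mx_representation F G n) := MxRepresentation (dual_mx_repr r).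

Variable p : nat.
Hypothesis charF : p \in [pchar F].
Hypothesis pP : (p.-group P)%g.

Lemma fixed_row n (r : mx_representation F G n) : (0 < n)%N ->
  exists2 v : 'rV_n, v != 0 & forall x, x \in P -> v *m r x = v.
Proof.
move=> n_gt0; pose rP := subg_repr r sPG.
have nz : rfix_mx rP P != 0 by apply: (rfix_pgroup_pchar charF).
have /rowV0Pn[v vf nzv] := nz; exists v => // x Px.
exact: (rfix_mxP _ vf).
Qed.

Lemma fixed_col n (r : mx_representation F G n) : (0 < n)%N ->
  exists2 v : 'cV_n, v != 0 & forall x, x \in P -> r x *m v = v.
Proof.
move=> n_gt0; have [v nzv vP] := fixed_row (dual_repr r) n_gt0.
exists v^T => [|x Px]; first by apply: contraNneq nzv => e; rewrite -(trmxK v) e trmx0.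
by rewrite -{2}(vP x^-1%g) ?groupV // /= /dual_mx trmx_mul trmxK invgK.
Qed.
End Bounds.

Section Bound1.
Local Open Scope ring_scope.
Variables (gT : finGroupType) (G P : {group gT}) (p : nat).
Hypothesis p_pr : prime p.
Hypothesis sylP : p.-Sylow(G)%g P.

Theorem kp'_double_cosets : (kp' p G <= #|dcs P G|)%N.
Proof.
have [F charF] := closed_pfield_exists p_pr.
have [I [phi [inj leI]]] := brauer_irr_count G charF; apply: leq_trans leI _.
have pos i : (0 < idim (phi i))%N by have /andP[] := irep_abs (phi i).
have sPG := pHall_sub sylP; have pP := pHall_pgroup sylP.
have [v nzv vP] := fin_all_exists2 (fun i => fixed_row sPG charF pP (phi i) (pos i)).
have [w nzw wP] := fin_all_exists2 (fun i => fixed_col sPG charF pP (phi i) (pos i)).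
pose h i g := if g \in G then (v i *m phi i g *m w i) 0 0 else 0.
apply: (@biinv_bound F _ G P I h G) => // [i g x y Gg Px Py|i g|c c0 i].
- have [Gx Gy] := (subsetP sPG x Px, subsetP sPG y Py).
  rewrite /h !groupM // Gg !repr_mxM ?groupM // !mulmxA vP //.
  by rewrite -mulmxA wP.
- by rewrite inE; case/andP=> /negP.
have rel g : g \in G -> \sum_i \tr (c i *: (w i *m v i) *m phi i g) = 0.
  move=> Gg; rewrite -[RHS](c0 g Gg); apply: eq_bigr => j _.
  by rewrite /h Gg -scalemxAl mxtraceZ mxtrace_outer.
have nzwv : w i *m v i != 0 by apply: outer_neq0.
have /eqP := coef_indep inj rel i.
by rewrite scaler_eq0 (negPf nzwv) orbF => /eqP.
Qed.

Theorem kp'_bound : (kp' p G * p <= #|G : P|%g + #|'N_G(P) : P|%g * p.-1)%N.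
Proof.
apply: leq_trans (card_dcs p_pr sylP); rewrite leq_pmul2r ?prime_gt0 //.
exact: kp'_double_cosets.
Qed.

Lemma card_p'part : (#|G|`_p^')%N = #|G : P|%g.
Proof.
have := card_Hall sylP; rewrite -(divgS (pHall_sub sylP)) => ->.
by rewrite -{2}(partnC p (cardG_gt0 G)) mulKn // part_gt0.
Qed.

Lemma index_norm_card : (#|G : 'N_G(P)|%g * #|'N_G(P) : P|%g = #|G : P|%g)%N.
Proof.
apply: Lagrange_index; first exact: subsetIl.
by rewrite subsetI (pHall_sub sylP) normG.
Qed.

Lemma index_norm_mod : (#|G : 'N_G(P)|%g = 1 %[mod p])%N.
Proof. by rewrite -(card_Syl sylP) (card_Syl_mod G p_pr) modn_small ?prime_gt1. Qed.

(** With n = |G : N| and t = |N : P|, the bound n t + t (p - 1) is at most n t p as soon as n >=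
    1. *)
Theorem kp'_le : (kp' p G <= #|G|`_p^')%N.
Proof.
have [p_gt0 n_gt0] := (prime_gt0 p_pr, indexg_gt0 G 'N_G(P)%g).
have := kp'_bound; rewrite card_p'part -index_norm_card.
set n := #|G : _|%g; set t := #|_ : P|%g => le1.
have le2 : (n * t + t * p.-1 <= n * t * p)%N.
  have n_gt0' : (0 < n)%N by [].
  case: (p) p_gt0 => // q _; case: (n) n_gt0' => // n' _; rewrite /=; nia.
by rewrite -(leq_pmul2r p_gt0); apply: leq_trans le1 le2.
Qed.

Theorem kp'_nonnormal : ~~ (P <| G)%g -> (p.+1 * kp' p G <= 2 * #|G|`_p^')%N.
Proof.
move=> nnP; have p_gt1 := prime_gt1 p_pr.
(* The index is 1 modulo p and not 1, hence at least p + 1. *)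
have n1 : (p < #|G : 'N_G(P)|%g)%N.
  have : #|G : 'N_G(P)|%g != 1%N.
    apply: contra nnP; rewrite indexg_eq1 => sGN; rewrite /normal (pHall_sub sylP).
    exact: subset_trans sGN (subsetIr _ _).
  have := index_norm_mod; rewrite [in RHS]modn_small //.
  set n := #|G : _|%g => e; rewrite (divn_eq n p) e.
  by case: (n %/ p)%N => [|q] // _; rewrite addn1 ltnS leq_pmull.
have := kp'_bound; rewrite card_p'part -index_norm_card.
set n := #|G : _|%g in n1 *; set t := #|_ : P|%g; set k := kp' p G => le1.
rewrite -(leq_pmul2r (ltnW p_gt1)) -mulnA.
have le2 : (p.+1 * (n * t + t * p.-1) <= 2 * (n * t) * p)%N.
  case: (p) p_gt1 n1 => // q q0 n1; rewrite /=.
  have -> : n = (q.+2 + (n - q.+2))%N by rewrite subnKC.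
  set m := (n - q.+2)%N.
  have -> : (2 * ((q.+2 + m) * t) * q.+1 = q.+2 * ((q.+2 + m) * t + t * q) + t * m * q)%N by lia.
  exact: leq_addr.
by apply: leq_trans le2; rewrite leq_mul2l le1 orbT.
Qed.
End Bound1.

Lemma mem_Syl (gT : finGroupType) (p : nat) (M R : {group gT}) :
  ((R \in 'Syl_p(M)) = p.-Sylow(M) R)%g.
Proof. by rewrite inE. Qed.

(** * Groups with few Sylow subgroups *)

Section ManySylows.
Local Open Scope group_scope.
Variables (gT : finGroupType) (G : {group gT}) (p : nat).
Hypothesis p_pr : prime p.
Hypothesis Op1 : 'O_p(G) = 1.
Hypothesis few : (#|'Syl_p(G)| < p ^ 2)%N.
Implicit Types A B S R U : {group gT}.

Lemma card_Syl_eq A B : A \in 'Syl_p(G) -> B \in 'Syl_p(G) -> #|A| = #|B|.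
Proof. by rewrite !inE => sA sB; rewrite (card_Hall sA) (card_Hall sB). Qed.

(** The intersection is the stabilizer of [B] when [A] acts by conjugation, so the index is the
    length of an orbit on fewer than p^2 Sylow subgroups; it is a power of p other than 1. *)
Lemma syl_index A B : A \in 'Syl_p(G) -> B \in 'Syl_p(G) -> A != B -> #|A : A :&: B| = p.
Proof.
move=> sA sB nAB.
have sylA : p.-Sylow(G) A by rewrite inE in sA.
have sylB : p.-Sylow(G) B by rewrite inE in sB.
have pA := pHall_pgroup sylA.
have nI : #|A : A :&: B| != 1%N.
  rewrite indexg_eq1 subsetI subxx /=; apply: contra nAB => sAB.
  by rewrite -val_eqE /= eqEcard sAB (card_Syl_eq sB sA) leqnn.
have pI : p.-nat #|A : A :&: B| := pnat_dvd (dvdn_indexg _ _) pA.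
have ltI : (#|A : A :&: B| < p ^ 2)%N.
  apply: leq_ltn_trans few.
  have -> : A :&: B = 'N_A(B).
    apply/eqP; rewrite eqEsubset subsetI subsetIl /=.
    rewrite (subset_trans (subsetIr _ _) (normG B)) /= subsetI subsetIl /=.
    have pN : p.-group ('N_A(B)) := pgroupS (subsetIl _ _) pA.
    have sBN : B \subset 'N_G(B) by rewrite subsetI (pHall_sub sylB) normG.
    rewrite (sub_normal_Hall (pHall_subl sBN (subsetIl _ _) sylB)) ?pN //.
      by rewrite /normal sBN subsetIr.
    by rewrite setSI // (pHall_sub sylA).
  rewrite -astab1JG -card_orbit; apply/subset_leq_card/subsetP=> _ /orbitP[a Aa <-].
  by rewrite inE /= pHallJ // (subsetP (pHall_sub sylA)).
case/p_natP: pI nI ltI => // -[|[|k]] -> //; rewrite ?expn1 //.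
by rewrite ltn_exp2l ?prime_gt1.
Qed.

Lemma syl_int_normal A B : A \in 'Syl_p(G) -> B \in 'Syl_p(G) -> A != B -> A :&: B <| A.
Proof.
move=> sA sB nAB; have pA : p.-group A by rewrite inE in sA; exact: pHall_pgroup sA.
apply: (p_maximal_normal pA); rewrite p_index_maximal ?subsetIl // syl_index //.
Qed.

(** [A :&: B] has index p in both, so its normalizer contains two, hence at least p + 1, Sylow
    subgroups; each contains the normal p-subgroup [A :&: B] and is Sylow in [G]. *)
Lemma many_over A B : A \in 'Syl_p(G) -> B \in 'Syl_p(G) -> A != B ->
  (p < #|[set R in 'Syl_p(G) | A :&: B \subset R]|)%N.
Proof.
move=> sA sB nAB; set K := A :&: B.
have sylA : p.-Sylow(G) A by rewrite inE in sA.
have sylB : p.-Sylow(G) B by rewrite inE in sB.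
pose M := 'N_G(K)%G.
have sAM : A \subset M by rewrite subsetI (pHall_sub sylA) normal_norm ?syl_int_normal.
have sBM : B \subset M.
  by rewrite subsetI (pHall_sub sylB) normal_norm // /K setIC syl_int_normal // eq_sym.
have sMG : M \subset G := subsetIl _ _.
have sAm := pHall_subl sAM sMG sylA; have sBm := pHall_subl sBM sMG sylB.
have nKM : K <| M by rewrite /normal subsetIr andbT (subset_trans (subsetIl _ _)).
apply: (@leq_trans #|'Syl_p(M)|); last first.
  apply/subset_leq_card/subsetP=> R; rewrite mem_Syl => sR; rewrite !inE.
  have eR : #|R| = #|A| by rewrite (card_Hall sR) (card_Hall sAm).
  rewrite pHallE (subset_trans (pHall_sub sR) sMG) eR (card_Hall sylA) eqxx /=.
  apply: normal_sub_max_pgroup (Hall_max sR) _ nKM.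
  exact: pgroupS (subsetIl _ _) (pHall_pgroup sylA).
have := card_Syl_mod M p_pr.
have : (1 < #|'Syl_p(M)|)%N.
  by rewrite (cardsD1 A) (cardsD1 B) !inE sAm sBm (eq_sym B) nAB.
rewrite -/('Syl_p(M)); set n := #|_| => n1 e; rewrite (divn_eq n p) e addn1 ltnS.
have : (n %/ p != 0)%N.
  by apply: contraTneq n1 => q0; rewrite (divn_eq n p) e q0.
by case: (n %/ p)%N => // q _; rewrite leq_pmull.
Qed.

(** If every Sylow subgroup contains [P :&: Q], this intersection lies in the trivial p-core and |P|
    = p. One that does not contain it leads to at least p (p + 1) Sylow subgroups. *)
Lemma few_sylow_card P : P \in 'Syl_p(G) -> (#|P| <= p)%N.
Proof.
move=> sP; have sylP : p.-Sylow(G) P by rewrite inE in sP.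
have [/existsP[Q /andP[sQ nPQ]]|noQ] := boolP [exists Q : {group gT}, (Q \in 'Syl_p(G)) && (P != Q)]; last first.
  have : P <| G.
    rewrite /normal (pHall_sub sylP); apply/normsP=> g Gg; apply/eqP; rewrite eq_sym.
    move: noQ; rewrite negb_exists => /forallP/(_ (P :^ g)%G).
    by rewrite inE pHallJ // sylP /= negbK -val_eqE.
  move/(normal_Hall_pcore sylP); rewrite Op1 => <-; rewrite cards1.
  exact: prime_gt0.
have iPQ := syl_index sP sQ nPQ.
suff allK S : S \in 'Syl_p(G) -> P :&: Q \subset S.
  have: P :&: Q \subset gcore P G.
    apply/bigcapsP=> g Gg; apply: allK; by rewrite inE pHallJ.
  have: gcore P G \subset 'O_p(G).
    rewrite pcore_max ?gcore_normal ?(pHall_sub sylP) //.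
    exact: pgroupS (gcore_sub _ _) (pHall_pgroup sylP).
  rewrite Op1 => s1 s2; have := subset_trans s2 s1; rewrite subG1 => /eqP I1.
  by rewrite -(indexg1 P) -I1 iPQ.
move=> sS; apply: contraT => nKS.
pose KK := [set R in 'Syl_p(G) | P :&: Q \subset R].
have neS R : R \in KK -> S != R.
  by rewrite inE => /andP[_ sK]; apply: contraNneq nKS => ->.
pose UU R := [set U in 'Syl_p(G) | (S :&: R \subset U) && (U != S)].
have cardUU R : R \in KK -> (p <= #|UU R|)%N.
  move=> KR; have sR : R \in 'Syl_p(G) by move: KR; rewrite inE => /andP[].
  have := many_over sS sR (neS R KR).
  rewrite (cardsD1 S) inE sS subsetIl /= add1n ltnS => /leq_trans; apply.
  by apply/subset_leq_card/subsetP=> U; rewrite !inE => /and3P[-> -> ->].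
have cardI A B : A \in 'Syl_p(G) -> B \in 'Syl_p(G) -> A != B -> (#|A :&: B| * p = #|P|)%N.
  move=> sA sB nAB; rewrite -(syl_index sA sB nAB) Lagrange ?subsetIl //.
  exact: card_Syl_eq.
(* The sets [UU R] are disjoint: a common member forces [S :&: R = S :&: R'], of the same order as
   [R :&: R' = P :&: Q], and then [P :&: Q] lies in [S]. *)
have uniqR U R R' : R \in KK -> R' \in KK -> U \in UU R -> U \in UU R' -> R = R'.
  move=> KR KR'; rewrite !inE => /and3P[sU s1 nUS] /and3P[_ s2 _].
  have sR : R \in 'Syl_p(G) by move: KR; rewrite inE => /andP[].
  have sR' : R' \in 'Syl_p(G) by move: KR'; rewrite inE => /andP[].
  have sU' : U \in 'Syl_p(G) by rewrite inE.
  have nSU : S != U by rewrite eq_sym.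
  have p_gt0 := prime_gt0 p_pr.
  have eqI R1 : R1 \in KK -> S :&: R1 \subset U -> S :&: R1 = S :&: U.
    move=> KR1 s3; have sR1 : R1 \in 'Syl_p(G) by move: KR1; rewrite inE => /andP[].
    apply/eqP; rewrite eqEcard subsetI subsetIl s3 /=.
    by rewrite -(leq_pmul2r p_gt0) (cardI S U) // (cardI S R1) ?neS.
  have e : S :&: R = S :&: R' by rewrite (eqI R) // (eqI R').
  apply/eqP/idPn=> nRR'; case/negP: nKS.
  have K1 : P :&: Q = R :&: R'.
    apply/eqP; rewrite eqEcard subsetI; move: KR KR'; rewrite !inE => /andP[_ ->] /andP[_ ->].
    by rewrite /= -(leq_pmul2r p_gt0) (cardI R R') // (cardI P Q).
  have K2 : S :&: R = R :&: R'.
    apply/eqP; rewrite eqEcard subsetI subsetIr /= e subsetIr /=.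
    by rewrite -e -(leq_pmul2r p_gt0) (cardI R R') // (cardI S R) ?neS.
  by rewrite K1 -K2 subsetIl.
have cK : (p < #|KK|)%N by apply: many_over.
have : (\sum_(R in KK) #|UU R| <= #|'Syl_p(G)|)%N.
  rewrite -[X in (_ <= X)%N]sum1_card.
  under eq_bigr do rewrite -sum1_card.
  rewrite (exchange_big_dep (mem 'Syl_p(G))) /=; last by move=> R U _; rewrite inE => /andP[].
  apply: leq_sum => U sU; rewrite sum1dep_card.
  have [->|[R0]] := set_0Vmem [set R in KK | U \in UU R]; first by rewrite cards0.
  rewrite inE => /andP[KR0 UR0]; rewrite -(cards1 R0); apply/subset_leq_card/subsetP=> R.
  by rewrite inE => /andP[KR UR]; rewrite inE; apply/eqP; apply: (uniqR U).
have : (#|KK| * p <= \sum_(R in KK) #|UU R|)%N.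
  by rewrite -sum_nat_const; apply: leq_sum.
move: few => few' h1 h2; have := leq_ltn_trans (leq_trans h1 h2) few'.
by rewrite -mulnn ltn_pmul2r ?prime_gt0 // ltnNge (ltnW cK).
Qed.
End ManySylows.

Section LargeSylow.
Local Open Scope group_scope.
Variables (gT : finGroupType) (G P : {group gT}) (p : nat).
Hypothesis p_pr : prime p.
Hypothesis sylP : p.-Sylow(G) P.

(** With n = |G : N|, the claim reduces to (p - 1)^2 < n, and n >= p^2 by [few_sylow_card]. *)
Lemma kp'_large_sylow : 'O_p(G) = 1 -> (p < #|P|)%N -> (p.-1 * kp' p G < #|G|`_p^')%N.
Proof.
move=> Op1 ltP; have p_gt1 := prime_gt1 p_pr.
have n2 : (p ^ 2 <= #|G : 'N_G(P)|)%N.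
  rewrite -(card_Syl sylP) leqNgt; apply/negP=> few.
  by have := few_sylow_card p_pr Op1 few (P := P); rewrite inE => /(_ sylP); rewrite leqNgt ltP.
have t_gt0 : (0 < #|'N_G(P) : P|)%N by apply: indexg_gt0.
have := kp'_bound p_pr sylP; rewrite (card_p'part sylP) -(index_norm_card sylP).
move: n2; set n := #|G : _|; move: t_gt0; set t := #|_ : P|; set k := kp' p G => t_gt0 n2 le1.
rewrite -(ltn_pmul2r (ltnW p_gt1)) -mulnA.
apply: leq_ltn_trans (leq_mul (leqnn p.-1) le1) _.
case: (p) p_gt1 n2 => // q q0 n2; rewrite /=.
have -> : n = (q.+1 ^ 2 + (n - q.+1 ^ 2))%N by rewrite subnKC.
set m := (n - _)%N; rewrite -mulnn.
have -> : ((q.+1 * q.+1 + m) * t * q.+1 = q * ((q.+1 * q.+1 + m) * t + t * q) + t * (2 * q + 1 + m))%N by lia.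
by rewrite -[X in (X < _)%N]addn0 ltn_add2l muln_gt0 t_gt0 addn1 addSn.
Qed.
End LargeSylow.

(** * Sylow subgroups of prime order *)

Section PolySums.
Local Open Scope ring_scope.
Variables (F : fieldType) (p : nat).
Hypothesis charF : p \in [pchar F].
Let p_pr := pcharf_prime charF.

Lemma natr_neq0 j : (0 < j < p)%N -> j%:R != 0 :> F.
Proof.
by case/andP=> j0 jp; rewrite -(dvdn_pcharf charF); apply/negP=> /(dvdn_leq j0); rewrite leqNgt jp.
Qed.

Lemma fact_neq0 j : (j < p)%N -> j`!%:R != 0 :> F.
Proof.
elim: j => [|j IHj] jp; first by rewrite oner_neq0.
by rewrite factS natrM; apply: mulf_neq0; [rewrite natr_neq0 | apply/IHj/ltnW].
Qed.

(** Telescoping (a + 1)^(j + 1) - a^(j + 1) over the prime field gives 0; the binomial expansion and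
    induction leave j + 1 times the sum of the j-th powers. *)
Lemma sum_pow j : (j.+1 < p)%N -> \sum_(a < p) a%:R ^+ j = 0 :> F.
Proof.
elim/ltn_ind: j => j IHj jp.
have tel : \sum_(a < p) ((a.+1%:R : F) ^+ j.+1 - a%:R ^+ j.+1) = 0.
  rewrite -(big_mkord xpredT (fun a => (a.+1%:R : F) ^+ j.+1 - a%:R ^+ j.+1)).
  by rewrite telescope_sumr // (pcharf0 charF) !expr0n subrr.
have : j.+1%:R * \sum_(a < p) a%:R ^+ j = 0 :> F.
  rewrite -[RHS]tel; rewrite mulr_sumr.
  under [RHS]eq_bigr => a _ do rewrite -natr1 exprD1n !big_ord_recr /= binn mulr1n.
  have -> : \sum_(a < p) (\sum_(i < j) (a%:R : F) ^+ i *+ 'C(j.+1, i) + a%:R ^+ j *+ 'C(j.+1, j) + a%:R ^+ j.+1 - a%:R ^+ j.+1)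
    = \sum_(i < j) (\sum_(a < p) (a%:R : F) ^+ i) *+ 'C(j.+1, i) + \sum_(a < p) a%:R ^+ j *+ 'C(j.+1, j).
    under eq_bigr do rewrite addrK; rewrite big_split /= exchange_big /=; congr (_ + _).
    by apply: eq_bigr => i _; rewrite sumrMnl.
  rewrite [X in _ = X + _]big1 ?add0r => [|i _]; last by rewrite IHj ?mul0rn //; have := ltn_ord i; lia.
  by apply: eq_bigr => a _; rewrite binSn mulr_natl.
by move/eqP; rewrite mulf_eq0 (negPf (natr_neq0 _)) ?jp //= => /eqP.
Qed.

Lemma sum_poly (P : {poly F}) : (size P < p)%N -> \sum_(a < p) P.[a%:R] = 0.
Proof.
move=> sP; under eq_bigr do rewrite horner_coef.
rewrite exchange_big big1 // => i _; rewrite -mulr_sumr sum_pow ?mulr0 //.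
exact: leq_ltn_trans (ltn_ord i) sP.
Qed.

(** Natural arguments allow exponents of group elements to be substituted directly. *)
Definition polyfun (d : nat) (f : nat -> F) :=
  exists2 P : {poly F}, (size P <= d.+1)%N & forall a : nat, f a = P.[a%:R].

Lemma polyfun_sum0 d f : polyfun d f -> (d.+1 < p)%N -> \sum_(a < p) f a = 0.
Proof.
case=> P sP fE dp; under eq_bigr do rewrite fE; apply: sum_poly.
exact: leq_ltn_trans sP dp.
Qed.

Lemma polyfun_eq d f g : polyfun d f -> f =1 g -> polyfun d g.
Proof. by case=> P sP fE e; exists P => // a; rewrite -e. Qed.

Lemma polyfun_const d c : polyfun d (fun=> c).
Proof.
exists c%:P => [|a]; last by rewrite hornerC.
by apply: leq_trans (size_polyC_leq1 _) _.
Qed.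

Lemma polyfun_leq d d' f : (d <= d')%N -> polyfun d f -> polyfun d' f.
Proof. by move=> le [P sP fE]; exists P => //; apply: leq_trans sP _. Qed.

Lemma polyfunD d f g : polyfun d f -> polyfun d g -> polyfun d (fun a => f a + g a).
Proof.
case=> P sP fE [Q sQ gE]; exists (P + Q) => [|a]; last by rewrite hornerD fE gE.
by apply: leq_trans (size_polyD _ _) _; rewrite geq_max sP.
Qed.

Lemma polyfunZ d c f : polyfun d f -> polyfun d (fun a => c * f a).
Proof.
case=> P sP fE; exists (c *: P) => [|a]; last by rewrite hornerZ fE.
exact: leq_trans (size_scale_leq _ _) sP.
Qed.

Lemma polyfun_bigsum d (I : Type) (r : seq I) (f : I -> nat -> F) :
  (forall i, polyfun d (f i)) -> polyfun d (fun a => \sum_(i <- r) f i a).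
Proof.
move=> pf; elim: r => [|i r IHr]; first by apply: polyfun_eq (polyfun_const d 0) _ => a; rewrite big_nil.
by apply: polyfun_eq (polyfunD (pf i) IHr) _ => a; rewrite big_cons.
Qed.

Lemma polyfunM d d' f g : polyfun d f -> polyfun d' g -> polyfun (d + d') (fun a => f a * g a).
Proof.
case=> P sP fE [Q sQ gE]; exists (P * Q) => [|a]; last by rewrite hornerM fE gE.
apply: leq_trans (size_polyMleq _ _) _.
by rewrite -subn1 leq_subLR add1n -addnS -addSn leq_add.
Qed.

Lemma polyfunX d f k : polyfun d f -> polyfun (k * d) (fun a => f a ^+ k).
Proof.
move=> pf; elim: k => [|k IHk]; first exact: polyfun_const.
by apply: polyfun_eq (polyfunM pf IHk) _ => a; rewrite exprS.
Qed.

(** A falling factorial divided by j!, which is invertible for j < p. *)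
Lemma polyfun_bin j : (j < p)%N -> polyfun j (fun a => 'C(a, j)%:R).
Proof.
move=> jp; have : polyfun j (fun a => (a ^_ j)%:R).
  elim: j {jp} => [|j IHj]; first by apply: polyfun_eq (polyfun_const 0 1) _ => a; rewrite ffactn0.
  have pX : polyfun 1 (fun a => a%:R - j%:R).
    by exists ('X - j%:R%:P) => [|a]; rewrite ?size_XsubC // !hornerE.
  have := polyfunM IHj pX; rewrite addn1 => pM; apply: polyfun_eq pM _ => a.
  rewrite ffactnSr natrM; case: (leqP j a) => ja; first by rewrite natrB.
  by rewrite ffact_small // !mul0r.
move=> pf; apply: polyfun_eq (polyfunZ (j`!%:R)^-1 pf) _ => a.
by rewrite -bin_ffact natrM mulrC mulfK ?fact_neq0.
Qed.

Lemma poly_ext (P Q : {poly F}) : (size P <= p)%N -> (size Q <= p)%N ->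
  (forall a : nat, P.[a%:R] = Q.[a%:R]) -> P = Q.
Proof.
move=> sP sQ e; apply/eqP; rewrite -subr_eq0; apply/eqP.
apply: (@roots_geq_poly_eq0 _ _ [seq a%:R | a <- iota 0 p]).
- by apply/allP=> _ /mapP[a _ ->]; rewrite /root !hornerE e subrr.
- rewrite map_inj_in_uniq ?iota_uniq // => a b; rewrite !mem_iota !add0n /= => ap bp eab.
  wlog ab : a b ap bp eab / (a <= b)%N.
    by move=> W; case/orP: (leq_total a b) => [/W->//|/W H]; rewrite H.
  apply/eqP; rewrite eqn_leq ab -subn_eq0 -(modn_small (leq_ltn_trans (leq_subr a b) bp)).
  by rewrite /= -[_ == _]/(p %| b - a)%N (dvdn_pcharf charF) natrB // eab subrr.
- rewrite size_map size_iota; apply: leq_trans (size_polyD _ _) _.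
  by rewrite size_polyN geq_max sP.
Qed.

Lemma unip_pow n (u : 'M[F]_n) d a : u ^+ d.+1 = 0 ->
  (1 + u) ^+ a = \sum_(j < d.+1) 'C(a, j)%:R *: u ^+ j.
Proof.
move=> ud; have uz j : (d < j)%N -> u ^+ j = 0.
  by move=> dj; rewrite -(subnK dj) exprD ud mulr0.
rewrite addrC exprD1n -(big_mkord xpredT (fun j => u ^+ j *+ 'C(a, j))).
rewrite -(big_mkord xpredT (fun j => 'C(a, j)%:R *: u ^+ j)).
(* Both sums are brought to a common range: binomials vanish above [a], powers of [u] above [d]. *)
have E c m f : (forall j, (c < j)%N -> f j = 0) -> (c < m)%N ->
  \sum_(0 <= j < m) f j = \sum_(0 <= j < c.+1) f j :> 'M[F]_n.
  move=> f0 am; rewrite (@big_cat_nat _ _ _ c.+1 0 m) //= [X in _ + X](_ : _ = 0) ?addr0 //.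
  by rewrite big_nat_cond big1 // => j /andP[/andP[aj _] _]; apply: f0.
rewrite -(E a (maxn a.+1 d.+1)) ?leq_max ?leqnn // => [|j aj]; last by rewrite bin_small.
rewrite -(E d (maxn a.+1 d.+1)) ?leq_max ?leqnn ?orbT // => [|j dj]; last by rewrite uz // scaler0.
by apply: eq_bigr => j _; rewrite scaler_nat.
Qed.

Lemma polyfun_unip n m k (u : 'M[F]_n) d (A : 'M[F]_(m, n)) (B : 'M[F]_(n, k)) i j :
  u ^+ d.+1 = 0 -> (d < p)%N -> polyfun d (fun a => (A *m (1 + u) ^+ a *m B) i j).
Proof.
move=> ud dp.
apply: (@polyfun_eq _ (fun a => \sum_(l < d.+1) (A *m u ^+ l *m B) i j * 'C(a, l)%:R)); last first.
  move=> a; rewrite (unip_pow a ud) mulmx_sumr mulmx_suml summxE; apply: eq_bigr => l _.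
  by rewrite -scalemxAr -scalemxAl [RHS]mxE mulrC.
apply: polyfun_bigsum => l; apply/polyfunZ/polyfun_leq/polyfun_bin.
  by rewrite -ltnS.
exact: leq_trans (ltn_ord l) dp.
Qed.
End PolySums.

(** * Sums over the cosets of the normalizer *)

Section CosetIndex.
Local Open Scope group_scope.
Variables (gT : finGroupType) (G N : {group gT}).
Hypothesis sNG : N \subset G.

(** Index of the coset [N :* g]; the default is reached only outside [G]. *)
Definition crank (g : gT) : 'I_(nrc G N) :=
  odflt (enum_rank_in (imset_f (rcoset N) (group1 G)) (rcoset N 1)) [pick c | g * (rrep c)^-1 \in N].

Lemma crankP g : g \in G -> g * (rrep (crank g))^-1 \in N.
Proof.
move=> Gg; rewrite /crank; case: pickP => [c //|no].
by have [c Nc] := rrep_exists N Gg; have := no c; rewrite Nc.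
Qed.

Lemma crank_eq g c : g \in G -> g * (rrep c)^-1 \in N -> crank g = c.
Proof. by move=> Gg; apply: rrep_uniq; apply: crankP. Qed.

Lemma crank_rrep c : crank (rrep c) = c.
Proof. by apply: crank_eq; rewrite ?mulgV ?group1 ?rrep_in. Qed.

Lemma crank_mul n g : n \in N -> g \in G -> crank (n * g) = crank g.
Proof.
move=> Nn Gg; apply: crank_eq; first by rewrite groupM // (subsetP sNG).
by rewrite -mulgA groupM ?crankP.
Qed.

Lemma crank_eqP g h : g \in G -> h \in G -> (crank g == crank h) = (g * h^-1 \in N).
Proof.
move=> Gg Gh; apply/eqP/idP => [e|Ngh].
  have := groupM (crankP Gg) (groupVr (crankP Gh)).
  by rewrite e invMg invgK mulgA mulgKV.
by rewrite -(crank_mul Ngh Gh) mulgKV.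
Qed.

Lemma rrep_crank (T : Type) (Psi : gT -> T) g :
  (forall n g, n \in N -> g \in G -> Psi (n * g) = Psi g) ->
  g \in G -> Psi (rrep (crank g)) = Psi g.
Proof.
by move=> PsiN Gg; rewrite -(PsiN _ _ (crankP Gg)) ?mulgKV // rrep_in.
Qed.

Lemma card_nrc : nrc G N = #|G : N|.
Proof. by []. Qed.

Lemma coset_sum_shift (V : zmodType) (Psi : gT -> V) h :
  (forall n g, n \in N -> g \in G -> Psi (n * g) = Psi g) -> h \in G ->
  (\sum_(c < nrc G N) Psi (rrep c * h)%g = \sum_(c < nrc G N) Psi (rrep c))%R.
Proof.
move=> PsiN Gh; have Gr (c : 'I_(nrc G N)) : rrep c \in G by apply: rrep_in.
rewrite [RHS](reindex_inj (h := fun c => crank (rrep c * h))) /=; last first.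
  move=> c d /= /eqP; rewrite (crank_eqP (groupM (Gr c) Gh) (groupM (Gr d) Gh)) invMg mulgA mulgK => Ncd.
  by rewrite -(crank_rrep c) -(crank_rrep d); apply/eqP; rewrite crank_eqP.
by apply: eq_bigr => c _; rewrite rrep_crank ?groupM.
Qed.
End CosetIndex.

Section PrimeSylow.
Local Open Scope group_scope.
Variables (gT : finGroupType) (G : {group gT}) (x : gT).
Let P := <[x]>.
Let p := #[x].
Let N := ('N_G(P))%G.
Hypothesis p_pr : prime p.
Hypothesis sylP : p.-Sylow(G) P.

Let sPG : P \subset G. Proof. exact: pHall_sub sylP. Qed.
Let sNG : N \subset G. Proof. exact: subsetIl. Qed.
Let sPN : P \subset N. Proof. by rewrite subsetI sPG normG. Qed.
Let Gx : x \in G. Proof. by rewrite -cycle_subG. Qed.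

(** [P] is the only Sylow p-subgroup of [N], and both [y] and its conjugate generate it. Thus [P]
    acts freely on the cosets of [N] other than [N]. *)
Lemma norm_of_conj g y : g \in G -> y \in P -> y != 1 -> g * y * g^-1 \in N -> g \in N.
Proof.
move=> Gg Py ny Ngy; have nPN : P <| N by rewrite /normal sPN subsetIr.
have sylN : p.-Sylow(N) P := pHall_subl sPN sNG sylP.
have e : g * y * g^-1 = y ^ g^-1 by rewrite conjgE invgK mulgA.
have pP : p.-group P := pHall_pgroup sylP.
have Pgy : y ^ g^-1 \in P.
  rewrite -cycle_subG (sub_normal_Hall sylN nPN) ?cycle_subG -?e //.
  by have : p.-elt (g * y * g^-1) by rewrite e p_eltJ (mem_p_elt pP).
have gen z : z \in P -> z != 1 -> <[z]> = P.
  move=> Pz nz; apply/eqP; rewrite eqEcard cycle_subG Pz /= -!orderE.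
  have dz : #[z] %| p by exact: (order_dvdG Pz).
  by rewrite ((prime_nt_dvdP p_pr _) dz) // order_eq1.
have ny' : y ^ g^-1 != 1 by rewrite conjg_eq1.
rewrite inE Gg /= -groupV; apply/normP.
by rewrite -{1}(gen y Py ny) -cycleJ gen.
Qed.

(** Right multiplication by [P] fixes the coset [N] and permutes the others in regular orbits, each
    contributing 0. *)
Lemma coset_orbit_sum (V : zmodType) (Psi : gT -> V) :
  (forall n g, n \in N -> g \in G -> Psi (n * g) = Psi g) ->
  (forall g, g \in G :\: N -> (\sum_(a < p) Psi (g * x ^+ a)%g = 0)%R) ->
  (\sum_(c < nrc G N) Psi (rrep c) = Psi 1%g)%R.
Proof.
move=> PsiN Psi0; have Gr (c : 'I_(nrc G N)) : rrep c \in G by apply: rrep_in.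
have Px a : x ^+ a \in P by apply: mem_cycle.
have Gxa a : x ^+ a \in G by rewrite (subsetP sPG).
pose c1 := crank G N 1.
rewrite (bigD1 c1) //= (rrep_crank sNG PsiN (group1 G)).
rewrite [X in (_ + X)%R](_ : _ = 0%R) ?GRing.addr0 //.
(* The double coset of [N] and [P] labels the P-orbit of a coset. *)
pose dd (c : 'I_(nrc G N)) := N :* rrep c * P.
have ddP c d : reflect (exists a : 'I_p, d = crank G N (rrep c * x ^+ a)) (dd d == dd c).
  apply: (iffP eqP) => [e|[a ->]].
    have : rrep d \in dd c.
      by rewrite -e; apply/mulsgP; exists (rrep d) 1; rewrite ?rcoset_refl ?group1 ?mulg1.
    case/mulsgP=> _ y /rcosetP[n Nn ->] /cycleP[k ->] rd.
    have ltk : (k %% p < p)%N by rewrite ltn_mod prime_gt0.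
    exists (Ordinal ltk); rewrite /= expg_mod_order -(crank_rrep sNG d) rd -mulgA.
    by rewrite crank_mul ?groupM.
  have Nn := crankP N (groupM (Gr c) (Gxa a)).
  move: Nn; rewrite /dd; set d' := crank _ _ _ => Nn.
  have -> : N :* rrep d' = N :* (rrep c * x ^+ a) by apply/esym/rcoset_eqP; rewrite mem_rcoset.
  rewrite -!mulg_set1 -!mulgA; congr (_ * (_ * _)).
  exact: lcoset_id.
rewrite (partition_big dd xpredT) //= big1 // => D _.
have [c /= /andP[nc /eqP <-]|noc] := pickP [pred c | (c != c1) && (dd c == D)]; last first.
  by rewrite big_pred0.
have nNc : rrep c \in G :\: N.
  rewrite inE Gr andbT; apply: contra nc => Nc; rewrite -(crank_rrep sNG c) crank_eqP //.
  by rewrite invg1 mulg1.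
have hinj : injective (fun a : 'I_p => crank G N (rrep c * x ^+ a)).
  move=> a b /= /eqP; rewrite (crank_eqP sNG (groupM (Gr c) (Gxa a)) (groupM (Gr c) (Gxa b))) => Nab.
  apply/val_inj/eqP; rewrite /= -(modn_small (ltn_ord a)) -(modn_small (ltn_ord b)).
  rewrite -eq_expg_mod_order eq_mulgV1; apply: contraLR nNc => ne1.
  rewrite inE negb_and negbK; apply/orP; left.
  have Nab' : rrep c * (x ^+ a * x ^- b) * (rrep c)^-1 \in N.
    by move: Nab; rewrite invMg !mulgA.
  exact: norm_of_conj (Gr c) (groupM (Px a) (groupVr (Px b))) ne1 Nab'.
rewrite -[RHS](Psi0 _ nNc).
transitivity (\sum_(d in [set crank G N (rrep c * x ^+ a) | a : 'I_p]) Psi (rrep d))%R; last first.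
  rewrite big_imset /=; last exact: in2W hinj.
  by apply: eq_bigr => a _; rewrite rrep_crank ?groupM.
apply: eq_bigl => d; apply/andP/imsetP => [[_ /ddP[a ->]]|[a _ ->]]; first by exists a.
split; last by apply/ddP; exists a.
rewrite (crank_eqP sNG (groupM (Gr c) (Gxa a)) (group1 G)) invg1 mulg1; move: nNc; rewrite inE => /andP[nNc _].
by apply: contra nNc; rewrite groupMr // (subsetP sPN).
Qed.

(** Applying [coset_orbit_sum] to every right translate of [Psi] identifies each value with the same
    coset sum. *)
Lemma coset_sum_const (V : zmodType) (Psi : gT -> V) :
  (forall n g, n \in N -> g \in G -> Psi (n * g) = Psi g) ->
  (forall g h, g \in G -> h \in G -> (\sum_(a < p) Psi (g * x ^+ a * h)%g = 0)%R) ->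
  forall h, h \in G -> Psi h = Psi 1%g.
Proof.
move=> PsiN Psi0 h Gh.
have step k : k \in G -> (\sum_(c < nrc G N) Psi (rrep c) = Psi k)%R.
  move=> Gk; rewrite -(coset_sum_shift sNG PsiN Gk).
  rewrite (@coset_orbit_sum _ (fun g => Psi (g * k))) ?mul1g // => [n g Nn Gg|g].
    by rewrite -mulgA PsiN ?groupM.
  by rewrite inE => /andP[_ Gg]; apply: Psi0.
by rewrite -(step h Gh) (step 1 (group1 G)).
Qed.
End PrimeSylow.

(** * Nilpotent matrices with one Jordan block *)

Section Nilpotent.
Local Open Scope ring_scope.
Variable F : fieldType.

Lemma nil_index n (u : 'M[F]_n) k : u != 0 -> u ^+ k = 0 ->
  exists D, [/\ (0 < D < k)%N, u ^+ D != 0 & u ^+ D.+1 = 0].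
Proof.
move=> nzu uk; have ex : exists j, u ^+ j == 0 by exists k; apply/eqP.
have [m /eqP um mmin] := ex_minnP ex.
have m2 : (1 < m)%N.
  case: m um {mmin} => [|[|m]] //; last by rewrite expr1 => /eqP; rewrite (negPf nzu).
  rewrite expr0 => one0; case/eqP: nzu.
  by rewrite -[u]mulr1 one0 mulr0.
exists m.-1; rewrite prednK ?(ltnW m2) //; split=> //.
  have := mmin k; rewrite uk eqxx => /(_ isT); lia.
by apply/eqP => /eqP/mmin; lia.
Qed.

(** A one-dimensional kernel lets the rank drop by at most one at each power, and nilpotency of
    exact index D + 1 makes the first D + 1 drops strict. *)
Lemma nil_single n (u : 'M[F]_n) D : u ^+ D != 0 -> u ^+ D.+1 = 0 -> \rank (kermx u) = 1%N ->
  n = D.+1 /\ forall j, (j <= n)%N -> \rank (u ^+ j) = (n - j)%N.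
Proof.
move=> uD uD1 rk1.
have rk j : (\rank (u ^+ j) <= (\rank (u ^+ j.+1)).+1)%N.
  have := mxrank_mul_ker (u ^+ j) u; rewrite -[_ *m u]/(u ^+ j * u) -exprSr.
  have : (\rank (u ^+ j :&: kermx u) <= 1)%N by rewrite -rk1 mxrankS ?capmxSr.
  lia.
have rklt j : (j <= D)%N -> (\rank (u ^+ j.+1) < \rank (u ^+ j))%N.
  move=> jD; have := mxrank_mul_ker (u ^+ j) u; rewrite -[_ *m u]/(u ^+ j * u) -exprSr => <-.
  rewrite -[X in (X < _)%N]addn0 ltn_add2l lt0n mxrank_eq0 -submx0; apply: contra uD => cap0.
  rewrite -submx0; apply: submx_trans cap0; rewrite sub_capmx; apply/andP; split.
    by rewrite -(subnK jD) exprD; apply: submxMl.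
  by apply/sub_kermxP; rewrite -[_ *m u]/(u ^+ D * u) -exprSr.
have r0 : \rank (u ^+ 0) = n by rewrite expr0 mxrank1.
have rkE j : (j <= D.+1)%N -> (\rank (u ^+ j) + j)%N = n.
  elim: j => [|j IHj] jD; first by rewrite addn0.
  have := rklt j jD; have := rk j; have := IHj (ltnW jD); lia.
have nD : n = D.+1 by have := rkE _ (leqnn _); rewrite uD1 mxrank0.
split=> // j; rewrite {1}nD => /rkE; lia.
Qed.

(** Factor (1 + u)^c - 1 as u q; after u^D the factor q acts as c. This is the source of the ratio
    c^D between the two weights of a representation. *)
Lemma unip_pow_sub n (u : 'M[F]_n) D c : u ^+ D.+1 = 0 ->
  ((1 + u) ^+ c - 1) ^+ D = (c%:R ^+ D) *: u ^+ D.
Proof.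
move=> uD1; rewrite subrX1 addrC addKr.
set q := \sum_(i < c) _.
have cuq : GRing.comm u q.
  by rewrite /q; apply: commr_sum => i _; apply/commrX/commrD; [apply: commr1|].
have uq : u ^+ D * q = c%:R *: u ^+ D.
  rewrite /q mulr_sumr (eq_bigr (fun=> u ^+ D)) ?sumr_const ?card_ord ?scaler_nat // => i _.
  elim: (nat_of_ord i) => [|k IHk]; first by rewrite expr0 mulr1.
  by rewrite exprS mulrA mulrDr mulr1 -exprSr uD1 addr0.
have uqk k : u ^+ D * q ^+ k = c%:R ^+ k *: u ^+ D.
  elim: k => [|k IHk]; first by rewrite !expr0 mulr1 scale1r.
  by rewrite exprSr mulrA IHk -[LHS]scalemxAl -[_ *m q]/(u ^+ D * q) uq scalerA exprSr.
by rewrite exprMn_comm.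
Qed.

Lemma unip_pow_char n (u : 'M[F]_n) p : p \in [pchar F] -> (1 + u) ^+ p = 1 + u ^+ p.
Proof.
move=> charF; have p_pr := pcharf_prime charF.
case: p charF p_pr => // p charF p_pr.
rewrite addrC exprD1n big_ord_recr big_ord_recl /= bin0 binn expr0 !mulr1n big1 ?addr0 // => i _.
rewrite -scaler_nat -[bump 0 i]/i.+1; suff -> : 'C(p.+1, i.+1)%:R = 0 :> F by rewrite scale0r.
by apply/eqP; rewrite -(dvdn_pcharf charF) prime_dvd_bin //= ltnS.
Qed.
End Nilpotent.

Section EigenPower.
Local Open Scope ring_scope.
Variables (gT : finGroupType) (G : {group gT}) (x : gT).
Let P := <[x]>%g.
Let p := #[x]%g.
Let N := ('N_G(P))%G.
Hypothesis p_pr : prime p.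
Hypothesis sylP : (p.-Sylow(G) P)%g.
Variable F : fieldType.
Hypothesis charF : p \in [pchar F].

Let Gx : x \in G. Proof. by rewrite -cycle_subG (pHall_sub sylP). Qed.
Let sNG : N \subset G. Proof. exact: subsetIl. Qed.

Lemma repr_expg n (r : mx_representation F G n) g a : g \in G -> r (g ^+ a)%g = r g ^+ a.
Proof.
move=> Gg; elim: a => [|a IHa]; first by rewrite expg0 repr_mx1 expr0.
by rewrite expgS repr_mxM ?groupX // IHa exprS.
Qed.

Lemma polyfun_repr n (r : mx_representation F G n) D m k (A : 'M_(m, n)) (B : 'M_(n, k)) i j :
  (r x - 1) ^+ D.+1 = 0 -> (D < p)%N -> polyfun D (fun a => (A *m r (x ^+ a)%g *m B) i j).
Proof.
move=> uD Dp; apply: polyfun_eq (polyfun_unip charF A B i j uD Dp) _ => a.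
by rewrite (repr_expg _ _ Gx) addrC subrK.
Qed.

(** For a column killed by [v], the k-th power of its coefficient is left N-invariant and of degree
    at most k D along the orbits of [x], hence constant and equal to its value 0 at 1. *)
Lemma eigen_power n (r : mx_representation F G n) (v : 'rV_n) (la : gT -> F) D k :
  (forall h, h \in N -> v *m r h = la h *: v) ->
  (r x - 1) ^+ D.+1 = 0 ->
  (forall h, h \in N -> la h ^+ k = 1) -> (0 < k)%N -> (k * D < p.-1)%N ->
  forall g, g \in G -> (v *m r g <= v)%MS.
Proof.
move=> vN uD lak k_gt0 kD g Gg.
have key (xi : 'cV_n) : v *m xi = 0 -> v *m r g *m xi = 0.
  move=> vxi; pose Psi h := if h \in G then ((v *m r h *m xi) 0 0) ^+ k else 0.
  have PsiN h h' : h \in N -> h' \in G -> Psi (h * h')%g = Psi h'.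
    move=> Nh Gh; have Gh1 := subsetP sNG _ Nh.
    rewrite /Psi groupM // Gh repr_mxM // mulmxA vN // -!scalemxAl mxE exprMn lak //.
    by rewrite mul1r.
  have Psi0 h h' : h \in G -> h' \in G -> \sum_(a < p) Psi (h * x ^+ a * h')%g = 0.
    move=> Gh Gh'.
    have Dp : (D < p)%N by have := prime_gt0 p_pr; nia.
    rewrite (eq_bigr (fun a : 'I_p => ((v *m r h) *m r (x ^+ a)%g *m (r h' *m xi)) 0 0 ^+ k)).
      apply: (polyfun_sum0 charF (polyfunX k (polyfun_repr _ _ _ _ uD Dp))).
      by have := prime_gt0 p_pr; lia.
    by move=> a _; rewrite /Psi !groupM ?groupX // !repr_mxM ?groupM ?groupX // !mulmxA.
  have := coset_sum_const p_pr sylP PsiN Psi0 Gg; rewrite /Psi Gg group1 repr_mx1 mulmx1 vxi.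
  have -> : (0 : 'M[F]_1) 0 0 = 0 by rewrite mxE.
  rewrite expr0n eqn0Ngt k_gt0 => /eqP; rewrite expf_eq0 k_gt0 /= => /eqP e.
  by apply/matrixP=> i j; rewrite !ord1 e mxE.
rewrite submxE; apply/eqP/matrixP=> i j; rewrite [RHS]mxE.
have /matrixP/(_ i 0) : v *m r g *m col j (cokermx v) = 0.
  by apply: key; rewrite colE mulmxA mulmx_coker mul0mx.
by rewrite [RHS]mxE colE mulmxA -colE mxE.
Qed.

Lemma line_module_irr n (r : mx_representation F G n) (v : 'rV_n) :
  mx_irreducible r -> v != 0 -> (forall g, g \in G -> (v *m r g <= v)%MS) -> n = 1%N.
Proof.
move=> /mx_irrP[_ irr] nzv vG; have modv : mxmodule r <<v>>%MS.
  by apply/mxmoduleP=> g Gg; rewrite genmxE (eqmxMr _ (genmxE v)) vG.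
have nz : <<v>>%MS != 0 by rewrite -submx0 genmxE submx0.
have /eqP e := irr _ modv nz.
apply/eqP; rewrite eqn_leq -{1}e genmxE rank_leq_row /=.
by rewrite -e genmxE lt0n mxrank_eq0.
Qed.
End EigenPower.

(** * Equality in the double coset count *)

Section Core1.
Local Open Scope ring_scope.
Variables (gT : finGroupType) (G : {group gT}) (x : gT).
Let P := <[x]>%g.
Let p := #[x]%g.
Let N := ('N_G(P))%G.
Hypothesis p_pr : prime p.
Hypothesis sylP : (p.-Sylow(G) P)%g.
Variable F : closedFieldType.
Hypothesis charF : p \in [pchar F].
Hypothesis genG : forall K : {group gT}, (K <| G)%g -> (P \subset K)%g -> (G \subset K)%g.
Variables (I : finType) (phi : I -> irrep F G).
Hypothesis inj : irr_distinct phi.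

Let Gx : x \in G. Proof. by rewrite -cycle_subG (pHall_sub sylP). Qed.
Let sPG : P \subset G. Proof. exact: pHall_sub sylP. Qed.
Let sNG : N \subset G. Proof. exact: subsetIl. Qed.
Let sPN : P \subset N. Proof. by rewrite subsetI sPG normG. Qed.

Definition ntriv : pred I := fun i => irepr (phi i) x != 1.

Let u i : 'M_(idim (phi i)) := irepr (phi i) x - 1.

Lemma triv_idim i : ~~ ntriv i -> idim (phi i) = 1%N /\ forall g, g \in G -> phi i g = 1.
Proof.
rewrite negbK => /eqP x1.
have kG : G \subset rker (phi i).
  apply: genG; first exact: rker_normal.
  by rewrite cycle_subG inE Gx x1 mul1mx eqxx.
have g1 g : g \in G -> phi i g = 1.
  by move=> Gg; have := subsetP kG g Gg; rewrite inE Gg mul1mx => /eqP.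
split=> //; have irr := mx_abs_irrW (irep_abs (phi i)).
have /andP[n_gt0 _] := irep_abs (phi i).
have [v nzv _] := fixed_row sPG charF (pHall_pgroup sylP) (phi i) n_gt0.
by apply: line_module_irr irr nzv _ => g Gg; rewrite g1 // mulmx1.
Qed.

Lemma card_ntriv : (#|I| <= #|ntriv|.+1)%N.
Proof.
have le1 : (#|[predC ntriv]| <= 1)%N.
  apply/card_le1_eqP=> i j; rewrite !inE => /triv_idim[i1 gi] /triv_idim[j1 gj].
  apply: inj; exists (const_mx 1) => [||g Gg].
  - by rewrite i1 j1.
  - have r1 : (idim (phi i) <= 1)%N by rewrite i1.
    have r2 : (idim (phi j) <= 1)%N by rewrite j1.
    rewrite -row_leq_rank (leq_trans _ (_ : (1 <= _)%N)) // lt0n mxrank_eq0; apply/eqP=> /matrixP.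
    have i0 : 'I_(idim (phi i)) by rewrite i1; exact: ord0.
    have j0 : 'I_(idim (phi j)) by rewrite j1; exact: ord0.
    by (move/(_ i0 j0)/eqP || move/(_ j0 i0)/eqP); rewrite !mxE oner_eq0.
  by rewrite gi // gj // [LHS]mul1mx [RHS]mulmx1.
by have := cardC ntriv; rewrite -addn1 => <-; rewrite leq_add2l.
Qed.

Lemma unipotent_exp_p i : u i ^+ p = 0.
Proof.
apply: (addrI 1); rewrite addr0 -unip_pow_char // /u addrC subrK.
by rewrite -(repr_expg _ _ Gx) expg_order repr_mx1.
Qed.

Lemma ntriv_index i : ntriv i -> exists D, [/\ (0 < D < p)%N, u i ^+ D != 0 & u i ^+ D.+1 = 0].
Proof. by move=> nt; apply: nil_index (unipotent_exp_p i); rewrite subr_eq0. Qed.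

(* Vectors in the image and the kernel of [x - 1] give functions vanishing on [N]. *)
Lemma coef_norm_eq0 i (z : 'rV_(idim (phi i))) (w : 'cV_(idim (phi i))) D n : (0 < D)%N ->
  (forall y, y \in P -> phi i y *m w = w) -> n \in N ->
  z *m u i ^+ D *m phi i n *m w = 0.
Proof.
move=> D_gt0 Pw Nn; have Gn := subsetP sNG n Nn.
have Pxn : (x ^ n)%g \in P.
  by have := Nn; rewrite inE => /andP[_ /normP <-]; rewrite memJ_conjg cycle_id.
have e : u i *m phi i n = phi i n *m (phi i (x ^ n)%g - 1).
  rewrite /u mulmxBl mulmxBr -!repr_mxM ?groupJ //.
  by rewrite conjgE !mulgA mulgV mul1g [X in _ - X]mul1mx [X in _ = _ - X]mulmx1.
case: D D_gt0 => // D _; rewrite exprSr -[u i ^+ D * _]/(u i ^+ D *m u i).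
rewrite -!mulmxA (mulmxA (u i)) e -mulmxA [(_ - _) *m w]mulmxBl Pw //.
by rewrite [1 *m w]mul1mx subrr !mulmx0.
Qed.

Definition dc_out := #|dcs P (G :\: N)|.

Lemma dc_out_bound : (dc_out * p <= #|N : P|%g * #|G : N|%g.-1)%N.
Proof.
have := card_dcs_out p_pr sylP; rewrite -/dc_out -/N.
have P_gt0 : (0 < #|P|)%N := cardG_gt0 _.
have h3 := Lagrange sPN; have h4 := Lagrange sNG; have hp : #|P| = p by [].
have p_gt0 := prime_gt0 p_pr.
rewrite -h4 -h3 hp; have := indexg_gt0 G N; case: (#|G : N|%g : nat) => // n _ /=.
have key m k : (m * (p * p) <= p * k * n.+1 - p * k)%N -> (m * p <= k * n)%N.
  have -> : (p * k * n.+1 - p * k = k * n * p)%N by rewrite mulnS addKn; lia.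
  by rewrite mulnA leq_pmul2r.
exact: key.
Qed.

(** The sums over i of tr(B g) are P-biinvariant functions vanishing on [N], independent because
    matrix coefficients are. *)
Lemma mat_bound (K : finType) (B : K -> forall i, 'M[F]_(idim (phi i))) :
  (forall k i y, y \in P -> phi i y *m B k i = B k i) ->
  (forall k i y, y \in P -> B k i *m phi i y = B k i) ->
  (forall k i n, n \in N -> \tr (B k i *m phi i n) = 0) ->
  (forall c, (forall i, \sum_k c k *: B k i = 0) -> forall k, c k = 0) -> (#|K| <= dc_out)%N.
Proof.
move=> PB BP BN ind.
pose h k g := if g \in G then \sum_i \tr (B k i *m phi i g) else 0.
change (#|K| <= #|dcs <[x]>%G (G :\: N)|)%N.
apply: (@biinv_bound F gT G <[x]>%G K h) => [|k g y z Gg Py Pz|k g|c c0]; first exact: subsetDl.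
- have [Gy Gz] := (subsetP sPG y Py, subsetP sPG z Pz).
  rewrite /h !groupM // Gg; apply: eq_bigr => i _.
  rewrite !repr_mxM ?groupM // !mulmxA BP // mxtrace_mulC mulmxA PB //.
- case/setDP=> Gg nD; have Ng : g \in N by apply: contraNT nD => nN; rewrite inE nN.
  by rewrite /h Gg big1 // => i _; apply: BN.
apply: ind; apply: (coef_indep inj) => g Gg.
rewrite -[RHS](c0 g Gg) (eq_bigr (fun k => \sum_i c k * \tr (B k i *m phi i g))); last first.
  by move=> k _; rewrite /h Gg mulr_sumr.
rewrite exchange_big /=; apply: eq_bigr => i _.
rewrite mulmx_suml raddf_sum; apply: eq_bigr => k _.
by rewrite -mxtraceZ scalemxAl.
Qed.

Hypothesis big : (#|G : P|%g <= p.-1 * #|I|)%N.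

Let t := #|N : P|%g.
Let r := (#|G : N|%g %/ p)%N.

Lemma index_norm_eq : #|G : N|%g = (r * p).+1.
Proof.
rewrite {1}(divn_eq #|G : N|%g p) -/r (index_norm_mod p_pr sylP) modn_small ?addn1 //.
exact: prime_gt1.
Qed.

Lemma dc_out_le : (dc_out <= t * r)%N.
Proof.
by have := dc_out_bound; rewrite index_norm_eq /= mulnA leq_pmul2r // prime_gt0.
Qed.

(* The hypothesis [big] forces equality in the count of double cosets as soon as the nontrivial
   representations give independent functions. *)
Lemma tight J : (J <= dc_out)%N -> (#|I| <= J.+1)%N -> [/\ dc_out = J, dc_out = (t * r)%N & (t * r.+1 <= p.-1)%N].
Proof.
move=> JM IJ; have Mt := dc_out_le; have t_gt0 : (0 < t)%N by apply: indexg_gt0.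
have e : #|G : P|%g = (t * (r * p).+1)%N.
  by rewrite -(index_norm_card sylP) -/N index_norm_eq mulnC.
move: big; rewrite e; have := prime_gt1 p_pr.
case: p => // q _ /= h.
have h2 : (t * (r * q.+1).+1 <= q * J.+1)%N by apply: leq_trans h _; rewrite leq_mul2l IJ orbT.
have h3 : (t * (r * q.+1).+1 = q * (t * r) + (t * r + t))%N by rewrite !mulnS; lia.
rewrite h3 in h2; move: Mt; set s := (t * r)%N in h2 h3 *; move=> Ms.
have sJ : (s <= J)%N.
  rewrite leqNgt; apply/negP=> Js; have : (q * J.+1 <= q * s)%N by rewrite leq_mul2l Js orbT.
  lia.
have <- : s = J by lia.
split; [lia|lia|]; rewrite mulnS -/s; have : (q * s.+1 = q * s + q)%N by rewrite mulnS addnC.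
have Js : J = s by lia.
rewrite Js in h2; lia.
Qed.

Lemma outer_fix_left i (w : 'cV_(idim (phi i))) k (v : 'M_(1, k)) y :
  u i *m w = 0 -> y \in P -> phi i y *m (w *m v) = w *m v.
Proof.
move=> uw /cycleP[a ->]; rewrite mulmxA; congr (_ *m _).
have xw : phi i x *m w = w by move: uw; rewrite /u mulmxBl mul1mx => /eqP; rewrite subr_eq0 => /eqP.
by elim: a => [|a IHa]; rewrite ?expg0 ?repr_mx1 ?mul1mx // expgS repr_mxM ?groupX // -mulmxA IHa.
Qed.

Lemma outer_fix_right i (v : 'rV_(idim (phi i))) k (w : 'M_(k, 1)) y :
  v *m u i = 0 -> y \in P -> w *m v *m phi i y = w *m v.
Proof.
move=> vu /cycleP[a ->]; rewrite -mulmxA; congr (_ *m _).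
have vx : v *m phi i x = v by move: vu; rewrite /u mulmxBr mulmx1 => /eqP; rewrite subr_eq0 => /eqP.
by elim: a => [|a IHa]; rewrite ?expg0 ?repr_mx1 ?mulmx1 // expgSr repr_mxM ?groupX // mulmxA IHa.
Qed.

Lemma outer_N i (v : 'rV_(idim (phi i))) (w : 'cV_(idim (phi i))) z D n :
  v = z *m u i ^+ D -> (0 < D)%N -> u i *m w = 0 -> n \in N -> \tr (w *m v *m phi i n) = 0.
Proof.
move=> -> D_gt0 uw Nn; rewrite mxtrace_outer (coef_norm_eq0 z D_gt0) ?mxE // => y Py.
by have := outer_fix_left (1%:M : 'M_1) uw Py; rewrite !mulmx1.
Qed.

Let J : finType := {i | ntriv i}.

(** The row is taken in the image of a positive power of [u i], which makes its coefficient vanish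
    on [N] by [coef_norm_eq0]. *)
Lemma initial_data : exists (v : forall i, 'rV[F]_(idim (phi i))) (w : forall i, 'cV[F]_(idim (phi i))),
  forall i, ntriv i -> [/\ v i != 0, w i != 0, v i *m u i = 0, u i *m w i = 0
    & exists z D, (0 < D)%N /\ v i = z *m u i ^+ D].
Proof.
suff h i : exists vw : 'rV[F]_(idim (phi i)) * 'cV[F]_(idim (phi i)),
  ntriv i -> [/\ vw.1 != 0, vw.2 != 0, vw.1 *m u i = 0, u i *m vw.2 = 0
    & exists z D, (0 < D)%N /\ vw.1 = z *m u i ^+ D].
  have [f fP] := fin_all_exists h.
  by exists (fun i => (f i).1), (fun i => (f i).2).
have [nt|nt] := boolP (ntriv i); last by exists (0, 0).
have [D [/andP[D0 Dp] uD uD1]] := ntriv_index nt.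
have /rowV0Pn[v /submxP[z vz] nzv] := uD.
have /andP[n_gt0 _] := irep_abs (phi i).
have [w nzw wP] := fixed_col sPG charF (pHall_pgroup sylP) (phi i) n_gt0.
exists (v, w) => _; split=> //=; last by exists z, D.
  by rewrite vz -mulmxA -[_ *m u i]/(u i ^+ D * u i) -exprSr uD1 mulmx0.
by rewrite /u mulmxBl mul1mx wP ?cycle_id // subrr.
Qed.

(** The chosen coefficients already number [dc_out]; a second fixed column in some representation
    would give one more independent function. *)
Lemma kernel_line : [/\ dc_out = #|ntriv|, dc_out = (t * r)%N, (t * r.+1 <= p.-1)%N
  & forall i, ntriv i -> \rank (kermx (u i)) = 1%N].
Proof.
have [v [w vwP]] := initial_data.
pose B1 (k : J) i := (val k == i)%:R *: (w i *m v i).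
have B1P (k : J) i : B1 k i = 0 \/ ntriv i.
  by rewrite /B1; case: eqVneq => [<-|]; [right; exact: (valP k)|left; rewrite scale0r].
have B1l k i y : y \in P -> phi i y *m B1 k i = B1 k i.
  move=> Py; have [->|nt] := B1P k i; first by rewrite mulmx0.
  by have [_ _ _ uw _] := vwP i nt; rewrite /B1 -scalemxAr outer_fix_left.
have B1r k i y : y \in P -> B1 k i *m phi i y = B1 k i.
  move=> Py; have [->|nt] := B1P k i; first by rewrite mul0mx.
  by have [_ _ vu _ _] := vwP i nt; rewrite /B1 -scalemxAl outer_fix_right.
have B1N k i n : n \in N -> \tr (B1 k i *m phi i n) = 0.
  move=> Nn; have [->|nt] := B1P k i; first by rewrite mul0mx raddf0.
  have [_ _ _ uw [z [D [D0 vz]]]] := vwP i nt.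
  by rewrite /B1 -scalemxAl mxtraceZ (outer_N vz D0 uw Nn) mulr0.
have sumB1 (c : J -> F) (k : J) : \sum_l c l *: B1 l (val k) = c k *: (w (val k) *m v (val k)).
  rewrite (bigD1 k) //= /B1 eqxx scale1r big1 ?addr0 // => l nlk.
  by rewrite (inj_eq val_inj) (negPf nlk) scale0r scaler0.
have cJ : #|{: J}| = #|ntriv| by rewrite card_sig.
have leJM : (#|ntriv| <= dc_out)%N.
  rewrite -cJ; apply: (mat_bound B1l B1r B1N) => c c0 k.
  have := c0 (val k); rewrite sumB1 => /eqP; rewrite scaler_eq0 => /orP[/eqP//|].
  by have [nzv nzw _ _ _] := vwP _ (valP k); rewrite (negPf (outer_neq0 nzw nzv)).
have [MJ Mt tp] := tight leJM card_ntriv.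
split=> // i0 nt0; apply/eqP; rewrite eqn_leq; apply/andP; split; last first.
  have [nzv _ vu _ _] := vwP i0 nt0; rewrite lt0n mxrank_eq0; apply: contra nzv => /eqP k0.
  by rewrite -submx0 -k0; apply/sub_kermxP.
rewrite leqNgt; apply/negP=> rk2.
have rk2' : (1 < \rank (kermx (u i0)^T))%N by rewrite mxrank_ker mxrank_tr -mxrank_ker.
have [w0 uw0 nw0] : exists2 w0 : 'cV_(idim (phi i0)), u i0 *m w0 = 0 & ~~ (w0^T <= (w i0)^T)%MS.
  have /row_subPn[j nj] : ~~ (kermx (u i0)^T <= (w i0)^T)%MS.
    apply/negP=> /mxrankS; rewrite leqNgt (leq_ltn_trans _ rk2') //.
    exact: rank_leq_row.
  exists (row j (kermx (u i0)^T))^T; last by rewrite trmxK.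
  by apply: trmx_inj; rewrite trmx_mul trmxK -row_mul mulmx_ker linear0 trmx0.
(* The extra member of the family lives in the single component [i0]. *)
pose w' := dfwith (fun i => 0 : 'cV[F]_(idim (phi i))) w0.
have w'0 : w' i0 = w0 by apply: dfwith_in.
have w'n i : i0 != i -> w' i = 0 by move=> ne; apply: dfwith_out.
pose B (k : option J) i := if k is Some k' then B1 k' i else w' i *m v i.
suff : (#|{: option J}| <= dc_out)%N by rewrite card_option cJ MJ ltnn.
have w'P i : w' i = 0 \/ ntriv i /\ u i *m w' i = 0.
  by have [<-|/w'n] := eqVneq i0 i; [right; rewrite w'0|left].
apply: (@mat_bound _ B) => [[k|] i y Py|[k|] i y Py|[k|] i n Nn|c c0].
- exact: B1l.
- rewrite /B; have [->|[nt uw]] := w'P i; first by rewrite mul0mx mulmx0.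
  by rewrite outer_fix_left.
- exact: B1r.
- rewrite /B; have [->|[nt uw]] := w'P i; first by rewrite !mul0mx.
  by have [_ _ vu _ _] := vwP i nt; rewrite outer_fix_right.
- exact: B1N.
- rewrite /B; have [->|[nt uw]] := w'P i; first by rewrite !mul0mx raddf0.
  have [_ _ _ _ [z [D [D0 vz]]]] := vwP i nt.
  exact: (outer_N vz D0 uw Nn).
have sumB i : \sum_k c k *: B k i = c None *: (w' i *m v i) + \sum_k c (Some k) *: B1 k i.
  rewrite (bigD1 None) //= (reindex_omap Some id) /=; last by case.
  by congr (_ + _); apply: eq_bigl => k; rewrite eqxx.
have cN0 : c None = 0.
  have := c0 i0; rewrite sumB (sumB1 (fun k => c (Some k)) (Sub i0 nt0 : J)) /= w'0.
  rewrite !scalemxAl -mulmxDl => /eqP e0; apply/eqP; apply: contraNT nw0 => ncN.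
  have [nzv _ _ _ _] := vwP i0 nt0.
  have : c None *: w0 + c (Some (Sub i0 nt0 : J)) *: w i0 == 0.
    by apply: contraLR e0 => /outer_neq0/(_ nzv).
  rewrite addr_eq0 => /eqP e; apply/submxP; exists ((- (c None)^-1 * c (Some (Sub i0 nt0 : J)))%:M).
  rewrite mul_scalar_mx -linearZ /= -scalerA scaleNr -scalerN -e scalerA mulVf // scale1r //.
case=> [k|//]; have := c0 (val k); rewrite sumB cN0 scale0r add0r (sumB1 (fun k => c (Some k))).
move/eqP; rewrite scaler_eq0 => /orP[/eqP//|].
by have [nzv nzw _ _ _] := vwP _ (valP k); rewrite (negPf (outer_neq0 nzw nzv)).
Qed.

(** A single Jordan block makes [u i ^+ D i] of rank one, a column times a row that spans the left
    kernel of [u i]. *)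
Lemma core_structure : exists (D : I -> nat) (v : forall i, 'rV[F]_(idim (phi i)))
    (xi : forall i, 'cV[F]_(idim (phi i))), forall i, ntriv i ->
  [/\ (0 < D i < p)%N, idim (phi i) = (D i).+1, u i ^+ D i = xi i *m v i, u i ^+ (D i).+1 = 0
    & [/\ v i != 0, xi i != 0 & (kermx (u i) <= v i)%MS]].
Proof.
suff h i : exists q : nat * ('rV[F]_(idim (phi i)) * 'cV[F]_(idim (phi i))), ntriv i ->
   [/\ (0 < q.1 < p)%N, idim (phi i) = q.1.+1, u i ^+ q.1 = q.2.2 *m q.2.1, u i ^+ q.1.+1 = 0
    & [/\ q.2.1 != 0, q.2.2 != 0 & (kermx (u i) <= q.2.1)%MS]].
  have [f fP] := fin_all_exists h.
  by exists (fun i => (f i).1), (fun i => (f i).2.1), (fun i => (f i).2.2).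
have [nt|nt] := boolP (ntriv i); last by exists (0%N, (0, 0)).
have [D [D0p uD uD1]] := ntriv_index nt; have [_ _ _ /(_ i nt) rk1] := kernel_line.
have [dimE _] := nil_single uD uD1 rk1.
have /rowV0Pn[v /submxP[z vz] nzv] := uD.
have vker : (v <= kermx (u i))%MS.
  by apply/sub_kermxP; rewrite vz -mulmxA -[_ *m u i]/(u i ^+ D * u i) -exprSr uD1 mulmx0.
have kerv : (kermx (u i) <= v)%MS.
  by have := mxrank_leqif_sup vker; rewrite rk1 rank_rV nzv => -[_ <-].
have /submxP[xi uxi] : (u i ^+ D <= v)%MS.
  apply: submx_trans kerv; apply/sub_kermxP.
  by rewrite -[_ *m u i]/(u i ^+ D * u i) -exprSr uD1.
exists (D, (v, xi)) => _; split=> //=; split=> //.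
by apply: contraNneq uD => xi0; rewrite uxi xi0 mul0mx.
Qed.

End Core1.

(** * Transfer, and the vectors fixed by x in a cyclic module *)

Section FixedLine.
Local Open Scope ring_scope.
Variables (gT : finGroupType) (G : {group gT}) (x : gT).
Let P := <[x]>%g.
Let p := #[x]%g.
Let N := ('N_G(P))%G.
Hypothesis p_pr : prime p.
Hypothesis sylP : (p.-Sylow(G) P)%g.

Let Gx : x \in G. Proof. by rewrite -cycle_subG (pHall_sub sylP). Qed.
Let sPG : P \subset G. Proof. exact: pHall_sub sylP. Qed.
Let sNG : N \subset G. Proof. exact: subsetIl. Qed.
Let sPN : P \subset N. Proof. by rewrite subsetI sPG normG. Qed.

(** If [N] centralized [P], the transfer from [G] to [P] would send [x] to [x ^+ #|G : P|], which is
    not 1, while a perfect group has no nontrivial homomorphism to [P]. *)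
Lemma perfect_norm_noncentral : (G^`(1))%g = G -> exists2 n, n \in N & n \notin 'C(P)%g.
Proof.
move=> perfG; apply: NNPP => nex.
have cNP n : n \in N -> n \in 'C(P)%g by move=> Nn; apply/negPn/negP=> nC; case: nex; exists n.
have cPP : abelian (idm_morphism <[x]>%G @* <[x]>%G)%g by rewrite morphim_idm ?cycle_abelian.
pose V := transfer_morphism G cPP.
have Vx : V x = 1%g.
  suff /subsetP sub : (G \subset 'ker V)%g by apply: mker; apply: sub.
  rewrite -{1}perfG; apply: der1_min; first exact: normal_norm (ker_normal _).
  by rewrite (isog_abelian (first_isog V)); apply/centsP=> a _ b _; apply: addrC.
have part := rcosets_cycle_partition sPG Gx.
pose X := transversal (rcosets <[x]>%G G :* <[x]>%g)%g G.
have trX : is_transversal X (rcosets <[x]>%G G :* <[x]>%g)%g G := transversalP part.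
have exp_V := transfer_cycle_expansion sPG cPP Gx trX; have sumX := sum_index_rcosets_cycle sPG Gx trX.
move: Vx; rewrite /V /= exp_V.
have Ax : x \in (idm_morphism <[x]>%G @* <[x]>%G)%g by rewrite morphim_idm ?cycle_id.
pose f z := FiniteModule.fmod cPP z; rewrite -[restrm _ _]/f.
have sXG : X \subset G by apply: transversal_sub trX.
pose n_ y := #|<[x]> : (<[x]> :* y)|%g.
rewrite (eq_bigr (fun y => f x *+ n_ y)); last first.
  move=> y Xy; have Gy := subsetP sXG y Xy.
  have Pyx : (y * x ^+ n_ y * y^-1)%g \in P by rewrite -mem_rcoset mulg_exp_card_rcosets.
  (* A nontrivial power of [x] conjugated into [P] puts [y] in [N], where the conjugation is trivial
     by assumption. *)
  rewrite -/(n_ y); have -> : ((x ^+ n_ y) ^ y^-1 = x ^+ n_ y)%g.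
    have [->|nx] := eqVneq (x ^+ n_ y)%g 1%g; first by rewrite conj1g.
    have Ny : y \in N by apply: (norm_of_conj p_pr sylP Gy (mem_cycle x (n_ y)) nx); apply: (subsetP sPN).
    by rewrite conjgE invgK mulgA (centP (cNP y Ny) _ (mem_cycle x _)) mulgK.
  by rewrite /f FiniteModule.fmodX.
rewrite sumrMnr [(\sum_(y in X) _)%N]sumX -(FiniteModule.fmodX cPP _ Ax) => Vx.
have : (x ^+ #|G : P|)%g = 1%g.
  rewrite -(FiniteModule.fmodK cPP (groupX #|G : P|%g Ax)) Vx.
  exact: FiniteModule.fmval0.
move/eqP; rewrite -order_dvdn; apply/negP; rewrite -prime_coprime //.
have /and3P[_ _] := sylP; rewrite p'natE // prime_coprime //.
Qed.

Variable F : fieldType.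
Hypothesis charF : p \in [pchar F].
Variables (n : nat) (rW : mx_representation F G n) (y : 'rV[F]_n) (la : gT -> F).
Hypothesis yN : forall h, h \in N -> y *m rW h = la h *: y.
Hypothesis nzy : y != 0.
Let u : 'M_n := rW x - 1.
Hypothesis yu : y *m u = 0.
Hypothesis orb0 : \sum_(a < p) rW (x ^+ a)%g = 0.
Hypothesis gen : forall A : 'M[F]_n, (forall g, g \in G -> y *m rW g *m A = 0) -> A = 0.

Lemma fixed_P_row m (w : 'M_(m, n)) h : w *m u = 0 -> h \in P -> w *m rW h = w.
Proof.
move=> wu /cycleP[a ->].
have wx : w *m rW x = w by move: wu; rewrite /u mulmxBr mulmx1 => /eqP; rewrite subr_eq0 => /eqP.
by elim: a => [|a IHa]; rewrite ?expg0 ?repr_mx1 ?mulmx1 // expgSr repr_mxM ?groupX // mulmxA IHa.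
Qed.

Lemma fixed_norm (w : 'rV_n) h : w *m u = 0 -> h \in N -> (w *m rW h) *m u = 0.
Proof.
move=> wu Nh; have Gh := subsetP sNG h Nh.
have Pxh : (x ^ h^-1)%g \in P.
  by rewrite memJ_norm ?cycle_id // groupV; case/setIP: Nh.
rewrite /u mulmxBr mulmx1 -mulmxA -repr_mxM //.
have -> : (h * x)%g = (x ^ h^-1 * h)%g by rewrite conjgE invgK !mulgA mulgKV.
by rewrite (repr_mxM _ (subsetP sPG _ Pxh) Gh) mulmxA (fixed_P_row wu Pxh) subrr.
Qed.

Lemma last_power : exists s, (y <= u ^+ s)%MS && ~~ (y <= u ^+ s.+1)%MS.
Proof.
have ex : exists s, ~~ (y <= u ^+ s)%MS.
  exists p; suff -> : u ^+ p = 0 by rewrite submx0.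
  apply: (addrI 1); rewrite addr0 -unip_pow_char // /u addrC subrK.
  by rewrite -(repr_expg _ _ Gx) expg_order repr_mx1.
have [[|s] ns smin] := ex_minnP ex; first by rewrite expr0 submx1 in ns.
by exists s; rewrite ns andbT; apply/negPn/negP=> /smin; rewrite ltnn.
Qed.

Lemma index_norm_neq0 : (nrc N <[x]>%G)%:R != 0 :> F.
Proof.
rewrite card_nrc -(dvdn_pcharf charF) -prime_coprime //.
have := pHall_subl sPN sNG sylP; case/and3P=> _ _; rewrite p'natE //.
by rewrite prime_coprime.
Qed.

(* An operator commuting with [x] sending every fixed vector into the line of [y] is averaged over
   [N] and then over the cosets of [N]; orbit sums of [x] kill all cosets but one. *)
Theorem fixed_line (w : 'rV_n) : w *m u = 0 -> (w <= y)%MS.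
Proof.
move=> wu; have [s /andP[/submxP[z yz] ny]] := last_power.
have [j nzj] : exists j, (y *m col j (cokermx (u ^+ s.+1))) 0 0 != 0.
  move: ny; rewrite submxE => /matrix0Pn[i [j]]; rewrite ord1 => nz; exists j.
  by rewrite colE mulmxA -colE mxE.
set eta := col j _ in nzj; pose a := (y *m eta) 0 0.
have ueta : u ^+ s.+1 *m eta = 0 by rewrite /eta colE mulmxA mulmx_coker mul0mx.
have zu : z *m u ^+ s.+1 = 0 by rewrite exprSr mulmxA -yz.
(* This convolution commutes with [u] because both boundary terms of the commutator contain
   [u ^+ s.+1]; on fixed rows only the term i = 0 survives and gives a multiple of [y]. *)
pose th0 := \sum_(i < s.+1) u ^+ i *m eta *m (z *m u ^+ (s - i)).
have th0_u : u *m th0 = th0 *m u.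
  rewrite /th0 mulmx_sumr mulmx_suml big_ord_recr [RHS]big_ord_recl /=.
  rewrite subnn expr0 mulmx1 !mulmxA -[u *m u ^+ s]/(u * u ^+ s) -exprS ueta mul0mx addr0.
  rewrite subn0 [1 *m eta]mul1mx -!mulmxA -[u ^+ s *m u]/(u ^+ s * u) -exprSr zu mulmx0 add0r.
  apply: eq_bigr => i _; rewrite !mulmxA -[u *m u ^+ i]/(u * u ^+ i) -exprS -!mulmxA.
  by rewrite -[u ^+ (s - bump 0 i) *m u]/(u ^+ _ * u) -exprSr /bump /= add1n subnSK.
have th0_fix (w0 : 'rV_n) : w0 *m u = 0 -> w0 *m th0 = (w0 *m eta) 0 0 *: y.
  move=> w0u; rewrite /th0 mulmx_sumr big_ord_recl /= big1 ?addr0 => [|i _].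
    by rewrite subn0 expr0 mul1mx !mulmxA -mulmxA -yz {1}(mx11_scalar (w0 *m eta)) mul_scalar_mx.
  by rewrite !mulmxA /bump /= add1n exprS -[u * _]/(u *m _) mulmxA w0u !mul0mx.
have th0_P h : h \in P -> th0 *m rW h = rW h *m th0.
  case/cycleP=> b ->; have thx : th0 *m rW x = rW x *m th0.
    by move/eqP: th0_u; rewrite /u mulmxBl mulmxBr mul1mx mulmx1 (inj_eq (addIr _)) => /eqP.
  elim: b => [|b IHb]; first by rewrite expg0 repr_mx1 mulmx1 mul1mx.
  by rewrite expgS repr_mxM ?groupX // mulmxA thx -mulmxA IHb mulmxA.
pose PsiN h := rW h^-1%g *m th0 *m rW h.
have PsiNP h k : h \in <[x]>%G -> k \in N -> PsiN (h * k)%g = PsiN k.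
  move=> Ph Nk; have [Gh Gk] := (subsetP sPG h Ph, subsetP sNG k Nk).
  rewrite /PsiN invMg !repr_mxM ?groupV // -!mulmxA; congr (_ *m _); rewrite !mulmxA.
  by rewrite -[_ *m th0 *m _]mulmxA th0_P // mulmxA -repr_mxM ?groupV // mulVg repr_mx1 mul1mx.
pose th := \sum_(c < nrc N <[x]>%G) PsiN (rrep c).
have th_N h : h \in N -> rW h^-1%g *m th *m rW h = th.
  move=> Nh; have Gh := subsetP sNG h Nh; rewrite -[RHS](coset_sum_shift sPN PsiNP Nh).
  rewrite /th mulmx_sumr mulmx_suml; apply: eq_bigr => c _.
  have Gc : rrep c \in G by apply: (subsetP sNG); apply: rrep_in.
  by rewrite /PsiN invMg !repr_mxM ?groupV // !mulmxA.
have th_fix (w0 : 'rV_n) : w0 *m u = 0 -> exists b, w0 *m th = b *: y.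
  move=> w0u; exists (\sum_(c < nrc N <[x]>%G) (w0 *m rW (rrep c)^-1%g *m eta) 0 0 * la (rrep c)).
  rewrite scaler_suml /th mulmx_sumr; apply: eq_bigr => c _; have Nc : rrep c \in N by apply: rrep_in.
  by rewrite /PsiN !mulmxA th0_fix ?fixed_norm ?groupV // -scalemxAl yN // scalerA.
have yth : y *m th = ((nrc N <[x]>%G)%:R * a) *: y.
  rewrite /th mulmx_sumr (eq_bigr (fun=> a *: y)) ?sumr_const ?card_ord ?scaler_nat ?scalerMnl //.
    by rewrite mulr_natl.
  move=> c _; have Nc : rrep c \in N by apply: rrep_in.
  have Gc := subsetP sNG _ Nc.
  rewrite /PsiN !mulmxA th0_fix ?fixed_norm ?groupV // yN ?groupV // -!scalemxAl mxE -/a.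
  rewrite yN // scalerA -mulrA mulrCA.
  have -> : la (rrep c)^-1%g * la (rrep c) = 1; last by rewrite mulr1.
  apply/eqP; rewrite -subr_eq0; apply/eqP; have : (la (rrep c)^-1%g * la (rrep c) - 1) *: y = 0.
    rewrite scalerBl scale1r -scalerA -yN // scalemxAl -yN ?groupV // -mulmxA -repr_mxM ?groupV //.
    by rewrite mulVg repr_mx1 mulmx1 subrr.
  by move/eqP; rewrite scaler_eq0 (negPf nzy) orbF => /eqP.
pose Psi h := rW h^-1%g *m th *m rW h.
have PsiP h k : h \in N -> k \in G -> Psi (h * k)%g = Psi k.
  move=> Nh Gk; have Gh := subsetP sNG h Nh.
  by rewrite /Psi invMg !repr_mxM ?groupV // -!mulmxA -[in RHS](th_N h Nh) !mulmxA.
pose Th := \sum_(c < nrc G N) Psi (rrep c).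
have Th_G h : h \in G -> Th *m rW h = rW h *m Th.
  move=> Gh; rewrite /Th -[in RHS](coset_sum_shift sNG PsiP Gh) mulmx_suml mulmx_sumr.
  apply: eq_bigr => c _; have Gc : rrep c \in G by apply: rrep_in.
  rewrite /Psi invMg !repr_mxM ?groupV // !mulmxA -repr_mxM ?groupV // mulgV repr_mx1 mul1mx //.
have Th_fix (w0 : 'rV_n) : w0 *m u = 0 -> w0 *m Th = w0 *m th.
  move=> w0u; pose Ps h := w0 *m Psi h.
  have PsP h k : h \in N -> k \in G -> Ps (h * k)%g = Ps k by move=> Nh Gk; rewrite /Ps PsiP.
  have -> : w0 *m Th = \sum_(c < nrc G N) Ps (rrep c) by rewrite /Th mulmx_sumr.
  rewrite (coset_orbit_sum p_pr sylP PsP) => [|g /setDP[Gg _]].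
    by rewrite /Ps /Psi invg1 repr_mx1 mul1mx mulmx1.
  pose R := w0 *m rW g^-1%g *m th *m rW g.
  rewrite (eq_bigr (fun b : 'I_p => R *m rW (x ^+ b)%g)) => [|b _]; last first.
    have Gb : (x ^+ b)%g \in G by rewrite groupX.
    rewrite /Ps /Psi invMg !repr_mxM ?groupV // !mulmxA (fixed_P_row w0u (h := (x ^- b)%g)) //.
    by rewrite groupV mem_cycle.
  by rewrite -mulmx_sumr orb0 mulmx0.
pose t : F := (nrc N <[x]>%G)%:R * a.
have nzt : t != 0 by rewrite mulf_neq0 // index_norm_neq0.
(* [Th] commutes with [G] and multiplies the generator [y] by [t], so it is a scalar; yet it sends
   [w] into the line of [y]. *)
have ThE : Th = t%:M.
  apply/eqP; rewrite -subr_eq0; apply/eqP; apply: gen => g Gg.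
  by rewrite mulmxBr -mulmxA -Th_G // mulmxA Th_fix // yth mul_mx_scalar -scalemxAl subrr.
have [b wth] := th_fix w wu; have := Th_fix w wu; rewrite ThE mul_mx_scalar wth => e.
by rewrite -[w]scale1r -(mulVf nzt) -scalerA e scalerA scalemx_sub.
Qed.
End FixedLine.

(** * Pascal matrices and the action of sl_2 on polynomials *)

Section Pascal.
Local Open Scope ring_scope.
Variables (F : fieldType) (p D : nat).
Hypothesis charF : p \in [pchar F].
Hypothesis Dp : (D < p)%N.

(** Substitution of X + a for X on polynomials of degree at most [D], in the basis of monomials. *)
Definition pas (a : F) : 'M[F]_D.+1 := \matrix_(i, j) ('C(i, j)%:R * a ^+ (i - j)).

Lemma coefXD (c : F) i j : (('X + c%:P) ^+ i)`_j = 'C(i, j)%:R * c ^+ (i - j).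
Proof.
rewrite addrC exprDn coef_sum; have [ji|ij] := leqP j i; last first.
  rewrite bin_small // mul0r big1 // => k _; rewrite coefMn -rmorphXn /= coefCM coefXn.
  by rewrite gtn_eqF ?mulr0 ?mul0rn //; apply: leq_ltn_trans ij; rewrite -ltnS.
have lt : (j < i.+1)%N by [].
rewrite (bigD1 (Ordinal lt)) //= coefMn -rmorphXn /= coefCM coefXn eqxx mulr1 big1 ?addr0 => [|k nk].
  by rewrite mulr_natl.
rewrite coefMn -rmorphXn /= coefCM coefXn; case: eqP => [e|_]; last by rewrite mulr0 mul0rn.
by case/eqP: nk; apply: val_inj.
Qed.

Lemma pasM a b : pas a *m pas b = pas (a + b).
Proof.
apply/matrixP=> i j; rewrite !mxE -coefXD.
have -> : 'X + (a + b)%:P = a%:P + ('X + b%:P) :> {poly F} by rewrite polyCD; ring.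
rewrite exprDn coef_sum (big_ord_widen _ (fun k => (a%:P ^+ (i - k) * ('X + b%:P) ^+ k *+ 'C(i, k))`_j) (ltn_ord i)).
rewrite [RHS]big_mkcond; apply: eq_bigr => k _; rewrite !mxE; case: ifP => ki.
  by rewrite [RHS]coefMn -[RHS]mulr_natl -mulrA -rmorphXn /= coefCM coefXD.
by rewrite bin_small ?mul0r // ltnNge -ltnS ki.
Qed.

Lemma pas0 : pas 0 = 1%:M.
Proof.
apply/matrixP=> i j; rewrite !mxE; case: (ltngtP i j) => [ij|ji|/val_inj->].
- by rewrite bin_small // mul0r -val_eqE /= ltn_eqF.
- by rewrite expr0n subn_eq0 leqNgt ji mulr0 -val_eqE /= gtn_eqF.
by rewrite eqxx subnn binn mul1r.
Qed.

Lemma pas_exp k : pas 1 ^+ k = pas k%:R.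
Proof.
elim: k => [|k IHk]; first by rewrite expr0 pas0.
by rewrite exprS IHk -[_ * _]/(_ *m _) pasM -natr1 addrC.
Qed.

Lemma pas_lt k (i j : 'I_D.+1) : (i < j + k)%N -> ((pas 1 - 1) ^+ k) i j = 0.
Proof.
elim: k i j => [|k IHk] i j ij.
  by rewrite expr0 mxE; case: eqP ij => // ->; rewrite addn0 ltnn.
rewrite exprS mxE big1 // => l _; have [li|il] := ltnP l i.
  by rewrite IHk ?mulr0 //; apply: leq_trans li _; rewrite -ltnS -addnS.
rewrite !mxE; have [->|nil] := eqVneq i l; first by rewrite binn subnn mul1r subrr mul0r.
rewrite bin_small ?mul0r ?subr0 ?mul0r // ltn_neqAle il andbT.
by apply: contra nil => /eqP/val_inj->.
Qed.

Lemma pas_nil : (pas 1 - 1) ^+ D.+1 = 0.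
Proof.
by apply/matrixP=> i j; rewrite pas_lt ?mxE // (leq_trans (ltn_ord i)) ?leq_addl.
Qed.

(** The difference operator takes X^i to leading term i X^(i - 1), so its k-th power has leading
    coefficient i! / j!. *)
Lemma pas_diag k (i j : 'I_D.+1) : i = (j + k)%N :> nat -> ((pas 1 - 1) ^+ k) i j * j`!%:R = i`!%:R.
Proof.
elim: k i j => [|k IHk] i j ij.
  by rewrite expr0 mxE; case: eqP ij => [-> _|ne]; rewrite ?mul1r // addn0 => /val_inj/ne.
have lt : (j + k < D.+1)%N by have := ltn_ord i; rewrite {1}ij addnS => /ltnW.
rewrite exprS mxE (bigD1 (Ordinal lt)) //= big1 ?addr0 => [|l nl].
  rewrite -mulrA (IHk (Ordinal lt)) //= !mxE /= -val_eqE /= ij addnS gtn_eqF // subr0.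
  by rewrite expr1n mulr1 binSn factS natrM.
have [li|il] := ltnP l i; last first.
  rewrite !mxE; have [->|nil] := eqVneq i l; first by rewrite binn subnn mul1r subrr mul0r.
  rewrite bin_small ?mul0r ?subr0 ?mul0r // ltn_neqAle il andbT.
  by apply: contra nil => /eqP/val_inj->.
rewrite pas_lt ?mulr0 // ltn_neqAle -ltnS -addnS -ij li andbT.
by apply: contra nl => /eqP e; apply/eqP/val_inj.
Qed.

Lemma pas_neq0 : (pas 1 - 1) ^+ D != 0.
Proof.
apply/eqP=> /matrixP/(_ ord_max ord0); rewrite mxE => e.
have := @pas_diag D ord_max ord0 (esym (add0n _)); rewrite e mul0r => /esym/eqP.
by rewrite (negPf (fact_neq0 charF Dp)).
Qed.

(** With [hmx] and [fmx], the standard basis of sl_2 acting on polynomials of degree at most [D];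
    [dmx] is differentiation, the logarithm of [pas 1]. *)
Definition dmx : 'M[F]_D.+1 := \matrix_(i, j) ((i == j.+1 :> nat)%:R * i%:R).
Definition hmx : 'M[F]_D.+1 := \matrix_(i, j) ((i == j)%:R * (D%:R - i%:R - i%:R)).
Definition fmx : 'M[F]_D.+1 := \matrix_(i, j) ((j == i.+1 :> nat)%:R * (D%:R - i%:R)).

Lemma pas1E i j : pas 1 i j = 'C(i, j)%:R.
Proof. by rewrite mxE expr1n mulr1. Qed.

Lemma mulDmx i j : (dmx *m pas 1) i j = (i%:R - j%:R) * 'C(i, j)%:R.
Proof.
rewrite mxE; case: i => [[|i] lt] /=.
  rewrite big1 => [|k _]; last by rewrite !mxE /= mul0r mul0r.
  by case: j => [[|j] ?] /=; rewrite ?subrr ?mul0r // bin0n mulr0.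
have lti : (i < D.+1)%N by exact: ltnW.
rewrite (bigD1 (Ordinal lti)) //= big1 ?addr0 => [|k nk]; last first.
  rewrite !mxE /= eqSS; case: eqP => [e|_]; last by rewrite !mul0r.
  by case/eqP: nk; apply: val_inj.
rewrite pas1E mxE /= eqxx mul1r -natrM.
have [ij|ji] := ltnP i j.
  rewrite bin_small // muln0; have [->|ne] := eqVneq (i.+1) j; first by rewrite subrr mul0r.
  by rewrite bin_small ?mulr0 // ltn_neqAle ne.
by rewrite -natrB 1?leqW // -natrM -mul_bin_down.
Qed.

Lemma mulDmx_r i j : (pas 1 *m dmx) i j = (i%:R - j%:R) * 'C(i, j)%:R.
Proof.
rewrite mxE; have [ij|ji] := leqP i j.
  rewrite big1 => [|k _].
    by move: ij; rewrite leq_eqVlt => /orP[/eqP->|/bin_small->]; rewrite ?subrr ?mul0r ?mulr0.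
  rewrite pas1E mxE; case: eqP => [e|_]; last by rewrite mul0r mulr0.
  by rewrite bin_small ?mul0r // e ltnS.
have ltj : (j.+1 < D.+1)%N by apply: leq_ltn_trans (ltn_ord i).
rewrite (bigD1 (Ordinal ltj)) //= big1 ?addr0 => [|k nk]; last first.
  rewrite pas1E mxE; case: eqP => [e|_]; last by rewrite mul0r mulr0.
  by case/eqP: nk; apply: val_inj.
by rewrite pas1E mxE /= eqxx mul1r -natrB 1?ltnW // -!natrM mulnC mul_bin_left.
Qed.

Lemma pas_d : pas 1 *m dmx = dmx *m pas 1.
Proof. by apply/matrixP=> i j; rewrite mulDmx mulDmx_r. Qed.

Lemma mulHmx i j : (hmx *m pas 1) i j = (D%:R - i%:R - i%:R) * 'C(i, j)%:R.
Proof.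
rewrite mxE (bigD1 i) //= big1 ?addr0 => [|k nk]; last by rewrite !mxE eq_sym (negPf nk) !mul0r.
by rewrite pas1E mxE eqxx mul1r.
Qed.

Lemma mulHmx_r i j : (pas 1 *m hmx) i j = (D%:R - j%:R - j%:R) * 'C(i, j)%:R.
Proof.
rewrite mxE (bigD1 j) //= big1 ?addr0 => [|k nk]; last by rewrite !mxE (negPf nk) mul0r mulr0.
by rewrite pas1E mxE eqxx mul1r mulrC.
Qed.

Lemma pas_h : pas 1 *m hmx = (hmx + dmx + dmx) *m pas 1.
Proof.
apply/matrixP=> i j; rewrite !mulmxDl [in RHS]mxE [X in X + _]mxE mulDmx mulHmx mulHmx_r; ring.
Qed.

Lemma mulFmx i j : (fmx *m pas 1) i j = (D%:R - i%:R) * 'C(i.+1, j)%:R.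
Proof.
rewrite mxE; have [iD|Di] := ltnP i D.
  rewrite (bigD1 (Ordinal (iD : (i.+1 < D.+1)%N))) //= big1 ?addr0 => [|k nk]; last first.
    rewrite mxE; case: eqP => [e|_]; last by rewrite !mul0r.
    by case/eqP: nk; apply: val_inj.
  by rewrite pas1E mxE /= eqxx mul1r.
have -> : i = D :> nat by apply/eqP; rewrite eqn_leq Di -ltnS ltn_ord.
rewrite subrr mul0r big1 // => k _; rewrite mxE; case: eqP => [e|_]; last by rewrite !mul0r.
by have := ltn_ord k; rewrite e ltnS ltnNge Di.
Qed.

Lemma mulFmx_r i j : (pas 1 *m fmx) i j = if nat_of_ord j is j'.+1 then (D%:R - j'%:R) * 'C(i, j')%:R else 0.
Proof.
rewrite mxE; case: j => [[|j] lt] /=.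
  by rewrite big1 // => k _; rewrite !mxE /= mul0r mulr0.
have ltj : (j < D.+1)%N by exact: ltnW.
rewrite (bigD1 (Ordinal ltj)) //= big1 ?addr0 => [|k nk]; last first.
  rewrite pas1E mxE /= eqSS; case: eqP => [e|_]; last by rewrite mul0r mulr0.
  by case/eqP: nk; apply: val_inj.
by rewrite pas1E mxE /= eqxx mul1r mulrC.
Qed.

Lemma pas_f : pas 1 *m fmx = (fmx - hmx - dmx) *m pas 1.
Proof.
apply/matrixP=> i j; rewrite !mulmxBl [in RHS]mxE [X in _ = X + _]mxE [X in _ = _ + X]mxE.
rewrite [X in _ = _ + X + _]mxE mulDmx mulHmx mulFmx mulFmx_r.
case: j => [[|j] lt] /=; first by rewrite !bin0; ring.
have key : 'C(i, j.+1)%:R * j.+1%:R = 'C(i, j)%:R * (i%:R - j%:R) :> F.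
  have [ji|ij] := leqP j i; first by rewrite -natrB // -!natrM mulnC mul_bin_left mulnC.
  by rewrite !bin_small ?mul0r // ltnW.
rewrite binS natrD; rewrite -natr1 in key *.
have -> : (D%:R - j%:R) * 'C(i, j)%:R = (D%:R - i%:R) * 'C(i, j)%:R + 'C(i, j)%:R * (i%:R - j%:R) :> F by ring.
rewrite -key; ring.
Qed.

Lemma sum_mul_rev n : (\sum_(i < n.+1) i * (n.+1 - i) = 'C(n.+2, 3))%N.
Proof.
elim: n => [|n IHn]; first by rewrite big_ord_recl big_ord0.
rewrite binS -IHn big_ord_recr /= subSnn muln1.
rewrite (eq_bigr (fun i : 'I_n.+1 => i * (n.+1 - i) + i)%N); last first.
  by move=> i _; rewrite subSn 1?ltnW // mulnS addnC.
rewrite big_split /= -addnA; congr (_ + _)%N.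
by rewrite -bin2_sum big_nat_recr //= big_mkord.
Qed.

Lemma tr_df : \tr (dmx *m fmx) = 'C(D.+2, 3)%:R.
Proof.
rewrite -sum_mul_rev /mxtrace natr_sum; apply: eq_bigr => i _; rewrite mxE.
case: i => [[|i] lt] /=; first by rewrite mul0n big1 // => k _; rewrite !mxE /= !mul0r.
have lti : (i < D.+1)%N by exact: ltnW.
rewrite (bigD1 (Ordinal lti)) //= big1 ?addr0 => [|k nk]; last first.
  rewrite !mxE /= eqSS; case: eqP => [e|_]; last by rewrite !mul0r.
  by case/eqP: nk; apply: val_inj.
by rewrite !mxE /= eqxx !mul1r -natrB 1?ltnW // -natrM subSS.
Qed.

(** The trace form moves a difference from the left factor to [fmx], and three differences
    annihilate [fmx]: it goes to - h - d, then to - 2 d, then to 0. *)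
Lemma third_difference (w1 w2 w3 : 'M[F]_D.+1) (w : 'M[F]_D.+1) :
  w *m pas 1 = pas 1 *m (w + w1) -> w1 *m pas 1 = pas 1 *m (w1 + w2) ->
  w2 *m pas 1 = pas 1 *m (w2 + w3) -> \tr (w3 *m fmx) = 0.
Proof.
have U : pas 1 \in unitmx.
  by have := pasM 1 (-1); rewrite subrr pas0 => /mulmx1_unit[].
have step (a b A B : 'M[F]_D.+1) : a *m pas 1 = pas 1 *m (a + b) -> pas 1 *m A = (A + B) *m pas 1 ->
    \tr (b *m A) = \tr (a *m B).
  move=> ab AB; have e1 : a + b = invmx (pas 1) *m (a *m pas 1) by rewrite ab mulKmx.
  have : \tr ((a + b) *m A) = \tr (a *m (A + B)).
    by rewrite e1 -!mulmxA AB mxtrace_mulC -!mulmxA mulmxV // mulmx1.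
  rewrite mulmxDl mulmxDr !linearD /= => /addrI; exact.
move=> e1 e2 e3.
have f' : pas 1 *m fmx = (fmx + (- hmx - dmx)) *m pas 1 by rewrite pas_f addrA.
have h' : pas 1 *m (- hmx - dmx) = ((- hmx - dmx) + (- dmx - dmx)) *m pas 1.
  by rewrite mulmxBr mulmxN pas_h pas_d -mulNmx -mulmxBl; congr (_ *m _); by rewrite !opprD !addrA.
have d' : pas 1 *m (- dmx - dmx) = ((- dmx - dmx) + 0) *m pas 1.
  by rewrite addr0 mulmxBr mulmxN pas_d mulmxBl mulNmx.
by rewrite (step _ _ _ _ e3 f') (step _ _ _ _ e2 h') (step _ _ _ _ e1 d') mulmx0 linear0.
Qed.

(** Entries are polynomials in [a] of degree less than p agreeing on the prime field, hence equal;
    [dmx] is the linear coefficient of [pas]. *)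
Lemma log_conj (m' m : 'M[F]_D.+1) (c : nat) :
  (forall a : nat, m' *m pas a%:R *m m = pas (c * a)%:R) -> m' *m dmx *m m = c%:R *: dmx.
Proof.
move=> mE; have dE i j : dmx i j = ((('X : {poly F}) ^+ (i - j) *+ 'C(i, j)) : {poly F})`_1.
  rewrite mxE coefMn coefXn; case: eqP => [->|ne].
    by rewrite subSnn eqxx binSn mul1r.
  have [e|_] := eqVneq 1%N (i - j)%N; last by rewrite mul0r mul0rn.
  by case: ne; lia.
apply/matrixP=> i j.
pose Q1 : {poly F} := \sum_k \sum_l (m' i k * m l j) *: ('X ^+ (k - l) *+ 'C(k, l)).
pose Q2 : {poly F} := c%:R ^+ (i - j) *: ('X ^+ (i - j) *+ 'C(i, j)).
have szX (k l : 'I_D.+1) : (size ('X ^+ (k - l) *+ 'C(k, l) : {poly F}) <= p)%N.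
  rewrite -scaler_nat; apply: leq_trans (size_scale_leq _ _) _; rewrite size_polyXn.
  by apply: leq_trans Dp; rewrite ltnS (leq_trans (leq_subr _ _)) // -ltnS.
have Q12 : Q1 = Q2.
  apply: (poly_ext charF); rewrite ?/Q1 ?/Q2.
  - apply: (leq_trans (size_sum _ _ _)); apply/bigmax_leqP=> k _.
    apply: (leq_trans (size_sum _ _ _)); apply/bigmax_leqP=> l _.
    exact: leq_trans (size_scale_leq _ _) (szX k l).
  - exact: leq_trans (size_scale_leq _ _) (szX i j).
  move=> a; have /matrixP/(_ i j) := mE a; rewrite !mxE => e.
  rewrite !hornerE hornerMn hornerXn natrM exprMn in e *.
  rewrite -[X in _ * X]mulr_natl mulrCA -e horner_sum; under eq_bigr do rewrite horner_sum.
  rewrite exchange_big /=; apply: eq_bigr => l _; rewrite mxE mulr_suml; apply: eq_bigr => k _.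
  by rewrite hornerZ hornerMn hornerXn mxE -mulr_natl; ring.
have := congr1 (fun q : {poly F} => q`_1) Q12; rewrite /Q1 /Q2 coef_sum coefZ -dE.
under eq_bigr do rewrite coef_sum.
rewrite exchange_big /= => e.
rewrite mxE; transitivity (c%:R ^+ (i - j) * dmx i j); last first.
  rewrite !mxE; case: eqP => [->|_]; last by rewrite !mul0r !mulr0.
  by rewrite subSnn expr1.
rewrite -e; apply: eq_bigr => l _; rewrite mxE mulr_suml; apply: eq_bigr => k _.
by rewrite coefZ -dE; ring.
Qed.

Lemma jordan_basis (u : 'M[F]_D.+1) : u ^+ D != 0 -> u ^+ D.+1 = 0 ->
  exists2 B : 'M[F]_D.+1, B \in unitmx & B *m u = \matrix_(i, j) (i == j.+1 :> nat)%:R *m B.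
Proof.
move=> uD uD1; have /rowV0Pn[w1 /submxP[w wE] nz] := uD; rewrite {}wE in nz.
pose B := \matrix_(i < D.+1) (w *m u ^+ (D - i)).
have uk k : (D < k)%N -> u ^+ k = 0 by move=> Dk; rewrite -(subnK Dk) exprD uD1 mulr0.
exists B; last first.
  apply/row_matrixP=> i; rewrite !row_mul rowK [RHS]mulmx_sum_row.
  case: i => [[|i] lt] /=.
    rewrite big1 => [|k _]; last by rewrite !mxE /= scale0r.
    by rewrite subn0 -mulmxA -[u ^+ D *m u]/(u ^+ D * u) -exprSr uD1 mulmx0.
  have lti : (i < D.+1)%N by exact: ltnW.
  rewrite (bigD1 (Ordinal lti)) //= big1 ?addr0 => [|k nk]; last first.
    rewrite !mxE /= eqSS; case: eqP => [e|_]; last by rewrite scale0r.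
    by case/eqP: nk; apply: val_inj.
  rewrite !mxE /= eqxx scale1r rowK /= -mulmxA -[u ^+ _ *m u]/(u ^+ _ * u) -exprSr.
  by rewrite subnSK.
rewrite -row_free_unit; apply: inj_row_free => c c0; apply/eqP; apply/negPn/negP=> /matrix0Pn[i0 [j0]].
rewrite ord1 => nz0.
(* Multiplying by the power of [u] given by the largest index with nonzero coefficient kills all the
   other rows. *)
have [i nzi imax] := arg_maxnP (P := fun i => c 0 i != 0) (fun i : 'I_D.+1 => nat_of_ord i) nz0.
have : c *m B *m u ^+ i = 0 by rewrite c0 mul0mx.
rewrite (mulmx_sum_row c B) mulmx_suml (bigD1 i) //= big1 ?addr0 => [|k nk].
  rewrite rowK -scalemxAl -mulmxA -[u ^+ _ *m _]/(u ^+ _ * u ^+ _) -exprD subnK; last by rewrite -ltnS.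
  by move/eqP; rewrite scaler_eq0 (negPf nz) orbF (negPf nzi).
have [->|nzk] := eqVneq (c 0 k) 0; first by rewrite scale0r mul0mx.
have ki : (k < i)%N by rewrite ltn_neqAle [(k <= i)%N]imax // andbT; apply: contra nk => /eqP/val_inj->.
rewrite rowK -scalemxAl -mulmxA -[u ^+ _ *m _]/(u ^+ _ * u ^+ _) -exprD uk ?mulmx0 ?scaler0 //.
by have := ltn_ord k; have := ltn_ord i; lia.
Qed.

(** [u] and [pas 1 - 1] have the same single Jordan block. *)
Lemma pascal_basis n (u : 'M[F]_n) : n = D.+1 -> u ^+ D != 0 -> u ^+ D.+1 = 0 ->
  exists (B : 'M[F]_(D.+1, n)) (B' : 'M[F]_(n, D.+1)),
    [/\ B *m B' = 1%:M, B' *m B = 1%:M & B *m (1 + u) = pas 1 *m B].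
Proof.
move=> e; move: u; rewrite {}e => u uD uD1.
have [B1 U1 e1] := jordan_basis uD uD1; have [B2 U2 e2] := jordan_basis pas_neq0 pas_nil.
set J := \matrix_(i, j) _ in e1 e2.
exists (invmx B2 *m B1), (invmx B1 *m B2); split.
- by rewrite mulmxA mulmxK // mulVmx.
- by rewrite mulmxA mulmxK // mulVmx.
rewrite mulmxDr mulmx1 -mulmxA e1 -[pas 1](addrNK 1) mulmxDl mul1mx addrC; congr (_ + _).
by rewrite !mulmxA -[in RHS](mulKmx U2 (pas 1 - 1)) e2 !mulmxA mulmxK.
Qed.

Lemma dmx_neq0 : (0 < D)%N -> dmx != 0.
Proof.
move=> D0; apply/eqP=> /matrixP/(_ (Ordinal (D0 : 1 < D.+1)%N) ord0); rewrite !mxE /= mul1r.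
by move/eqP; rewrite oner_eq0.
Qed.

(** For D >= 2 the hypothesis gives D + 2 < p, so p does not divide (D + 2)!; for D = 1 the binomial
    is 1. *)
Lemma bin3_neq0 : (0 < D)%N -> ((2 * D).+1 <= p)%N -> 'C(D.+2, 3)%:R != 0 :> F.
Proof.
move=> D0 D2; have p_pr := pcharf_prime charF.
have [D1|D1] := eqVneq D 1%N; first by rewrite D1 oner_neq0.
have lt : (D.+2 < p)%N.
  move: D0 D1 D2; case: (D) => [|[|d]] // _ _ h; have : (d.+4 <= p)%N by lia.
  rewrite leq_eqVlt => /orP[/eqP e|//]; move: h; rewrite -e => h; have d0 : d = 0%N by lia.
  by rewrite -e d0 in p_pr.
have := fact_neq0 charF lt; apply: contra => /eqP e.
by rewrite -(@bin_fact D.+2 3) // natrM e mul0r.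
Qed.
End Pascal.

Section ConjOrbit.
Local Open Scope ring_scope.
Variables (F : fieldType) (p : nat).
Hypothesis charF : p \in [pchar F].
Let p_pr := pcharf_prime charF.

Lemma polyfun_scale d c (f : nat -> F) : polyfun d f -> polyfun d (fun a => f (c * a)%N).
Proof.
case=> Q szQ QE; exists (Q \Po (c%:R *: 'X)) => [|a].
  apply: leq_trans (size_comp_poly_leq _ _) _; rewrite ltnS.
  have szX : ((size (c%:R *: 'X : {poly F})).-1 <= 1)%N.
    by rewrite -subn1 leq_subLR; apply: leq_trans (size_scale_leq _ _) _; rewrite size_polyX.
  have : ((size Q).-1 <= d)%N by move: szQ; lia.
  by move=> h; apply: leq_trans (leq_mul h szX) _; rewrite muln1.
by rewrite horner_comp hornerZ hornerX -natrM QE.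
Qed.

(** The exponent [p.-1 * a] stands for - a. The term in u^k and u^l has degree at most k + l in [a],
    so only k + l >= p - 1 could contribute. *)
Lemma conj_orbit_sum n (u A : 'M[F]_n) d : u ^+ d.+1 = 0 -> (d < p)%N ->
  (forall k l, (k <= d)%N -> (l <= d)%N -> (p.-1 <= k + l)%N -> u ^+ k *m A *m u ^+ l = 0) ->
  \sum_(a < p) ((1 + u) ^+ (p.-1 * a) *m A *m (1 + u) ^+ a) = 0.
Proof.
move=> ud dp kl0.
have e (a : 'I_p) : (1 + u) ^+ (p.-1 * a) *m A *m (1 + u) ^+ a = \sum_(k < d.+1) \sum_(l < d.+1)
    ('C(p.-1 * a, k)%:R * 'C(a, l)%:R) *: (u ^+ k *m A *m u ^+ l).
  rewrite !(unip_pow _ ud) !mulmx_suml; apply: eq_bigr => k _; rewrite mulmx_sumr; apply: eq_bigr => l _.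
  by rewrite -!scalemxAl -scalemxAr scalerA mulrC.
rewrite (eq_bigr _ (fun a _ => e a)) exchange_big big1 //= => k _; rewrite exchange_big big1 //= => l _.
rewrite -scaler_suml; have [kl|kl] := leqP p.-1 (k + l).
  by rewrite kl0 ?scaler0 // -ltnS.
have pk : polyfun k (fun a => 'C(p.-1 * a, k)%:R : F).
  by apply: (polyfun_scale p.-1 (polyfun_bin charF _)); apply: leq_ltn_trans dp; rewrite -ltnS.
have pl : polyfun l (fun a => 'C(a, l)%:R : F).
  by apply: (polyfun_bin charF); apply: leq_ltn_trans dp; rewrite -ltnS.
rewrite (polyfun_sum0 charF (polyfunM pk pl)) ?scale0r //.
by have := prime_gt0 p_pr; lia.
Qed.
End ConjOrbit.

Section CyclicSubmodule.
Local Open Scope ring_scope.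
Variables (F : fieldType) (gT : finGroupType) (G : {group gT}) (n : nat).
Variable rG : mx_representation F G n.

(** Translates of the generator span the module; this discharges the hypothesis [gen] of
    [fixed_line]. *)
Lemma cyclic_gen (y : 'rV_n) (A : 'M_(\rank (cyclic_mx rG y))) :
  (forall g, g \in G -> in_submod (cyclic_mx rG y) y *m submod_repr (cyclic_mx_module rG y) g *m A = 0) ->
  A = 0.
Proof.
move=> A0; apply/row_matrixP=> i; rewrite row0 rowE; set w := delta_mx 0 i.
rewrite -[w](val_submodK (U := cyclic_mx rG y)).
have /cyclic_mxP[B /envelop_mxP[a ->] ->] := val_submodP (U := cyclic_mx rG y) w.
rewrite mulmx_sumr linear_sum mulmx_suml big1 //= => g Gg.
rewrite -scalemxAr linearZ /= -scalemxAl (in_submodJ (cyclic_mx_module rG y)) ?cyclic_mx_id //.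
by have := A0 g Gg; rewrite /= => ->; rewrite scaler0.
Qed.

Definition ad_mx g : 'M_(n * n) := lin_mx (mulmxr (rG g) \o mulmx (rG g^-1%g)).

Lemma ad_mxE A g : mxvec A *m ad_mx g = mxvec (rG g^-1%g *m A *m rG g).
Proof. by rewrite mul_vec_lin. Qed.

Lemma ad_mx_repr : mx_repr G ad_mx.
Proof.
split=> [|g h Gg Gh]; apply/row_matrixP=> i; rewrite !rowE -[delta_mx _ _]vec_mxK.
  by rewrite ad_mxE invg1 repr_mx1 mul1mx !mulmx1.
by rewrite mulmxA !ad_mxE invMg !repr_mxM ?groupV // !mulmxA.
Qed.
Definition ad_repr := MxRepresentation ad_mx_repr.
End CyclicSubmodule.

Lemma odd_double_gt p d : odd p -> ~~ (2 * d <= p.-1)%N -> (p < 2 * d)%N.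
Proof. lia. Qed.

Lemma odd_double_ge3 p d : odd p -> (p < 2 * d)%N -> (p + 3 <= 2 * d.+1)%N.
Proof. lia. Qed.

Lemma mul_lt_succ a r p : (1 < p)%N -> (a * p <= (r * p).+1)%N -> (a * p < r.+1 * p)%N.
Proof. rewrite mulSn; lia. Qed.

Lemma sum_extreme k l d q : (k <= d)%N -> (l <= d)%N -> (q <= k + l)%N -> (2 * d <= q)%N ->
  [/\ (2 * d)%N = q, k = d & l = d].
Proof. by move=> *; split; lia. Qed.

Lemma index_arith k c s r q : (0 < k)%N -> (0 < c)%N -> (0 < r)%N -> (s <= 2)%N ->
  (q <= k * s)%N -> (k * c * r.+1 <= q)%N -> [/\ c = 1%N, r = 1%N, s = 2%N & (2 * k)%N = q].
Proof.
move=> k0 c0 r0 s2 qk tr; have : (k * (c * r.+1) <= k * s)%N by rewrite mulnA (leq_trans tr).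
rewrite leq_pmul2l // => cr.
have [c1 r1] : c = 1%N /\ r = 1%N by nia.
have s1 : s = 2%N by subst; lia.
by split=> //; subst; lia.
Qed.

(** Adding the two rank bounds and using ia, ib >= r gives (a + b)(p + 3) <= (a + b) p + 2, so a + b
    = 0. *)
Lemma weight_count r p a b ia ib ra rb : (ra + (rb + (ib - b) * p) <= (r * p).+1)%N ->
  (ra + (ia - a) * p + rb <= (r * p).+1)%N -> (r <= ia)%N -> (r <= ib)%N ->
  (a * (p + 3) <= 2 * ra)%N -> (b * (p + 3) <= 2 * rb)%N -> (a <= ia)%N -> (b <= ib)%N ->
  a = 0%N /\ b = 0%N.
Proof.
move=> e1 e2 ha hb la lb /subnKC ea /subnKC eb.
move: ea eb e1 e2; set a' := (ia - a)%N; set b' := (ib - b)%N.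
move: a' b' => a' b' ea eb e1 e2; subst ia ib.
have h1 : (r * p <= (a + a') * p)%N by rewrite leq_mul2r ha orbT.
have h2 : (r * p <= (b + b') * p)%N by rewrite leq_mul2r hb orbT.
rewrite !mulnDl in h1 h2; rewrite !mulnDr in la lb; lia.
Qed.

Section CycleExp.
Local Open Scope group_scope.
Variables (gT : finGroupType) (x : gT).
Definition cexp (n : gT) := find (fun k => x ^ n == x ^+ k) (iota 0 #[x]).

Lemma cexpP n : n \in 'N(<[x]>) -> x ^ n = x ^+ cexp n.
Proof.
move=> /normP Nn; have : x ^ n \in <[x]> by rewrite -Nn memJ_conjg cycle_id.
case/cyclePmin=> k lk e; have h : has (fun k => x ^ n == x ^+ k) (iota 0 #[x]).
  by apply/hasP; exists k; rewrite ?mem_iota ?e.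
have /eqP -> := nth_find 0%N h; rewrite nth_iota //.
by move: h; rewrite has_find size_iota.
Qed.

Lemma cexpM n m : n \in 'N(<[x]>) -> m \in 'N(<[x]>) -> cexp (n * m) = cexp n * cexp m %[mod #[x]].
Proof.
move=> Nn Nm; apply/eqP; rewrite -eq_expg_mod_order -cexpP ?groupM //.
by rewrite conjgM (cexpP Nn) conjXg (cexpP Nm) -expgM mulnC.
Qed.

Lemma cexp_cent n : n \in 'C(<[x]>) -> cexp n = 1 %[mod #[x]].
Proof.
move=> Cn; apply/eqP; rewrite -eq_expg_mod_order -cexpP ?(subsetP (cent_sub _)) // expg1.
by rewrite conjgE -(centP Cn x (cycle_id x)) mulKg.
Qed.
End CycleExp.

Section DoubleCosetCount.
Local Open Scope group_scope.
Variables (gT : finGroupType) (G N P : {group gT}).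
Hypotheses (sPN : P \subset N) (sNG : N \subset G).

Definition ndc (g : gT) : {set gT} := [set z.1 * g * z.2 | z in setX N P].

Lemma ndcP g h : reflect (exists n y, [/\ n \in N, y \in P & h = n * g * y]) (h \in ndc g).
Proof.
apply: (iffP imsetP) => [[[n y] /setXP[/= Nn Py] ->]|[n [y [Nn Py ->]]]]; first by exists n, y.
by exists (n, y); rewrite // in_setX Nn.
Qed.

Lemma ndc_refl g : g \in ndc g.
Proof. by apply/ndcP; exists 1, 1; rewrite !group1 mul1g mulg1. Qed.

Lemma ndc_sym g h : h \in ndc g -> g \in ndc h.
Proof.
case/ndcP=> n [y [Nn Py ->]]; apply/ndcP; exists n^-1, y^-1.
by rewrite !groupV Nn Py !mulgA mulVg mul1g mulgK.
Qed.

Lemma ndc_trans g h k : h \in ndc g -> k \in ndc h -> k \in ndc g.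
Proof.
case/ndcP=> n [y [Nn Py ->]] /ndcP[m [z [Nm Pz ->]]].
by apply/ndcP; exists (m * n), (y * z); rewrite !groupM // !mulgA.
Qed.

Lemma ndc_eq g h : h \in ndc g -> ndc h = ndc g.
Proof.
move=> gh; apply/eqP; rewrite eqEsubset; apply/andP; split; apply/subsetP=> k; apply: ndc_trans => //.
exact: ndc_sym.
Qed.

Definition ndcs := ndc @: (G :\: N).

Lemma ndcs_count : (#|G| - #|N| <= #|ndcs| * (#|N| * #|P|))%N.
Proof.
have sub : G :\: N \subset cover ndcs.
  apply/subsetP=> g Dg; apply/bigcupP; exists (ndc g); [exact: imset_f|exact: ndc_refl].
have -> : (#|G| - #|N|)%N = #|G :\: N| by rewrite cardsD (setIidPr sNG).
apply: leq_trans (subset_leq_card sub) _; apply: leq_trans (leq_card_cover _) _.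
rewrite -sum_nat_const; apply: leq_sum => d /imsetP[g _ ->].
by rewrite -cardsX leq_imset_card.
Qed.

Lemma ndcs_repr d : d \in ndcs -> repr d \in G :\: N /\ ndc (repr d) = d.
Proof.
case/imsetP=> g /setDP[Gg nNg] ->; have h := mem_repr g (ndc_refl g); rewrite (ndc_eq h); split=> //.
have /ndcP[n [y [Nn Py ->]]] := h; have [Gn Gy] := (subsetP sNG n Nn, subsetP sNG y (subsetP sPN y Py)).
apply/setDP; split; first by apply: groupM (groupM _ _) _.
by rewrite (groupMr _ (subsetP sPN y Py)) (groupMl _ Nn).
Qed.
End DoubleCosetCount.

(** * Weights of the normalizer *)

Section Core2.
Local Open Scope ring_scope.
Variables (gT : finGroupType) (G : {group gT}) (x : gT).
Let P := <[x]>%g.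
Let p := #[x]%g.
Let N := ('N_G(P))%G.
Hypothesis p_pr : prime p.
Hypothesis p_odd : odd p.
Hypothesis sylP : (p.-Sylow(G) P)%g.
Variable F : closedFieldType.
Hypothesis charF : p \in [pchar F].
Variables (I : finType) (phi : I -> irrep F G).
Hypothesis inj : irr_distinct phi.
Variables (D : I -> nat) (v : forall i, 'rV[F]_(idim (phi i))) (xi : forall i, 'cV[F]_(idim (phi i))).
Let nt := ntriv x phi.
Let u i : 'M_(idim (phi i)) := irepr (phi i) x - 1.
Hypothesis core : forall i, nt i ->
  [/\ (0 < D i < p)%N, idim (phi i) = (D i).+1, u i ^+ D i = xi i *m v i, u i ^+ (D i).+1 = 0
    & [/\ v i != 0, xi i != 0 & (kermx (u i) <= v i)%MS]].

Let Gx : x \in G. Proof. by rewrite -cycle_subG (pHall_sub sylP). Qed.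
Let sPG : P \subset G. Proof. exact: pHall_sub sylP. Qed.
Let sNG : N \subset G. Proof. exact: subsetIl. Qed.
Let sPN : P \subset N. Proof. by rewrite subsetI sPG normG. Qed.
Let NP n : n \in N -> n \in 'N(P)%g. Proof. by case/setIP. Qed.

(** The character of [N] on [P] by conjugation, with values in the prime field. *)
Definition cF n : F := (cexp x n)%:R.

Lemma natF_mod a b : a = b %[mod p] -> a%:R = b%:R :> F.
Proof. by move=> e; rewrite -(GRing.natr_mod_pchar charF a) e GRing.natr_mod_pchar. Qed.

Lemma cFM n m : n \in N -> m \in N -> cF (n * m)%g = cF n * cF m.
Proof. by move=> Nn Nm; rewrite /cF -natrM; apply/natF_mod/cexpM; apply: NP. Qed.

Lemma cF_cent n : n \in 'C(P)%g -> cF n = 1.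
Proof. by move=> /cexp_cent/natF_mod. Qed.

Lemma cF1 : cF 1%g = 1. Proof. by rewrite cF_cent ?group1. Qed.

Lemma cF_P y : y \in P -> cF y = 1.
Proof. by move=> Py; apply: cF_cent; apply: subsetP Py; apply: cycle_abelian. Qed.

Lemma cF_neq0 n : n \in N -> cF n != 0.
Proof.
move=> Nn; apply/eqP=> c0; have := cFM Nn (groupVr Nn).
by rewrite mulgV cF1 c0 mul0r => /eqP; rewrite oner_eq0.
Qed.

Lemma cFp n : n \in N -> cF n ^+ p.-1 = 1.
Proof.
move=> Nn; apply: (mulfI (cF_neq0 Nn)); rewrite -exprS prednK ?prime_gt0 // mulr1.
by rewrite -[LHS]/(pFrobenius_aut charF (cF n)) /cF rmorph_nat.
Qed.

Lemma vu i : nt i -> v i *m u i = 0.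
Proof.
move=> nti; have [_ _ uD uD1 [nzv nzxi _]] := core nti.
have e : xi i *m (v i *m u i) = 0.
  by rewrite mulmxA -uD -[_ *m u i]/(u i ^+ D i * u i) -exprSr.
by apply/eqP; apply/negPn/negP=> /(outer_neq0 nzxi)/eqP.
Qed.

Lemma uxi i : nt i -> u i *m xi i = 0.
Proof.
move=> nti; have [_ _ uD uD1 [nzv nzxi _]] := core nti.
have e : (u i *m xi i) *m v i = 0.
  by rewrite -mulmxA -uD -[_ *m u i ^+ _]/(u i * u i ^+ D i) -exprS.
by apply/eqP; apply/negPn/negP=> /outer_neq0/(_ nzv)/eqP.
Qed.

Lemma vP i y : nt i -> y \in P -> v i *m phi i y = v i.
Proof.
move=> nti Py; have := outer_fix_right sylP (1%:M : 'M_1) (vu nti) Py.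
by rewrite !mul1mx.
Qed.

Lemma xiP i y : nt i -> y \in P -> phi i y *m xi i = xi i.
Proof.
move=> nti Py; have := outer_fix_left sylP (1%:M : 'M_1) (uxi nti) Py.
by rewrite !mulmx1.
Qed.

(** Eigenvalue of [n] on the row [v i], read off with a pseudo-inverse so that it is defined for
    every element. *)
Definition la i n : F := (v i *m phi i n *m pinvmx (v i)) 0 0.

Lemma fixed_sub_v i (w : 'rV_(idim (phi i))) : nt i -> w *m u i = 0 -> exists a, w = a *: v i.
Proof.
move=> nti wu; have [_ _ _ _ [_ _ kerv]] := core nti.
by apply/sub_rVP; apply: submx_trans kerv; apply/sub_kermxP.
Qed.

Lemma conj_xn n : n \in N -> (n * (x ^ n))%g = (x * n)%g.
Proof. by move=> _; rewrite conjgE !mulgA mulgV mul1g. Qed.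

Lemma laP i n : nt i -> n \in N -> v i *m phi i n = la i n *: v i.
Proof.
move=> nti Nn; have Gn := subsetP sNG n Nn.
have [|a e] := @fixed_sub_v i (v i *m phi i n) nti.
  have Pxn : (x ^ n^-1)%g \in P by rewrite memJ_norm ?cycle_id ?groupV ?NP.
  rewrite /u mulmxBr mulmx1 -mulmxA -repr_mxM //.
  have -> : (n * x)%g = (x ^ n^-1 * n)%g by rewrite conjgE invgK !mulgA mulgKV.
  by rewrite (repr_mxM _ (subsetP sPG _ Pxn) Gn) mulmxA (vP nti Pxn) subrr.
have [_ _ _ _ [nzv _ _]] := core nti.
rewrite e; congr (_ *: _); rewrite /la e.
have := mulmxKpV (submx_refl (v i)); rewrite -scalemxAl mxE => h.
have [j vj] : exists j, v i 0 j != 0.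
  by case/matrix0Pn: nzv => k [j]; rewrite ord1; exists j.
have /matrixP/(_ 0 j) := h; rewrite mxE big_ord1 => e2.
by rewrite (mulIf vj (etrans e2 (esym (mul1r _)))) mulr1.
Qed.

(** Eigenvalue on the column [xi i]; [unip_pow_sub] dictates its ratio to [la i]. *)
Definition rho i n : F := la i n / cF n ^+ D i.

Lemma la_rho i n : n \in N -> la i n = cF n ^+ D i * rho i n.
Proof. by move=> Nn; rewrite /rho mulrC mulfVK // expf_neq0 // cF_neq0. Qed.

Lemma rhoP i n : nt i -> n \in N -> phi i n *m xi i = rho i n *: xi i.
Proof.
move=> nti Nn; have Gn := subsetP sNG n Nn; have [_ _ uD uD1 [nzv _ _]] := core nti.
have xnE : irepr (phi i) (x ^ n)%g = (1 + u i) ^+ cexp x n.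
  by rewrite cexpP ?NP // (repr_expg _ _ Gx) addrC subrK.
have un : u i *m phi i n = phi i n *m ((1 + u i) ^+ cexp x n - 1).
  rewrite -xnE /u mulmxBl mulmxBr -!repr_mxM ?groupJ // conj_xn //.
  by rewrite [X in _ - X]mul1mx [X in _ = _ - X]mulmx1.
have unk k : u i ^+ k *m phi i n = phi i n *m ((1 + u i) ^+ cexp x n - 1) ^+ k.
  elim: k => [|k IHk]; first by rewrite !expr0 [LHS]mul1mx [RHS]mulmx1.
  rewrite exprSr -[u i ^+ k * u i]/(u i ^+ k *m u i) -mulmxA un mulmxA IHk -mulmxA.
  by rewrite -[_ *m (_ - 1)]/(((1 + u i) ^+ cexp x n - 1) ^+ k * ((1 + u i) ^+ cexp x n - 1)) -exprSr.
have := unk (D i); rewrite unip_pow_sub // uD -mulmxA laP // -scalemxAr -scalemxAr mulmxA.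
rewrite -/(cF n) => e.
have {}e : (la i n *: xi i - cF n ^+ D i *: (phi i n *m xi i)) *m v i = 0.
  by rewrite mulmxBl -!scalemxAl e subrr.
have {}e : la i n *: xi i = cF n ^+ D i *: (phi i n *m xi i).
  apply/eqP; rewrite -subr_eq0; apply/negPn/negP=> /outer_neq0/(_ nzv).
  by rewrite e eqxx.
by rewrite /rho mulrC -scalerA e scalerA mulVf ?scale1r // expf_neq0 // cF_neq0.
Qed.

Lemma scale_inj_v i a b : nt i -> a *: v i = b *: v i -> a = b.
Proof.
move=> nti /eqP; have [_ _ _ _ [nzv _ _]] := core nti.
by rewrite -subr_eq0 -scalerBl scaler_eq0 (negPf nzv) orbF subr_eq0 => /eqP.
Qed.

Lemma laM i n m : nt i -> n \in N -> m \in N -> la i (n * m)%g = la i n * la i m.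
Proof.
move=> nti Nn Nm; have [Gn Gm] := (subsetP sNG n Nn, subsetP sNG m Nm).
apply: (scale_inj_v nti); rewrite -laP ?groupM // repr_mxM // mulmxA laP //.
by rewrite -scalemxAl laP // scalerA.
Qed.

Lemma la_P i y : nt i -> y \in P -> la i y = 1.
Proof. by move=> nti Py; apply: (scale_inj_v nti); rewrite -laP ?(subsetP sPN) // vP // scale1r. Qed.

Lemma la1 i : nt i -> la i 1%g = 1.
Proof. by move=> nti; rewrite la_P ?group1. Qed.

(** The square of u^D is zero because D > 0, and it equals xi (v xi) v. *)
Lemma vxi i : nt i -> v i *m xi i = 0.
Proof.
move=> nti; have [/andP[D0 _] _ uD uD1 [nzv nzxi _]] := core nti.
have /eqP e : xi i *m (v i *m xi i) *m v i = 0.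
  rewrite mulmxA -mulmxA -!uD -[LHS]/(u i ^+ D i * u i ^+ D i) -exprD.
  by case: (D i) D0 uD1 => // d _ d1; rewrite addSnnS exprD d1 mulr0.
apply/eqP; apply/negPn/negP=> nz; case/negP: (outer_neq0 (outer_neq0 nzxi nz) nzv); exact: e.
Qed.

Definition biinv_fun i g := (v i *m phi i g *m xi i) 0 0.

Lemma biinv_fun_N i n : nt i -> n \in N -> biinv_fun i n = 0.
Proof. by move=> nti Nn; rewrite /biinv_fun laP // -scalemxAl vxi // scaler0 mxE. Qed.

Lemma biinv_fun_l i n g : nt i -> n \in N -> g \in G -> biinv_fun i (n * g)%g = la i n * biinv_fun i g.
Proof.
move=> nti Nn Gg; rewrite /biinv_fun (repr_mxM _ (subsetP sNG _ Nn) Gg) mulmxA laP //.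
by rewrite -!scalemxAl mxE.
Qed.

Lemma biinv_fun_r i n g : nt i -> n \in N -> g \in G -> biinv_fun i (g * n)%g = rho i n * biinv_fun i g.
Proof.
move=> nti Nn Gg; rewrite /biinv_fun (repr_mxM _ Gg (subsetP sNG _ Nn)) -!mulmxA rhoP //.
by rewrite -!scalemxAr mxE.
Qed.

Lemma biinv_fun_P i y z g : nt i -> y \in P -> z \in P -> g \in G -> biinv_fun i (y * g * z)%g = biinv_fun i g.
Proof.
move=> nti Py Pz Gg; have [Gy Gz] := (subsetP sPG y Py, subsetP sPG z Pz).
by rewrite /biinv_fun !repr_mxM ?groupM // !mulmxA vP // -mulmxA xiP.
Qed.

Lemma biinv_fun_ind (c : I -> F) : (forall g, g \in G -> \sum_(i | nt i) c i * biinv_fun i g = 0) ->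
  forall i, nt i -> c i = 0.
Proof.
move=> c0 i nti; pose A i := if nt i then c i *: (xi i *m v i) else 0.
suff /(_ i) : forall i, A i = 0.
  rewrite /A nti => /eqP; have [_ _ _ _ [nzv nzxi _]] := core nti.
  by rewrite scaler_eq0 (negPf (outer_neq0 nzxi nzv)) orbF => /eqP.
apply: (coef_indep inj) => g Gg; rewrite -[RHS](c0 g Gg) [RHS]big_mkcond; apply: eq_bigr => j _.
rewrite /A; case: ifP => _; last by rewrite mul0mx raddf0.
by rewrite -scalemxAl mxtraceZ mxtrace_outer.
Qed.

Hypothesis tight : dc_out G x = #|nt|.

(** The coefficients [biinv_fun] already reach the bound [dc_out], so no further independent
    function fits. *)
Lemma biinv_span (h : gT -> F) :
  (forall y z g, y \in P -> z \in P -> g \in G -> h (y * g * z)%g = h g) ->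
  (forall n, n \in N -> h n = 0) ->
  exists c : I -> F, forall g, g \in G -> h g = \sum_(i | nt i) c i * biinv_fun i g.
Proof.
move=> hP hN; apply: NNPP => nex.
pose J : finType := {i | nt i}.
pose H (k : option J) g := if g \in G then if k is Some i then biinv_fun (val i) g else h g else 0.
suff : (#|{: option J}| <= #|dcs <[x]>%G (G :\: N)|)%N.
  by rewrite -/(dc_out G x) tight card_option card_sig ltnn.
apply: (@biinv_bound F gT G <[x]>%G _ H) => [|k g y z Gg Py Pz|k g|c c0]; first exact: subsetDl.
- have [Gy Gz] := (subsetP sPG y Py, subsetP sPG z Pz).
  by rewrite /H !groupM // Gg; case: k => [k|]; [rewrite biinv_fun_P ?(valP k)|rewrite hP].
- case/setDP=> Gg nD; have Ng : g \in N by apply: contraNT nD => nN; rewrite inE nN.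
  by rewrite /H Gg; case: k => [k|]; [rewrite biinv_fun_N ?(valP k)|rewrite hN].
have sumE g : g \in G -> \sum_k c k * H k g = c None * h g + \sum_(i : J) c (Some i) * biinv_fun (val i) g.
  move=> Gg; rewrite (bigD1 None) //= (reindex_omap Some id) /=; last by case.
  rewrite /H Gg; congr (_ + _); apply: eq_big => [k|k _ //]; by rewrite eqxx.
pose d i := if insub i is Some j then c (Some j) else 0.
have sumJ g : \sum_(i : J) c (Some i) * biinv_fun (val i) g = \sum_(i | nt i) d i * biinv_fun i g.
  rewrite [RHS](reindex_omap (val : J -> I) insub) /=; last first.
    by move=> i nti; rewrite insubT.
  rewrite [RHS](eq_bigl xpredT); last by move=> j; rewrite valK (valP j) eqxx.
  by apply: eq_bigr => j _; rewrite /d valK.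
have cN : c None = 0.
  apply/eqP; apply/negPn/negP=> nz; case: nex; exists (fun i => - (c None)^-1 * d i) => g Gg.
  apply: (mulfI nz); have := c0 g Gg; rewrite sumE // sumJ => /eqP; rewrite addr_eq0 => /eqP ->.
  rewrite -mulrN1 mulrC !mulr_sumr; apply: eq_bigr => i _.
  by rewrite !mulrA mulrN divff // mulN1r.
case=> [k|//]; have dk : d (val k) = c (Some k) by rewrite /d valK.
rewrite -dk; apply: biinv_fun_ind (valP k) => g Gg.
by rewrite -sumJ -[RHS](c0 g Gg) sumE // cN mul0r add0r.
Qed.

(** Comparing h(n g) with lam(n) h(g) in independent coefficients kills every term whose weight
    differs from [lam]. *)
Lemma span_weight (lam : gT -> F) (h : gT -> F) (c : I -> F) :
  (forall g, g \in G -> h g = \sum_(i | nt i) c i * biinv_fun i g) ->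
  (forall n g, n \in N -> g \in G -> h (n * g)%g = lam n * h g) ->
  forall i, nt i -> c i != 0 -> forall n, n \in N -> la i n = lam n.
Proof.
move=> hE hl i nti nzc n Nn.
have /(_ i nti) : forall i, nt i -> c i * (la i n - lam n) = 0.
  apply: biinv_fun_ind => g Gg; have Gn := subsetP sNG n Nn; have := hl n g Nn Gg.
  rewrite (hE _ (groupM Gn Gg)) (hE _ Gg) mulr_sumr => /eqP.
  rewrite -subr_eq0 -sumrB => /eqP e; rewrite -[RHS]e; apply: eq_bigr => j ntj.
  by rewrite biinv_fun_l //; ring.
by move/eqP; rewrite mulf_eq0 (negPf nzc) subr_eq0 => /eqP.
Qed.

Lemma span_weight_r (mu : gT -> F) (h : gT -> F) (c : I -> F) :
  (forall g, g \in G -> h g = \sum_(i | nt i) c i * biinv_fun i g) ->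
  (forall n g, n \in N -> g \in G -> h (g * n)%g = mu n * h g) ->
  forall i, nt i -> c i != 0 -> forall n, n \in N -> rho i n = mu n.
Proof.
move=> hE hr i nti nzc n Nn.
have /(_ i nti) : forall i, nt i -> c i * (rho i n - mu n) = 0.
  apply: biinv_fun_ind => g Gg; have Gn := subsetP sNG n Nn; have := hr n g Nn Gg.
  rewrite (hE _ (groupM Gg Gn)) (hE _ Gg) mulr_sumr => /eqP.
  rewrite -subr_eq0 -sumrB => /eqP e; rewrite -[RHS]e; apply: eq_bigr => j ntj.
  by rewrite biinv_fun_r //; ring.
by move/eqP; rewrite mulf_eq0 (negPf nzc) subr_eq0 => /eqP.
Qed.

Lemma weight_power i k : nt i -> (0 < k)%N -> (forall n, n \in N -> la i n ^+ k = 1) ->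
  (p.-1 <= k * D i)%N.
Proof.
move=> nti k0 lak; rewrite leqNgt; apply/negP=> small.
have [/andP[D0 _] dimE uD uD1 [nzv _ _]] := core nti.
have sub := eigen_power p_pr sylP charF (fun n => laP nti (n := n)) uD1 lak k0 small.
have := line_module_irr (mx_abs_irrW (irep_abs (phi i))) nzv sub.
by rewrite dimE; case: (D i) D0.
Qed.

Lemma dual_pow i k : (dual_repr (phi i) x - 1) ^+ k = ((phi i x^-1%g - 1) ^+ k)^T.
Proof.
have e : dual_repr (phi i) x - 1 = (phi i x^-1%g - 1)^T.
  by rewrite linearB /= trmx1 /dual_mx.
rewrite e; elim: k => [|k IHk]; first by rewrite !expr0 trmx1.
by rewrite exprS IHk exprSr -[_^T * _^T]/(_^T *m _^T) -trmx_mul.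
Qed.

Lemma dual_nil i : nt i -> (dual_repr (phi i) x - 1) ^+ (D i).+1 = 0.
Proof.
move=> nti; have [_ _ uD uD1 _] := core nti; rewrite dual_pow.
have e : phi i x^-1%g - 1 = - (phi i x^-1%g *m u i).
  by rewrite /u mulmxBr -repr_mxM ?groupV // mulVg repr_mx1 [X in _ = - (_ - X)]mulmx1 opprB.
have c : GRing.comm (phi i x^-1%g : 'M_(idim (phi i))) (u i).
  rewrite /GRing.comm /u -[LHS]/(_ *m _) -[RHS]/(_ *m _) mulmxBr mulmxBl -!repr_mxM ?groupV //.
  by rewrite mulVg mulgV [X in _ - X]mulmx1 [X in _ = _ - X]mul1mx.
have -> : phi i x^-1%g - 1 = - ((phi i x^-1%g : 'M_(idim (phi i))) * u i) by exact: e.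
by rewrite exprNn exprMn_comm // uD1 mulr0 mulr0 trmx0.
Qed.

Lemma weight_power_r i k : nt i -> (0 < k)%N -> (forall n, n \in N -> rho i n ^+ k = 1) ->
  (p.-1 <= k * D i)%N.
Proof.
move=> nti k0 rhok; rewrite leqNgt; apply/negP=> small.
have [/andP[D0 _] dimE uD uD1 [_ nzxi _]] := core nti.
have nzt : (xi i)^T != 0 by apply: contraNneq nzxi => e; rewrite -(trmxK (xi i)) e trmx0.
have xiN n : n \in N -> (xi i)^T *m dual_repr (phi i) n = rho i n^-1%g *: (xi i)^T.
  by move=> Nn; rewrite /= /dual_mx -trmx_mul rhoP ?groupV // linearZ.
have rk n : n \in N -> rho i n^-1%g ^+ k = 1 by move=> Nn; apply: rhok; rewrite groupV.
have sub := eigen_power p_pr sylP charF xiN (dual_nil nti) rk k0 small.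
have modv g : g \in G -> ((xi i)^T *m (phi i g)^T <= (xi i)^T)%MS.
  by move=> Gg; have := sub g^-1%g; rewrite groupV /= /dual_mx invgK; apply.
have colG g : g \in G -> exists a, phi i g *m xi i = a *: xi i.
  move=> Gg; have := modv g Gg; rewrite -trmx_mul => /sub_rVP[a e].
  by exists a; apply: trmx_inj; rewrite e linearZ.
(* The column [xi i] is stable up to scalars and v xi = 0; as the representation spans all matrices,
   every v B xi vanishes. *)
have all0 (B : 'M_(idim (phi i))) : v i *m B *m xi i = 0.
  have [c ->] := abs_irr_span B (irep_abs (phi i)).
  rewrite mulmx_sumr mulmx_suml big1 // => g Gg; have [a e] := colG g Gg.
  by rewrite -scalemxAr -scalemxAl -mulmxA e -scalemxAr vxi // !scaler0.
have [_ _ _ _ [nzv _ _]] := core nti.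
by have /eqP := mulmx_all_eq0 all0 nzxi; rewrite (negPf nzv).
Qed.

Let r := (#|G : N|%g %/ p)%N.

Definition weight_reps (lam : gT -> F) : pred I := [pred i | nt i && [forall n in N, la i n == lam n]].

Lemma weight_repsP lam i : reflect (nt i /\ forall n, n \in N -> la i n = lam n) (weight_reps lam i).
Proof.
apply: (iffP andP) => [[nti /forall_inP h]|[nti h]]; first by split=> // n /h/eqP.
by split=> //; apply/forall_inP => n /h->.
Qed.

Section Weight.
Variable lam : gT -> F.
Hypothesis lamM : forall n m, n \in N -> m \in N -> lam (n * m)%g = lam n * lam m.
Hypothesis lamP : forall y, y \in P -> lam y = 1.

Lemma lam_neq0 n : n \in N -> lam n != 0.
Proof.
move=> Nn; apply/eqP=> c0; have := lamM Nn (groupVr Nn).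
by rewrite mulgV lamP ?group1 // c0 mul0r => /eqP; rewrite oner_eq0.
Qed.

(** The indicator of P g P spread over the cosets of [P] in [N] so as to have left weight [lam]; the
    support lies in N g P. *)
Let hh (g z : gT) : F := \sum_(c < nrc N <[x]>%G) (lam (rrep c))^-1 * ((rrep c * z)%g \in dc <[x]>%G g)%:R.

Lemma dc_inv g y z w : y \in P -> w \in P -> ((y * z * w)%g \in dc <[x]>%G g) = (z \in dc <[x]>%G g).
Proof.
move=> Py Pw; apply/idP/idP=> h; rewrite -(dc_eq h); last by rewrite -(dc_mul z Py Pw) dc_refl.
by have := dc_refl <[x]>%G (y^-1 * (y * z * w) * w^-1)%g; rewrite dc_mul ?groupV // !mulgA mulVg mul1g mulgK.
Qed.

Lemma rrepN (c : 'I_(nrc N <[x]>%G)) : rrep c \in N.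
Proof. exact: rrep_in. Qed.

Lemma hh_l g m z : m \in N -> hh g (m * z)%g = lam m * hh g z.
Proof.
move=> Nm; pose Psi k := (lam (k * m^-1)%g)^-1 * ((k * z)%g \in dc <[x]>%G g)%:R.
have PsiP y k : y \in <[x]>%G -> k \in N -> Psi (y * k)%g = Psi k.
  move=> Py Nk; have Ny := subsetP sPN y Py.
  rewrite /Psi -!mulgA lamM ?groupM ?groupV // lamP // mul1r; congr (_ * _%:R).
  by have := dc_inv g (k * z)%g Py (group1 <[x]>%G); rewrite mulg1 => ->.
have := coset_sum_shift sPN PsiP Nm.
rewrite (eq_bigr (fun c : 'I_(nrc N <[x]>%G) => (lam (rrep c))^-1 * ((rrep c * (m * z))%g \in dc <[x]>%G g)%:R)).
  rewrite -/(hh g (m * z)%g) => ->; rewrite /hh mulr_sumr; apply: eq_bigr => c _.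
  rewrite /Psi lamM ?groupV ?rrepN // invfM mulrA; congr (_ * _); rewrite mulrC; congr (_ * _).
  apply: (mulfI (lam_neq0 (groupVr Nm))); rewrite divff ?lam_neq0 ?groupV //.
  by rewrite -lamM ?groupV // mulVg lamP ?group1.
by move=> c _; rewrite /Psi mulgK mulgA.
Qed.

Lemma hh_r g z y : y \in P -> hh g (z * y)%g = hh g z.
Proof.
move=> Py; apply: eq_bigr => c _; congr (_ * _%:R).
by have := dc_inv g (rrep c * z)%g (group1 <[x]>%G) Py; rewrite mul1g mulgA => ->.
Qed.

Lemma hh_supp g z : hh g z != 0 -> z \in ndc N <[x]>%G g.
Proof.
move=> nz; apply/negPn/negP=> nin; case/eqP: nz; apply: big1 => c _.
case: (boolP (_ \in dc _ _)) => [/mem_dcP[y [y' [Py Py' e]]]|_]; last by rewrite mulr0.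
case/negP: nin; apply/ndcP; exists ((rrep c)^-1 * y)%g, y'.
by rewrite groupM ?groupV ?rrepN ?(subsetP sPN) // -!mulgA (mulgA y) -e mulgA mulVg mul1g.
Qed.

Lemma hh_diag g : g \in G :\: N -> hh g g = 1.
Proof.
case/setDP=> Gg nNg; pose c1 := crank N <[x]>%G 1; have := crankP <[x]>%G (group1 N).
rewrite mul1g groupV -/c1 => Pc1; rewrite /hh (bigD1 c1) //= lamP // invr1 mul1r.
have -> : (rrep c1 * g)%g \in dc <[x]>%G g.
  by rewrite -(mulg1 (_ * g)%g) dc_inv ?group1 // dc_refl.
rewrite big1 ?addr0 // => c nc; case: (boolP (_ \in dc _ _)) => [/mem_dcP[y [y' [Py Py' e]]]|_]; last by rewrite mulr0.
have e2 : (g * y' * g^-1 = y^-1 * rrep c)%g.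
  by rewrite (canRL (mulgK g) e) !mulgA mulVg mul1g.
have Nyc : (g * y' * g^-1)%g \in N by rewrite e2 groupM ?groupV ?rrepN ?(subsetP sPN).
have [y'1|ny'] := eqVneq y' 1%g; last by case/negP: nNg; apply: (norm_of_conj p_pr sylP Gg Py' ny').
move: e2; rewrite y'1 mulg1 mulgV => /esym/(canRL (mulKVg _)); rewrite mulg1 => rc.
case/eqP: nc; rewrite -(crank_rrep sPN c) /c1; apply/eqP; rewrite crank_eqP ?group1 ?rrepN //.
by rewrite invg1 mulg1 rc.
Qed.

(** The functions [hh] attached to distinct double cosets N g P outside [N] have disjoint supports
    and lie in the span of coefficients of weight [lam]. Comparing sizes, there are at least r such
    double cosets. *)
Lemma card_weight : (r <= #|weight_reps lam|)%N.
Proof.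
pose DD := ndcs G N <[x]>%G; pose K : finType := {d | d \in DD}.
have rK : (r <= #|{: K}|)%N.
  rewrite card_sig; have := ndcs_count <[x]>%G sNG; rewrite -/DD.
  have h4 := Lagrange sNG; rewrite -h4 (index_norm_eq p_pr sylP) -/p -/N -/r.
  have N0 : (0 < #|N|)%N := cardG_gt0 _; have p0 : (0 < p)%N := prime_gt0 p_pr.
  have key m : (#|N| * (r * p).+1 - #|N| <= m * (#|N| * p))%N -> (r <= m)%N.
    rewrite mulnS addKn mulnA [(m * _)%N]mulnA leq_pmul2r // mulnC leq_pmul2r //.
  exact: key.
have DP (d : K) : repr (val d) \in G :\: N /\ ndc N <[x]>%G (repr (val d)) = val d.
  exact: ndcs_repr sPN sNG _ (valP d).
pose h (d : K) := hh (repr (val d)).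
have hc (d : K) : exists c : I -> F, forall g, g \in G -> h d g = \sum_(i | nt i) c i * biinv_fun i g.
  have [/setDP[Gd nNd] _] := DP d.
  apply: biinv_span => [y z g Py Pz Gg|n Nn].
    by rewrite /h hh_r // hh_l ?(subsetP sPN) // lamP // mul1r.
  apply/eqP; apply: contraNT nNd => /hh_supp/ndc_sym/ndcP[m [y [Nm Py ->]]].
  by rewrite !groupM // (subsetP sPN).
have [c cE] := fin_all_exists hc.
have cw (d : K) i : nt i -> c d i != 0 -> weight_reps lam i.
  move=> nti nz; apply/weight_repsP; split=> //.
  apply: (span_weight (cE d) _ nti nz) => n g Nn Gg.
  by rewrite /h hh_l.
pose L : finType := {i | weight_reps lam i}.
apply: leq_trans rK _; have -> : #|weight_reps lam| = #|{: L}| by rewrite card_sig.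
apply: (@indep_card F K L (fun d i => c d (val i))) => b b0 d.
have b0' i : nt i -> \sum_d b d * c d i = 0.
  move=> nti; have [wi|nwi] := boolP (weight_reps lam i); first exact: (b0 (Sub i wi)).
  by rewrite big1 // => e _; have [->|/(cw e i nti)] := eqVneq (c e i) 0; rewrite ?mulr0 // (negPf nwi).
have [Dd _] := DP d; have Gd : repr (val d) \in G by case/setDP: Dd.
have : \sum_e b e * h e (repr (val d)) = 0.
  rewrite (eq_bigr (fun e => \sum_(i | nt i) b e * c e i * biinv_fun i (repr (val d)))).
    rewrite exchange_big big1 // => i nti; rewrite -mulr_suml b0' // mul0r //.
  by move=> e _; rewrite cE // mulr_sumr; apply: eq_bigr => i _; rewrite mulrA.
rewrite (bigD1 d) //= /h hh_diag // mulr1 big1 ?addr0 // => e ned.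
have [->|/hh_supp/ndc_eq] := eqVneq (hh (repr (val e)) (repr (val d))) 0; first by rewrite mulr0.
rewrite (DP d).2 (DP e).2 => /val_inj ed; by rewrite ed eqxx in ned.
Qed.

(** The matrix intertwining [phi i] with the module induced from the weight of [v i]. *)
Definition coset_rows i : 'M[F]_(nrc G N, idim (phi i)) := \matrix_(c < nrc G N) (v i *m phi i (rrep c)).

Lemma coset_rows_col i (w : 'cV_(idim (phi i))) c : (coset_rows i *m w) c 0 = (v i *m phi i (rrep c) *m w) 0 0.
Proof. by rewrite mxE [RHS]mxE; apply: eq_bigr => j _; rewrite mxE. Qed.

Lemma lam_monM : {in N &, {morph lam : y z / (y * z)%g >-> y * z}}.
Proof. by move=> y z; apply: lamM. Qed.

Let rm := mon_repr sNG (lamP (group1 <[x]>%G)) lam_monM.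

Lemma coset_rows_mon i h : weight_reps lam i -> h \in G -> coset_rows i *m phi i h = rm h *m coset_rows i.
Proof.
case/weight_repsP=> nti law Gh; apply/row_matrixP=> c; rewrite !row_mul rowK.
have Gc : rrep c \in G by exact: rrep_in.
pose d := crank G N (rrep c * h)%g; have Nd := crankP N (groupM Gc Gh).
rewrite [row c (rm h) *m _]mulmx_sum_row (bigD1 d) //= big1 ?addr0 => [|e ne]; last first.
  rewrite !mxE; case: ifP => [Ne|]; last by rewrite scale0r.
  by case/eqP: ne; apply: rrep_uniq Ne Nd.
rewrite !mxE Nd rowK -law // -[in LHS]mulmxA -repr_mxM // -[in LHS](mulgKV (rrep d) (rrep c * h)%g).
rewrite repr_mxM ?(subsetP sNG _ Nd) ?rrep_in // mulmxA.
by rewrite (laP nti Nd) -scalemxAl.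
Qed.

Lemma coset_rows_indep (A : pred I) (w : forall i, 'cV[F]_(idim (phi i))) : {subset A <= weight_reps lam} ->
  \sum_(i | A i) coset_rows i *m w i = 0 -> forall i, A i -> w i = 0.
Proof.
move=> sA w0 i Ai; have [nti _] := weight_repsP _ _ (sA i Ai).
pose B j := if A j then w j *m v j else 0.
suff /(_ i) : forall j, B j = 0.
  rewrite /B Ai => /eqP e; have [_ _ _ _ [nzv _ _]] := core nti.
  by apply/eqP; apply/negPn/negP=> /outer_neq0/(_ nzv); rewrite e.
apply: (coef_indep inj) => g Gg.
transitivity (\sum_(j | A j) (v j *m phi j g *m w j) 0 0).
  rewrite [RHS]big_mkcond; apply: eq_bigr => j _; rewrite /B; case: ifP => _; last by rewrite mul0mx raddf0.
  by rewrite mxtrace_outer.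
pose c := crank G N g; have Nc := crankP N Gg.
have e j : A j -> (v j *m phi j g *m w j) 0 0 = lam (g * (rrep c)^-1)%g * (coset_rows j *m w j) c 0.
  move=> Aj; have [ntj law] := weight_repsP _ _ (sA j Aj).
  rewrite coset_rows_col -{1}(mulgKV (rrep c) g) repr_mxM ?(subsetP sNG _ Nc) ?rrep_in // mulmxA.
  by rewrite laP // law // -!scalemxAl mxE.
rewrite (eq_bigr _ e) -mulr_sumr; have /matrixP/(_ c 0) := w0; rewrite summxE !mxE => ->.
by rewrite mulr0.
Qed.

(** Transposes turn column spaces into row spaces. Independence of coefficients makes the sum direct
    and each matrix of full column rank. *)
Lemma coset_rows_rank (A : pred I) : {subset A <= weight_reps lam} ->
  \rank (\sum_(i | A i) <<(coset_rows i)^T>>)%MS = (\sum_(i | A i) idim (phi i))%N.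
Proof.
move=> sA; have dir : mxdirect (\sum_(i | A i) <<(coset_rows i)^T>>)%MS.
  apply/mxdirect_sumsP=> i Ai; apply/eqP; rewrite -submx0; apply/row_subP=> k.
  have := row_sub k (<<(coset_rows i)^T>> :&: \sum_(j | A j && (j != i)) <<(coset_rows j)^T>>)%MS.
  rewrite sub_capmx genmxE => /andP[/submxP[w wE] /sub_sumsmxP[w' w'E]].
  have [t tE] : exists t : forall j, 'rV[F]_(idim (phi j)), forall j, w' j *m <<(coset_rows j)^T>>%MS = t j *m (coset_rows j)^T.
    apply: (@fin_all_exists I (fun j => 'rV[F]_(idim (phi j))) (fun j t => w' j *m <<(coset_rows j)^T>>%MS = t *m (coset_rows j)^T)) => j.
    by apply/submxP; rewrite -(genmxE (coset_rows j)^T) submxMl.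
  pose W := dfwith (fun j => - (t j)^T) w^T.
  have W0 := @coset_rows_indep A W sA.
  have wi : w = 0.
    apply: trmx_inj; rewrite trmx0 -(dfwith_in (fun j => - (t j)^T) w^T); apply: W0 (Ai).
    rewrite (bigD1 i) //= /W dfwith_in; apply: trmx_inj; rewrite trmx0 linearD /= trmx_mul trmxK -wE.
    rewrite w'E linear_sum /= -big_split big1 //= => j /andP[_ nji].
    by rewrite dfwith_out 1?eq_sym // mulmxN linearN /= trmx_mul trmxK tE subrr.
  by rewrite wE wi mul0mx sub0mx.
rewrite (mxdirectP dir) /=; apply: eq_bigr => i Ai; rewrite genmxE; apply/eqP; apply: inj_row_free => w w0.
pose W := dfwith (fun j => 0 : 'cV[F]_(idim (phi j))) w^T.
apply: trmx_inj; rewrite trmx0 -(dfwith_in (fun j => 0 : 'cV[F]_(idim (phi j))) w^T).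
apply: (@coset_rows_indep A W sA _ i Ai).
rewrite (bigD1 i) //= /W dfwith_in big1 ?addr0 => [|j /andP[_ nji]].
  by apply: trmx_inj; rewrite trmx0 trmx_mul trmxK.
by rewrite dfwith_out 1?eq_sym // mulmx0.
Qed.
End Weight.

Lemma coset_rows_prod i j (w1 : 'cV_(idim (phi i))) (w2 : 'cV_(idim (phi j))) :
  (w1^T *m (coset_rows i)^T *m coset_rows j *m w2) 0 0 =
  \sum_(c < nrc G N) (v i *m phi i (rrep c) *m w1) 0 0 * (v j *m phi j (rrep c) *m w2) 0 0.
Proof.
by rewrite -trmx_mul -mulmxA mxE; apply: eq_bigr => c _; rewrite mxE !coset_rows_col.
Qed.

(** For inverse weights the product of two coefficients is left N-invariant. Along an orbit of [x]
    the factor with the fixed column [xi j] is constant and the other has degree below p - 1, so the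
    coset sum is the value at 1, which contains v xi = 0. *)
Lemma coset_rows_orth lam mu i j : (forall n, n \in N -> lam n * mu n = 1) -> weight_reps lam i -> weight_reps mu j ->
  ((D i).+1 < p)%N -> (coset_rows i)^T *m coset_rows j = 0.
Proof.
move=> lm /weight_repsP[nti lai] /weight_repsP[ntj laj] Dp; have [_ _ uD uD1 [nzv nzxi _]] := core nti.
have [_ _ _ _ [_ nzxj _]] := core ntj.
suff key h (w1 : 'cV_(idim (phi i))) : h \in G -> (w1^T *m (coset_rows i)^T *m coset_rows j *m (phi j h *m xi j)) 0 0 = 0.
  apply: (mulmx_all_eq0 _ nzxj) => B; have [c ->] := abs_irr_span B (irep_abs (phi j)).
  rewrite mulmx_sumr mulmx_suml big1 // => h Gh; rewrite -scalemxAr -scalemxAl.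
  apply/matrixP=> a b; rewrite [RHS]mxE !ord1 mxE; apply/eqP; rewrite mulf_eq0; apply/orP; right.
  have := key h (delta_mx a 0) Gh; rewrite trmx_delta -!mulmxA -rowE mxE => e.
  by rewrite e.
move=> Gh; pose Psi g := (v i *m phi i (g * h^-1)%g *m w1) 0 0 * (v j *m phi j g *m xi j) 0 0.
have PsiN n g : n \in N -> g \in G -> Psi (n * g)%g = Psi g.
  move=> Nn Gg; have Gn := subsetP sNG n Nn.
  rewrite /Psi -mulgA (repr_mxM _ Gn (groupM Gg (groupVr Gh))) (repr_mxM _ Gn Gg) !mulmxA (laP nti Nn) (laP ntj Nn).
  by rewrite -!scalemxAl mxE [X in _ * X]mxE lai // laj // mulrACA lm // mul1r.
rewrite coset_rows_prod; transitivity (\sum_(c < nrc G N) Psi (rrep c * h)%g).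
  apply: eq_bigr => c _; rewrite /Psi mulgK repr_mxM ?rrep_in //; congr (_ * _).
  by rewrite !mulmxA.
rewrite (coset_sum_shift sNG PsiN Gh) (coset_orbit_sum p_pr sylP PsiN) => [|g /setDP[Gg _]].
  by rewrite /Psi repr_mx1 mulmx1 (vxi ntj) [X in _ * X]mxE mulr0.
have e (a : 'I_p) : Psi (g * x ^+ a)%g =
    (v j *m phi j g *m xi j) 0 0 * ((v i *m phi i g) *m phi i (x ^+ a)%g *m (phi i h^-1%g *m w1)) 0 0.
  have Gxa : (x ^+ a)%g \in G by rewrite groupX.
  rewrite /Psi mulrC -mulgA (repr_mxM _ Gg (groupM Gxa (groupVr Gh))) (repr_mxM _ Gxa (groupVr Gh)) !mulmxA.
  by rewrite (repr_mxM _ Gg Gxa) mulmxA -(mulmxA _ (phi j (x ^+ a)%g)) xiP ?mem_cycle.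
rewrite (eq_bigr _ (fun a _ => e a)) -mulr_sumr.
have Dp' : (D i < p)%N by exact: ltnW.
by rewrite (polyfun_sum0 charF (polyfun_repr sylP charF _ _ _ _ uD1 Dp') Dp) mulr0.
Qed.

Lemma rank_sum_le lam mu (A B : pred I) :
  (forall n m, n \in N -> m \in N -> lam (n * m)%g = lam n * lam m) ->
  (forall y, y \in P -> lam y = 1) ->
  (forall n m, n \in N -> m \in N -> mu (n * m)%g = mu n * mu m) ->
  (forall y, y \in P -> mu y = 1) ->
  {subset A <= weight_reps lam} -> {subset B <= weight_reps mu} ->
  (forall i j, A i -> B j -> (coset_rows j)^T *m coset_rows i = 0) ->
  (\sum_(i | A i) idim (phi i) + \sum_(j | B j) idim (phi j) <= (r * p).+1)%N.
Proof.
move=> lM lP mM mP sA sB KK; rewrite -(coset_rows_rank sA) -(coset_rows_rank sB) -(index_norm_eq p_pr sylP).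
rewrite -[X in (_ + X)%N]mxrank_tr; apply: mulmx0_rank_max; apply/sub_kermxP/sumsmx_subP=> i Ai.
rewrite genmxE; apply/sub_kermxP/trmx_inj; rewrite trmx0 trmx_mul !trmxK; apply/sub_kermxP/sumsmx_subP=> j Bj.
by rewrite genmxE; apply/sub_kermxP/KK.
Qed.

Hypothesis perfG : (G^`(1))%g = G.
Hypothesis r_gt0 : (0 < r)%N.

(** The scalars on a stable line are multiplicative, hence trivial on commutators. *)
Lemma perfect_stab n (rG : mx_representation F G n) (z : 'rV_n) :
  z != 0 -> (forall g, g \in G -> exists a, z *m rG g = a *: z) -> forall g, g \in G -> z *m rG g = z.
Proof.
move=> nzz zG; suff /subsetP sub : (G \subset rstab rG z)%g by move=> g /sub/rstab_act; apply.
rewrite -perfG gen_subG; apply/subsetP=> _ /imset2P[a b Ga Gb ->]; rewrite inE groupR //=.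
have [al zal] := zG a Ga; have [be zbe] := zG b Gb.
have inv c ga : c \in G -> z *m rG c = ga *: z -> ga != 0 /\ z *m rG c^-1%g = ga^-1 *: z.
  move=> Gc zc; have e : z = ga *: (z *m rG c^-1%g).
    by rewrite -[LHS](repr_mxK rG Gc) zc -scalemxAl.
  have nz : ga != 0 by apply: contraNneq nzz => g0; rewrite e g0 scale0r.
  by split=> //; rewrite {2}e scalerA mulVf // scale1r.
have [nza zaV] := inv a al Ga zal; have [nzb zbV] := inv b be Gb zbe.
rewrite commgEl conjgE !repr_mxM ?groupM ?groupV // !mulmxA zaV -!scalemxAl zbV -!scalemxAl zal.
by rewrite -!scalemxAl zbe !scalerA -mulrA mulrACA !mulVf // mulr1 scale1r.
Qed.

(* Otherwise the matrices [coset_rows] of the weights [lam] and [1 / lam] are orthogonal to each other,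
   and their ranks add up to more than [#|G : N|] allows. *)
Lemma small_weight_rep lam :
  (forall n m, n \in N -> m \in N -> lam (n * m)%g = lam n * lam m) ->
  (forall y, y \in P -> lam y = 1) -> (exists2 n, n \in N & lam n != 1) ->
  exists i, [/\ nt i, (2 * D i <= p.-1)%N
    & (forall n, n \in N -> la i n = lam n) \/ (forall n, n \in N -> la i n = (lam n)^-1)].
Proof.
move=> lM lP [n0 Nn0 lam_n0]; apply: NNPP => nex.
pose mu n := (lam n)^-1.
have mM n m : n \in N -> m \in N -> mu (n * m)%g = mu n * mu m.
  by move=> Nn Nm; rewrite /mu lM // invfM.
have mP y : y \in P -> mu y = 1 by move=> Py; rewrite /mu lP // invr1.
have lmu n : n \in N -> lam n * mu n = 1 by move=> Nn; rewrite /mu divff // (lam_neq0 lM lP).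
have mul n : n \in N -> mu n * lam n = 1 by move=> Nn; rewrite mulrC lmu.
have bigl i : weight_reps lam i -> (p < 2 * D i)%N.
  case/weight_repsP=> nti lai; have : ~~ (2 * D i <= p.-1)%N by apply/negP=> h; case: nex; exists i; split=> //; left.
  exact: odd_double_gt.
have bigm i : weight_reps mu i -> (p < 2 * D i)%N.
  case/weight_repsP=> nti lai; have : ~~ (2 * D i <= p.-1)%N by apply/negP=> h; case: nex; exists i; split=> //; right.
  exact: odd_double_gt.
(* All dimensions D i + 1 in question are now at least (p + 3)/2; those failing [sm] equal p. *)
pose sm i := ((D i).+1 < p)%N.
pose A' := [pred i | weight_reps lam i && sm i]; pose B' := [pred i | weight_reps mu i && sm i].
have sA' : {subset A' <= weight_reps lam} by move=> i /andP[].
have sB' : {subset B' <= weight_reps mu} by move=> i /andP[].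
have sub0 (A : pred I) : {subset A <= A} by [].
have e1 := rank_sum_le lM lP mM mP sA' (sub0 (weight_reps mu)) _.
have e2 := rank_sum_le lM lP mM mP (sub0 (weight_reps lam)) sB' _.
have {}e1 : (\sum_(i | A' i) idim (phi i) + \sum_(j | weight_reps mu j) idim (phi j) <= (r * p).+1)%N.
  apply: e1 => i j /andP[Ai smi] Bj; apply: trmx_inj; rewrite trmx_mul trmxK trmx0.
  exact: coset_rows_orth lmu Ai Bj smi.
have {}e2 : (\sum_(i | weight_reps lam i) idim (phi i) + \sum_(j | B' j) idim (phi j) <= (r * p).+1)%N.
  by apply: e2 => i j Ai /andP[Bj smj]; apply: coset_rows_orth mul Bj Ai smj.
have cl := card_weight lM lP; have cm := card_weight mM mP.
have split_sum (nu : gT -> F) : (\sum_(i | weight_reps nu i) idim (phi i) =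
    \sum_(i | weight_reps nu i && sm i) idim (phi i) + (#|weight_reps nu| - #|[pred i | weight_reps nu i && sm i]|) * p)%N.
  rewrite (bigID sm) /=; congr (_ + _)%N.
  rewrite (eq_bigr (fun=> p)) => [|i /andP[/weight_repsP[nti _] nsm]].
    rewrite sum_nat_const; congr (_ * _)%N; rewrite -(cardID sm (weight_reps nu)).
    have -> : #|[predI weight_reps nu & sm]| = #|[pred i | weight_reps nu i && sm i]| by apply: eq_card.
    by rewrite addKn; apply: eq_card => i; rewrite !inE andbC.
  have [/andP[_ Dp] dimE _ _ _] := core nti; apply/eqP; rewrite dimE eqn_leq Dp /=.
    by rewrite leqNgt.
have low (nu : gT -> F) : (forall i, weight_reps nu i -> p < 2 * D i)%N ->
    (#|[pred i | weight_reps nu i && sm i]| * (p + 3) <= 2 * \sum_(i | weight_reps nu i && sm i) idim (phi i))%N.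
  move=> big; rewrite -sum_nat_const big_distrr /=; apply: leq_sum => i /andP[Ii _].
  have [nti _] := weight_repsP _ _ Ii; have [_ dimE _ _ _] := core nti; rewrite dimE.
  exact: odd_double_ge3 (big i Ii).
have la1 := low lam bigl; have lb1 := low mu bigm.
have ca (nu : gT -> F) : (#|[pred i | weight_reps nu i && sm i]| <= #|weight_reps nu|)%N.
  by apply: subset_leq_card; apply/subsetP=> i /andP[].
have cal := ca lam; have cam := ca mu.
have sl := split_sum lam; have sm' := split_sum mu.
have p2 := prime_gt1 p_pr.
have noA : #|A'| = 0%N /\ #|B'| = 0%N.
  by rewrite sm' in e1; rewrite sl in e2; apply: weight_count e1 e2 cl cm la1 lb1 cal cam.
have [a0 b0] := noA; have /card0_eq A0 := a0.
have ra0 : (\sum_(i | weight_reps lam i && sm i) idim (phi i) = 0)%N by apply: big_pred0 => i; exact: (A0 i).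
have dimS : (\sum_(i | weight_reps lam i) idim (phi i) = r * p)%N.
  rewrite sl ra0 a0 add0n subn0; congr (_ * _)%N; apply/eqP; rewrite eqn_leq cl andbT.
  rewrite -ltnS -(ltn_pmul2r (prime_gt0 p_pr)).
  apply: mul_lt_succ p2 _.
  by apply: leq_trans e2; rewrite sl a0 subn0 -addnA addnCA leq_addr.
(* Weight [lam] takes up rank r p out of r p + 1; the orthogonal line is stable under [G], hence
   fixed pointwise. *)
pose S := (\sum_(i | weight_reps lam i) <<(coset_rows i)^T>>)%MS.
have rkS : \rank S = (r * p)%N by rewrite (coset_rows_rank (sub0 (weight_reps lam))).
have rkZ : \rank (kermx S^T) = 1%N.
  by rewrite mxrank_ker mxrank_tr rkS card_nrc (index_norm_eq p_pr sylP) subSnn.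
have kerP (z : 'rV_(nrc G N)) : (z <= kermx S^T)%MS <-> forall i, weight_reps lam i -> z *m coset_rows i = 0.
  split=> [/sub_kermxP zS i Ii|zK].
    have : (<<(coset_rows i)^T>> <= S)%MS by apply: (sumsmx_sup i).
    rewrite genmxE => /submxP[B BE]; apply: trmx_inj.
    by rewrite trmx_mul BE trmx0 -mulmxA -[S]trmxK -trmx_mul zS trmx0 mulmx0.
  apply/sub_kermxP/trmx_inj; rewrite trmx0 trmx_mul trmxK; apply/sub_kermxP/sumsmx_subP=> i Ii.
  by rewrite genmxE; apply/sub_kermxP; rewrite -trmx_mul zK ?trmx0.
have [z zK nzz] : exists2 z : 'rV_(nrc G N), (z <= kermx S^T)%MS & z != 0.
  by apply/rowV0Pn; rewrite -mxrank_eq0 rkZ.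
have lineZ (w : 'rV_(nrc G N)) : (w <= kermx S^T)%MS -> exists a, w = a *: z.
  move=> wK; apply/sub_rVP; apply: submx_trans wK _.
  by have := mxrank_leqif_sup zK; rewrite rkZ rank_rV nzz => -[_ <-].
have lM' : {in N &, {morph lam : y z / (y * z)%g >-> y * z}} by move=> y w; apply: lM.
pose rm := mon_repr sNG (lP _ (group1 <[x]>%G)) lM'.
have stab g : g \in G -> exists a, z *m rm g = a *: z.
  move=> Gg; apply: lineZ; apply/kerP=> i Ii; rewrite -mulmxA -(coset_rows_mon lM lP Ii Gg) mulmxA.
  by rewrite (kerP z).1 // mul0mx.
have fix_z := perfect_stab nzz stab.
case/eqP: nzz; apply/matrixP=> a d; rewrite !ord1 mxE {a}.
have Gd : rrep d \in G by apply: rrep_in.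
(* This conjugate of [n0] multiplies the coordinate [d] of every vector by [lam n0], so a fixed
   vector is 0. *)
have Gh : ((rrep d)^-1 * n0 * rrep d)%g \in G by rewrite !groupM ?groupV // (subsetP sNG).
have /matrixP/(_ 0 d) := fix_z _ Gh; rewrite mxE (bigD1 d) //= big1 ?addr0 => [|c ncd]; last first.
  rewrite mxE !mulgA mulgK; case: ifP => [Nc|]; last by rewrite mulr0.
  case/eqP: ncd; apply: (@rrep_uniq _ G N (rrep c)); first by rewrite mulgV group1.
  by move: Nc; rewrite groupMr.
rewrite mxE !mulgA mulgV mul1g mulgK Nn0 => /eqP.
rewrite -subr_eq0 -{2}[z 0 d]mulr1 -mulrBr mulf_eq0 subr_eq0 (negPf lam_n0) orbF => /eqP.
by [].
Qed.
Lemma natF_inj a b : a%:R = b%:R :> F -> a = b %[mod p].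
Proof.
wlog ab : a b / (a <= b)%N.
  by move=> W e; case/orP: (leq_total a b) => ab; [apply: W|apply/esym/W].
move=> e; apply/esym/eqP; rewrite eqn_mod_dvd // (dvdn_pcharf charF) natrB // e subrr //.
Qed.

Lemma cF_eq1 n : n \in N -> cF n = 1 -> n \in 'C(P)%g.
Proof.
move=> Nn cn; have e : cexp x n = 1 %[mod p] by apply: natF_inj; rewrite -/(cF n) cn.
have xn : (x ^ n)%g = x.
  by rewrite cexpP ?NP // -[RHS]expg1; apply/eqP; rewrite eq_expg_mod_order e.
by rewrite /P cent_cycle; apply/cent1P/esym/commgP; apply/conjg_fixP.
Qed.

Lemma cF_nontriv : exists2 n, n \in N & cF n != 1.
Proof.
have [n Nn nC] := perfect_norm_noncentral p_pr sylP perfG; exists n => //.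
by apply: contra nC => /eqP; apply: cF_eq1.
Qed.

Lemma half_p : (p.-1)./2.*2 = p.-1.
Proof. by rewrite even_halfK // -subn1 oddB ?prime_gt0 // p_odd. Qed.

(** Otherwise this power of [cF] is a character of order two, its own inverse. A small
    representation of that weight has D = (p - 1)/2 by [weight_power], whence rho = 1, and
    [weight_power_r] demands D >= p - 1. *)
Lemma conj_char_half n : n \in N -> cF n ^+ (p.-1)./2 = 1.
Proof.
move=> Nn; apply/eqP/negPn/negP=> nz; pose lam m := cF m ^+ (p.-1)./2.
have lM a b : a \in N -> b \in N -> lam (a * b)%g = lam a * lam b.
  by move=> Na Nb; rewrite /lam cFM // exprMn.
have lP y : y \in P -> lam y = 1 by move=> Py; rewrite /lam cF_P // expr1n.
have l2 m : m \in N -> lam m ^+ 2 = 1.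
  by move=> Nm; rewrite /lam -exprM muln2 half_p cFp.
have [i [nti D2 laE]] := small_weight_rep lM lP (ex_intro2 _ _ n Nn nz).
have {}laE m : m \in N -> la i m = lam m.
  move=> Nm; case: laE => ->//; apply: (mulfI (lam_neq0 lM lP Nm)).
  by rewrite divff ?(lam_neq0 lM lP) // -expr2 l2.
have e2 : (2 * D i)%N = p.-1.
  apply/eqP; rewrite eqn_leq D2 /=; apply: weight_power => // m Nm; rewrite laE //.
  exact: l2.
have Dh : D i = (p.-1)./2 by rewrite -e2 mul2n doubleK.
have := @weight_power_r i 1%N nti isT; rewrite mul1n => pD.
have {}pD : (p.-1 <= D i)%N.
  apply: pD => m Nm; rewrite expr1 /rho laE // Dh divff // ; exact: (lam_neq0 lM lP).
move: pD.
by rewrite -e2 leqNgt ltn_Pmull //; have [/andP[]] := core nti.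
Qed.

Lemma small_rep : exists2 i, nt i & (2 * D i <= p.-1)%N.
Proof.
have [n Nn nz] := cF_nontriv.
by have [i [nti D2 _]] := small_weight_rep cFM cF_P (ex_intro2 _ _ n Nn nz); exists i.
Qed.

(** rho = 1 forces D = p - 1; then la is the (p - 1)-th power of [cF], which is trivial while [cF]
    is not. *)
Lemma no_weight i : nt i -> (forall n, n \in N -> la i n = cF n) ->
  (forall n, n \in N -> rho i n = 1) -> False.
Proof.
move=> nti lac rho1; have := @weight_power_r i 1%N nti isT; rewrite mul1n => pD.
have {}pD : (p.-1 <= D i)%N by apply: pD => n Nn; rewrite rho1.
have [/andP[_ Dp] _ _ _ _] := core nti.
have Dpp : D i = p.-1 by apply/eqP; rewrite eqn_leq pD andbT -ltnS prednK ?prime_gt0.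
have [n Nn /eqP] := cF_nontriv; apply.
by rewrite -(lac n Nn) la_rho // rho1 // mulr1 Dpp cFp.
Qed.

(** * The conjugation module generated by log x *)

Section Adjoint.
Variable i : I.
Hypothesis nti : nt i.
Hypothesis D2 : (2 * D i <= p.-1)%N.
Variables (B : 'M[F]_((D i).+1, idim (phi i))) (B' : 'M[F]_(idim (phi i), (D i).+1)).
Hypotheses (BB' : B *m B' = 1%:M) (B'B : B' *m B = 1%:M) (Bx : B *m phi i x = pas (D i) 1 *m B).

Let Dp : (D i < p)%N. Proof. by have [/andP[]] := core nti. Qed.
Let D0 : (0 < D i)%N. Proof. by have [/andP[]] := core nti. Qed.

(** The logarithm of [x] in the representation, carried over from differentiation by the Pascal
    basis; the lock keeps tactics from unfolding it. *)
Definition y0 : 'M_(idim (phi i)) := locked (B' *m dmx F (D i) *m B).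

Lemma y0E : y0 = B' *m dmx F (D i) *m B.
Proof. by rewrite /y0 -lock. Qed.

Lemma By0 : B *m y0 *m B' = dmx F (D i).
Proof. by rewrite y0E !mulmxA BB' mul1mx -mulmxA BB' mulmx1. Qed.

Lemma Bxa a : B *m phi i (x ^+ a)%g *m B' = pas (D i) a%:R.
Proof.
rewrite -(pas_exp F (D i)); elim: a => [|a IHa].
  by rewrite expg0 repr_mx1 mulmx1 BB' expr0.
rewrite expgS repr_mxM ?groupX // mulmxA Bx -!mulmxA (mulmxA B) IHa.
by rewrite exprS.
Qed.

Lemma y0_x : y0 *m phi i x = phi i x *m y0.
Proof.
have xE : phi i x = B' *m pas (D i) 1 *m B by rewrite -mulmxA -Bx mulmxA B'B mul1mx.
rewrite xE y0E -!mulmxA (mulmxA B B') BB' mul1mx (mulmxA B B') BB' mul1mx !mulmxA.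
by rewrite -(mulmxA B' (pas _ 1)) pas_d mulmxA.
Qed.

Lemma y0_N n : n \in N -> phi i n^-1%g *m y0 *m phi i n = cF n *: y0.
Proof.
move=> Nn; have Gn := subsetP sNG n Nn.
have h a : (B *m phi i n^-1%g *m B') *m pas (D i) a%:R *m (B *m phi i n *m B') = pas (D i) (cexp x n * a)%:R.
  rewrite -!Bxa -!mulmxA (mulmxA B' B) B'B mul1mx (mulmxA B' B) B'B mul1mx !mulmxA.
  congr (_ *m _); rewrite -!mulmxA -!repr_mxM ?groupM ?groupV ?groupX //; congr (_ *m phi i _).
  by rewrite mulgA -[(_ * x ^+ a * n)%g]mulgA -conjgE conjXg cexpP ?NP // expgM.
have := log_conj charF Dp h; rewrite -/(cF n) -By0 => e.
rewrite -[y0]mul1mx -[y0]mulmx1 -B'B; have <- : B' *m (B *m y0 *m B') *m B = y0.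
  by rewrite !mulmxA B'B mul1mx -mulmxA B'B mulmx1.
move: e; rewrite -!mulmxA (mulmxA B' B) B'B mul1mx (mulmxA B' B) B'B mul1mx => e.
have := congr1 (fun M => B' *m M *m B) e; rewrite -scalemxAr -scalemxAl !mulmxA B'B !mul1mx.
by rewrite -!mulmxA !(mulmxA B' B) B'B ?mulmx1 ?mul1mx -?mulmxA ?B'B ?mulmx1.
Qed.

Lemma y0_neq0 : y0 != 0.
Proof.
apply: contraNneq (dmx_neq0 F D0) => e; by rewrite -By0 e mulmx0 mul0mx.
Qed.

(** As a function of [g] it is P-biinvariant, vanishes on [N], and has left weight [cF] and right
    weight 1, because D = (p - 1)/2 makes la = rho by [conj_char_half]. By [no_weight] no
    coefficient has these weights. *)
Lemma v_conj_xi g : (2 * D i)%N = p.-1 -> g \in G ->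
  (v i *m phi i g^-1%g *m y0 *m phi i g *m xi i) = 0.
Proof.
move=> eD Gg0; pose h g := (v i *m phi i g^-1%g *m y0 *m phi i g *m xi i) 0 0.
have hl n k : n \in N -> k \in G -> h (n * k)%g = cF n * h k.
  move=> Nn Gk; have Gn := subsetP sNG n Nn; rewrite /h invMg !repr_mxM ?groupV // !mulmxA.
  rewrite -[_ *m phi i n^-1%g *m y0]mulmxA -[_ *m phi i n]mulmxA y0_N // -scalemxAr.
  by rewrite -!scalemxAl mxE.
have hr n k : n \in N -> k \in G -> h (k * n)%g = 1 * h k.
  move=> Nn Gk; have Gn := subsetP sNG n Nn; rewrite /h invMg !repr_mxM ?groupV // !mulmxA.
  rewrite laP ?groupV // -!scalemxAl -[_ *m phi i n *m _]mulmxA rhoP // -scalemxAr scalerA mxE.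
  congr (_ * _).
  have e1 : la i n^-1%g * la i n = 1 by rewrite -laM ?groupV // mulVg la1.
  have Dh : D i = (p.-1)./2 by rewrite -eD mul2n doubleK.
  by rewrite /rho Dh conj_char_half // divr1.
have hP y z k : y \in P -> z \in P -> k \in G -> h (y * k * z)%g = h k.
  move=> Py Pz Gk; have [Gy Gz] := (subsetP sPG y Py, subsetP sPG z Pz).
  by rewrite hr ?(subsetP sPN) ?groupM // mul1r hl ?(subsetP sPN) // cF_P // mul1r.
have hN n : n \in N -> h n = 0.
  move=> Nn; rewrite -[n]mulg1 hl // /h invg1 repr_mx1 !mulmx1.
  suff [b ->] : exists b, v i *m y0 = b *: v i by rewrite -scalemxAl vxi // scaler0 mxE mulr0.
  apply: fixed_sub_v => //; rewrite /u mulmxBr mulmx1 -mulmxA y0_x mulmxA vP ?cycle_id // subrr //.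
have [c cE] := biinv_span hP hN.
have c0 j : nt j -> c j = 0.
  move=> ntj; apply/eqP/negPn/negP=> nz; apply: (no_weight ntj).
    exact: (span_weight cE hl ntj nz).
  exact: (span_weight_r cE hr ntj nz).
apply/matrixP=> a b; rewrite !ord1 [RHS]mxE -[LHS]/(h g) cE // big1 // => j ntj.
by rewrite c0 // mul0r.
Qed.

Let adR := ad_repr (phi i).
Let Y := cyclic_mx adR (mxvec y0).
Let rW := submod_repr (cyclic_mx_module adR (mxvec y0)).
Let yW : 'rV_(\rank Y) := in_submod Y (mxvec y0).

Lemma val_yW : val_submod yW = mxvec y0.
Proof. by rewrite in_submodK // cyclic_mx_id. Qed.

Lemma val_rW (w : 'rV_(\rank Y)) g : g \in G ->
  vec_mx (val_submod (w *m rW g)) = phi i g^-1%g *m vec_mx (val_submod w) *m phi i g.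
Proof.
move=> Gg; rewrite val_submodJ //= -{1}[val_submod w]vec_mxK ad_mxE mxvecK //.
Qed.

Lemma val_inj_W (w w' : 'rV_(\rank Y)) : vec_mx (val_submod w) = vec_mx (val_submod w') -> w = w'.
Proof.
move=> e; apply: (can_inj (@val_submodK _ _ Y _)); apply: (can_inj (@vec_mxK _ _ _)); exact: e.
Qed.

Lemma yW_N n : n \in N -> yW *m rW n = cF n *: yW.
Proof.
move=> Nn; apply: val_inj_W; rewrite val_rW ?(subsetP sNG) // val_yW mxvecK y0_N //.
by rewrite !linearZ /= val_yW mxvecK.
Qed.

Lemma yW_neq0 : yW != 0.
Proof.
apply: contraNneq y0_neq0 => e; have := val_yW; rewrite e linear0 => e2.
by rewrite -(mxvecK y0) -e2 linear0.
Qed.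

Lemma yW_u : yW *m (rW x - 1) = 0.
Proof.
by rewrite mulmxBr mulmx1 yW_N ?(subsetP sPN) ?cycle_id // cF_P ?cycle_id // scale1r subrr.
Qed.

(** Since 2 D <= p - 1, the only critical term is k = l = D with 2 D = p - 1, which is xi (v A xi) v
    and vanishes by [v_conj_xi]. *)
Lemma orbit_W : \sum_(a < p) rW (x ^+ a)%g = 0.
Proof.
apply: (@cyclic_gen F gT G _ adR (mxvec y0)) => g Gg; rewrite -/Y -/rW -/yW.
apply: val_inj_W; rewrite !linear0 mulmx_sumr !linear_sum /=.
have [_ dimE uD uD1 _] := core nti; pose A := phi i g^-1%g *m y0 *m phi i g.
transitivity (\sum_(a < p) (1 + u i) ^+ (p.-1 * a) *m A *m (1 + u i) ^+ a).
  apply: eq_bigr => a _; rewrite -mulmxA -repr_mxM ?groupX // val_rW ?groupM ?groupX // val_yW mxvecK.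
  have Gxa : (x ^+ a)%g \in G by rewrite groupX.
  have e1 : (1 + u i) ^+ a = phi i (x ^+ a)%g by rewrite (repr_expg _ _ Gx) addrC subrK.
  have e2 : (1 + u i) ^+ (p.-1 * a) = phi i (x ^- a)%g.
    have -> : (x ^- a = x ^+ (p.-1 * a))%g.
      by apply/eqP; rewrite eq_invg_mul -expgD -mulSn prednK ?prime_gt0 // expgM expg_order expg1n.
    by rewrite (repr_expg _ _ Gx) addrC subrK.
  rewrite e1 e2 invMg (repr_mxM _ (groupVr Gxa) (groupVr Gg)) (repr_mxM _ Gg Gxa) /A.
  by rewrite !mulmxA.
have e0 : v i *m A *m xi i = 0 \/ (2 * D i)%N <> p.-1.
  by have [e|/eqP] := eqVneq (2 * D i)%N p.-1; [left; rewrite /A !mulmxA v_conj_xi|right].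
clearbody A; apply: (conj_orbit_sum charF uD1 Dp) => k l kD lD pkl.
have [e2 -> ->] := sum_extreme kD lD pkl D2.
case: e0 => // e0; rewrite uD -!mulmxA (mulmxA A) (mulmxA (v i)) (mulmxA (v i) A) e0.
by rewrite mul0mx mulmx0.
Qed.

Lemma fixed_W (w : 'rV_(\rank Y)) : w *m (rW x - 1) = 0 -> (w <= yW)%MS.
Proof.
apply: (fixed_line p_pr sylP charF yW_N yW_neq0 yW_u orbit_W) => A.
exact: cyclic_gen.
Qed.

Lemma jordan_W : exists s, [/\ \rank Y = s.+1, (rW x - 1) ^+ s != 0, (rW x - 1) ^+ s.+1 = 0 & (s < p)%N].
Proof.
have rk1 : \rank (kermx (rW x - 1)) = 1%N.
  apply/eqP; rewrite eqn_leq; apply/andP; split.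
    apply: leq_trans (rank_leq_row yW); apply: mxrankS; apply/row_subP=> k.
    by apply: fixed_W; rewrite -row_mul mulmx_ker row0.
  rewrite lt0n mxrank_eq0; apply: contra yW_neq0 => /eqP k0.
  by rewrite -submx0 -k0; apply/sub_kermxP; exact: yW_u.
have [u0|nu] := eqVneq (rW x - 1) 0.
  exists 0%N; rewrite expr0 expr1; split=> //.
  - by move: rk1; rewrite u0 mxrank_ker mxrank0 subn0.
  - apply: contraNneq yW_neq0 => e; by rewrite -[yW]mulmx1 -[1%:M]/(1 : 'M_(\rank Y)) e mulmx0.
  - exact: prime_gt0.
have up : (rW x - 1) ^+ p = 0.
  apply: (addrI 1); rewrite addr0 -unip_pow_char // addrC subrK.
  by rewrite -(repr_expg _ _ Gx) expg_order repr_mx1.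
have [s [/andP[s0 sp] us us1]] := nil_index nu up.
by have [m _] := nil_single us us1 rk1; exists s.
Qed.

(** A longer block would make log x a third difference, against [third_difference]: the trace of
    [dmx *m fmx] is a nonzero binomial coefficient. *)
Lemma depth_W s : (rW x - 1) ^+ s != 0 -> (rW x - 1) ^+ s.+1 = 0 -> (s <= 2)%N.
Proof.
move=> us us1; rewrite leqNgt; apply/negP=> s3.
have /rowV0Pn[w0 /submxP[w wE] nz] := us.
have : (w0 <= yW)%MS.
  apply: fixed_W; rewrite wE -mulmxA -[_ *m (rW x - 1)]/((rW x - 1) ^+ s * (rW x - 1)) -exprSr us1 mulmx0 //.
case/sub_rVP=> b be.
have nzb : b != 0 by apply: contraNneq nz => b0; rewrite be b0 scale0r.
pose z0 := b^-1 *: (w *m (rW x - 1) ^+ (s - 3)).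
have z3 : z0 *m (rW x - 1) *m (rW x - 1) *m (rW x - 1) = yW.
  rewrite /z0 -!scalemxAl -!mulmxA.
  have -> : (rW x - 1) ^+ (s - 3) *m ((rW x - 1) *m ((rW x - 1) *m (rW x - 1))) = (rW x - 1) ^+ s.
    rewrite -[(rW x - 1) *m (rW x - 1)]/((rW x - 1) * (rW x - 1)) -expr2.
    rewrite -[(rW x - 1) *m _]/((rW x - 1) * _) -exprS -[LHS]/(_ * _) -exprD subnK //.
  by rewrite -wE be scalerA mulVf // scale1r.
pose M (w : 'rV_(\rank Y)) := vec_mx (val_submod w) : 'M_(idim (phi i)).
have step (w1 : 'rV_(\rank Y)) : (B *m M w1 *m B') *m pas (D i) 1 =
    pas (D i) 1 *m (B *m M w1 *m B' + B *m M (w1 *m (rW x - 1)) *m B').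
  have e : M w1 *m phi i x = phi i x *m (M w1 + M (w1 *m (rW x - 1))).
    rewrite /M mulmxBr mulmx1 [val_submod (_ - _)]linearB [vec_mx (_ - _)]linearB /= addrC subrK val_rW // -(mulmxA (phi i x^-1%g)).
    by rewrite mulmxA -repr_mxM ?groupV // mulgV repr_mx1 mul1mx.
  have x1 : pas (D i) 1 = B *m phi i x *m B' by rewrite Bx -mulmxA BB' mulmx1.
  rewrite x1 -mulmxDl -mulmxDr -!mulmxA (mulmxA B' B) B'B mul1mx (mulmxA B' B) B'B mul1mx.
  by congr (_ *m _); rewrite !mulmxA e.
have := third_difference (step z0) (step _) (step _); rewrite z3 /M val_yW mxvecK By0 tr_df.
have h : ((2 * D i).+1 <= p)%N by rewrite -[X in (_ <= X)%N](prednK (prime_gt0 p_pr)) ltnS.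
by move/eqP; rewrite (negPf (bin3_neq0 charF Dp D0 h)).
Qed.

Let t := #|N : P|%g.
Hypothesis tr_le : (t * r.+1 <= p.-1)%N.

Lemma cFX n k : n \in N -> cF (n ^+ k)%g = cF n ^+ k.
Proof.
move=> Nn; elim: k => [|k IHk]; first by rewrite expg0 cF1 expr0.
by rewrite expgS cFM ?groupX // IHk exprS.
Qed.

(** Otherwise [eigen_power], with k = |N : C_N(P)| killing [cF], stabilizes the line of log x; a
    perfect group then fixes log x, but [cF] is not trivial. *)
Lemma depth_index : exists s, [/\ \rank Y = s.+1, (s <= 2)%N
  & (p.-1 <= #|N : 'C_N(P)|%g * s)%N].
Proof.
have [s [rY us us1 sp]] := jordan_W; exists s; split=> //; first exact: depth_W us us1.
set k := #|_ : _|%g; rewrite leqNgt; apply/negP=> small.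
have k0 : (0 < k)%N by apply: indexg_gt0.
have nC : (N \subset 'N('C_N(P)))%g.
  by rewrite normsI ?normG // norms_cent // subsetIr.
have ck n : n \in N -> cF n ^+ k = 1.
  move=> Nn; rewrite -cFX // cF_cent //.
  have Cq : coset ('C_N(P))%G n \in (N / 'C_N(P))%g by apply: mem_quotient.
  have : (coset ('C_N(P))%G n ^+ k = 1)%g.
    by apply/eqP; rewrite -order_dvdn /k -card_quotient // order_dvdG.
  rewrite -morphX ?(subsetP nC) // => /coset_idr; rewrite groupX ?(subsetP nC) // => /(_ isT).
  by case/setIP.
have sub := eigen_power p_pr sylP charF yW_N us1 ck k0 small.
have stab g : g \in G -> exists a, yW *m rW g = a *: yW by move=> /sub/sub_rVP.
have [n Nn nz] := cF_nontriv; have := perfect_stab yW_neq0 stab (subsetP sNG n Nn).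
rewrite yW_N // -[RHS]scale1r => /eqP; rewrite -subr_eq0 -scalerBl scaler_eq0 (negPf yW_neq0) orbF subr_eq0.
by rewrite (negPf nz).
Qed.

(** With k = |N : C_N(P)| and c = |C_N(P) : P|, the inequalities k c (r + 1) <= p - 1 <= k s <= 2 k
    leave only c = r = 1, s = 2 and 2 k = p - 1. *)
Lemma tight_index : [/\ \rank Y = 3, r = 1%N, (2 * t)%N = p.-1, 'C_N(P)%g = P & (3 < p)%N].
Proof.
have [s [rY s2 pk]] := depth_index.
have sPC : P \subset 'C_N(P)%g by rewrite subsetI sPN; apply: cycle_abelian.
have tE : t = (#|N : 'C_N(P)|%g * #|'C_N(P)%g : P|%g)%N.
  by rewrite /t -(Lagrange_index (subsetIl _ _) sPC) mulnC.
have C0 : (0 < #|'C_N(P)%g : P|%g)%N by apply: indexg_gt0.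
have p2 := prime_gt1 p_pr.
move: tr_le; rewrite tE; move: pk C0; set k := #|N : _|%g; set c := #|_ : P|%g => pk C0 tr.
have k_gt0 : (0 < k)%N by apply: indexg_gt0.
have [c1 r1 s1 p1E] := index_arith k_gt0 C0 r_gt0 s2 pk tr.
have CP : 'C_N(P)%g = P by apply/eqP; rewrite eqEsubset sPC andbT -indexg_eq1; apply/eqP.
split=> //; [by rewrite rY s1 | by rewrite c1 muln1|].
rewrite ltnNge; apply/negP=> p3; have pE : p = 3%N by move: p_odd p2 p3; case: (p) => [|[|[|[|]]]].
have k1 : k = 1%N by apply: double_inj; rewrite -!mul2n p1E pE.
have [n Nn nz] := cF_nontriv; case/eqP: nz; apply: cF_cent.
suff : n \in 'C_N(P)%g by case/setIP.
by have := indexg_eq1 N 'C_N(P); rewrite -/k k1 eqxx => /esym/subsetP; apply.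
Qed.

(** As |G : N| = p + 1, the cosets are [N] and one regular orbit of [P]. *)
Lemma cosets_T k g : k \in G -> k \notin N -> g \in G -> g \notin N ->
  exists b, (g * (k * x ^+ b)^-1)%g \in N.
Proof.
move=> Gk nNk Gg nNg; have [_ r1 _ _ _] := tight_index.
have Gkx a : (k * x ^+ a)%g \in G by rewrite groupM ?groupX.
pose f (o : option 'I_p) := if o is Some a then crank G N (k * x ^+ a)%g else crank G N 1%g.
have finj : injective f.
  have nN a : (k * x ^+ a)%g \notin N by rewrite groupMr // groupX // (subsetP sPN) ?cycle_id.
  move=> [a|] [b|] //= /eqP; rewrite (crank_eqP sNG) ?group1 //.
  - rewrite invMg -!mulgA (mulgA (x ^+ a)%g) mulgA => Nab.
    have [e|ne] := eqVneq (x ^+ a * (x ^+ b)^-1)%g 1%g.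
      congr Some; apply/val_inj/eqP => /=.
      rewrite -(modn_small (ltn_ord a)) -(modn_small (ltn_ord b)) -eq_expg_mod_order eq_mulgV1.
      by apply/eqP.
    case/negP: nNk; apply: (norm_of_conj p_pr sylP Gk _ ne Nab).
    by rewrite groupM ?groupV ?mem_cycle.
  - by rewrite invg1 mulg1 (negPf (nN a)).
  - by rewrite mul1g groupV (negPf (nN b)).
have onto : forall c, c \in codom f.
  apply: inj_card_onto => //; rewrite card_option !card_ord card_nrc (index_norm_eq p_pr sylP).
  by rewrite -/p -/N -/r r1 mul1n.
have /codomP[[a|] e] := onto (crank G N g).
  by exists a; rewrite -(crank_eqP sNG Gg (Gkx a)) e.
by move/eqP: e; rewrite /f (crank_eqP sNG) // invg1 mulg1 (negPf nNg).
Qed.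

Lemma swap_exists : exists w, [/\ w \in G, w \notin N & (w * w)%g \in N].
Proof.
have [k Gk nNk] : exists2 k, k \in G & k \notin N.
  apply/subsetPn; apply: contraTN r_gt0 => sGN; rewrite -leqNgt /r.
  have -> : #|G : N|%g = 1%N by apply/eqP; rewrite indexg_eq1.
  by rewrite divn_small ?prime_gt1.
have nNkV : k^-1%g \notin N by rewrite groupV.
have [b Nb] := cosets_T Gk nNk (groupVr Gk) nNkV.
(* The inverse of [k] lies in N k x^b; the factor [n] corrects [k] to an element whose square is
   x^-b n. *)
set n := (_ * _)%g in Nb; have e : (k * n * k * x ^+ b = 1)%g.
  by rewrite /n invMg !mulgA mulgV mul1g mulgKV mulVg.
exists (k * n)%g; rewrite groupM ?(subsetP sNG n Nb) //.
split=> //; first by rewrite groupMr.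
rewrite mulgA groupMr //.
have -> : (k * n * k = x ^- b)%g by apply/eqP; rewrite eq_mulgV1 invgK; apply/eqP.
by rewrite groupV groupX // (subsetP sPN) ?cycle_id.
Qed.

Lemma quadratic_zero (q0 q1 q2 : F) : (forall b, (0 < b < p)%N -> q0 + q1 * b%:R + q2 * b%:R ^+ 2 = 0) ->
  q0 = 0 /\ q2 = 0.
Proof.
have [_ _ _ _ p3] := tight_index; move=> q.
have h1 := q 1%N (ltnW (ltnW p3)); have h2 := q 2%N (ltnW p3); have h3 := q 3%N p3.
have two : 2%:R != 0 :> F by apply: (natr_neq0 charF); rewrite (ltnW p3).
have q20 : q2 = 0.
  apply: (mulfI two); rewrite mulr0 -[RHS](subrr (0 : F)) -{1}[0]addr0 -{1}h1 -{1}h3.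
  by rewrite -[0 in RHS](mulr0 2%:R) -h2; ring.
split=> //; move: h1 h2; rewrite q20 !mul0r !addr0 mulr1 => h1 h2.
have -> : q0 = 2%:R * (q0 + q1) - (q0 + q1 * 2%:R) by ring.
by rewrite h1 h2 mulr0 subr0.
Qed.

(* In the three-dimensional module [Y], comparing the image of the fixed line under [w * x ^+ b * w]
   with the orbit of its image under [w] forces [b * b'] to be constant modulo [p]. *)
Theorem mobius : exists w c0, [/\ w \in G, w \notin N, (w * w)%g \in N, ~~ (p %| c0)%N
  & forall b, ~~ (p %| b)%N -> exists b', (w * x ^+ b * w * (w * x ^+ b')^-1)%g \in N /\ (b * b' = c0 %[mod p])].
Proof.
have [w [Gw nNw Nww]] := swap_exists; have [rY _ _ _ p3] := tight_index.
have [s [rY' us us1 sp]] := jordan_W; have s2 : s = 2%N by move: rY'; rewrite rY => -[].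
rewrite {}s2 in us us1; set U := rW x - 1 in us us1.
have two : 2%:R != 0 :> F by apply: (natr_neq0 charF); rewrite (ltnW p3).
have [e0 e0E] : exists e0, e0 = yW *m rW w by eexists.
(* These vectors are chosen so that e0 x^b = e0 + b e1 + b^2 f2: the orbit of [e0] traces a
   conic. *)
have [f2 f2D] : exists f2, f2 = 2%:R^-1 *: (e0 *m U *m U) by eexists.
have [e1 e1D] : exists e1, e1 = e0 *m U - f2 by eexists.
have U3 : U *m U *m U = 0 by rewrite -us1 exprS expr2 mulrA.
have e0U2 : e0 *m U *m U != 0.
  apply: contraNneq us => z; apply/eqP.
  apply: (@cyclic_gen F gT G _ adR (mxvec y0)) => g Gg; rewrite -/Y -/rW -/yW expr2.
  have [Ng|nNg] := boolP (g \in N).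
    by rewrite yW_N // -scalemxAl -[U * U]/(U *m U) mulmxA yW_u mul0mx scaler0.
  have [b Nb] := cosets_T Gw nNw Gg nNg; rewrite -[g](mulgKV (w * x ^+ b)%g).
  have Gb : (w * x ^+ b)%g \in G by rewrite groupM ?groupX.
  rewrite (repr_mxM _ (subsetP sNG _ Nb) Gb) (mulmxA yW) yW_N // -!scalemxAl (repr_mxM _ Gw (groupX b Gx)).
  rewrite (mulmxA yW) -e0E -(mulmxA e0).
  have -> : rW (x ^+ b)%g *m (U * U) = U *m U *m rW (x ^+ b)%g.
    have c : GRing.comm (rW x : 'M_(\rank Y)) U by apply: commrB; [|apply: commr1].
    rewrite (repr_expg _ _ Gx); exact: (commr_sym (commrX b (commr_sym (commrM c c)))).
  by rewrite (mulmxA e0) (mulmxA e0) z mul0mx scaler0.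
have f2U : f2 *m U = 0 by rewrite f2D -scalemxAl -(mulmxA e0) -(mulmxA e0) U3 mulmx0 scaler0.
have nzf2 : f2 != 0 by rewrite f2D scaler_eq0 invr_eq0 (negPf two).
have e1U : e1 *m U = 2%:R *: f2.
  by rewrite e1D mulmxBl f2U subr0 f2D scalerA divff // scale1r.
have e0x b : e0 *m rW (x ^+ b)%g = e0 + b%:R *: e1 + (b%:R ^+ 2) *: f2.
  elim: b => [|b IHb]; first by rewrite expg0 repr_mx1 mulmx1 scale0r expr0n scale0r !addr0.
  rewrite expgSr repr_mxM ?groupX // mulmxA IHb -[rW x](subrK 1) -/U mulmxDr mulmx1.
  have e0Ue : e0 *m U = e1 + f2 by rewrite e1D subrK.
  rewrite !mulmxDl -!scalemxAl e1U f2U e0Ue scaler0 addr0 -[b.+1%:R]natr1.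
  by apply/matrixP=> a c; rewrite !mxE; ring.
have ind a0 a1 a2 : a0 *: e0 + a1 *: e1 + a2 *: f2 = 0 -> [/\ a0 = 0, a1 = 0 & a2 = 0].
  move=> e;
  have a00 : a0 = 0.
    have := congr1 (fun z => z *m U *m U) e; rewrite !mulmxDl -!scalemxAl e1U -!scalemxAl f2U mul0mx.
    rewrite !scaler0 !addr0 mul0mx => /eqP; rewrite scaler_eq0 (negPf e0U2) orbF => /eqP //.
  rewrite a00 scale0r add0r in e; have a10 : a1 = 0.
    have := congr1 (fun z => z *m U) e; rewrite !mulmxDl -!scalemxAl e1U f2U scaler0 addr0 mul0mx scalerA.
    by move/eqP; rewrite scaler_eq0 (negPf nzf2) orbF mulf_eq0 (negPf two) orbF => /eqP.
  by move: e; rewrite a10 scale0r add0r => /eqP; rewrite scaler_eq0 (negPf nzf2) orbF => /eqP.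
have uniq3 a0 a1 a2 b0 b1 b2 : a0 *: e0 + a1 *: e1 + a2 *: f2 = b0 *: e0 + b1 *: e1 + b2 *: f2 ->
    [/\ a0 = b0, a1 = b1 & a2 = b2].
  move=> e; have [|/eqP h0 /eqP h1 /eqP h2] := ind (a0 - b0) (a1 - b1) (a2 - b2).
    move/eqP: e; rewrite -subr_eq0 => /eqP e; rewrite -[RHS]e.
    by apply/matrixP=> a c; rewrite !mxE; ring.
  by move: h0 h1 h2; rewrite !subr_eq0 => /eqP-> /eqP-> /eqP->.
have [ka f2E] : exists ka, f2 = ka *: yW by apply/sub_rVP; apply: fixed_W f2U.
have nzka : ka != 0 by apply: contraNneq nzf2 => k0; rewrite f2E k0 scale0r.
have f2w : f2 *m rW w = ka *: e0 by rewrite f2E -scalemxAl -e0E.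
pose al := cF (w * w)%g / ka.
have e0w : e0 *m rW w = al *: f2.
  by rewrite e0E -mulmxA -repr_mxM // yW_N // f2E scalerA /al divfK.
have key b : (0 < b < p)%N -> exists c b', e0 *m rW (x ^+ b)%g *m rW w = c *: (e0 + b'%:R *: e1 + (b'%:R ^+ 2) *: f2)
     /\ (w * x ^+ b * w * (w * x ^+ b')^-1)%g \in N.
  move=> /andP[b0 bp]; have Gwb : (w * x ^+ b * w)%g \in G by rewrite !groupM ?groupX.
  have nNb : (w * x ^+ b * w)%g \notin N.
    apply/negP=> Nb; have : (w * x ^+ b * w^-1)%g \in N.
      by have := groupM Nb (groupVr Nww); rewrite invMg !mulgA mulgK.
    move/(norm_of_conj p_pr sylP Gw (mem_cycle x b)) => h; case/negP: nNw; apply: h.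
    by rewrite -order_dvdn gtnNdvd.
  have [b' Nb'] := cosets_T Gw nNw Gwb nNb; exists (cF (w * x ^+ b * w * (w * x ^+ b')^-1)%g), b'; split=> //.
  have Gb' : (w * x ^+ b')%g \in G by rewrite groupM ?groupX.
  rewrite -e0x e0E -!(mulmxA yW (rW w)) -(repr_mxM rW Gw (groupX b Gx)) -(repr_mxM rW Gw (groupX b' Gx)).
  rewrite -(mulmxA yW) -(repr_mxM rW (groupM Gw (groupX b Gx)) Gw).
  rewrite -{1}(mulgKV (w * x ^+ b')%g (w * x ^+ b * w)%g) (repr_mxM rW (subsetP sNG _ Nb') Gb').
  by rewrite (mulmxA yW) yW_N // -scalemxAl.
have [c1 [b1 [e1w _]]] := key 1%N (ltnW (ltnW p3)).
pose A0 := c1 - ka; pose A1 := c1 * b1%:R; pose A2 := c1 * b1%:R ^+ 2 - al.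
have e1wE : e1 *m rW w = A0 *: e0 + A1 *: e1 + A2 *: f2.
  have : e0 *m rW (x ^+ 1)%g *m rW w = al *: f2 + e1 *m rW w + ka *: e0.
    by rewrite e0x expr1n !scale1r !mulmxDl e0w f2w.
  rewrite e1w => e; have -> : e1 *m rW w = c1 *: (e0 + b1%:R *: e1 + (b1%:R ^+ 2) *: f2) - al *: f2 - ka *: e0.
    by rewrite e; apply/matrixP=> a c; rewrite !mxE; ring.
  by apply/matrixP=> a c; rewrite !mxE /A0 /A1 /A2; ring.
have coefs b : (0 < b < p)%N -> exists c b', [/\ b%:R * A0 + b%:R ^+ 2 * ka = c,
    b%:R * A1 = c * b'%:R, al + b%:R * A2 = c * b'%:R ^+ 2 & (w * x ^+ b * w * (w * x ^+ b')^-1)%g \in N].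
  move=> bp; have [c [b' [e Nb']]] := key b bp; exists c, b'.
  have [] := @uniq3 (b%:R * A0 + b%:R ^+ 2 * ka) (b%:R * A1) (al + b%:R * A2) c (c * b'%:R) (c * b'%:R ^+ 2); last by split.
  transitivity (c *: (e0 + b'%:R *: e1 + b'%:R ^+ 2 *: f2)); last by rewrite !scalerDr !scalerA.
  rewrite -e e0x !mulmxDl -!scalemxAl e0w f2w e1wE.
  by apply/matrixP=> a d; rewrite !mxE; ring.
have nzal : al != 0 by rewrite mulf_neq0 ?invr_eq0 // cF_neq0.
(* Eliminating c and b' gives (b A1)^2 = (b A0 + b^2 ka)(al + b A2); after division by b this is a
   quadratic vanishing at all nonzero b, so its outer coefficients are 0. *)
have [A00 A20] : A0 = 0 /\ A2 = 0.
  have [|h0 h2] := @quadratic_zero (A0 * al) (A0 * A2 + ka * al - A1 ^+ 2) (ka * A2).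
    move=> b bp; have [c [b' [h0 h1 h2 _]]] := coefs b bp.
    have nzb : b%:R != 0 :> F by apply: (natr_neq0 charF).
    apply: (mulfI nzb); rewrite mulr0.
    have : (b%:R * A1) ^+ 2 = c * (al + b%:R * A2) by rewrite h1 h2; ring.
    rewrite -h0 => /eqP; rewrite eq_sym -subr_eq0 => /eqP e; rewrite -[RHS]e; ring.
  by split; apply/eqP; [move/eqP: h0|move/eqP: h2]; rewrite mulf_eq0 ?(negPf nzka) ?(negPf nzal) ?orbF.
have prodE b : (0 < b < p)%N -> exists b', (w * x ^+ b * w * (w * x ^+ b')^-1)%g \in N /\ (b * b')%:R = A1 / ka :> F.
  move=> bp; have [c [b' [h0 h1 _ Nb']]] := coefs b bp; exists b'; split=> //.
  have nzb : b%:R != 0 :> F by apply: (natr_neq0 charF).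
  rewrite A00 mulr0 add0r in h0; rewrite -h0 in h1.
  apply: (mulfI nzb); rewrite mulrA h1 natrM; field.
  exact: nzka.
have [b1' [Nb1 b1E]] := prodE 1%N (ltnW (ltnW p3)); rewrite mul1n in b1E.
exists w, b1'; split=> //.
  apply/negP=> pb; move: Nb1; have -> : (x ^+ b1' = 1)%g by apply/eqP; rewrite -order_dvdn.
  rewrite mulg1 expg1 mulgK groupMr ?(negPf nNw) // (subsetP sPN) ?cycle_id //.
move=> b pb; have bp : (0 < b %% p < p)%N by rewrite lt0n -[_ == _]/(p %| b)%N pb ltn_mod prime_gt0.
have [b' [Nb' bE]] := prodE _ bp; exists b'; split; first by rewrite expg_mod_order in Nb'.
by rewrite -modnMml; apply: natF_inj; rewrite bE b1E.
Qed.
End Adjoint.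
End Core2.

(** * The bound for perfect groups generated by their Sylow p-subgroups *)

Section CoreTheorem.
Local Open Scope group_scope.
Variable gT : finGroupType.
Implicit Types (G K : {group gT}) (x : gT).

(** What the identification with PSL_2(p) needs from the representations, stated with group elements
    and naturals only. *)
Definition mobius_data (G : {group gT}) (x : gT) : Prop :=
  let P := <[x]> in let p := #[x] in let N := 'N_G(P) in
  [/\ p.-Sylow(G) P, #|G : N| = p.+1, (2 * #|N : P|)%N = p.-1, 'C_N(P) = P
    & exists w c0, [/\ w \in G, w \notin N, w * w \in N, ~~ (p %| c0)%N
    & (forall b, ~~ (p %| b)%N ->
        exists b', w * x ^+ b * w * (w * x ^+ b')^-1 \in N /\ (b * b' = c0 %[mod p])%N) /\
      (forall g, g \in G -> g \notin N -> exists b, g * (w * x ^+ b)^-1 \in N)]].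

Definition gen_by_sylow (p : nat) (G : {group gT}) :=
  forall K : {group gT}, K <| G -> (forall P : {group gT}, p.-Sylow(G) P -> P \subset K) -> G \subset K.

Lemma core_cyclic G x : prime #[x] -> odd #[x] -> (#[x].-Sylow(G) <[x]>) -> G^`(1) = G ->
  gen_by_sylow #[x] G -> (#|G : <[x]>| <= #[x].-1 * kp' #[x] G)%N ->
  [/\ mobius_data G x, (3 < #[x])%N & (#[x].-1 * kp' #[x] G)%N = #|G : <[x]>|].
Proof.
move=> p_pr p_odd sylP perfG genG' big.
have [F charF] := closed_pfield_exists p_pr.
have genG K : K <| G -> <[x]> \subset K -> G \subset K.
  move=> nK sPK; apply: genG' => // R sylR; have [g Gg ->] := Sylow_trans sylP sylR.
  by rewrite -(normP (subsetP (normal_norm nK) g Gg)) conjSg.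
have [I [phi [inj cI]]] := brauer_irr_count G charF.
have big' : (#|G : <[x]>| <= #[x].-1 * #|I|)%N.
  by apply: leq_trans big _; rewrite leq_mul2l cI orbT.
have [MJ Mt tr rk1] := kernel_line p_pr sylP charF genG inj big'.
have [D [v [xi core]]] := core_structure p_pr sylP charF genG inj big'.
set N := 'N_G(<[x]>) in Mt tr; set t := #|N : <[x]>| in Mt tr; set r := (#|G : N| %/ #[x])%N in Mt tr.
have sPG := pHall_sub sylP.
(* If r = 0 then [P] is normal, so it contains [G], which is abelian and perfect, hence trivial. *)
have r_gt0 : (0 < r)%N.
  rewrite lt0n; apply/eqP=> r0; have : #|G : N| = 1%N.
    by have := index_norm_eq p_pr sylP; rewrite -/N -/r r0 mul0n.
  move/eqP; rewrite indexg_eq1 => sGN; have nP : <[x]> <| G.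
    by rewrite /normal sPG (subset_trans sGN) ?subsetIr.
  have GP : G \subset <[x]> by apply: (genG <[x]>%G).
  have abG : abelian G := abelianS GP (cycle_abelian x).
  move: perfG; rewrite (derG1P abG) => G1; have : x \in G by rewrite -cycle_subG.
  by rewrite -G1 => /set1P x1; rewrite x1 order1 in p_pr.
have [i nti D2] := small_rep p_pr p_odd sylP charF inj core MJ perfG.
have [D0p dimE uD uD1 _] := core i nti.
have uDn : ((irepr (phi i) x - 1) ^+ D i != 0)%R.
  by rewrite uD outer_neq0 //; have [_ _ _ _ []] := core i nti.
have Dp : (D i < #[x])%N by case/andP: D0p.
have [B [B' [BB' B'B Bx]]] := pascal_basis charF Dp dimE uDn uD1.
have {}Bx : (B *m phi i x = pas (D i) 1 *m B)%R by rewrite -Bx addrC subrK.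
have [_ r1 t2 CP p3] := tight_index p_pr p_odd sylP charF inj core MJ perfG r_gt0 nti D2 BB' B'B Bx tr.
have {}r1 : r = 1%N := r1.
have [w [c0 [Gw nNw Nww pc0 mob]]] := mobius p_pr p_odd sylP charF inj core MJ perfG r_gt0 nti D2 BB' B'B Bx tr.
have cos := cosets_T p_pr p_odd sylP charF inj core MJ perfG r_gt0 nti D2 BB' B'B Bx tr Gw nNw.
have nE : #|G : N| = #[x].+1.
  by have := index_norm_eq p_pr sylP; rewrite -/N -/r r1 mul1n.
split=> //; first by split=> //; exists w, c0.
(* The inequality is an equality: k <= t + 1, and |G : P| = (p + 1) t = (p - 1)(t + 1) because 2 t =
   p - 1. *)
apply/eqP; rewrite eqn_leq big andbT.
have I_le : (#|I| <= t.+1)%N.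
  by have := card_ntriv sylP charF genG inj; rewrite -MJ Mt r1 muln1.
apply: (@leq_trans (#[x].-1 * t.+1)); first by rewrite leq_mul2l (leq_trans cI) ?orbT.
rewrite -(index_norm_card sylP) -/N -/t nE -t2.
have -> : #[x].+1 = (2 * t.+1)%N by rewrite -(prednK (prime_gt0 p_pr)) -t2 mulnS add2n.
by rewrite mulnAC.
Qed.

Theorem core_theorem G p : prime p -> odd p -> G^`(1) = G -> gen_by_sylow p G -> 'O_p(G) = 1 ->
  p %| #|G| ->
  (p.-1 * kp' p G <= #|G|`_p^')%N /\
  ((p.-1 * kp' p G)%N = (#|G|`_p^')%N -> exists x, [/\ #[x] = p, mobius_data G x & 3 < p]).
Proof.
move=> p_pr p_odd perfG genG Op1 pG; have [P sylP] := Sylow_exists p G.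
have pP : p.-group P := pHall_pgroup sylP.
have ntP : P :!=: 1.
  apply: contraTneq pG => P1; have := card_Hall sylP; rewrite P1 cards1 => /esym/eqP.
  by rewrite -p'natE // -partn_eq1 ?cardG_gt0.
have [largeP|smallP] := ltnP p #|P|.
  have lt := kp'_large_sylow p_pr sylP Op1 largeP; split; first exact: ltnW.
  by move=> e; rewrite e ltnn in lt.
have cP : #|P| = p.
  have [_ pdvP _] := pgroup_pdiv pP ntP; apply/eqP; rewrite eqn_leq smallP.
  exact: dvdn_leq (cardG_gt0 P) pdvP.
have /cyclicP[x Px] : cyclic P by apply: prime_cyclic; rewrite cP.
have ox : #[x] = p by rewrite orderE -Px.
have sylx : #[x].-Sylow(G) <[x]> by rewrite ox -Px.
rewrite (card_p'part sylP) Px -ox.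
have [big|small] := leqP #|G : <[x]>| (#[x].-1 * kp' #[x] G).
  rewrite -ox in p_pr p_odd genG.
  have [md p3 e] := core_cyclic p_pr p_odd sylx perfG genG big; split; first by rewrite e.
  by move=> _; exists x.
by split; [exact: ltnW|move=> e; rewrite e ltnn in small].
Qed.
End CoreTheorem.

(** * Projective linear groups *)

Section Matrices2.
Local Open Scope ring_scope.
Variable F : fieldType.

Definition row2 (a b : F) : 'rV[F]_2 := \row_j (if j == 0 then a else b).
Definition mx2 (a b c d : F) : 'M[F]_2 :=
  \matrix_(i, j) (if i == 0 then if j == 0 then a else b else if j == 0 then c else d).

Lemma row2E (v : 'rV[F]_2) : v = row2 (v 0 0) (v 0 1).
Proof.
apply/rowP=> j; rewrite mxE; case: eqVneq => [->//|]; case: j => [[|[|j]] lt] //= _.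
by congr (v _ _); apply: val_inj.
Qed.

Lemma row2_0 a b : row2 a b 0 0 = a. Proof. by rewrite mxE. Qed.
Lemma row2_1 a b : row2 a b 0 1 = b. Proof. by rewrite mxE. Qed.

Lemma mx2E (A : 'M[F]_2) : A = mx2 (A 0 0) (A 0 1) (A 1 0) (A 1 1).
Proof.
apply/matrixP=> i j; rewrite mxE; case: (eqVneq i 0) => [->|]; case: (eqVneq j 0) => [->|] //.
- by case: j => [[|[|j]] lt] //= _; congr (A _ _); apply: val_inj.
- by case: i => [[|[|i]] lt] //= _; congr (A _ _); apply: val_inj.
case: i => [[|[|i]] lt] //; case: j => [[|[|j]] lt'] //= _ _.
by congr (A _ _); apply: val_inj.
Qed.

Lemma row2_mul a b (A : 'M[F]_2) : row2 a b *m A = row2 (a * A 0 0 + b * A 1 0) (a * A 0 1 + b * A 1 1).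
Proof.
by rewrite [LHS]row2E; congr row2; rewrite mxE big_ord_recl big_ord1 !mxE /=;
   congr (_ + _ * A _ _); apply: val_inj.
Qed.

Lemma det_mx2 (A : 'M[F]_2) : \det A = A 0 0 * A 1 1 - A 0 1 * A 1 0.
Proof.
rewrite (expand_det_row A 0) big_ord_recl big_ord1 /cofactor !det_mx11 !mxE /=.
have -> : lift 0 0 = 1 :> 'I_2 by apply: val_inj.
have -> : lift 1 0 = 0 :> 'I_2 by apply: val_inj.
by rewrite /= addn0 add0n expr0 expr1 mul1r; ring.
Qed.

Lemma row2_eq0 a b : (row2 a b == 0) = (a == 0) && (b == 0).
Proof.
apply/eqP/andP => [e|[/eqP-> /eqP->]]; last by apply/rowP=> j; rewrite !mxE; case: ifP.
by split; apply/eqP; [rewrite -(row2_0 a b)|rewrite -(row2_1 a b)]; rewrite e mxE.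
Qed.

Lemma mx2_mul (A B : 'M[F]_2) : A *m B = mx2 (A 0 0 * B 0 0 + A 0 1 * B 1 0) (A 0 0 * B 0 1 + A 0 1 * B 1 1)
  (A 1 0 * B 0 0 + A 1 1 * B 1 0) (A 1 0 * B 0 1 + A 1 1 * B 1 1).
Proof.
rewrite [LHS]mx2E; congr mx2; rewrite mxE big_ord_recl big_ord1;
  by congr (_ * _ + A _ _ * B _ _); apply: val_inj.
Qed.
End Matrices2.

Section Projective.
Local Open Scope ring_scope.
Variables (F : finFieldType) (p : nat).
Notation GL := {'GL_2[F]}.

(* [option F] is the projective line; [None] is the point (1 : 0). *)
Definition toP (v : 'rV[F]_2) : option F := if v 0 1 == 0 then None else Some (v 0 0 / v 0 1).
Definition frP (o : option F) : 'rV[F]_2 := if o is Some a then row2 a 1 else row2 1 0.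

Lemma frP_neq0 o : frP o != 0.
Proof. by case: o => [a|]; rewrite row2_eq0 oner_eq0 ?andbF. Qed.

Lemma toP_scale c v : c != 0 -> toP (c *: v) = toP v.
Proof.
move=> nzc; rewrite /toP !mxE mulf_eq0 (negPf nzc) /=; case: eqP => // nz.
by rewrite -mulf_div divff // mul1r.
Qed.

Lemma frP_toP v : v != 0 -> exists2 c, c != 0 & frP (toP v) = c *: v.
Proof.
rewrite {1}(row2E v) row2_eq0 /toP; have [v1|v1] := eqVneq (v 0 1) 0 => nz.
  rewrite andbT in nz; exists (v 0 0)^-1; first by rewrite invr_eq0.
  by rewrite [RHS]row2E !mxE v1 mulr0 mulVf.
exists (v 0 1)^-1; first by rewrite invr_eq0.
by rewrite [RHS]row2E !mxE mulVf // mulrC.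
Qed.

Lemma toP_frP o : toP (frP o) = o.
Proof. by case: o => [a|]; rewrite /toP row2_1 ?oner_eq0 ?eqxx // row2_0 divr1. Qed.

Definition pact (o : option F) (g : GL) : option F := toP (frP o *m GLval g).

Lemma GL_row_neq0 (v : 'rV[F]_2) (g : GL) : v != 0 -> v *m GLval g != 0.
Proof.
apply: contraNneq => vg; have U : GLval g \in unitmx by exact: GL_unitmx.
by rewrite -[v](mulmxK U) vg mul0mx.
Qed.

Lemma pact1 : pact^~ 1%g =1 id.
Proof. by move=> o; rewrite /pact GL_1E mulmx1 toP_frP. Qed.

Lemma pactM o : act_morph pact o.
Proof.
move=> g h; have [c nzc e] := frP_toP (GL_row_neq0 g (frP_neq0 o)).
by rewrite /pact e -scalemxAl toP_scale // -mulmxA.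
Qed.

Definition pgl_act := TotalAction pact1 pactM.
Definition pgl := actperm pgl_act.

Lemma pglE g o : pgl g o = toP (frP o *m GLval g).
Proof. by rewrite actpermE. Qed.

Definition mkGL (A : 'M[F]_2) (dA : \det A != 0) : GL :=
  @FinRing.Unit _ A (etrans (unitmxE A) (etrans (unitfE _) dA)).

Lemma mkGLE A dA : GLval (@mkGL A dA) = A. Proof. by []. Qed.

Lemma GL_inj (g h : GL) : GLval g = GLval h -> g = h.
Proof. exact: val_inj. Qed.

Lemma GL_det_neq0 (g : GL) : \det (GLval g) != 0.
Proof. by have := GL_unitmx g; rewrite unitmxE unitfE. Qed.

(** Fixing infinity, 0 and 1 forces a diagonal matrix with equal entries. *)
Lemma ker_pglP g : reflect (exists a, GLval g = a%:M) (g \in 'ker pgl)%g.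
Proof.
apply: (iffP idP) => [/(kerP _ (in_setT _)) g1|[a ga]]; last first.
  apply/(kerP _ (in_setT _))/permP=> o; rewrite pglE perm1 ga mul_mx_scalar toP_scale ?toP_frP //.
  by apply: contraNneq (GL_det_neq0 g) => a0; rewrite ga a0 det_scalar expr0n.
have fix_ o : toP (frP o *m GLval g) = o by rewrite -pglE [pgl g]g1 perm1.
have := fix_ None; rewrite row2_mul /toP row2_1 !mul1r !mul0r !addr0; case: eqP => // g01 _.
have := fix_ (Some 0); rewrite row2_mul /toP row2_1 row2_0 !mul1r !mul0r !add0r.
case: eqP => // /eqP nz11 /Some_inj e; have g10 : GLval g 1 0 = 0 by rewrite -[LHS](mulfVK nz11) e mul0r.
have := fix_ (Some 1); rewrite row2_mul /toP row2_1 row2_0 !mul1r g01 g10 add0r addr0.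
rewrite (negPf nz11) => /Some_inj/(canRL (mulfVK nz11)); rewrite mul1r => g00.
exists (GLval g 1 1); rewrite [LHS]mx2E g01 g10 g00.
by apply/matrixP=> i j; rewrite !mxE; case: i => [[|[|i]] ?]; case: j => [[|[|j]] ?].
Qed.

Definition elemU : 'M[F]_2 := mx2 1 1 0 1.
Definition elemL : 'M[F]_2 := mx2 1 0 1 1.
Lemma det_elemU : \det elemU = 1. Proof. by rewrite det_mx2 !mxE /=; ring. Qed.
Lemma det_elemL : \det elemL = 1. Proof. by rewrite det_mx2 !mxE /=; ring. Qed.
Lemma nz1 : (1 : F) != 0. Proof. exact: oner_neq0. Qed.
Definition gU : GL := mkGL (eq_ind_r (fun z => z != 0) nz1 det_elemU).
Definition gL : GL := mkGL (eq_ind_r (fun z => z != 0) nz1 det_elemL).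

Lemma comm_scalar (g : GL) : commute g gU -> commute g gL -> exists a, GLval g = a%:M.
Proof.
move=> /(congr1 (fun z : GL => GLval z)) cU /(congr1 (fun z : GL => GLval z)) cL.
rewrite !GL_ME in cU cL; rewrite -![GLval g * _]/(GLval g *m _) -![_ * GLval g]/(_ *m GLval g) in cU cL.
move/matrixP: cU => cU; move/matrixP: cL => cL.
move: (cU 0 0) (cU 0 1) (cL 0 0) (cL 1 0).
rewrite /gU /gL !mkGLE !mx2_mul !mxE /= => e1 e2 e3 _; exists (GLval g 0 0).
have g10 : GLval g 1 0 = 0.
  apply: (addrI (GLval g 0 0)); transitivity (1 * GLval g 0 0 + 1 * GLval g 1 0); first by ring.
  by rewrite -e1; ring.
have g01 : GLval g 0 1 = 0.
  apply: (addrI (GLval g 0 0)); transitivity (GLval g 0 0 * 1 + GLval g 0 1 * 1); first by ring.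
  by rewrite e3; ring.
have g11 : GLval g 1 1 = GLval g 0 0.
  apply: (addrI (GLval g 0 1)); transitivity (1 * GLval g 0 1 + 1 * GLval g 1 1); first by ring.
  by rewrite -e2; ring.
rewrite [LHS]mx2E g01 g10 g11.
by apply/matrixP=> i j; rewrite !mxE; case: i => [[|[|i]] ?]; case: j => [[|[|j]] ?].
Qed.

Lemma scalar_central (g h : GL) a : GLval g = a%:M -> commute g h.
Proof. by move=> ga; apply: GL_inj; rewrite !GL_ME ga -[LHS]/(a%:M *m _) -[RHS]/(_ *m a%:M) scalar_mxC. Qed.

Lemma center_GL : ('Z('GL_2[F]) = 'ker pgl)%g.
Proof.
apply/setP=> g; apply/idP/ker_pglP => [/centerP[_ c]|[a ga]].
  exact: comm_scalar (c gU (in_setT _)) (c gL (in_setT _)).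
by apply/centerP; split; rewrite ?inE // => h _; apply: scalar_central ga.
Qed.

Lemma center_SL : ('Z(SL_group 2 F) = SL_group 2 F :&: 'ker pgl)%g.
Proof.
apply/setP=> g; rewrite [RHS]inE; apply/idP/andP => [/centerP[Sg c]|[Sg /ker_pglP[a ga]]].
  split=> //; apply/ker_pglP; apply: comm_scalar (c gU _) (c gL _); rewrite inE mkGLE.
    by rewrite det_elemU.
  by rewrite det_elemL.
by apply/centerP; split=> // h _; apply: scalar_central ga.
Qed.

Definition psl_im := (pgl @* SL_group 2 F)%G.
Definition pgl_im := (pgl @* 'GL_2[F])%G.

Lemma der_pgl_sub : (pgl_im^`(1) \subset psl_im)%g.
Proof.
rewrite -morphim_der ?subsetT // morphimS // gen_subG; apply/subsetP=> _ /imset2P[a b _ _ ->].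
rewrite inE commgEl conjgE !GL_ME !det_mulmx; apply/eqP.
have dV (g : GL) : \det (GLval g^-1%g) * \det (GLval g) = 1.
  by rewrite -det_mulmx -[_ *m _]/(GLval (g^-1 * g)%g) mulVg GL_1E det1.
transitivity ((\det (GLval (a : GL)^-1%g) * \det (GLval (a : GL))) *
  (\det (GLval (b : GL)^-1%g) * \det (GLval (b : GL)))); first by rewrite -!mulrA (mulrCA (\det (GLval b^-1%g))).
by rewrite !dV mulr1.
Qed.

Hypotheses (p_pr : prime p) (card_Fp : #|F| = p).

Lemma charFp : p \in [pchar F].
Proof. by apply: (@card_finPcharP F p 1) => //; rewrite expn1. Qed.

(* A matrix of determinant 1 is determined by its first row and one entry of the second. *)
Lemma card_SL_le : (#|SL_group 2 F| <= p * (p ^ 2 - 1))%N.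
Proof.
pose h (g : GL) : F * (F * F) := (if GLval g 0 0 == 0 then GLval g 1 1 else GLval g 1 0, (GLval g 0 0, GLval g 0 1)).
have hinj : {in SL_group 2 F &, injective h}.
  move=> g g'; rewrite !inE !det_mx2 => /eqP d1 /eqP d2 [e1 e2 e3]; apply: GL_inj.
  rewrite [LHS]mx2E [RHS]mx2E e3; rewrite -e2 in e1 d2 *; rewrite -e3 in d2.
  move: e1; have [z|nz] := eqVneq (GLval g 0 0) 0 => e1.
    rewrite e1; congr mx2; move: d1 d2; rewrite z !mul0r !sub0r => d1 d2.
    have nz1 : GLval g 0 1 != 0 by apply: contraTneq isT => z1; move/eqP: d1; rewrite z1 mul0r oppr0 eq_sym oner_eq0.
    by apply: (mulfI nz1); apply: oppr_inj; rewrite d1 d2.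
  rewrite e1; congr mx2; apply: (mulfI nz); rewrite -e1 in d2.
  by apply: (addIr (- (GLval g 0 1 * GLval g 1 0))); rewrite d1 d2.
rewrite -(card_in_imset hinj).
have sub : h @: SL_group 2 F \subset setX [set: F] [set~ (0, 0)].
  apply/subsetP=> _ /imsetP[g Sg ->]; rewrite !inE /= /h /= xpair_eqE; apply/negP=> /andP[/eqP z0 /eqP z1].
  by move: Sg; rewrite inE det_mx2 z0 z1 !mul0r subr0 eq_sym oner_eq0.
apply: leq_trans (subset_leq_card sub) _; rewrite cardsX cardsT card_Fp cardsC1 card_prod card_Fp.
by rewrite subn1 mulnn.
Qed.

Hypothesis p_odd : odd p.

Lemma neg1_neq1 : (-1 : F) != 1.
Proof.
rewrite eq_sym -subr_eq0 opprK -[1 + 1]/(2%:R : F) -(dvdn_pcharf charFp).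
by apply: contraTN p_odd => /(dvdn_leq (ltn0Sn _)); move: (prime_gt1 p_pr); case: (p) => [|[|[|]]].
Qed.

Lemma det_neg1 : \det (- 1 : 'M[F]_2) = 1.
Proof. by rewrite det_mx2 !mxE /= !mulr1n !mulr0n oppr0 mul0r subr0 mulrNN mulr1. Qed.

(** The kernel on SL_2 contains -1, which differs from 1 as p is odd. An upper bound is enough:
    equality comes later from a subgroup of that order. *)
Lemma card_psl_im_le : (2 * #|psl_im| <= p * (p ^ 2 - 1))%N.
Proof.
apply: leq_trans card_SL_le; rewrite -(card_isog (first_isog_loc pgl (subsetT (SL_group 2 F)))).
have ss : ('ker_(SL_group 2 F) pgl \subset SL_group 2 F)%g by apply: subsetIl.
have nk : (SL_group 2 F \subset 'N('ker_(SL_group 2 F) pgl))%g.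
  by rewrite normsI ?normG // (subset_trans (subsetT _) (ker_norm _)).
rewrite card_quotient //.
rewrite -(Lagrange ss) leq_mul2r; apply/orP; right.
have dn : \det (- 1 : 'M[F]_2) != 0 by rewrite det_neg1 nz1.
have sub : [set 1%g; mkGL dn] \subset ('ker_(SL_group 2 F) pgl)%g.
  rewrite subUset !sub1set group1 /= in_setI; apply/andP; split; first by rewrite inE mkGLE det_neg1.
  by apply/ker_pglP; exists (-1); rewrite mkGLE raddfN.
apply: leq_trans (subset_leq_card sub); rewrite cards2; case: eqP => // e.
have := congr1 (fun g : GL => GLval g 0 0) e; rewrite mkGLE GL_1E !mxE /= => /eqP.
by rewrite eq_sym (negPf neg1_neq1).
Qed.

Definition scal (a : F) : GL := insubd (1%g : GL) (a%:M : 'M[F]_2).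

Lemma scalE a : a != 0 -> GLval (scal a) = a%:M.
Proof.
move=> nza; have U : (a%:M : 'M[F]_2) \is a GRing.unit.
  by rewrite -[_ \is a GRing.unit]/(a%:M \in unitmx) unitmxE det_scalar unitfE expf_neq0.
by rewrite /scal /insubd insubT.
Qed.

Lemma card_pgl_im_le : (#|pgl_im| <= p * (p ^ 2 - 1))%N.
Proof.
have kn : ('GL_2[F] \subset 'N('ker pgl))%g by apply: ker_norm.
have iso := card_isog (first_isog pgl); rewrite card_quotient // in iso.
have kc : (p.-1 <= #|('ker pgl)%g|)%N.
  have <- : #|[set~ (0 : F)]| = p.-1 by rewrite cardsC1 card_Fp.
  have inj : {in [set~ (0 : F)] &, injective scal}.
    move=> a b; rewrite !inE => nza nzb /(congr1 (fun g : GL => GLval g 0 0)).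
    by rewrite !scalE // !mxE eqxx !mulr1n.
  rewrite -(card_in_imset inj); apply: subset_leq_card; apply/subsetP=> _ /imsetP[a nza ->].
  by rewrite !inE in nza; apply/ker_pglP; exists a; rewrite scalE.
have cG := Lagrange (subsetT ('ker pgl)%G); have := card_GL_2 F; rewrite card_Fp -/pgl.
have p1 : (0 < p.-1)%N by move: (prime_gt1 p_pr); case: (p) => [|[]].
have e2 : (p * p.-1 ^ 2 * p.+1 = p.-1 * (p * (p ^ 2 - 1)))%N.
  have -> : (p ^ 2 - 1 = p.-1 * p.+1)%N by rewrite -mulnn; case: (p) => // q; lia.
  by rewrite -mulnn; ring.
rewrite e2 -cG => e3; rewrite -(leq_pmul2l p1) -e3 /pgl_im /= -iso leq_mul2r kc orbT //.
Qed.

Section TraceInvariant.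
Implicit Types g h : GL.
(** Invariant under conjugation and under scalars, hence a class function on PGL_2. *)
Definition tau g : F := \tr (GLval g) ^+ 2 / \det (GLval g).

Lemma tr_mx2 (A : 'M[F]_2) : \tr A = A 0 0 + A 1 1.
Proof. by rewrite /mxtrace big_ord_recl big_ord1; congr (_ + A _ _); apply: val_inj. Qed.

Lemma tauJ g h : tau (g ^ h)%g = tau g.
Proof.
have e : GLval (g ^ h)%g = GLval h^-1%g *m (GLval g *m GLval h) by rewrite conjgE.
have eV : GLval h *m GLval h^-1%g = 1%:M by rewrite -[LHS]/(GLval (h * h^-1)%g) mulgV.
rewrite /tau e mxtrace_mulC -mulmxA eV mulmx1 !det_mulmx mulrCA -det_mulmx.
have -> : GLval h^-1%g *m GLval h = 1%:M by rewrite -[LHS]/(GLval (h^-1 * h)%g) mulVg.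
by rewrite det1 mulr1.
Qed.

Lemma tau_scal a g h : a != 0 -> GLval g = a *: GLval h -> tau g = tau h.
Proof.
move=> nza e; rewrite /tau e mxtraceZ detZ exprMn invfM mulrACA divff ?mul1r //.
by rewrite expf_neq0.
Qed.

Lemma pgl_eqP g h : pgl g = pgl h -> exists2 a, a != 0 & GLval g = a *: GLval h.
Proof.
move=> e; have /ker_pglP[a ae] : (g * h^-1)%g \in ('ker pgl)%g.
  apply/(kerP _ (in_setT _)); rewrite morphM ?morphV ?in_setT //= -[actperm _ g]/(pgl g) e.
  exact: mulgV.
exists a.
  apply: contraNneq (GL_det_neq0 (g * h^-1)%g) => a0; rewrite ae a0 det_scalar expr0n //.
by rewrite -mul_scalar_mx -ae -[RHS]/(GLval (g * h^-1 * h)%g) mulgKV.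
Qed.

Lemma tau_pgl g h k : pgl h = (pgl g ^ pgl k)%g -> tau h = tau g.
Proof.
have -> : (pgl g ^ pgl k = pgl (g ^ k))%g by rewrite -morphJ ?in_setT.
by case/pgl_eqP=> a nza /(tau_scal nza)->; rewrite tauJ.
Qed.

(** Scalars multiply the determinant by a square. This second invariant separates the two classes on
    which [tau] is 0. *)
Definition sqclass (a b : F) := exists c, b = c ^+ 2 * a.

Lemma det_pgl g h k : pgl h = (pgl g ^ pgl k)%g -> sqclass (\det (GLval g)) (\det (GLval h)).
Proof.
have -> : (pgl g ^ pgl k = pgl (g ^ k))%g by rewrite -morphJ ?in_setT.
case/pgl_eqP=> a nza e; exists a; rewrite e detZ; congr (_ * _).
have -> : GLval (g ^ k)%g = GLval k^-1%g *m (GLval g *m GLval k) by rewrite conjgE.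
rewrite !det_mulmx mulrCA -det_mulmx.
have -> : GLval k^-1%g *m GLval k = 1%:M by rewrite -[LHS]/(GLval (k^-1 * k)%g) mulVg.
by rewrite det1 mulr1.
Qed.

Lemma two_neq0 : (2%:R : F) != 0.
Proof. by have := neg1_neq1; rewrite eq_sym -subr_eq0 opprK. Qed.

Lemma fermat (a : F) : a != 0 -> a ^+ p.-1 = 1.
Proof.
move=> nza; apply: (mulfI nza); rewrite mulr1 -exprS prednK ?prime_gt0 //.
by rewrite -[in LHS]card_Fp expf_card.
Qed.

Lemma sqr_odd_pred : (p ^ 2 = (p.-1 * (p.+1)./2).*2.+1)%N.
Proof.
have := odd_double_half p; rewrite p_odd add1n => e.
rewrite -{}e; move: (p./2) => k; rewrite -pred_Sn -[(_.*2.+2)./2]/(_.*2./2.+1) doubleK -mulnn; lia.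
Qed.

Lemma p_ndvd : ~~ (p %| p ^ 2 - 1)%N.
Proof.
apply/negP=> pd; have : (p %| 1)%N.
  by rewrite -(@dvdn_addr (p ^ 2 - 1) p) // subnK ?expn_gt0 ?prime_gt0 // dvdn_exp.
by rewrite dvdn1 => /eqP p1; move: p_pr; rewrite p1.
Qed.

(* Completing the square: [g = t/2 + h] with [h ^ 2] a nonzero scalar, so [g ^ (p ^ 2) = g]. *)
Lemma pgl_p'elt g : tau g != 4%:R -> (p^'.-elt (pgl g))%g.
Proof.
move=> ng; pose t := \tr (GLval g); pose d := \det (GLval g).
pose h : 'M[F]_2 := GLval g - (t / 2%:R)%:M; pose de : F := t ^+ 2 / 4%:R - d.
have four : (4%:R : F) = 2%:R ^+ 2 by rewrite -natrX.
have nz4 : (4%:R : F) != 0 by rewrite four expf_neq0 // two_neq0.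
have h2 : h * h = de%:M.
  rewrite -[h * h]/(h *m h) [LHS]mx2_mul; apply/matrixP=> i j; rewrite [in LHS]mxE [RHS]mxE /h !mxE.
  rewrite /de /d /t det_mx2 tr_mx2.
  by case: i => [[|[|i]] ?] //; case: j => [[|[|j]] ?] //=; rewrite ?mulr1n ?mulr0n; field; rewrite ?nz4 ?two_neq0.
have nzde : de != 0.
  apply: contra ng; rewrite /de subr_eq0 => /eqP e; rewrite /tau -/t -/d -e.
  have nzt : t != 0.
    by apply: contraNneq (GL_det_neq0 g) => z; rewrite -/d -e z expr0n mul0r.
  by apply/eqP; field; rewrite nz4 nzt.
have hp2 : h ^+ (p ^ 2) = h.
  have hh : h ^+ 2 = de%:M by rewrite expr2 h2.
  have h0 n m : n = (p.-1 * m).*2.+1 -> h ^+ n = h.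
    move->; rewrite exprS -mul2n exprM hh -rmorphXn /= exprM fermat // expr1n.
    by rewrite mulr1.
  exact: h0 sqr_odd_pred.
have gp2 : GLval g ^+ (p ^ 2) = GLval g :> 'M[F]_2.
  have eg : GLval g = (t / 2%:R)%:M + h :> 'M[F]_2 by rewrite addrC subrK.
  have ch : GRing.comm ((t / 2%:R)%:M : 'M[F]_2) h.
    by rewrite /GRing.comm -[LHS]/(_ *m h) -[RHS]/(h *m _) scalar_mxC.
  have chM : p \in [pchar 'M[F]_2] := rmorph_pchar (@scalar_mx F 2) charFp.
  rewrite -mulnn exprM eg.
  have frob (A B : 'M[F]_2) : GRing.comm A B -> (A + B) ^+ p = A ^+ p + B ^+ p.
    by move=> cAB; rewrite -[LHS]/(pFrobenius_aut chM (A + B)) pFrobenius_autD_comm.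
  have fs (a : F) : (a%:M : 'M[F]_2) ^+ p = a%:M.
    rewrite -rmorphXn /=; congr (_%:M); have [->|nza] := eqVneq a 0.
      by rewrite expr0n; case: (p) (prime_gt0 p_pr).
    by rewrite -(prednK (prime_gt0 p_pr)) exprS fermat ?mulr1.
  rewrite (frob _ _ ch) fs frob; last exact: commrX.
  by rewrite fs -exprM mulnn hp2.
have o1 : (g ^+ (p ^ 2 - 1) = 1)%g.
  apply: (mulgI g); rewrite -expgS mulg1 subn1 prednK ?expn_gt0 ?prime_gt0 //.
  by apply: GL_inj; rewrite -[RHS]gp2; elim: (p ^ 2)%N => [|n IHn]; rewrite ?expgS ?GL_ME ?IHn ?exprS ?expg0 ?expr0 ?GL_1E.
have dv : (#[pgl g]%g %| p ^ 2 - 1)%N by rewrite order_dvdn -morphX ?in_setT // o1 morph1.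
by apply: (pnat_dvd dv); rewrite p'natE // p_ndvd.
Qed.
End TraceInvariant.
End Projective.

Lemma PSL2_isog p : PSL2 p \isog psl_im 'F_p.
Proof. by rewrite /PSL2 /= center_SL; apply: first_isog_loc; apply: subsetT. Qed.

Lemma PGL2_isog p : PGL2 p \isog pgl_im 'F_p.
Proof. by rewrite /PGL2 /= center_GL; apply: first_isog. Qed.

(** * Regular classes of PSL_2(p) and PGL_2(p) *)

Section CountClasses.
Local Open Scope group_scope.
Variables (gT : finGroupType) (G : {group gT}) (p : nat).

Lemma kp'_ge (T : finType) (A : {set T}) (f : T -> gT) :
  {in A, forall a, f a \in G /\ p^'.-elt (f a)} ->
  {in A &, forall a b, f a \in f b ^: G -> a = b} -> #|A| <= kp' p G.
Proof.
move=> fG fJ; have inj : {in A &, injective (fun a => f a ^: G)}.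
  by move=> a b Aa Ab /= e; apply: (fJ a b Aa Ab); rewrite -e class_refl.
rewrite -(card_in_imset inj); apply: subset_leq_card; apply/subsetP=> _ /imsetP[a Aa ->].
by have [Ga pa] := fG a Aa; apply/imsetP; exists (f a); rewrite // inE Ga.
Qed.
End CountClasses.

Section ProjectiveClasses.
Local Open Scope ring_scope.
Variables (F : finFieldType) (p : nat).
Hypotheses (p_pr : prime p) (card_F : #|F| = p) (p_odd : odd p).
Notation GL := {'GL_2[F]}.

Lemma pglM g h : (pgl (g * h) = pgl g * pgl h :> {perm option F})%g.
Proof. by rewrite -[pgl _]/(actperm_morphism _ _) morphM ?in_setT. Qed.

Lemma pgl1 : (pgl 1 = 1 :> {perm option F})%g.
Proof. by apply: (mulgI (pgl 1%g)); rewrite -pglM !mulg1. Qed.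

Definition companion (t d : F) : GL := insubd (1%g : GL) (mx2 0 1 (- d) t).

Lemma companionE t d : d != 0 -> GLval (companion t d) = mx2 0 1 (- d) t.
Proof.
move=> nzd; have U : mx2 0 1 (- d) t \is a GRing.unit.
  rewrite -[_ \is a GRing.unit]/(_ \in unitmx) unitmxE det_mx2 !mxE /= unitfE.
  by rewrite mul0r mul1r sub0r opprK.
by rewrite /companion /insubd insubT.
Qed.

Lemma det_companion t d : d != 0 -> \det (GLval (companion t d)) = d.
Proof. by move=> nzd; rewrite companionE // det_mx2 !mxE /= mul0r mul1r sub0r opprK. Qed.

Lemma tau_companion t d : d != 0 -> tau (companion t d) = t ^+ 2 / d.
Proof.
by move=> nzd; rewrite /tau det_companion // companionE // tr_mx2 !mxE /= add0r.
Qed.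

Lemma tau1 : tau (1%g : GL) = 4%:R :> F.
Proof. by rewrite /tau GL_1E mxtrace1 det1 divr1 -natrX. Qed.

(* The classes are separated by the invariant [tau], which is [4] at the identity. *)
Definition tau_rep (c t d : F) : GL := if c == 4%:R then 1%g else companion t d.

Lemma tau_repE c t d : d != 0 -> c = t ^+ 2 / d -> tau (tau_rep c t d) = c.
Proof. by move=> nzd e; rewrite /tau_rep; case: eqP => [->|_]; rewrite ?tau1 ?tau_companion. Qed.

Lemma tau_rep_p'elt c t d : d != 0 -> c = t ^+ 2 / d -> (p^'.-elt (pgl (tau_rep c t d)))%g.
Proof.
move=> nzd e; rewrite /tau_rep; case: eqP => [_|/eqP nc]; first by rewrite pgl1 /p_elt order1.
by apply: (pgl_p'elt p_pr card_F p_odd); rewrite tau_companion // -e.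
Qed.

Lemma pgl_im_conj (A : {set GL}) g h : (pgl h \in pgl g ^: (@pgl F @* A) -> exists k, pgl h = pgl g ^ pgl k)%g.
Proof. by case/imsetP=> _ /morphimP[k _ _ ->] e; exists k. Qed.

(** Determinant 1 and trace t give the invariant t^2, so the (p + 1)/2 squares index distinct
    regular classes. *)
Lemma kp'_psl_im : (p.+1 <= 2 * kp' p (psl_im F))%N.
Proof.
pose A := [set t ^+ 2 | t in [set: F]].
pose s c : F := if [pick t : F | t ^+ 2 == c] is Some t then t else 0.
have sE c : c \in A -> s c ^+ 2 = c.
  by case/imsetP=> t _ ->; rewrite /s; case: pickP => [u /eqP//|/(_ t)]; rewrite eqxx.
have n1 := oner_neq0 F.
have cA : (#|A| <= kp' p (psl_im F))%N.
  apply: (kp'_ge (f := fun c => pgl (tau_rep c (s c) 1))) => [c Ac|c c' Ac Ac'].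
    split; last by apply: tau_rep_p'elt; rewrite // sE // divr1.
    apply: mem_morphim; rewrite ?inE // /tau_rep; case: ifP => _; first by rewrite GL_1E det1.
    by rewrite det_companion.
  case/pgl_im_conj=> k /tau_pgl; rewrite !tau_repE // ?sE ?divr1 //.
have : (#|F| <= 2 * #|A|)%N.
  rewrite mulnC -[leqRHS]sum_nat_const -cardsT -sum1_card.
  rewrite (partition_big_imset (fun t : F => t ^+ 2)) -/A.
  apply: leq_sum => c /imsetP[t _ ->]; rewrite sum1_card.
  apply: leq_trans (_ : #|[set t; - t]| <= 2)%N; last by rewrite cards2; case: eqP.
  by apply: subset_leq_card; apply/subsetP=> u; rewrite unfold_in !inE eqf_sqr.
by rewrite card_F; have := odd_double_half p; rewrite p_odd; lia.
Qed.

Lemma nonsquare : exists d : F, forall c, c ^+ 2 != d.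
Proof.
have [/forallP sq|] := boolP [forall d : F, [exists c : F, c ^+ 2 == d]]; last first.
  by case/forallPn=> d /existsPn; exists d.
have inj : {in F &, injective (fun c : F => c ^+ 2)}.
  apply/image_injP/eqP/eq_card => d; apply/imageP.
  by case/existsP: (sq d) => c /eqP<-; exists c.
have := inj (-1) 1 isT isT; rewrite sqrrN => /(_ erefl)/eqP.
by rewrite (negPf (neg1_neq1 p_pr card_F p_odd)).
Qed.

Lemma kp'_pgl_im : (p.+1 <= kp' p (pgl_im F))%N.
Proof.
have [e eN] := nonsquare; have nze : e != 0 by apply: contraNneq (eN 0) => ->; rewrite expr0n.
have n1 := oner_neq0 F; have n4 : 0 != 4%:R :> F.
  by rewrite eq_sym (natrX _ 2 2) expf_neq0 // (two_neq0 p_pr card_F p_odd).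
(* Trace [c] and determinant [dd c] give the invariant [c], also at 0. *)
pose dd (c : F) := if c == 0 then 1 else c.
have nzd c : dd c != 0 by rewrite /dd; case: ifP => // /negbT.
have ddE c : c = c ^+ 2 / dd c.
  by rewrite /dd; case: eqP => [->|/eqP nz]; rewrite ?expr0n ?mul0r // expr2 mulfK.
(* The index [None] has trace 0 and nonsquare determinant, a second class with invariant 0. *)
pose f (o : option F) : GL := if o is Some c then tau_rep c c (dd c) else companion 0 e.
have fN : tau (f None) = 0 by rewrite tau_companion // expr0n mul0r.
have f0 : \det (GLval (f (Some 0))) = 1.
  by rewrite /f /tau_rep (negPf n4) det_companion //= /dd eqxx.
have -> : p.+1 = #|[set: option F]| by rewrite cardsT card_option card_F.
apply: (kp'_ge (f := fun o => pgl (f o))) => [o _|o o' _ _].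
  split; first by apply: mem_morphim; rewrite ?inE.
  case: o => [c|]; first exact: tau_rep_p'elt.
  by apply: (pgl_p'elt p_pr card_F p_odd); rewrite fN.
case/pgl_im_conj=> k hk; have := tau_pgl hk; have [c] := det_pgl hk.
case: o o' {hk} => [a|] [b|] //; rewrite ?fN /= ?tau_repE // => ce e0.
- by rewrite e0.
- move: ce; rewrite e0 f0 det_companion // => ce; case/eqP: (eN c^-1).
  have nzc : c != 0 by apply: contra_eqN ce => /eqP->; rewrite expr0n mul0r.
  by apply: (mulfI (expf_neq0 2 nzc)); rewrite -ce exprVn divff // expf_neq0.
move: ce; rewrite -e0 f0 det_companion // mulr1 => ce.
by case/eqP: (eN c).
Qed.

(** Commuting in the quotient means commuting up to a scalar [a]; comparing entries with an
    elementary matrix forces a = 1. *)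
Lemma center_psl_im : ('Z(psl_im F) = 1)%g.
Proof.
apply/trivgP/subsetP=> _ /centerP[/morphimP[g _ Sg ->] cg].
have SU : pgl (gU F) \in psl_im F by apply: mem_morphim; rewrite ?inE // mkGLE det_elemU.
have SL : pgl (gL F) \in psl_im F by apply: mem_morphim; rewrite ?inE // mkGLE det_elemL.
have cUL h : commute (pgl g) (pgl h) ->
    (forall a, a *: (GLval h *m GLval g) = GLval g *m GLval h -> a = 1) -> commute g h.
  move=> cgh ha; have [a nza e] : exists2 a, a != 0 & GLval (g * h)%g = a *: GLval (h * g)%g.
    by apply: pgl_eqP; rewrite !pglM.
  by apply: GL_inj; rewrite e (ha a) ?scale1r // -e.
suff [a ga] : exists a, GLval g = a%:M.
  by rewrite inE; apply/eqP/mker/ker_pglP; exists a.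
have := GL_det_neq0 g; rewrite det_mx2 => dg.
apply: comm_scalar; apply: cUL (cg _ _) _ => // a /matrixP e.
  move: (e 1 0) (e 1 1); rewrite /gU mkGLE !mx2_mul !mxE /= !(mul0r, mulr0, mulr1, mul1r, add0r, addr0) => e1 e2.
  have [g10|nz] := eqVneq (GLval g 1 0) 0; last by apply: (mulIf nz); rewrite e1 mul1r.
  rewrite g10 add0r in e2; rewrite g10 mulr0 subr0 mulf_eq0 negb_or in dg; case/andP: dg => _ nz.
  by apply: (mulIf nz); rewrite e2 mul1r.
move: (e 0 0) (e 0 1); rewrite /gL mkGLE !mx2_mul !mxE /= !(mul0r, mulr0, mulr1, mul1r, add0r, addr0) => e1 e2.
have [g01|nz] := eqVneq (GLval g 0 1) 0; last by apply: (mulIf nz); rewrite e2 mul1r.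
rewrite g01 addr0 in e1; rewrite g01 mul0r subr0 mulf_eq0 negb_or in dg; case/andP: dg => nz _.
by apply: (mulIf nz); rewrite e1 mul1r.
Qed.
End ProjectiveClasses.

Lemma pred_mul_succ n : 0 < n -> n.-1 * n.+1 = n ^ 2 - 1.
Proof. by case: n => // n _; rewrite -mulnn; lia. Qed.

Section MobiusMap.
Local Open Scope ring_scope.
Variables (F : finFieldType) (a b c d : F).
Hypothesis dd : \det (mx2 a b c d) != 0.

Lemma pgl_mx2_Some u : pgl (mkGL dd) (Some u) =
  if u * b + d == 0 then None else Some ((u * a + c) / (u * b + d)).
Proof. by rewrite pglE mkGLE /= row2_mul /toP row2_1 row2_0 !mxE /= !mul1r. Qed.

Lemma pgl_mx2_None : pgl (mkGL dd) None = if b == 0 then None else Some (a / b).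
Proof. by rewrite pglE mkGLE /= row2_mul /toP row2_1 row2_0 !mxE /= !mul1r !mul0r !addr0. Qed.
End MobiusMap.

(** * The Moebius action on Sylow subgroups *)

Section Identification.
Local Open Scope group_scope.
Variables (gT : finGroupType) (H K : {group gT}) (x w : gT) (c0 : nat).
Local Notation p := #[x].
Local Notation P := <[x]>.
Local Notation N := 'N_K(<[x]>).
Local Notation F := 'F_p.
Hypotheses (p_pr : prime p) (nKH : K <| H) (sylP : p.-Sylow(K) P).
Hypotheses (indN : #|K : N| = p.+1) (Kw : w \in K).
Hypothesis wwN : w * w \in N.
Hypothesis wN : w \notin N.
Hypothesis c0p : ~~ (p %| c0)%N.
Hypothesis wxw : forall b, ~~ (p %| b)%N ->
  exists b', w * x ^+ b * w * (w * x ^+ b')^-1 \in N /\ (b * b' = c0 %[mod p])%N.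
Hypothesis cosK : forall g, g \in K -> g \notin N -> exists b, g * (w * x ^+ b)^-1 \in N.

Let sKH : K \subset H := normal_sub nKH.
Let Kx : x \in K.
Proof. by rewrite -cycle_subG (pHall_sub sylP). Qed.

(* [pt] identifies the projective line with the Sylow p-subgroups of [K]. *)
Definition ptn (n : nat) : {set gT} := P :^ (w * x ^+ n).
Definition pt (o : option F) : {set gT} := if o is Some b then ptn b else P.

Lemma ptn_mod n : pt (Some (n%:R : F)%R) = ptn n.
Proof. by rewrite /pt /ptn val_Fp_nat // expg_mod_order. Qed.

Lemma conjP_N g h : g * h^-1 \in N -> P :^ g = P :^ h.
Proof. by rewrite inE => /andP[_ /normP e]; rewrite -[in LHS](mulgKV h g) conjsgM e. Qed.

Lemma pt_sylow k : k \in K -> exists o, pt o = P :^ k.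
Proof.
move=> Kk; have [Nk|nk] := boolP (k \in N).
  by exists None; case/setIP: Nk => _ /normP->.
have [b eb] := cosK Kk nk; exists (Some (b%:R : F)%R); rewrite ptn_mod.
by rewrite (conjP_N eb).
Qed.

Lemma pt_K o : exists2 k, k \in K & pt o = P :^ k.
Proof.
case: o => [b|]; last by exists 1; rewrite ?group1 ?conjsg1.
by exists (w * x ^+ b); rewrite ?groupM ?groupX.
Qed.

(** The p + 1 points reach all Sylow subgroups, of which there are |K : N| = p + 1. *)
Lemma pt_inj : injective pt.
Proof.
suff /imset_injP inj : #|pt @: setT| == #|[set: option F]|.
  by move=> o o' e; apply: inj; rewrite ?in_setT.
rewrite eqn_leq leq_imset_card cardsT card_option card_Fp // -indN -(card_Syl sylP).
have <- : #|[set (R : {set gT}) | R : {group gT} in 'Syl_p(K)]| = #|'Syl_p(K)|.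
  by apply: card_imset; apply: val_inj.
apply: subset_leq_card; apply/subsetP=> R0 /imsetP[R sylR ->{R0}]; rewrite inE in sylR.
have [k Kk ->] := Sylow_trans sylP sylR; have [o <-] := pt_sylow Kk.
by apply: imset_f; rewrite in_setT.
Qed.

Lemma pt_conj h o : h \in H -> exists o', pt o' = pt o :^ h.
Proof.
move=> Hh; have [k Kk ->] := pt_K o; have nKh : h \in 'N(K) := subsetP (normal_norm nKH) h Hh.
have sylR : p.-Sylow(K) ((P :^ k) :^ h).
  by rewrite -{1}(normP nKh) pHallJ2 -{1}(conjGid Kk) pHallJ2.
have [k' Kk' ->] := Sylow_trans sylP (sylR : p.-Sylow(K) ((<[x]> :^ k) :^ h)%G).
exact: pt_sylow.
Qed.

(** Conjugation of Sylow subgroups carried to the line; outside [H] it is the identity, because an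
    action must be injective at every element. *)
Definition mobius_map (o : option F) (h : gT) : option F :=
  if [pick o' | (h \in H) && (pt o' == pt o :^ h)] is Some o' then o' else o.

Lemma mobius_mapE h o : h \in H -> pt (mobius_map o h) = pt o :^ h.
Proof.
move=> Hh; rewrite /mobius_map; case: pickP => [o' /andP[_ /eqP//]|no].
by have [o' e] := pt_conj o Hh; have := no o'; rewrite Hh e eqxx.
Qed.

Lemma mobius_map_is_action : is_action H mobius_map.
Proof.
split=> [h o o'|o h h' Hh Hh']; last first.
  by apply: pt_inj; rewrite !mobius_mapE ?groupM // conjsgM.
have [Hh|nh] := boolP (h \in H).
  move=> e; apply: pt_inj; apply: (@conjsg_inj _ h).
  by rewrite -!mobius_mapE // e.
have mo o1 : mobius_map o1 h = o1 by rewrite /mobius_map; case: pickP => // o2; rewrite (negPf nh).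
by rewrite !mo.
Qed.

Definition mobius_act := Action mobius_map_is_action.
Definition theta := actperm mobius_act.

Lemma thetaE h o : h \in H -> pt (theta h o) = pt o :^ h.
Proof. by move=> Hh; rewrite actpermE mobius_mapE. Qed.

Lemma thetaM h h' : h \in H -> h' \in H -> theta (h * h') = theta h * theta h'.
Proof. by move=> Hh Hh'; rewrite -[theta]/(actperm_morphism mobius_act : _ -> _) morphM. Qed.

Let Hx : x \in H := subsetP sKH x Kx.
Let Hw : w \in H := subsetP sKH w Kw.

Lemma F_natr (b : F) : exists n, b = n%:R%R.
Proof. by exists b; rewrite natr_Zp. Qed.

Lemma natrF_eq0 n : (n%:R == 0 :> F)%R = (p %| n)%N.
Proof. by rewrite (dvdn_pcharf (pchar_Fp p_pr)). Qed.

Lemma theta_xn n o : theta (x ^+ n) o = if o is Some b then Some (b + n%:R)%R else None.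
Proof.
apply: pt_inj; rewrite thetaE ?groupX //; case: o => [b|].
  have [m ->] := F_natr b; rewrite -natrD !ptn_mod /ptn -conjsgM -mulgA expgD //.
by apply/normP; rewrite groupX // -cycle_subG normG.
Qed.

Lemma theta_x : theta x = pgl (gL F).
Proof.
apply/permP=> o; have := theta_xn 1 o; rewrite expg1 => ->.
case: o => [b|]; first by rewrite pgl_mx2_Some mulr0 add0r oner_eq0 mulr1 divr1.
by rewrite pgl_mx2_None eqxx.
Qed.

Lemma det_inv_mx : (\det (mx2 0 1 (c0%:R : F) 0) != 0)%R.
Proof. by rewrite det_mx2 !mxE /= mul0r mul1r sub0r oppr_eq0 natrF_eq0. Qed.

(** The relation b b' = c0 says that [w] acts as b -> c0 / b. *)
Lemma theta_w : theta w = pgl (mkGL det_inv_mx).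
Proof.
apply/permP=> o; apply: pt_inj; rewrite thetaE // ?(pgl_mx2_Some, pgl_mx2_None).
case: o => [b|]; rewrite ?(pgl_mx2_Some, pgl_mx2_None); last first.
  by rewrite oner_eq0 mul0r (ptn_mod 0) /ptn mulg1.
rewrite mulr1 addr0 mulr0 add0r.
have [n ->] := F_natr b; rewrite ptn_mod natrF_eq0.
case: ifP => [|/negbT] pn.
  rewrite /ptn; have -> : x ^+ n = 1 by apply/eqP; rewrite -order_dvdn.
  by rewrite mulg1 -conjsgM; apply/normP; case/setIP: wwN.
have [b' [e eb]] := wxw pn; rewrite /ptn -conjsgM (conjP_N e) -/(ptn b') -ptn_mod.
congr (pt (Some _)); apply: (mulfI (_ : n%:R != 0)%R); first by rewrite natrF_eq0.
rewrite mulrCA divff ?natrF_eq0 // mulr1 -natrM.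
by apply: val_inj; rewrite /= !val_Fp_nat //.
Qed.

(** Such an [h] normalizes [P], so x^h = x^c for some c, and it multiplies every finite point by
    c. *)
Lemma theta_fix h : h \in H -> theta h None = None -> theta h (Some 0%R) = Some 0%R ->
  theta h \in pgl_im F.
Proof.
move=> Hh e1 e2; have hP : P :^ h = P by have := thetaE None Hh; rewrite e1.
have hw : P :^ (w * h) = P :^ w.
  by have := thetaE (Some 0%R) Hh; rewrite e2 /= /ptn mulg1 -conjsgM.
have /cycleP[c xc] : x ^ h \in P by rewrite -hP memJ_conjg cycle_id.
have pc : ~~ (p %| c)%N.
  rewrite order_dvdn -xc conjg_eq1 -order_eq1; apply: contraTneq p_pr => ->; exact: isT.
have dc : (\det (mx2 (c%:R : F) 0 0 1) != 0)%R by rewrite det_mx2 !mxE /= mulr1 mul0r subr0 natrF_eq0.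
have -> : theta h = pgl (mkGL dc); last by rewrite mem_morphim ?in_setT.
apply/permP=> o; apply: pt_inj; rewrite thetaE // ?(pgl_mx2_Some, pgl_mx2_None).
case: o => [b|]; rewrite ?(pgl_mx2_Some, pgl_mx2_None); last by rewrite eqxx.
rewrite mulr0 add0r oner_eq0 addr0 divr1; have [n ->] := F_natr b; rewrite -natrM !ptn_mod /ptn.
rewrite -conjsgM -mulgA (conjgC (x ^+ n)) conjXg xc -expgM mulgA (conjsgM _ (w * h)) hw -conjsgM.
by rewrite mulnC.
Qed.

(** Multiplication by powers of [x] and by the inverse of [w] brings any element to one fixing
    infinity and 0. *)
Lemma theta_pgl h : h \in H -> theta h \in pgl_im F.
Proof.
have thx n : theta (x ^+ n) \in pgl_im F.
  rewrite -[theta]/(actperm_morphism mobius_act : _ -> _) morphX //= -/theta groupX // theta_x.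
  by rewrite mem_morphim ?in_setT.
have thw : theta w \in pgl_im F by rewrite theta_w mem_morphim ?in_setT.
have wN0 : theta w None = Some 0%R.
  by apply: pt_inj; rewrite thetaE // -[0%R]/(0%:R : F)%R ptn_mod /ptn mulg1.
have neg b : exists n, (b + n%:R)%R = 0%R :> F.
  by have [n e] := F_natr (- b)%R; exists n; rewrite -e subrr.
have step2 h1 : h1 \in H -> theta h1 None = None -> theta h1 \in pgl_im F.
  move=> Hh1 e1; case e2: (theta h1 (Some 0%R)) => [b|]; last first.
    by have : Some 0%R = None :> option F by apply: (@perm_inj _ (theta h1)); rewrite e1.
  have [n en] := neg b; rewrite -(groupMr _ (thx n)) -thetaM ?groupX //.
  apply: theta_fix; rewrite ?groupM ?groupX // thetaM ?groupX // permM ?e1 ?e2 theta_xn //.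
  by rewrite en.
have step1 h1 : h1 \in H -> theta h1 None = Some 0%R -> theta h1 \in pgl_im F.
  move=> Hh1 e1; have thV : theta w^-1 = (theta w)^-1.
    by rewrite -[theta]/(actperm_morphism mobius_act : _ -> _) morphV.
  rewrite -(groupMr _ (groupVr thw)) -thV -thetaM ?groupV //.
  by apply: step2; rewrite ?groupM ?groupV // thetaM ?groupV // permM e1 thV -wN0 permK.
move=> Hh; case e: (theta h None) => [b|]; last exact: step2.
have [n en] := neg b; rewrite -(groupMr _ (thx n)) -thetaM ?groupX //.
by apply: step1; rewrite ?groupM ?groupX // thetaM ?groupX // permM e theta_xn en.
Qed.

Hypothesis CNP : 'C_N(P) = P.

Lemma ker_theta_fix h : h \in 'ker theta -> h \in H /\ forall o, pt o :^ h = pt o.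
Proof.
move=> kh; have Hh := dom_ker kh; split=> // o; rewrite -thetaE //.
by rewrite [theta h](mker kh) perm1.
Qed.

Lemma ker_theta_normal : 'ker theta <| H.
Proof. exact: ker_normal. Qed.

(** The intersection normalizes [P], and its commutator with [P] lies in [P] and in the kernel,
    hence is trivial; so it lies in C_N(P) = P, which meets the kernel trivially. *)
Lemma ker_theta_TI : 'ker theta :&: K = 1.
Proof.
have TI : P :&: 'ker theta = 1.
  apply: prime_TIg; rewrite -?orderE //; apply/negP; rewrite cycle_subG => kx.
  have := theta_xn 1 (Some 0%R); rewrite expg1 [theta x](mker kx) perm1 add0r => /esym.
  by move=> /Some_inj/eqP; rewrite oner_eq0.
apply/trivgP; rewrite -TI subsetI subsetIl andbT.
have nP : 'ker theta :&: K \subset N.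
  apply/subsetP=> h /setIP[/ker_theta_fix[Hh fx] Kh]; rewrite inE Kh; apply/normP; exact: fx None.
have cP : [~: 'ker theta :&: K, P] \subset P :&: 'ker theta.
  rewrite subsetI commg_subr (subset_trans nP) ?subsetIr //=.
  rewrite (subset_trans (commSg _ (subsetIl _ _))) // commg_subl.
  by rewrite (subset_trans _ (normal_norm ker_theta_normal)) // cycle_subG.
rewrite TI in cP; have /commG1P cP' : [~: 'ker theta :&: K, P] = 1 by apply/trivgP.
have : 'ker theta :&: K \subset 'C_N(P) by rewrite subsetI nP.
by rewrite CNP.
Qed.

Lemma ker_theta : 'ker theta = 'C_H(K).
Proof.
apply/eqP; rewrite eqEsubset; apply/andP; split; last first.
  apply/subsetP=> h /setIP[Hh Ch]; apply/kerP=> //; apply/permP=> o; apply: pt_inj.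
  rewrite thetaE // perm1; have [k Kk ->] := pt_K o.
  have sub : P :^ k \subset K by rewrite -(conjGid Kk) conjSg cycle_subG.
  by apply/normP/(subsetP (cent_sub _))/(subsetP (centS sub)).
rewrite subsetI (normal_sub ker_theta_normal) /=.
have : [~: 'ker theta, K] \subset 'ker theta :&: K.
  rewrite subsetI commg_subl (subset_trans sKH (normal_norm ker_theta_normal)) commg_subr.
  by rewrite (subset_trans (normal_sub ker_theta_normal) (normal_norm nKH)).
by rewrite ker_theta_TI => /trivgP/commG1P.
Qed.

Hypothesis perfK : K^`(1) = K.
Hypothesis p_odd : odd p.
Hypothesis tN : (2 * #|N : P|)%N = p.-1.

Lemma theta_K_isog : K \isog theta @* K.
Proof.
apply: isog_trans (first_isog_loc _ sKH).
by rewrite (_ : 'ker_K theta = 1) ?quotient1_isog // setIC ker_theta_TI.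
Qed.

Lemma card_K : (2 * #|K| = p * (p ^ 2 - 1))%N.
Proof.
have sPN : P \subset N by rewrite subsetI (pHall_sub sylP) normG.
have sNK : N \subset K := subsetIl _ _.
rewrite -(Lagrange sNK) -(Lagrange sPN) -orderE mulnA mulnCA tN indN.
by rewrite -mulnA pred_mul_succ ?prime_gt0.
Qed.

(** Perfection puts the image inside the derived subgroup of PGL_2, so inside PSL_2; the orders then
    match. *)
Lemma theta_K : theta @* K = psl_im F.
Proof.
have sub : theta @* K \subset psl_im F.
  rewrite -perfK morphim_der //; apply: subset_trans (der_pgl_sub _); apply: dergS.
  by apply/subsetP=> _ /morphimP[h Hh _ ->]; apply: theta_pgl.
apply/eqP; rewrite eqEcard sub -(card_isog theta_K_isog) -(leq_pmul2l (ltn0Sn 1)) card_K.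
by apply: card_psl_im_le; rewrite ?card_Fp.
Qed.

Lemma K_isog : K \isog PSL2 p.
Proof.
have := theta_K_isog; rewrite theta_K => iso.
by apply: isog_trans iso _; rewrite isog_sym; apply: PSL2_isog.
Qed.

Lemma quo_isog : H / 'C_H(K) \isog theta @* H.
Proof. by rewrite -ker_theta; apply: first_isog. Qed.

Lemma theta_H_sub : theta @* H \subset pgl_im F.
Proof. by apply/subsetP=> _ /morphimP[h Hh _ ->]; apply: theta_pgl. Qed.

Lemma card_quo_le : (#|H / 'C_H(K)| <= 2 * #|K|)%N.
Proof.
rewrite (card_isog quo_isog) card_K; apply: leq_trans (subset_leq_card theta_H_sub) _.
by apply: card_pgl_im_le; rewrite ?card_Fp.
Qed.

(** The image of [H] lies between PSL_2(p) and PGL_2(p), whose order is at most twice that of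
    [K]. *)
Lemma quo_isog_cases : H / 'C_H(K) \isog PSL2 p \/ H / 'C_H(K) \isog PGL2 p.
Proof.
have cK : #|theta @* K| = #|K| by rewrite -(card_isog theta_K_isog).
have sub : theta @* K \subset theta @* H by rewrite morphimS.
have [e|ne] := eqVneq #|theta @* H| #|theta @* K|.
  left; apply: isog_trans quo_isog _; rewrite isog_sym.
  have eKH : theta @* K = theta @* H by apply/eqP; rewrite eqEcard sub e leqnn.
  by rewrite /= -eKH theta_K; apply: PSL2_isog.
right; apply: isog_trans quo_isog _; rewrite isog_sym.
suff e : theta @* H = pgl_im F by rewrite /= e; apply: PGL2_isog.
apply/eqP; rewrite eqEcard theta_H_sub /=.
apply: (@leq_trans (2 * #|K|)).
  by rewrite card_K; apply: card_pgl_im_le; rewrite ?card_Fp.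
rewrite -cK -(Lagrange sub) mulnC leq_mul2l orbC.
have : (0 < #|theta @* H : theta @* K|)%N by [].
case e: #|_ : _| => [|[|n]] // _; case/eqP: ne.
by rewrite -(Lagrange sub) e muln1.
Qed.
End Identification.

Section MobiusGroup.
Local Open Scope group_scope.

Theorem mobius_isog (gT : finGroupType) (H K : {group gT}) x :
  prime #[x] -> odd #[x] -> K <| H -> K^`(1) = K -> mobius_data K x ->
  [/\ K \isog PSL2 #[x],
      H / 'C_H(K) \isog PSL2 #[x] \/ H / 'C_H(K) \isog PGL2 #[x]
    & (#|H / 'C_H(K)| <= 2 * #|K|)%N].
Proof.
move=> p_pr p_odd nKH perfK [sylP indN tN CNP [w [c0 [Kw wN wwN c0p [wxw cosK]]]]].
split.
- by eapply K_isog; eassumption.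
- by eapply quo_isog_cases; eassumption.
by eapply card_quo_le; eassumption.
Qed.
End MobiusGroup.

Lemma sum_gt0P (I : finType) (P : pred I) (F : I -> nat) :
  (0 < \sum_(i | P i) F i)%N -> exists2 i, P i & (0 < F i)%N.
Proof.
rewrite lt0n sum_nat_eq0 => /forallPn[i]; rewrite negb_imply -lt0n => /andP[Pi Fi].
by exists i.
Qed.

(** * Class numbers of simple groups *)

Section DegreeCounting.
Local Open Scope nat_scope.
Variables (I : finType) (P : pred I).

(** [d] are the degrees and [b] the multiplicities of the eigenvalue -1 of an involution. From b >=
    2, n is at least 4 times the sum of the degrees, which suffices once their excesses over 3 add
    up to 3; the few other cases are excluded by arithmetic. *)
Lemma even_degree_count (d b : I -> nat) n :
  (forall i, P i -> [/\ ~~ odd (b i), 0 < b i, b i < d i & d i %| n]) ->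
  n = 1 + \sum_(i | P i) d i * d i -> n = 2 * \sum_(i | P i) d i * b i ->
  12 * (1 + #|P|) <= n.
Proof.
move=> bd n1 n2.
have dE i : P i -> [/\ 2 <= b i, 3 <= d i & d i = 3 + (d i - 3)].
  case/bd=> ev b0 lt _; have b2 : 2 <= b i by case: (b i) ev b0 => [|[|q]].
  by split=> //; lia.
have sE : \sum_(i | P i) d i = 3 * #|P| + \sum_(i | P i) (d i - 3).
  rewrite mulnC -sum_nat_const -big_split /=.
  by apply: eq_big => [i|i /dE[_ _]//]; rewrite unfold_in.
have lo : 4 * \sum_(i | P i) d i <= n.
  rewrite n2 -[4]/(2 * 2) -mulnA leq_mul2l /= big_distrr /=; apply: leq_sum => i /dE[b2 _ _].
  by rewrite mulnC leq_mul2l b2 orbT.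
have [big|small] := leqP 3 (\sum_(i | P i) (d i - 3)); first by rewrite sE in lo; lia.
have fle i : P i -> d i - 3 <= \sum_(i | P i) (d i - 3) by move=> Pi; rewrite (bigD1 i) //= leq_addr.
have bv i : P i -> d i - 3 <= 1 -> b i = 2 /\ d i <= 4.
  move=> Pi f1; have [ev b0 lt _] := bd i Pi; have [b2 d3 _] := dE i Pi; split; last by lia.
  by move: ev b2 lt; case: (b i) => [|[|[|[|]]]] //=; lia.
have [/existsP[i0 /andP[Pi0 /eqP di0]]|/existsPn no] := boolP [exists i, P i && (d i == 5)]; last first.
  have f1 i : P i -> d i - 3 <= 1.
    by move=> Pi; have := no i; rewrite Pi /=; have := fle i Pi; have [_ d3 _] := dE i Pi; lia.
  (* All degrees are 3 or 4 with b = 2, so d^2 = 2 d b modulo 3, against the two formulas for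
     [n]. *)
  have : \sum_(i | P i) d i * d i = \sum_(i | P i) 2 * (d i * b i) %[mod 3].
    rewrite -modn_summ -[RHS]modn_summ; congr (_ %% 3); apply: eq_bigr => i Pi.
    have [-> d4] := bv i Pi (f1 i Pi); have [_ d3 _] := dE i Pi.
    by have [->|->] : d i = 3 \/ d i = 4 by lia.
  rewrite -big_distrr /= -n2 n1; move: (\sum_(i | P i) _) => q.
  by rewrite -{1}[q]add0n => /eqP; rewrite eqn_modDr.
have d3 i : P i && (i != i0) -> d i = 3 /\ b i = 2.
  case/andP=> Pi ni; have [_ d3 _] := dE i Pi.
  have : d i - 3 + 2 <= \sum_(i | P i) (d i - 3).
    by rewrite (bigD1 i0) //= (bigD1 i) ?Pi //= di0 addnA [5 - 3 + _]addnC leq_addr.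
  move=> le; have [b2 _] := bv i Pi ltac:(lia); split=> //; lia.
have [ev b0 lt _] := bd i0 Pi0.
have cP : #|P| = 1 + #|[pred i | P i && (i != i0)]|.
  rewrite (cardD1 i0) unfold_in Pi0; congr (_ + _); apply: eq_card => i.
  by rewrite !inE andbC.
move: n1 n2; rewrite (bigD1 i0) //= [in X in _ -> X -> _](bigD1 i0) //= di0.
rewrite (eq_bigr (fun=> 9)) => [|i /d3[-> _] //].
rewrite [in X in _ -> X -> _](eq_bigr (fun=> 6)) => [|i /d3[-> ->] //].
rewrite !sum_nat_const; set c := #|_|.
have cE : #|[pred i | P i && (i != i0)]| = c by apply: eq_card.
have bb : b i0 = 2 \/ b i0 = 4 by move: ev b0 lt; rewrite di0; case: (b i0) => [|[|[|[|[|]]]]] //=; auto.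
case: bb => -> n1 n2; last by lia.
(* From 26 + 9 c = 20 + 12 c; then n = 44, which the degree 3 does not divide. *)
have c2 : c = 2 by lia.
have : 0 < c by rewrite c2.
rewrite -cE => /card_gt0P[i]; rewrite inE => Pi.
have [_ _ _] := bd i (proj1 (andP Pi)); have [-> _] := d3 i Pi.
by rewrite n1 c2.
Qed.

(* Rules out degree 3 in odd order: chi * chi^* - 1 would be a real character of degree 8. *)
Lemma odd_degree_sum (c : I -> I) (m d : I -> nat) :
  involutive c -> (forall i, P i -> [/\ P (c i), c i != i, m (c i) = m i & d (c i) = d i]) ->
  (forall i, P i -> odd (d i) /\ 3 <= d i) -> \sum_(i | P i) m i * d i <> 8.
Proof.
move=> cK cP dP s8; have [i Pi mi] : exists2 i, P i & 0 < m i * d i by apply: sum_gt0P; rewrite s8.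
have [Pc nc mc dc] := cP i Pi; have [od d3] := dP i Pi; move: s8.
have nc' : P (c i) && (c i != i) by rewrite Pc.
rewrite (bigD1 i) //= (bigD1 (c i)) //= mc dc addnA addnn => s8.
have md : m i * d i = 3.
  move: s8; case: (m i) mi => [|[|q]] //= _; last by rewrite !mulSn; lia.
  by rewrite mul1n; move: od d3; case: (d i) => [|[|[|[|[|e]]]]] //=; lia.
have : \sum_(j | P j && (j != i) && (j != c i)) m j * d j = 2 by rewrite md in s8; lia.
move=> s2; have [j Pj mj] : exists2 j, P j && (j != i) && (j != c i) & 0 < m j * d j.
  by apply: sum_gt0P; rewrite s2.
move: s2; rewrite (bigD1 j) //=; have [_ dj] := dP j (proj1 (andP (proj1 (andP Pj)))).
by move: mj; case: (m j) => [|q] //= _; rewrite mulSn; lia.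
Qed.
End DegreeCounting.

Section Degrees.
Import Order.TTheory Num.Theory.
Local Open Scope ring_scope.
Variables (gT : finGroupType) (G : {group gT}).
Implicit Types (i : Iirr G).

Definition deg i : nat := Num.truncn ('chi_i 1%g).

Lemma degE i : 'chi_i 1%g = (deg i)%:R.
Proof. by rewrite /deg truncnK // Cnat_irr1. Qed.

Lemma deg0 : deg 0 = 1%N.
Proof. by apply/eqP; rewrite -(eqr_nat algC) -degE irr0 cfun11. Qed.

Lemma deg_dvd i : (deg i %| #|G|)%N.
Proof. by have := dvd_irr1_cardG i; rewrite degE dvdC_nat. Qed.

Lemma sum_deg2 : #|G| = (1 + \sum_(i : Iirr G | i != ord0) deg i * deg i)%N.
Proof.
apply/eqP; rewrite -(eqr_nat algC); have := second_orthogonality_relation 1%g (group1 G).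
rewrite class_refl cent11T setIT mulr1n => <-.
have <- : (\sum_i deg i * deg i = 1 + \sum_(i : Iirr G | i != ord0) deg i * deg i)%N.
  by rewrite (bigD1 (ord0 : Iirr G)) //= deg0.
rewrite natr_sum.
by apply/eqP; apply: eq_bigr => i _; rewrite natrM degE conjC_nat.
Qed.

Hypothesis perfG : G^`(1)%g = G.

Lemma deg_neq1 i : i != 0 -> deg i != 1%N.
Proof.
apply: contraNneq => d1; have : 'chi_i \is a linear_char by rewrite qualifE/= irr_char degE d1 eqxx.
rewrite lin_irr_der1 perfG => sk; rewrite -irr_eq1; apply/eqP/cfun_inP=> x Gx.
by rewrite cfun1E Gx (cfker1 (subsetP sk x Gx)) degE d1.
Qed.

(** [b] counts the eigenvalues -1; it is even because the determinant character of a perfect group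
    is trivial. *)
Lemma involution_value z i : z \in G -> #[z]%g = 2%N ->
  exists b, [/\ (b <= deg i)%N, ~~ odd b & 'chi_i z = (deg i)%:R - (2 * b)%:R].
Proof.
move=> Gz oz; have [e [[B uB rz] [e2 _] [ez _] _]] := repr_rsim_diag 'Chi_i Gz.
rewrite irrRepr in ez; set n := irr_degree _ in e B uB rz e2 ez.
have en : deg i = n by apply/eqP; rewrite -(eqr_nat algC) -degE irr1_degree.
pose b := #|[set j | e 0 j == -1]|.
have ev j : e 0 j = 1 - (e 0 j == -1)%:R *+ 2.
  have := e2 j; rewrite oz => /eqP; rewrite sqrf_eq1 => /orP[] /eqP->.
    by rewrite -subr_eq0 opprK -[1 + 1]/(2%:R) pnatr_eq0 mul0rn subr0.
  by rewrite eqxx mulr2n opprD addrA subrr sub0r.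
have sb (R : nmodType) (a : R) : \sum_j (if e 0 j == -1 then a else 0) = a *+ b.
  by rewrite -big_mkcond sumr_const; congr (_ *+ _); apply: eq_card => j; rewrite inE.
exists b; rewrite en; split.
- by rewrite -[n in (_ <= n)%N]card_ord max_card.
- have dz : \det ('Chi_i z) = 1.
    have := lin_char_der1 (detRepr_lin_char 'Chi_i); rewrite perfG => /subsetP/(_ z Gz)/cfker1.
    by rewrite (lin_char1 (detRepr_lin_char _)) cfunE Gz mulr1n trace_mx11 mxE mulr1n.
  move: dz; rewrite rz !det_mulmx mulrC mulrA det_inv divff ?mul1r ?det_diag; last first.
    by rewrite -unitfE -unitmxE.
  rewrite (eq_bigr (fun j => if e 0 j == -1 then -1 else 1)); last first.
    by move=> j _; case: eqP => // ne; rewrite ev; case: eqP => // _; rewrite mul0rn subr0.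
  rewrite -big_mkcond prodr_const /= -signr_odd.
  have -> : #|(fun j => e 0 j == -1)| = b by apply: eq_card => j; rewrite inE.
  by case: odd => // /eqP; rewrite expr1 -subr_eq0 -opprD oppr_eq0 -[1 + 1]/(2%:R) pnatr_eq0.
rewrite ez (eq_bigr (fun j => 1 - (e 0 j == -1)%:R *+ 2)) => [|j _]; last exact: ev.
rewrite sumrB sumr_const card_ord; congr (_ - _).
rewrite (eq_bigr (fun j => if e 0 j == -1 then 2%:R else 0)); last first.
  by move=> j _; case: eqP => _; rewrite ?mul0rn.
by rewrite sb -mulrnA.
Qed.

(* Orthogonality of the columns of 1 and [z]: #|G| is the sum of chi(1)^2 - chi(1)chi(z). *)
Lemma sum_involution z (b : Iirr G -> nat) : z \in G -> #[z]%g = 2%N ->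
  (forall i, 'chi_i z = (deg i)%:R - (2 * b i)%:R) -> b 0 = 0%N ->
  #|G| = (2 * \sum_(i : Iirr G | i != ord0) deg i * b i)%N.
Proof.
move=> Gz oz bz b0; apply/eqP; rewrite -(eqr_nat algC).
have := second_orthogonality_relation z (group1 G); rewrite class1G inE.
case: eqP oz => [->|_ oz]; rewrite ?order1 // mulr0n.
rewrite (eq_bigr (fun i => (deg i * deg i)%:R - (2 * (deg i * b i))%:R)); last first.
  by move=> i _; rewrite bz degE conjC_nat mulrBl -!natrM mulnAC mulnA.
rewrite sumrB -!natr_sum => /eqP; rewrite subr_eq0 => /eqP e.
rewrite sum_deg2; have <- : (\sum_i deg i * deg i = 1 + \sum_(i : Iirr G | i != ord0) deg i * deg i)%N.
  by rewrite (bigD1 (ord0 : Iirr G)) //= deg0.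
by rewrite e (bigD1 (ord0 : Iirr G)) //= b0 muln0 add0n -big_distrr.
Qed.

Hypothesis simG : simple G.

Lemma cfker_simple i : i != 0 -> cfker 'chi_i = 1%g.
Proof.
move=> ni; have [_ /(_ (cfker_group 'chi_i) (cfker_normal _))[//|/= e]] := simpleP _ simG.
have lin : 'chi_i \is a linear_char by rewrite lin_irr_der1 e der_sub.
have d1 : deg i = 1%N by apply/eqP; rewrite -(eqr_nat algC) -degE lin_char1.
by have := deg_neq1 ni; rewrite d1 eqxx.
Qed.

Lemma cfcenter_simple i : i != 0 -> ('Z('chi_i)%CF = 1)%g.
Proof.
move=> ni; have [_ /(_ _ (cfcenter_normal 'chi_i))[//|/= e]] := simpleP _ simG.
have := cfcenter_fful_irr (i := i); rewrite /cfaithful cfker_simple // subxx => /(_ isT).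
rewrite e => eZ; have : abelian G by rewrite /abelian {1}eZ subsetIr.
move/derG1P; rewrite perfG => G1; case/eqP: (proj1 (simpleP _ simG)) => //.
Qed.

Lemma dixon_even : (2 %| #|G|)%N -> (12 * #|classes G| <= #|G|)%N.
Proof.
case/(Cauchy (isT : prime 2)) => z Gz oz.
have /fin_all_exists[b bP] i : exists b, [/\ (b <= deg i)%N, ~~ odd b & 'chi_i z = (deg i)%:R - (2 * b)%:R].
  exact: involution_value.
have nz1 : z <> 1%g by move=> z1; rewrite z1 order1 in oz.
have bpos i : i != 0 -> (0 < b i < deg i)%N.
  move=> ni; have [le ev ez] := bP i; apply/andP; split.
    rewrite lt0n; apply/eqP=> b0; rewrite b0 muln0 subr0 -degE in ez.
    have : z \in cfker 'chi_i by rewrite cfkerEirr inE ez.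
    by rewrite cfker_simple // inE => /eqP.
  rewrite ltn_neqAle le andbT; apply/eqP=> bd.
  have : z \in 'Z('chi_i)%CF.
    rewrite irr_cfcenterE // ez bd mul2n -addnn natrD opprD addrA subrr sub0r normrN normr_nat degE //.
  by rewrite cfcenter_simple // inE => /eqP.
have b0 : b 0 = 0%N.
  have [_ _] := bP 0; rewrite deg0 irr0 cfun1E Gz => /eqP.
  by rewrite -subr_eq0 opprB addrCA subrr addr0 pnatr_eq0 muln_eq0 => /eqP.
have -> : #|classes G| = (1 + #|[pred i : Iirr G | i != ord0]|)%N.
  by rewrite -NirrE -[LHS]card_ord (cardD1 ord0) inE; congr addn; apply: eq_card => i; rewrite !inE andbT.
apply: (even_degree_count (d := deg) (b := b)) (sum_deg2) _ => [i ni|].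
  by have [_ ev _] := bP i; have /andP[] := bpos i ni; split=> //; apply: deg_dvd.
by apply: sum_involution Gz oz _ b0 => i; have [] := bP i.
Qed.

(** For a real character, pairing x with its inverse in the vanishing sum over the group gives
    chi(1) = -2 s with s an algebraic integer. As s is rational the degree is even, against odd
    order. *)
Lemma odd_conj_irr i : odd #|G| -> i != 0 -> conjC_Iirr i != i.
Proof.
move=> oG ni; apply/eqP=> ci.
have re x : 'chi_i x^-1%g = 'chi_i x by rewrite irr_inv -cfConjCE -conjC_IirrE ci.
have s0 : \sum_(x in G) 'chi_i x = 0.
  have := cfdot_irr i 0; rewrite (negPf ni) cfdotE irr0 => /eqP.
  rewrite mulf_eq0 invr_eq0 (negPf (neq0CG G)) /= => /eqP e0.
  by rewrite -[RHS]e0; apply: eq_bigr => x Gx; rewrite cfun1E Gx rmorph1 mulr1.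
(* Selects one element of each pair of inverses; the comparison is an equality only at 1. *)
pose T (x : gT) := (enum_rank x < enum_rank x^-1%g)%N.
have inv1 x : x \in G -> (x == 1%g) = (enum_rank x == enum_rank x^-1%g :> nat).
  move=> Gx; apply/eqP/eqP=> [->|/val_inj/enum_rank_inj e]; first by rewrite invg1.
  have : (#[x]%g %| 2)%N by rewrite order_dvdn expgS expg1 {2}e mulgV.
  move=> d2; apply/eqP; rewrite -order_eq1.
  have : odd #[x]%g by apply: dvdn_odd oG; apply: order_dvdG.
  by move: d2; rewrite (dvdn_divisors _ (isT : 0 < 2)%N) !inE => /orP[] /eqP->.
have : 'chi_i 1%g + 2%:R * \sum_(x in G | T x) 'chi_i x = 0.
  rewrite -[RHS]s0 [RHS](bigD1 1%g) //=; congr (_ + _); rewrite mulr_natl mulr2n.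
  rewrite [RHS](bigID T) /=; congr (_ + _).
    apply: eq_bigl => x; case Gx: (x \in G) => //=; rewrite inv1 // /T.
    by case: ltngtP.
  rewrite (reindex_inj invg_inj) /=; apply: eq_big => [x|x _]; last by rewrite re.
  rewrite groupV; case Gx: (x \in G) => //=; rewrite inv1 // /T invgK -leqNgt.
  by case: ltngtP.
move/eqP; rewrite addr_eq0 degE => /eqP e.
set s := \sum_(x in G | T x) _ in e.
have As : s \in Aint by apply: rpred_sum => x _; apply: Aint_irr.
have sE : s = - ((deg i)%:R / 2%:R) by rewrite e mulNr opprK mulrC mulKf // pnatr_eq0.
have Zs : s \in Num.int.
  by apply: Cint_rat_Aint As; rewrite sE rpredN rpred_div ?rpred_nat.
have : odd (deg i) by apply: dvdn_odd oG; apply: deg_dvd.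
apply/negP; rewrite -dvdn2 -dvdC_nat; apply/dvdCP; exists (- s); first by rewrite rpredN.
by rewrite mulNr mulrC.
Qed.

Lemma odd_deg_neq3 i : odd #|G| -> deg i <> 3%N.
Proof.
move=> oG d3; pose psi := 'chi_i * ('chi_i)^*%CF.
have chpsi : psi \is a character by apply: rpredM; rewrite ?cfAut_char ?irr_char.
have ni0 : i != 0 by apply: contra_eqN d3 => /eqP->; rewrite deg0.
have psiC : (psi^*)%CF = psi by rewrite rmorphM /= cfConjCK mulrC.
have /fin_all_exists[m mE] (j : Iirr G) : exists n, '[psi, 'chi_j] = n%:R by apply/natrP/Cnat_cfdot_char_irr.
have m0 : m 0 = 1%N.
  apply/eqP; rewrite -(eqr_nat algC) -mE.
  have := cfdot_irr i i; rewrite eqxx => <-; rewrite !cfdotE; apply/eqP; congr (_ * _).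
  by apply: eq_bigr => x Gx; rewrite irr0 cfun1E Gx rmorph1 mulr1 cfunE cfConjCE.
have mC j : m (conjC_Iirr j) = m j.
  by apply/eqP; rewrite -(eqr_nat algC) -!mE conjC_IirrE cfdot_conjCr psiC mE conjC_nat.
have dC j : deg (conjC_Iirr j) = deg j.
  by apply/eqP; rewrite -(eqr_nat algC) -!degE conjC_IirrE cfConjCE degE conjC_nat.
apply: (@odd_degree_sum (Iirr G) (fun j => j != ord0) (@conjC_Iirr _ G) m deg).
- exact: conjC_IirrK.
- by move=> j nj; rewrite mC dC conjC_Iirr_eq0 nj odd_conj_irr.
- move=> j nj; have od : odd (deg j) by apply: dvdn_odd oG; apply: deg_dvd.
  by have := deg_neq1 nj; split=> //; move: od (deg_neq1 nj); case: (deg j) => [|[|[|]]].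
have : psi 1%g = 9%:R by rewrite cfunE cfConjCE degE d3 conjC_nat -natrM.
rewrite [psi]cfun_sum_cfdot sum_cfunE (eq_bigr (fun j => (m j * deg j)%:R)); last first.
  by move=> j _; rewrite cfunE mE degE natrM.
rewrite -natr_sum => /eqP; rewrite eqr_nat (bigD1 (ord0 : Iirr G)) //= m0 deg0.
by rewrite muln1 => /eqP[].
Qed.

(** Nonprincipal degrees are odd, not 1 and not 3, hence at least 5, and 1 + 25 c >= 12 (1 + c) for
    c >= 1. *)
Lemma dixon_odd : odd #|G| -> (12 * #|classes G| <= #|G|)%N.
Proof.
move=> oG.
have -> : #|classes G| = (1 + #|[pred i : Iirr G | i != ord0]|)%N.
  by rewrite -NirrE -[LHS]card_ord (cardD1 ord0) inE; congr addn; apply: eq_card => i; rewrite !inE andbT.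
set c := #|[pred i : Iirr G | i != ord0]|; have c0 : (0 < c)%N.
  rewrite lt0n; apply/eqP=> c0; have := sum_deg2; rewrite big_pred0 => [G1|i].
    by case/eqP: (proj1 (simpleP _ simG)); apply/card1_trivg.
  by have := card0_eq c0 i; rewrite inE.
have : (25 * c <= \sum_(i : Iirr G | i != ord0) deg i * deg i)%N.
  rewrite mulnC -sum_nat_const; apply: (leq_sum (I := Iirr G)) => i ni.
  have od : odd (deg i) by apply: dvdn_odd oG; apply: deg_dvd.
  have := odd_deg_neq3 (i := i) oG; have := deg_neq1 ni.
  by move: od; case: (deg i) => [|[|[|[|[|q]]]]] // _ _ _; rewrite !mulSn; lia.
have := sum_deg2; lia.
Qed.
End Degrees.

Theorem simple_classes (gT : finGroupType) (G : {group gT}) :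
  simple G -> ~~ abelian G -> (12 * #|classes G| <= #|G|)%N.
Proof.
move=> simG nab; have perfG : (G^`(1) = G)%g.
  have [_ /(_ _ (der_normal 1 G))[/derG1P ab|//]] := simpleP _ simG.
  by rewrite ab in nab.
have [oG|eG] := boolP (odd #|G|); first exact: dixon_odd.
by apply: dixon_even => //; rewrite dvdn2.
Qed.

(** * Groups with many regular classes *)

Section Dense.
Local Open Scope group_scope.
Variable p : nat.
Hypotheses (p_pr : prime p) (p_odd : odd p).

Definition dense (gT : finGroupType) (G : {group gT}) := #|G|`_p^' < p.-1 * kp' p G.

Section OneGroup.
Variables (gT : finGroupType).
Implicit Types G N X M L : {group gT}.

Lemma p'part_quotient G N : N <| G -> (#|G|`_p^' = #|N|`_p^' * #|G / N|`_p^')%N.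
Proof.
move=> nNG; rewrite card_quotient ?normal_norm // -partnM ?cardG_gt0 ?indexg_gt0 //.
by rewrite Lagrange ?normal_sub.
Qed.

Lemma kp'_le_p'part G : kp' p G <= #|G|`_p^'.
Proof. by have [P sylP] := Sylow_exists p G; apply: kp'_le p_pr sylP. Qed.

Lemma dense_quo G N : N <| G -> dense G -> dense (G / N).
Proof.
move=> nNG; rewrite /dense (p'part_quotient nNG) => dG.
rewrite -(ltn_pmul2l (part_gt0 p^' #|N|)); apply: leq_trans dG _.
rewrite mulnCA leq_mul2l; apply/orP; right; apply: leq_trans (kp'_mul p nNG) _.
by rewrite leq_mul2r kp'_le_p'part orbT.
Qed.

Lemma dense_sub G N : N <| G -> dense G -> dense N.
Proof.
move=> nNG; rewrite /dense (p'part_quotient nNG) => dG.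
rewrite -(ltn_pmul2r (part_gt0 p^' #|G / N|)); apply: leq_trans dG _.
rewrite -mulnA leq_mul2l; apply/orP; right; apply: leq_trans (kp'_mul p nNG) _.
have [P sylP] := Sylow_exists p (G / N)%G.
by rewrite leq_mul2l (kp'_le p_pr sylP) orbT.
Qed.

Lemma kp'_core_trivial G : 'O_p(G) = 1 -> p %| #|G| -> p.+1 * kp' p G <= 2 * #|G|`_p^'.
Proof.
move=> Op1 pG; have [P sylP] := Sylow_exists p G; apply: (kp'_nonnormal p_pr sylP).
apply/negP=> nP; have := pcore_max (pHall_pgroup sylP) nP; rewrite Op1 => /trivgP P1.
have := card_Hall sylP; rewrite P1 cards1 => /esym/eqP; rewrite p_part_eq1.
by rewrite mem_primes p_pr cardG_gt0 pG.
Qed.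

(** Minimality is phrased with abelian and p'-quotients to serve both minimal normal subgroups and
    minimal subgroups without a chain. *)
Lemma perfect_core X M : M <| X -> M :!=: 1 -> 'O_p(X) = 1 ->
    (forall L, L <| X -> L \subset M -> abelian (M / L) \/ p^'.-group (M / L) -> M \subset L) ->
  [/\ M^`(1) = M, gen_by_sylow p M, 'O_p(M) = 1 & p %| #|M|].
Proof.
move=> nMX nt OpX minM; have sMX := normal_sub nMX.
have OpM : 'O_p(M) = 1.
  by apply/trivgP; rewrite -OpX pcore_max ?pcore_pgroup ?(char_normal_trans (pcore_char _ _)).
split=> //.
- apply/eqP; rewrite eqEsubset der_sub; apply: minM; rewrite ?der_sub //.
    exact: char_normal_trans (der_char _ _) nMX.
  by left; apply: sub_der1_abelian.
(* The p-elements of [M] generate an invariant subgroup whose quotient is a p'-group. *)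
- move=> K nKM sylK; pose A := [set x in M | p.-elt x]; pose L := <<A>>%G.
  have sAM : A \subset M by apply/subsetP=> x; rewrite inE => /andP[].
  have sLM : L \subset M by rewrite gen_subG.
  have nLX : L <| X.
    rewrite /normal (subset_trans sLM sMX) norms_gen //; apply/subsetP=> g Xg; rewrite inE.
    apply/subsetP=> _ /imsetP[x /[!inE] /andP[Mx px] ->].
    by rewrite p_eltJ px andbT memJ_norm // (subsetP (normal_norm nMX)).
  have ML : M \subset L.
    apply: minM => //; right; have [P sylP] := Sylow_exists p M.
    have nLM : L <| M := normalS sLM sMX nLX.
    have sPL : P \subset L.
      rewrite -[P : {set gT}]genGid genS //; apply/subsetP=> x Px; rewrite inE (subsetP (pHall_sub sylP)) //=.
      exact: mem_p_elt (pHall_pgroup sylP) Px.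
    rewrite /pgroup card_quotient ?normal_norm //.
    case/and3P: sylP => _ _; apply: pnat_dvd; exact: indexgS.
  apply: subset_trans ML _; rewrite gen_subG; apply/subsetP=> x; rewrite inE => /andP[Mx px].
  have [P sylP sxP] := Sylow_superset (Q := <[x]>%G) (G := M) (p := p) ltac:(by rewrite cycle_subG) px.
  by apply: (subsetP (sylK P sylP)); rewrite -cycle_subG.
apply: contraNT nt => pM; rewrite -subG1; apply: (minM 1%G); rewrite ?normal1 ?sub1G //.
right; rewrite /pgroup -(card_isog (quotient1_isog M)) p'natE //.
Qed.

Lemma abelian_p'group X N : N <| X -> abelian N -> 'O_p(X) = 1 -> p^'.-group N.
Proof.
move=> nN abN OpX; have hall := nilpotent_pcore_Hall p (abelian_nil abN).
have OpN : 'O_p(N) = 1.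
  by apply/trivgP; rewrite -OpX pcore_max ?pcore_pgroup ?(char_normal_trans (pcore_char _ _)).
by have := hall; rewrite /pHall OpN indexg1 => /and3P[].
Qed.

Lemma minnormal_core X M : minnormal M X -> M <| X -> 'O_p(X) = 1 -> 'O_p^'(X) = 1 ->
  [/\ M^`(1) = M, gen_by_sylow p M, 'O_p(M) = 1 & p %| #|M|].
Proof.
move=> /mingroupP[/andP[nt nMX'] minM] nMX OpX Op'X; apply: (perfect_core nMX) => // L nLX sLM ab.
have [L1|ntL] := eqVneq (L : {set gT}) 1; last first.
  by rewrite (minM L) //= ntL normal_norm.
have iso := quotient1_isog M.
have abM : abelian M \/ p^'.-group M.
  move: ab; rewrite L1 => -[ab|p'M]; [left|right].
    by rewrite (isog_abelian iso).
  by rewrite /pgroup (card_isog iso).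
have p'M : p^'.-group M by case: abM => // abM; apply: abelian_p'group nMX abM OpX.
by rewrite (subset_trans (pcore_max p'M nMX)) // Op'X sub1G.
Qed.

(** Density passes to a minimal normal subgroup, which would violate the bound of [core_theorem]. *)
Lemma dense_core_nontriv X : dense X -> X :!=: 1 -> 'O_p(X) = 1 -> 'O_p^'(X) = 1 -> False.
Proof.
move=> dX nt OpX Op'X; have [M minM sMX] := minnormal_exists nt (normG X).
have nMX : M <| X by rewrite /normal sMX; have /mingroupP[/andP[]] := minM.
have [perf gen OpM pM] := minnormal_core minM nMX OpX Op'X.
have [le _] := core_theorem p_pr p_odd perf gen OpM pM.
by have := dense_sub nMX dX; rewrite /dense ltnNge le.
Qed.
End OneGroup.

Section InvariantSeries.
Variables (gT : finGroupType).
Implicit Types G N X M L : {group gT}.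

(** Built from the bottom, with all terms normal in the fixed group [X], so that extending a chain
    by one factor is a constructor. *)
Inductive pp'_chain X : {group gT} -> Prop :=
| pp'_chain1 : pp'_chain X 1%G
| pp'_chain_cons (A B : {group gT}) of pp'_chain X B & B \subset A & A <| X & B <| X & p.-group (A / B) || p^'.-group (A / B) : pp'_chain X A.

Lemma pp'_chain_p_solvable X : pp'_chain X X -> p_solvable p X.
Proof.
have gen A : pp'_chain X A -> exists s : seq {group gT}, (last A s == 1%G) &&
    path (fun A B : {group gT} => [&& B <| X, B \subset A & (p.-group (A / B) || p^'.-group (A / B))]) A s.
  elim=> [|{}A B _ [s /andP[ls ps]] sBA nA nB pAB]; first by exists [::]; rewrite eqxx.
  by exists (B :: s); rewrite /= ls nB sBA pAB ps.
by case/gen=> s; exists s.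
Qed.

Lemma quotient_pp'_eq (A B : {group gT}) X : A <| X -> B <| X -> p.-group (A / B) -> p^'.-group (A / B) -> A \subset B.
Proof.
move=> nA nB pAB p'AB; rewrite -quotient_sub1.
  by have /eqP := coprime_TIg (pnat_coprime pAB p'AB); rewrite setIid => /eqP->.
exact: subset_trans (normal_sub nA) (normal_norm nB).
Qed.

(** A repeated term gives a trivial factor, which is a p-group and would be counted by
    [num_p_factors]; repeats are dropped. *)
Lemma p_length_dedupe X A s :
  (last A s == 1%G) -> path (fun A B : {group gT} =>
    [&& B <| X, B \subset A & (p.-group (A / B) || p^'.-group (A / B))]) A s ->
  exists s' : seq {group gT}, [/\ last A s' == 1%G, path (fun A B : {group gT} =>
    [&& B <| X, B \subset A & (p.-group (A / B) || p^'.-group (A / B))]) A s' &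
  num_p_factors p A s' <= count (fun AB : {group gT} * {group gT} => p.-group (AB.1 / AB.2) && ~~ (AB.1 \subset AB.2)) (zip (A :: s) s)].
Proof.
elim: s A => [|B s IHs] A /=; first by move=> A1 _; exists [::].
move=> ls /andP[/and3P[nB sBA pAB] ps]; have [AB|nAB] := boolP (A \subset B).
  have eAB : A = B by apply/eqP; rewrite -val_eqE eqEsubset AB sBA.
  by rewrite andbF add0n eAB; apply: IHs.
have [s' [ls' ps' le]] := IHs B ls ps; exists (B :: s'); split=> //=; first by rewrite nB sBA pAB.
by rewrite andbT /num_p_factors /= leq_add2l.
Qed.

(** Two ratios at most 2/(p + 1) multiply to at most 1/(p - 1), as 4 (p - 1) <= (p + 1)^2. *)
Lemma kp'_bound_product X N : N <| X ->
  p.+1 * kp' p N <= 2 * #|N|`_p^' -> p.+1 * kp' p (X / N) <= 2 * #|X / N|`_p^' -> ~ dense X.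
Proof.
move=> nN b1 b2; rewrite /dense (p'part_quotient nN) => dX.
have := kp'_mul p nN; move: b1 b2 dX.
move: (kp' p X) (kp' p N) (kp' p (X / N)) (#|N|`_p^')%N (#|X / N|`_p^')%N => k k1 k2 m1 m2 b1 b2 dX le.
have h1 : p.+1 ^ 2 * (k1 * k2) <= 4 * (m1 * m2).
  rewrite -mulnn -[4]/(2 * 2)%N mulnACA [leqRHS]mulnACA; exact: leq_mul.
have h2 : 4 * p.-1 <= p.+1 ^ 2 by rewrite -mulnn; lia.
have h3 : 4 * (m1 * m2) < p.+1 ^ 2 * (k1 * k2).
  apply: (@leq_trans (4 * (p.-1 * k))); first by rewrite ltn_pmul2l.
  by rewrite mulnA; apply: leq_mul.
by rewrite ltnNge h1 in h3.
Qed.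

Lemma pcore_pseries pis (pi : nat_pred) X : 'O_pi(X / pseries (rcons pis pi) X) = 1.
Proof. by rewrite -quotient_pseries pseries_rcons_id trivg_quotient. Qed.

(** If p divided the order of X / A3, this quotient would have ratio at most 2/(p + 1). So would A3,
    unless its Sylow p-subgroup is normal; then A3 = A2 and [dense_core_nontriv] applies to X /
    A2. *)
Lemma dense_top X (A2 A3 : {group gT}) : dense X -> A2 <| X -> A3 <| X -> A2 \subset A3 -> 'O_p(X) \subset A2 ->
  'O_p(X / A3) = 1 -> 'O_p^'(X / A2) = 1 -> A3 / A2 = 'O_p(X / A2) -> p^'.-group (X / A3).
Proof.
move=> dX n2 n3 s23 s12 Op3 Op'2 q3; rewrite /pgroup p'natE //; apply/negP=> p3.
have [P sylP] := Sylow_exists p A3.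
have b3 := kp'_core_trivial Op3 p3.
have [nP|nnP] := boolP (P <| A3); last first.
  exact: (kp'_bound_product n3 (kp'_nonnormal p_pr sylP nnP) b3) dX.
have sP2 : P \subset A2.
  have PE := normal_Hall_pcore sylP nP.
  have nPX : P <| X by rewrite -PE; apply: char_normal_trans (pcore_char _ _) n3.
  exact: subset_trans (pcore_max (pHall_pgroup sylP) nPX) _.
have p'32 : p^'.-group (A3 / A2).
  rewrite /pgroup card_quotient; last exact: subset_trans (normal_sub n3) (normal_norm n2).
  by case/and3P: sylP => _ _; apply: pnat_dvd; apply: indexgS.
have s32 : A3 \subset A2.
  by apply: (quotient_pp'_eq n3 n2) p'32; rewrite q3 pcore_pgroup.
have Op2 : 'O_p(X / A2) = 1 by rewrite -q3; apply/trivgP; rewrite quotient_sub1 // (subset_trans s32) ?normG.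
apply: (dense_core_nontriv (dense_quo n2 dX)) Op2 Op'2 => /=.
apply: contraTneq p3 => X2; have sX2 : X \subset A2 by rewrite -quotient_sub1 ?X2 // normal_norm.
have -> : X / A3 = 1 by apply/trivgP; rewrite quotient_sub1 ?normal_norm // (subset_trans sX2).
by rewrite cards1 dvdn1; case: eqP p_pr => // ->.
Qed.

Lemma p_length_chain X (A1 A2 A3 : {group gT}) : A1 <| X -> A2 <| X -> A3 <| X -> A1 \subset A2 -> A2 \subset A3 ->
  p.-group A1 -> p^'.-group (A2 / A1) -> p.-group (A3 / A2) -> p^'.-group (X / A3) -> p_length_le p X 2.
Proof.
move=> n1 n2 n3 s12 s23 p1 p2 p3 p4.
have [||s' [ls' ps' le]] := @p_length_dedupe X X [:: A3; A2; A1; 1%G]; first exact: eqxx.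
  rewrite /= n3 n2 n1 (normal_sub n3) s23 s12 normal1 sub1G p2 p3 p4 !orbT /=.
  by rewrite /pgroup -(card_isog (quotient1_isog _)) -[p.-nat _]/(p.-group A1) p1.
exists s'; split; first by rewrite /pp'_normal_series ls'.
apply: leq_trans le _ => /=.
have kill (A B : {group gT}) : A <| X -> B <| X -> p^'.-group (A / B) ->
    (p.-group (A / B) && ~~ (A \subset B)) = false.
  by move=> nA nB p'AB; apply/negbTE/negP=> /andP[pAB /negP[]]; apply: quotient_pp'_eq nA nB pAB p'AB.
rewrite (kill _ _ (normal_refl _) n3 p4) (kill _ _ n2 n1 p2).
by do 2!case: (_ && _).
Qed.

Lemma dense_p_length X : dense X -> p_length_le p X 2.
Proof.
move=> dX; have n3 : 'O_{p, p^', p}(X) <| X := pseries_normal _ X.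
have n2 : 'O_{p, p^'}(X) <| X := pseries_normal _ X.
have Op3 : 'O_p(X / 'O_{p, p^', p}(X)) = 1 := pcore_pseries [:: (p : nat_pred); p^'] p X.
have Op'2 : 'O_p^'(X / 'O_{p, p^'}(X)) = 1 := pcore_pseries [:: (p : nat_pred)] p^' X.
have q3 : 'O_{p, p^', p}(X) / 'O_{p, p^'}(X) = 'O_p(X / 'O_{p, p^'}(X)) := quotient_pseries [:: (p : nat_pred); p^'] p X.
have q2 : 'O_{p, p^'}(X) / 'O_p(X) = 'O_p^'(X / 'O_p(X)) by exact: quotient_pseries2.
have s23 : 'O_{p, p^'}(X) \subset 'O_{p, p^', p}(X) := pseries_sub_catl [:: (p : nat_pred); p^'] [:: (p : nat_pred)] X.
have s12 : 'O_p(X) \subset 'O_{p, p^'}(X).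
  by have := pseries_sub_catl [:: (p : nat_pred)] [:: p^'] X; rewrite pseries1.
have top := dense_top dX n2 n3 s23 s12 Op3 Op'2 q3.
apply: p_length_chain (pcore_normal p X) n2 n3 s12 s23 (pcore_pgroup _ _) _ _ top.
  by rewrite q2; apply: pcore_pgroup.
by rewrite q3; apply: pcore_pgroup.
Qed.

Lemma dense_p_solvable X : dense X -> p_solvable p X.
Proof. by case/dense_p_length=> s [ps _]; exists s. Qed.
End InvariantSeries.

Lemma kp'_p'group (gT : finGroupType) (G : {group gT}) : p^'.-group G -> kp' p G = #|classes G|.
Proof.
move=> p'G; rewrite /kp'; apply: eq_card => c; apply/imsetP/imsetP => -[x Gx ->]; exists x => //.
  by move: Gx; rewrite inE => /andP[].
by rewrite inE Gx (mem_p_elt p'G).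
Qed.

(** Along the series every factor has ratio at most 1, and a nonabelian simple p'-factor at most
    1/12, all its classes being p-regular. *)
Lemma comps_bound (gT : finGroupType) (G : {group gT}) s : comps G s ->
  kp' p G * 12 ^ num_nonab_p'_compfactors p G s <= #|G|`_p^'.
Proof.
elim: s G => [|N s IHs] G cG; first by rewrite muln1 kp'_le_p'part.
have cN := comps_cons cG; case/andP: cG => _ /= /andP[maxN _].
have nN := maxnormal_normal maxN; have simQ : simple (G / N) by rewrite quotient_simple.
rewrite /num_nonab_p'_compfactors /= -/(num_nonab_p'_compfactors p N s) expnD.
rewrite (p'part_quotient nN).
apply: leq_trans (leq_mul (kp'_mul p nN) (leqnn _)) _.
rewrite [X in (_ * X)%N]mulnC mulnACA.
apply: leq_mul (IHs N cN) _; case: andP => [[nab p'Q]|_]; last by rewrite muln1 kp'_le_p'part.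
rewrite expn1 (kp'_p'group p'Q) part_pnat_id // mulnC.
exact: simple_classes simQ nab.
Qed.

Lemma dense_comps (gT : finGroupType) (G : {group gT}) s : dense G -> comps G s ->
  12 ^ num_nonab_p'_compfactors p G s < p.-1.
Proof.
move=> dG /comps_bound le; have := leq_ltn_trans le dG; rewrite mulnC ltn_mul2r.
by case/andP.
Qed.

(** A dense simple group equals its p-core or its p'-core; with count zero, the p'-factors are
    abelian. *)
Lemma dense_comps_solvable (gT : finGroupType) (G : {group gT}) s : dense G -> comps G s ->
  num_nonab_p'_compfactors p G s = 0 -> solvable G.
Proof.
elim: s G => [|N s IHs] G dG cG; first by case/andP: cG => /= /eqP-> _ _; apply: solvable1.
have cN := comps_cons cG; case/andP: cG => _ /= /andP[maxN _].
have nN := maxnormal_normal maxN; have simQ : simple (G / N) by rewrite quotient_simple.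
rewrite /num_nonab_p'_compfactors /= -/(num_nonab_p'_compfactors p N s) => /eqP.
rewrite addn_eq0 eqb0 negb_and negbK => /andP[ab /eqP n0].
rewrite (series_sol nN) (IHs N (dense_sub nN dG) cN n0) /=.
have [ntQ nQ] := simpleP _ simQ; have dQ := dense_quo nN dG.
have [Op|Op] := nQ _ (pcore_normal p _); last first.
  by apply: (@pgroup_sol _ p); rewrite /= -Op pcore_pgroup.
have [Op'|Op'] := nQ _ (pcore_normal p^' _).
  by case: (dense_core_nontriv dQ ntQ Op Op').
case/orP: ab => [|/negP[]]; first exact: abelian_sol.
by rewrite -Op' pcore_pgroup.
Qed.
End Dense.

Lemma INR_expn a n : Raxioms.INR (a ^ n) = Rpow_def.pow (Raxioms.INR a) n :> Rdefinitions.R.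
Proof. by elim: n => // n IHn; rewrite expnS -multE RIneq.mult_INR IHn. Qed.

Lemma lt_ln_ratio_expn n p : 12 ^ n < p - 1 -> lt_ln_ratio n p.
Proof.
move=> lt; rewrite /lt_ln_ratio; move: (p - 1) lt => m lt.
have ltR a b : a < b -> Rdefinitions.Rlt (Raxioms.INR a) (Raxioms.INR b).
  by move/ltP; apply: RIneq.lt_INR.
have pos12 : Rdefinitions.Rlt (Rdefinitions.IZR BinNums.Z0) (Raxioms.INR 12) by apply: (ltR 0 12).
have ln12 : Rdefinitions.Rlt (Rdefinitions.IZR BinNums.Z0) (Rpower.ln (Raxioms.INR 12)).
  rewrite -Rpower.ln_1; apply: Rpower.ln_increasing; first exact: RIneq.Rlt_0_1.
  exact: (ltR 1 12).
apply: (RIneq.Rmult_lt_reg_r _ _ _ ln12); rewrite -(Rpower.ln_pow _ pos12) -INR_expn.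
rewrite /Rdefinitions.Rdiv Raxioms.Rmult_assoc Raxioms.Rinv_l; last exact: RIneq.Rgt_not_eq.
rewrite RIneq.Rmult_1_r; apply: Rpower.ln_increasing; last exact: ltR.
by apply: (ltR 0); rewrite expn_gt0.
Qed.

(** * The extremal case *)

Section Extremal.
Local Open Scope group_scope.
Variable p : nat.
Hypotheses (p_pr : prime p) (p_odd : odd p).

Lemma pgroup_quotient (gT : finGroupType) pi (A B X : {group gT}) : A <| X -> B <| X -> pi.-group (A / B) = pi.-nat #|A : B|.
Proof.
by move=> nA nB; rewrite /pgroup card_quotient // (subset_trans (normal_sub nA) (normal_norm nB)).
Qed.

Section Series.
Variable gT : finGroupType.
Implicit Types X N K L A B : {group gT}.

Lemma index_cosetpre N (A B : {group coset_of N}) : B \subset A ->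
  #|coset N @*^-1 A : coset N @*^-1 B| = #|A : B|.
Proof.
move=> sBA; rewrite -!divgS ?morphpreS // !card_cosetpre divnMl //.
Qed.

Lemma pp'_chain_cosetpre X N (A : {group coset_of N}) : N <| X -> p.-group N -> pp'_chain p (X / N) A ->
  pp'_chain p X (coset N @*^-1 A)%G.
Proof.
move=> nN pN; elim=> [|{}A B _ IH sBA nA nB pAB].
  have -> : (coset N @*^-1 1)%G = N by apply: val_inj; rewrite /= -kerE ker_coset.
  apply: pp'_chain_cons (pp'_chain1 p X) _ nN (normal1 _) _; rewrite ?sub1G //.
  by rewrite /pgroup -!(card_isog (quotient1_isog _)) -[p.-nat _]/(p.-group N) pN.
have nXA (D : {group coset_of N}) : D <| X / N -> coset N @*^-1 D <| X.
  by rewrite -{2}(quotientGK nN) cosetpre_normal.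
apply: pp'_chain_cons IH _ (nXA A nA) (nXA B nB) _; first exact: morphpreS.
by rewrite !(pgroup_quotient _ (nXA A nA) (nXA B nB)) /= !index_cosetpre // -!(pgroup_quotient _ nA nB).
Qed.

Lemma pp'_chain_quotient X N : N <| X -> p.-group N -> pp'_chain p (X / N) (X / N)%G -> pp'_chain p X X.
Proof.
move=> nN pN /(pp'_chain_cosetpre nN pN); suff -> : (coset N @*^-1 (X / N))%G = X by [].
by apply: val_inj; apply: quotientGK.
Qed.

(** The p-core of the abelian factor splits it into a p-factor and a p'-factor. *)
Lemma pp'_chain_abelian X K L : pp'_chain p X L -> L <| X -> K <| X -> L \subset K -> abelian (K / L) -> pp'_chain p X K.
Proof.
move=> hL nL nK sLK abQ; have nLK : L <| K := normalS sLK (normal_sub nK) nL.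
pose D := (coset L @*^-1 'O_p(K / L))%G.
have nD : D <| X.
  rewrite -(quotientGK nL) cosetpre_normal; apply: char_normal_trans (pcore_char _ _) _.
  exact: quotient_normal.
have sLD : L \subset D by rewrite -{1}(ker_coset L) ker_sub_pre.
have sDK : D \subset K by rewrite -(quotientGK nLK) morphpreS ?pcore_sub.
have hD : pp'_chain p X D.
  apply: pp'_chain_cons hL sLD nD nL _; apply/orP; left.
  by rewrite /= cosetpreK pcore_pgroup.
apply: (pp'_chain_cons hD sDK nK nD); apply/orP; right.
rewrite (pgroup_quotient _ nK nD) -{1}(quotientGK nLK) index_cosetpre ?pcore_sub //.
by case/and3P: (nilpotent_pcore_Hall p (abelian_nil abQ)).
Qed.

Lemma min_no_pp'_chain X : ~ pp'_chain p X X -> exists K, [/\ K <| X, ~ pp'_chain p X K &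
  forall L, L <| X -> L \subset K -> ~~ (K \subset L) -> pp'_chain p X L].
Proof.
suff gen n (M : {group gT}) : #|M| <= n -> M <| X -> ~ pp'_chain p X M -> exists K, [/\ K <| X, ~ pp'_chain p X K &
    forall L, L <| X -> L \subset K -> ~~ (K \subset L) -> pp'_chain p X L].
  by move/(gen _ X (leqnn _) (normal_refl X)).
elim: n M => [|n IHn] M; first by rewrite leqNgt cardG_gt0.
move=> cM nM nhM; case: (classic (exists L, [/\ L <| X, L \subset M, ~~ (M \subset L) & ~ pp'_chain p X L])).
  case=> L [nL sLM nsML nhL]; apply: (IHn L) => //; rewrite -ltnS; apply: leq_trans cM.
  by rewrite proper_card // properE sLM.
move=> no; exists M; split=> // L nL sLM nsML; apply: NNPP => nhL; case: no.
by exists L.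
Qed.

Lemma min_no_pp'_chain_core X K : 'O_p(X) = 1 -> K <| X -> ~ pp'_chain p X K ->
    (forall L, L <| X -> L \subset K -> ~~ (K \subset L) -> pp'_chain p X L) ->
  [/\ K^`(1) = K, gen_by_sylow p K, 'O_p(K) = 1 & p %| #|K|].
Proof.
move=> OpX nK nhK minK; apply: (perfect_core p_pr nK) => //.
  by apply/eqP=> K1; case: nhK; rewrite (_ : K = 1%G); [apply: pp'_chain1|apply: val_inj].
move=> L nL sLK ab; apply: contraT => nsKL; have hL := minK L nL sLK nsKL.
case: nhK; case: ab => [ab|p'Q]; first exact: pp'_chain_abelian hL nL nK sLK ab.
by apply: pp'_chain_cons hL sLK nK nL _; rewrite p'Q orbT.
Qed.

Lemma kp'_gt0 X : 0 < kp' p X.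
Proof.
rewrite card_gt0; apply/set0Pn; exists (1 ^: X); apply/imsetP; exists 1 => //.
by rewrite inE group1 /p_elt order1.
Qed.

Lemma tight_sub X N : N <| X -> kp' p X = (#|X|`_p^')%N -> kp' p N = (#|N|`_p^')%N.
Proof.
move=> nN kX; apply/eqP; rewrite eqn_leq (kp'_le_p'part p_pr).
have [P sylP] := Sylow_exists p (X / N)%G; have le := kp'_le p_pr sylP.
have := kp'_mul p nN; rewrite kX (p'part_quotient p nN) => le2.
by rewrite -(leq_pmul2r (part_gt0 p^' #|X / N|)) (leq_trans le2) // leq_mul2l le orbT.
Qed.

(** A nonnormal Sylow subgroup gives ratio at most 2/(p + 1) < 1, and a normal one lies in the
    trivial p-core. *)
Lemma tight_p'group X N : N <| X -> 'O_p(X) = 1 -> kp' p N = (#|N|`_p^')%N -> p^'.-group N.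
Proof.
move=> nN OpX kN; have [P sylP] := Sylow_exists p N.
have [nP|nnP] := boolP (P <| N); last first.
  have := kp'_nonnormal p_pr sylP nnP; rewrite -kN leq_mul2r => /orP[/eqP k0|].
    by have := kp'_gt0 N; rewrite k0.
  by move: (prime_gt1 p_pr); lia.
have PE := normal_Hall_pcore sylP nP.
have P1 : P :=: 1.
  by apply/trivgP; rewrite -OpX pcore_max ?(pHall_pgroup sylP) // -PE; apply: char_normal_trans (pcore_char _ _) nN.
by have := sylP; rewrite /pHall P1 indexg1 => /and3P[].
Qed.

(** Multiply a regular lift of each class of X / Z by the elements of [Z]. If two products are
    conjugate, they lie over the same class and their central factors differ by a commutator, hence
    by an element of the trivial intersection with X'. *)
Lemma kp'_central_mul X (Z : {group gT}) : Z \subset 'Z(X) -> Z :&: X^`(1) = 1 -> p^'.-group Z ->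
  #|Z| * kp' p (X / Z) <= kp' p X.
Proof.
move=> sZ ZX' p'Z; have nZ : Z <| X := sub_center_normal sZ.
pose CC := [set x ^: (X / Z) | x in X / Z & p^'.-elt x].
pose rep (c : {set coset_of Z}) := [pick y in X | p^'.-elt y && (coset Z y ^: (X / Z) == c)].
pose y c := if rep c is Some y then y else 1.
have yP c : c \in CC -> [/\ y c \in X, p^'.-elt (y c) & coset Z (y c) ^: (X / Z) = c].
  case/imsetP=> x; rewrite inE => /andP[/morphimP[u nu Xu ->] pu] ec; rewrite /y /rep.
  case: pickP => [v /and3P[Xv pv /eqP ev]//|/(_ u.`_p^')].
  rewrite groupX // p_elt_constt morph_constt // (constt_p_elt pu).
  by rewrite ec eqxx.
rewrite -cardsX; pose f (t : gT * {set coset_of Z}) := t.1 * y t.2.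
apply: (kp'_ge (f := f)) => [[z c]|[z c] [z' c']]; rewrite !inE /f /=.
  case/andP=> Zz Cc; have [Xy py _] := yP c Cc; have Xz := subsetP (normal_sub nZ) z Zz.
  split; first exact: groupM.
  apply: p_eltM => //; last exact: mem_p_elt p'Z Zz.
  by have /centerP[_ cz] := subsetP sZ z Zz; apply: cz.
case/andP=> Zz Cc /andP[Zz' Cc'] /imsetP[h Xh e].
have [Xy py ey] := yP c Cc; have [Xy' py' ey'] := yP c' Cc'.
have nZX := subsetP (normal_norm nZ).
have ec : c = c'.
  have Xz' := subsetP (normal_sub nZ) z' Zz'.
  have : coset Z (z * y c) = coset Z (z' * y c') ^ coset Z h.
    by rewrite e; apply: morphJ; rewrite nZX ?groupM.
  rewrite !coset_kerl // => ek.
  by rewrite -ey -ey'; apply/class_eqP; rewrite ek memJ_class // mem_quotient.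
rewrite -{}ec in e *; congr (_, _).
have /centerP[_ cz'] := subsetP sZ z' Zz'.
have zJ : z' ^ h = z' by apply/conjg_fixP/commgP; apply: cz'.
rewrite conjMg zJ in e.
have e2 : z'^-1 * z = [~ h, (y c)^-1].
  apply: (mulgI z'); rewrite mulKVg; apply: (mulIg (y c)); rewrite e /commg conjgE.
  by rewrite conjgE invgK !mulgA mulgKV.
have : z'^-1 * z \in Z :&: X^`(1).
  by rewrite inE groupM ?groupV //= e2 mem_commg ?groupV.
by rewrite ZX' inE -eq_mulVg1 => /eqP.
Qed.
End Series.

Lemma p'part_le (gT : finGroupType) (X : {group gT}) : p %| #|X| -> p * #|X|`_p^' <= #|X|.
Proof.
move=> pX; rewrite -{2}(partnC p (cardG_gt0 X)) leq_mul2r orbC dvdn_leq ?part_gt0 //.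
by rewrite p_part -{1}(expn1 p) dvdn_exp2l // logn_gt0 mem_primes p_pr cardG_gt0.
Qed.

Lemma trivial_center_PSL2 (gT : finGroupType) (K : {group gT}) : K \isog PSL2 p -> 'Z(K) = 1.
Proof.
move=> iso; have := isog_center (isog_trans iso (PSL2_isog p)).
by rewrite center_psl_im => isoZ; apply: card1_trivg; rewrite (card_isog isoZ) cards1.
Qed.

(** The p'-part is at most |X| / p, that is (p^2 - 1)/2 or p^2 - 1, against at least (p + 1)/2 or p
    + 1 classes. *)
Lemma kp'_PSL2_PGL2 (gT : finGroupType) (X : {group gT}) : p %| #|X| ->
  X \isog PSL2 p \/ X \isog PGL2 p -> (#|X|`_p^' <= p.-1 * kp' p X)%N.
Proof.
move=> pX; have le := p'part_le pX; have cF : #|'F_p| = p := card_Fp p_pr.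
have p0 := prime_gt0 p_pr; have e := pred_mul_succ p0.
case=> iso.
  have iso' := isog_trans iso (PSL2_isog p).
  have k1 := kp'_psl_im p_pr cF p_odd; rewrite -(kp'_isog p iso') in k1.
  have k2 := card_psl_im_le p_pr cF p_odd; rewrite -(card_isog iso') in k2.
  rewrite -(leq_pmul2l p0) -(leq_pmul2l (ltn0Sn 1)).
  apply: leq_trans (_ : 2 * #|X| <= _)%N; first by rewrite leq_mul2l.
  by apply: leq_trans k2 _; rewrite -e (mulnCA 2 p) (mulnCA 2 p.-1) !leq_mul2l k1 !orbT.
have iso' := isog_trans iso (PGL2_isog p).
have k1 := kp'_pgl_im p_pr cF p_odd; rewrite -(kp'_isog p iso') in k1.
have k2 := card_pgl_im_le p_pr cF p_odd; rewrite -(card_isog iso') in k2.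
rewrite -(leq_pmul2l p0); apply: leq_trans le _; apply: leq_trans k2 _.
by rewrite -e !leq_mul2l k1 !orbT.
Qed.

(** The center is a p'-group meeting H' trivially, as PSL_2(p) has trivial center; [kp'_central_mul]
    then reduces to the central quotient. *)
Lemma extremal_lower (gT : finGroupType) (H : {group gT}) : 'O_p(H) = 1 -> ~ pp'_chain p H H ->
  (H / 'Z(H)) \isog PSL2 p \/ (H / 'Z(H)) \isog PGL2 p -> H^`(1) \isog PSL2 p ->
  (#|H|`_p^' <= p.-1 * kp' p H)%N.
Proof.
move=> OpH nhs isoQ isoD; have nZ : 'Z(H) <| H := center_normal H.
have p'Z : p^'.-group 'Z(H) := abelian_p'group nZ (center_abelian H) OpH.
have ZD : 'Z(H) :&: H^`(1) = 1.
  apply/trivgP; rewrite -(trivial_center_PSL2 (K := H^`(1)%G) isoD) subsetI subsetIr /=.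
  apply: subset_trans (subsetIl _ _) _; apply: subset_trans (subsetIr _ _) _.
  by apply: centS; apply: der_sub.
have pQ : p %| #|H / 'Z(H)|.
  apply: contraT => npQ; case: nhs; apply: (@pp'_chain_cons _ _ H H 'Z(H)%G); rewrite ?center_sub //.
    apply: (@pp'_chain_cons _ _ H 'Z(H)%G 1%G); rewrite ?sub1G ?normal1 //; first exact: pp'_chain1.
    by rewrite /pgroup -!(card_isog (quotient1_isog _)) -[p^'.-nat _]/(p^'.-group 'Z(H)) p'Z orbT.
  by apply/orP; right; rewrite /pgroup p'natE.
rewrite (p'part_quotient p nZ) (part_pnat_id p'Z).
have le1 := kp'_PSL2_PGL2 (X := (H / 'Z(H))%G) pQ isoQ.
have le2 := kp'_central_mul (subxx 'Z(H)) ZD p'Z.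
apply: (@leq_trans (#|'Z(H)| * (p.-1 * kp' p (H / 'Z(H))))%N); first by rewrite leq_mul2l le1 orbT.
by rewrite mulnCA leq_mul2l le2 orbT.
Qed.

(** For [K] minimal without a chain, equality splits into equality for [K] and ratio 1 for H / K.
    The centralizer C of K embeds in H / K, so it is a p'-group; then H / K is a p'-group with as
    many classes as elements, hence abelian, and H' = K, Z(H) = C. *)
Lemma extremal_structure (gT : finGroupType) (H : {group gT}) : 'O_p(H) = 1 -> ~ pp'_chain p H H ->
  (p.-1 * kp' p H)%N = (#|H|`_p^')%N ->
  [/\ 3 < p, (H / 'Z(H)) \isog PSL2 p \/ (H / 'Z(H)) \isog PGL2 p & H^`(1) \isog PSL2 p].
Proof.
move=> OpH nhs kH; have [K [nK nhK minK]] := min_no_pp'_chain nhs.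
have [perf gen OpK pK] := min_no_pp'_chain_core OpH nK nhK minK.
have [leK eqK] := core_theorem p_pr p_odd perf gen OpK pK.
have [P sylP] := Sylow_exists p (H / K)%G; have leQ := kp'_le p_pr sylP.
have p1 : 0 < p.-1 by move: (prime_gt1 p_pr); case: (p) => [|[]].
have le3 : #|K|`_p^' * #|H / K|`_p^' <= (p.-1 * kp' p K) * kp' p (H / K).
  by rewrite -(p'part_quotient p nK) -kH -mulnA leq_mul2l (kp'_mul p nK) orbT.
have kQ : kp' p (H / K) = (#|H / K|`_p^')%N.
  apply/eqP; rewrite eqn_leq leQ -(leq_pmul2l (part_gt0 p^' #|K|)).
  by rewrite (leq_trans le3) // leq_mul2r leK orbT.
have {}kK : (p.-1 * kp' p K)%N = (#|K|`_p^')%N.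
  apply/eqP; rewrite eqn_leq leK -(leq_pmul2r (part_gt0 p^' #|H / K|)).
  by rewrite (leq_trans le3) // -kQ.
have [x [ox mx p3]] := eqK kK.
have [isoK isoQ cQ] : [/\ K \isog PSL2 p, (H / 'C_H(K)) \isog PSL2 p \/ (H / 'C_H(K)) \isog PGL2 p
    & #|H / 'C_H(K)| <= 2 * #|K|].
  by have := mobius_isog (x := x) (H := H) (K := K); rewrite ox; apply.
set C := 'C_H(K)%G; have nC : C <| H.
  by rewrite /normal subsetIl normsI ?normG // norms_cent ?normal_norm.
have CK : C :&: K = 1.
  by apply/trivgP; rewrite -(trivial_center_PSL2 isoK) subsetI subsetIr /= /C setIAC subsetIr.
have isoC : C \isog C / K by apply: quotient_isog (subset_trans (normal_sub nC) (normal_norm nK)) _; rewrite setIC.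
have kC : kp' p C = (#|C|`_p^')%N.
  rewrite (kp'_isog p isoC) (card_isog isoC); apply: (tight_sub (X := (H / K)%G)) kQ.
  exact: quotient_normal.
have p'C : p^'.-group C := tight_p'group nC OpH kC.
have isoKC : K \isog K / C.
  by apply: quotient_isog; rewrite ?(subset_trans (normal_sub nK) (normal_norm nC)) // setIC.
have [e ce] : exists e, #|H / C| = (#|K| * e)%N.
  have sub : K / C \subset H / C := quotientS _ (normal_sub nK).
  by exists #|H / C : K / C|; rewrite (card_isog isoKC) Lagrange.
have e2 : 0 < e <= 2.
  apply/andP; split; first by have := cardG_gt0 (H / C)%G; rewrite /= ce; case: (e); rewrite ?muln0.
  by move: cQ; rewrite -/C ce mulnC leq_pmul2r ?cardG_gt0.
have cHK : #|H / K| = (#|C| * e)%N.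
  rewrite card_quotient ?normal_norm //; apply/eqP; rewrite -(eqn_pmul2l (cardG_gt0 K)).
  rewrite Lagrange ?normal_sub // -(Lagrange (normal_sub nC)) -card_quotient ?normal_norm // ce.
  by rewrite mulnCA.
have p'Q : p^'.-group (H / K).
  rewrite /pgroup cHK pnatM -[p^'.-nat #|_|]/(p^'.-group C) p'C /= p'natE //.
  (* Here e <= 2 < p. *)
  apply/negP=> /dvdn_leq; case/andP: e2 => e0 e2 /(_ e0) pe.
  by have := leq_trans (leq_trans p3 pe) e2.
have abQ : abelian (H / K) by rewrite card_classes_abelian -(kp'_p'group p'Q) kQ part_pnat_id.
have derK : H^`(1) = K.
  apply/eqP; rewrite eqEsubset der1_min ?normal_norm //= -{1}perf.
  exact: dergS (normal_sub nK).
have eZ : 'Z(H) = C.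
  apply/eqP; rewrite eqEsubset; apply/andP; split.
    by rewrite subsetI center_sub (subset_trans (subsetIr _ _)) ?centS ?normal_sub.
  (* The commutator of C and H lies in H' = K and in C, hence is trivial. *)
  rewrite subsetI normal_sub //=; apply/commG1P/trivgP; rewrite -CK subsetI commg_subl normal_norm //=.
  by have := commSg H (normal_sub nC); rewrite -derg1 derK.
by split; rewrite ?eZ ?derK.
Qed.
End Extremal.

Section Ratios.
Import Order.TTheory Num.Theory.
Local Open Scope ring_scope.
Variables (gT : finGroupType) (G : {group gT}) (p : nat).
Hypothesis p_pr : prime p.

Let pred_gt0 : 0 < (p - 1)%:R :> rat.
Proof. by rewrite ltr0n subn_gt0 prime_gt1. Qed.

Let p'part_gt0 : 0 < (#|G|`_p^')%:R :> rat.
Proof. by rewrite ltr0n part_gt0. Qed.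

Lemma dp'_gt : (1 / (p - 1)%:R < dp' p G) = dense p G.
Proof.
by rewrite /dp' /dense ltr_pdivrMr // mulrAC ltr_pdivlMr // mul1r -natrM ltr_nat subn1 mulnC.
Qed.

Lemma dp'_eq : (dp' p G = 1 / (p - 1)%:R) <-> (p.-1 * kp' p G)%N = (#|G|`_p^')%N.
Proof.
have eqE : (dp' p G == 1 / (p - 1)%:R) = (p.-1 * kp' p G == #|G|`_p^')%N.
  rewrite /dp' eqr_div ?lt0r_neq0 //.
  by rewrite mul1r -natrM eqr_nat subn1 mulnC.
by split=> /eqP e; apply/eqP; rewrite ?eqE // -eqE.
Qed.
End Ratios.

Theorem theorem1p1 (gT : finGroupType) (G : {group gT}) (p : nat) :
  prime p -> odd p ->
  ( (1 / (p - 1)%:R < dp' p G)%R ->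
      [/\ p_solvable p G,
          p_length_le p G 2,
          (forall s : seq {group gT}, comps G s ->
             lt_ln_ratio (num_nonab_p'_compfactors p G s) p)
        & (p <= 13 -> solvable G)] )
  /\
  ( ~ p_solvable p G ->
      (dp' p G = 1 / (p - 1)%:R)%R <->
      [/\ 3 < p,
          (((G / 'O_p(G)) / 'Z(G / 'O_p(G)))%g \isog PSL2 p
           \/ ((G / 'O_p(G)) / 'Z(G / 'O_p(G)))%g \isog PGL2 p)
        & (G / 'O_p(G))^`(1)%g \isog PSL2 p] ).
Proof.
move=> p_pr p_odd; split.
  rewrite dp'_gt // => dG; split.
  - exact: dense_p_solvable.
  - exact: dense_p_length.
  - by move=> s cs; apply: lt_ln_ratio_expn; rewrite subn1; apply: dense_comps.
  move=> p13; have [s cs] := exists_comps G; apply: (dense_comps_solvable p_pr p_odd dG cs).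
  (* A positive count would give 12 < p - 1 <= 12. *)
  have := dense_comps p_pr dG cs; case: num_nonab_p'_compfactors => // n lt.
  have : 12 < p.-1 by apply: leq_ltn_trans lt; rewrite expnS leq_pmulr // expn_gt0.
  by move: p13; case: (p) => // q; rewrite ltnS /= => q12; rewrite ltnNge q12.
move=> npsol; set O := 'O_p(G)%g; have nO : (O <| G)%g := pcore_normal p G.
have pO : (p.-group O)%g := pcore_pgroup p G.
have OpH : ('O_p(G / O) = 1)%g := trivg_pcore_quotient p G.
have nhs : ~ pp'_chain p (G / O)%G (G / O)%G.
  by move=> hsH; apply: npsol; apply: pp'_chain_p_solvable; apply: pp'_chain_quotient nO pO hsH.
have kH : kp' p (G / O)%g = kp' p G.
  apply/eqP; rewrite eqn_leq kp'_quotient_ge //.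
  by have := kp'_mul p nO; rewrite (kp'_pgroup pO) mul1n.
have mH : (#|G|`_p^' = #|(G / O)%g|`_p^')%N.
  by rewrite (p'part_quotient p nO) part_p'nat ?pnatNK ?mul1n.
(* A larger ratio would make [G] p-solvable by the first part. *)
have upper : (p.-1 * kp' p G <= #|G|`_p^')%N.
  by rewrite leqNgt; apply/negP=> dG; apply: npsol; apply: dense_p_solvable dG.
split=> [/(dp'_eq _ p_pr)|[p3 isoQ isoD]].
  by rewrite -kH mH => e; apply: (extremal_structure p_pr p_odd (H := (G / O)%G)).
apply/(dp'_eq _ p_pr)/eqP; rewrite eqn_leq upper mH -kH /=.
exact: (extremal_lower p_pr p_odd (H := (G / O)%G)).
Qed.
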